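(* Let $N\ge0$ be an integer, $d_0,\dots,d_N\in\mathbb C\setminus\{0\}$, and $1\le\alpha_0\le\dots\le\alpha_N$. Then for $u_0\in H^1(\mathbb R)$ the Cauchy problem $$i\partial_tu+\partial_x^2u+d_0|u|^{\alpha_0}u+\dots+d_N|u|^{\alpha_N}u=0,\quad u(x,0)=u_0(x),\qquad x\in\mathbb R, \tag{P}$$ is locally well-posed in $H^1(\mathbb R)$. Moreover, suppose $2<\alpha_0\le\dots\le\alpha_N$, and for $v_0\in H^1(\mathbb R)\cap L^2(|x|^2dx)$ define $u_0=e^{\frac{ib|x|^2}4}v_0$, $b\in\mathbb R$. Then, for $b>0$ sufficiently large and the initial data $u_0\in H^1(\mathbb R)$, there exists a unique global solution $u$ of (P) in $C([0,\infty);H^1(\mathbb R))$. Furthermore, $u$ scatters in $H^1(\mathbb R)$, i.e., there exists $u_+\in H^1(\mathbb R)$ such that $$\lim_{t\to\infty}\|u(t)-e^{it\partial_x^2}u_+\|_{H^1}=0 .$$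
   Context: All functions are complex valued on $\mathbb R$. $L^2(|x|^2dx)$ is the space of $f$ with $xf\in L^2(\mathbb R)$. $e^{it\partial_x^2}$ is the linear Schrödinger group (Fourier multiplier with symbol $e^{-it|\xi|^2}$). Solutions are understood in the sense of the integral (Duhamel) equation $u(t)=e^{it\partial_x^2}u_0+i\int_0^te^{i(t-\tau)\partial_x^2}\mathcal N(u(\tau))u(\tau)\,d\tau$ with $\mathcal N(u)=\sum_{k=0}^Nd_k|u|^{\alpha_k}$. ''Locally well-posed in $H^1(\mathbb R)$'' means: for every $u_0\in H^1(\mathbb R)$ there exist $T>0$ and a unique solution $u\in C([-T,T],H^1(\mathbb R))$, and moreover there exist $T>0$ and a neighborhood $V$ of $u_0$ in $H^1(\mathbb R)$ such that the data-to-solution map from $V$ into $C([-T,T];H^1(\mathbb R))$ is continuous. ''For $b>0$ sufficiently large'' means: there is $b_0>0$ (depending on the fixed data $v_0$ and the other parameters) such that the conclusion holds for every $b\ge b_0$. *)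

(* Defs.v *)
From HB Require Import structures.
From mathcomp Require Import all_boot all_order all_algebra.
From mathcomp Require Import all_classical all_reals all_analysis.
From mathcomp Require Import complex.

Set Implicit Arguments.
Unset Strict Implicit.
Unset Printing Implicit Defensive.

Import Order.TTheory GRing.Theory Num.Theory.
Import numFieldNormedType.Exports.
Import Normc.

Local Open Scope classical_set_scope.
Local Open Scope ring_scope.
Local Open Scope complex_scope.

(* Elements of L^2(R) and H^1(R) are represented by functions R -> R[i];
   equality in these spaces is equality almost everywhere. *)

Section function_spaces.
Context {R : realType}.
Local Notation mu := (@lebesgue_measure R).
Implicit Types (f g : R -> R[i]).

Definition cis (a : R) : R[i] := cos a +i* sin a.

Definition Cintegral (D : set R) f : R[i] :=
  (\int[mu]_(x in D) complex.Re (f x)) +i* (\int[mu]_(x in D) complex.Im (f x)).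

Definition Cmeasurable f : Prop :=
  measurable_fun [set: R] (fun x => complex.Re (f x)) /\
  measurable_fun [set: R] (fun x => complex.Im (f x)).

Definition Cae_eq f g : Prop := {ae mu, forall x : R, f x = g x}.

Definition L2norm f : \bar R := Lnorm mu 2%:E (fun x : R => (normc (f x))%:E).

Definition L2 f : Prop := Cmeasurable f /\ (L2norm f < +oo)%E.

(* Real test functions suffice in the definition of weak derivatives, by
   linearity. *)
Definition test_function (phi : R -> R) : Prop :=
  (forall n x, derivable (derive1n n phi) x 1) /\
  (exists M : R, forall x, M < `|x| -> phi x = 0).

Definition Clocally_integrable f : Prop :=
  locally_integrable [set: R] (fun x => complex.Re (f x)) /\
  locally_integrable [set: R] (fun x => complex.Im (f x)).

Definition is_weak_derivative f g : Prop :=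
  [/\ Clocally_integrable f, Clocally_integrable g &
      forall phi : R -> R, test_function phi ->
        Cintegral [set: R] (fun x => f x * (derive1 phi x)%:C) =
        - Cintegral [set: R] (fun x => g x * (phi x)%:C)].

Definition weak_derivative f : R -> R[i] :=
  xget (fun=> 0) [set g | is_weak_derivative f g].

Definition H1 f : Prop := L2 f /\ exists2 g, L2 g & is_weak_derivative f g.

(* The value +oo outside H^1 makes "H1dist f g < e" meaningful without side
   conditions. *)
Definition H1norm f : \bar R :=
  if `[< H1 f >] then
    ((L2norm f `^ 2 + L2norm (weak_derivative f) `^ 2) `^ 2^-1)%E
  else +oo%E.

Definition H1dist f g : \bar R := H1norm (f \- g).

(* Fourier transform on L^2, as the L^2-limit of the truncated integrals
   \int_(-n)^n f(x) e^(-i x xi) dx; with this convention d/dx has symbol i xi,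
   so that e^(it d_x^2) has symbol e^(-it xi^2). *)
Definition fourier_trunc (n : nat) f (xi : R) : R[i] :=
  Cintegral `[- n%:R, n%:R] (fun x => f x * cis (- (x * xi))).

Definition is_fourier f g : Prop :=
  [/\ L2 f, L2 g &
      L2norm (fourier_trunc n f \- g) @[n --> \oo] --> 0%E].

Definition schrodinger (t : R) f : R -> R[i] :=
  xget (fun=> 0)
    [set g | exists2 fh, is_fourier f fh &
             is_fourier g (fun xi => cis (- (t * xi ^+ 2)) * fh xi)].

End function_spaces.

Section H1_valued.
Context {R : realType}.
Implicit Types (u v F : R -> R -> R[i]) (J : set R).

Definition CH1 J u : Prop :=
  (forall t, J t -> H1 (u t)) /\
  (forall t, J t -> H1dist (u s) (u t) @[s --> within J (nbhs t)] --> 0%E).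

Definition CH1dist J u v : \bar R :=
  ereal_sup [set H1dist (u t) (v t) | t in J].

Definition riemann_sum (n : nat) (p xi : nat -> R) F : R -> R[i] :=
  fun x => \sum_(k < n) (p k.+1 - p k)%:C * F (xi k) x.

(* Riemann integral over [a, b], a <= b, of an H^1-valued function: limit in
   H^1 of the sums over tagged partitions as the mesh tends to 0. *)
Definition is_riemann (a b : R) F (I : R -> R[i]) : Prop :=
  forall e : R, 0 < e -> exists2 del : R, 0 < del &
    forall (n : nat) (p xi : nat -> R), p 0%N = a -> p n = b ->
      (forall k, (k < n)%N ->
         [/\ p k <= xi k, xi k <= p k.+1 & p k.+1 - p k < del]) ->
      (H1dist (riemann_sum n p xi F) I < e%:E)%E.

Definition is_oriented_riemann (a b : R) F (I : R -> R[i]) : Prop :=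
  if a <= b then is_riemann a b F I else is_riemann b a F (\- I).

End H1_valued.

Section NLS.
Context {R : realType} {N : nat} (d : 'I_N.+1 -> R[i]) (alpha : 'I_N.+1 -> R).
Implicit Types (u v : R -> R -> R[i]) (w : R -> R[i]).

Definition nonlinearity (f : R -> R[i]) : R -> R[i] :=
  fun x => (\sum_(k < N.+1) d k * (normc (f x) `^ alpha k)%:C) * f x.

(* u is a solution in C(J; H^1), J an interval containing 0, of the Duhamel
   equation; the values of u outside J are irrelevant. *)
Definition solution (J : set R) (u0 : R -> R[i]) u : Prop :=
  CH1 J u /\
  forall t, J t -> exists2 I : R -> R[i],
    is_oriented_riemann 0 t
      (fun tau => schrodinger (t - tau) (nonlinearity (u tau))) I &
    Cae_eq (u t) (fun x => schrodinger t u0 x + 'i%C * I x).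

Definition unique_solution (J : set R) (u0 : R -> R[i]) u : Prop :=
  solution J u0 u /\
  forall v, solution J u0 v -> forall t, J t -> Cae_eq (v t) (u t).

Definition H1_neighborhood (u0 : R -> R[i]) (V : set (R -> R[i])) : Prop :=
  V `<=` H1 /\
  exists2 r : R, 0 < r & forall w, (H1dist w u0 < r%:E)%E -> V w.

(* Phi is the data-to-solution map on V, continuous into C(J; H^1). *)
Definition continuous_flow (J : set R) (V : set (R -> R[i]))
    (Phi : (R -> R[i]) -> R -> R -> R[i]) : Prop :=
  (forall w, V w -> unique_solution J w (Phi w)) /\
  (forall w, V w -> forall e : R, 0 < e -> exists2 eta : R, 0 < eta &
     forall w', V w' -> (H1dist w' w < eta%:E)%E ->
       (CH1dist J (Phi w') (Phi w) < e%:E)%E).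

Definition locally_well_posed : Prop :=
  forall u0 : R -> R[i], H1 u0 ->
    (exists2 T : R, 0 < T & exists u, unique_solution `[- T, T] u0 u) /\
    (exists2 T : R, 0 < T & exists2 V, H1_neighborhood u0 V &
       exists Phi, continuous_flow `[- T, T] V Phi).

End NLS.

Definition scatters {R : realType} (u : R -> R -> R[i]) : Prop :=
  exists2 up : R -> R[i], H1 up &
    H1dist (u t) (schrodinger t up) @[t --> +oo] --> 0%E.

Definition quadratic_phase {R : realType} (b : R) (v0 : R -> R[i]) : R -> R[i] :=
  fun x => cis (b * x ^+ 2 / 4) * v0 x.

(* Main.v *)
(** Write [z t = e^(-it d_x^2) u t]; the equation becomes
    [z t = u0 + i \int_0^t G s (z s) ds], where [G t f = e^(-it d_x^2) N(e^(it d_x^2) f)].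
    For [b >= 0] put [J f = f' - i b x f / 2] and
    [nu f = |f| + |J f| + |f'| / (1 + b)] with [L^2] norms; for [b = 0] this is an [H^1] norm.
    The function [e^(-i b x^2 / (4 (1 + b t))) e^(it d_x^2) f] has derivative of [L^2] norm
    [|J f| / (1 + b t)], so by Agmon's inequality the sup norm of [e^(it d_x^2) f] is at most
    [2 nu f / sqrt (1 + b t)].  As [N] is gauge invariant, [G t] is Lipschitz for [nu] on the
    ball of radius [M], with constant [C(M) (1 + b t)^(- alpha_0 / 2)].  With [b = 0] a fixed
    point argument on a short interval, and Gronwall's lemma, give the local theory.  For
    [u0 = e^(i b x^2 / 4) v0] one has [J u0 = e^(i b x^2 / 4) v0'], so [nu u0] is bounded
    independently of [b], while the integral of [(1 + b t)^(- alpha_0 / 2)] over [[0, oo)] is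
    [1 / (b (alpha_0 / 2 - 1))]: for large [b] the fixed point argument works on every
    [[0, n]] at once.  The bound on [G s (z s)] is integrable, so [z t] converges, and this is
    scattering. *)

Require Import Defs.
From HB Require Import structures.
From mathcomp Require Import all_boot all_order all_algebra.
From mathcomp Require Import all_classical all_reals all_analysis.
From mathcomp Require Import measurable_realfun.
From mathcomp Require Import complex ring lra.
Set Implicit Arguments.
Unset Strict Implicit.
Unset Printing Implicit Defensive.
Import Order.TTheory GRing.Theory Num.Theory.
Import numFieldNormedType.Exports.
Import Normc.
Local Open Scope classical_set_scope.
Local Open Scope ring_scope.
Local Open Scope complex_scope.

(** * The space L^2 *)

Section Integrals.
Context {R : realType}.
Local Notation mu := (@lebesgue_measure R).
Local Notation integ f := (mu.-integrable setT (EFin \o (f : R -> R))).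
Implicit Types (f g h : R -> R).

(** The group is specified only through [is_fourier], and $H^1$ only through test functions, so
    Plancherel's identity, surjectivity of the Fourier transform and absolutely continuous
    representatives have to be available before the equation can be treated. The form of [nu] has
    two reasons. The sup norm bound uses only $|f|$ and $|Jf|$, but these do not control $f'$ and
    $bxf$ separately; the third term makes [nu b] complete, equivalent for each fixed $b$ to
    $|f|+|f'|+|bxf|$. Its weight $1/(1+b)$ absorbs the derivative of $e^{ibx^2/4}$, which grows like
    $b$; the weight passes through the estimates because the differential of the nonlinearity is
    linear in $f'$. The unknown is $z$ because for $b>0$ the group does not preserve [nu b], while
    the equation for $z$ contains no group outside [G]. The constant $C(M)$ does not involve $b$, so
    $M$ is fixed from $v_0$ first and $b$ is chosen afterwards. The decay estimate needs $bt\ge0$: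
    the case $b=0$ serves both directions of time, the case $b>0$ only the future. *)

Lemma aeS (P Q : R -> Prop) : {ae mu, forall x, P x} ->
  (forall x, P x -> Q x) -> {ae mu, forall x, Q x}.
Proof.
move=> hP PQ; apply: (@filterS _ _ (ae_filter_ringOfSetsType mu) _ _ _ hP).
exact: PQ.
Qed.

Lemma aeS2 (P Q S : R -> Prop) : {ae mu, forall x, P x} ->
  {ae mu, forall x, Q x} -> (forall x, P x -> Q x -> S x) ->
  {ae mu, forall x, S x}.
Proof.
move=> hP hQ PQ.
by apply: (@filterS2 _ _ (ae_filter_ringOfSetsType mu) _ _ _ _ hP hQ).
Qed.

Lemma aeT (P : R -> Prop) : (forall x, P x) -> {ae mu, forall x, P x}.
Proof. by move=> h; apply: (@filterE _ _ (ae_filter_ringOfSetsType mu)). Qed.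

Lemma ae_eq_sym (T : Type) (f g : R -> T) : {ae mu, forall x, f x = g x} ->
  {ae mu, forall x, g x = f x}.
Proof. by move=> fg; apply: (aeS fg). Qed.

Lemma ae_eq_trans (T : Type) (f g h : R -> T) : {ae mu, forall x, f x = g x} ->
  {ae mu, forall x, g x = h x} -> {ae mu, forall x, f x = h x}.
Proof. by move=> fg gh; apply: (aeS2 fg gh) => x -> ->. Qed.

Lemma ae_eq_refl (T : Type) (f : R -> T) : {ae mu, forall x, f x = f x}.
Proof. exact: aeT. Qed.

Lemma mEFin f : measurable_fun setT f -> measurable_fun setT (fun x => (f x)%:E).
Proof. by move=> mf; apply/measurable_EFinP. Qed.

Lemma integ_meas f : integ f -> measurable_fun setT f.
Proof. by move=> /measurable_int/measurable_EFinP. Qed.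

Lemma integD f g : integ f -> integ g -> integ (fun x => f x + g x).
Proof. by move=> fi gi; exact: (@integrableD _ _ _ mu setT measurableT _ _ fi gi). Qed.

Lemma integZ (k : R) f : integ f -> integ (fun x => k * f x).
Proof. by move=> fi; exact: (@integrableZl _ _ _ mu setT measurableT k _ fi). Qed.

Lemma integ_le f g : measurable_fun setT f -> (forall x, `|f x| <= g x) ->
  integ g -> integ f.
Proof.
move=> mf fg gi; apply: (le_integrable measurableT _ _ gi).
  exact/measurable_EFinP.
by move=> x _ /=; rewrite lee_fin (le_trans (fg x))// ler_norm.
Qed.

Lemma integ_norm f : integ f -> integ (fun x => `|f x|).
Proof.
move=> fi; apply: (integ_le (g := fun x => `|f x|)); last first.
  exact: (integrable_norm fi).
  by move=> x; rewrite normr_id.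
by apply: measurableT_comp => //; exact: integ_meas.
Qed.

Lemma intD f g : integ f -> integ g ->
  \int[mu]_x (f x + g x) = \int[mu]_x f x + \int[mu]_x g x.
Proof. by move=> *; exact: RintegralD. Qed.

Lemma intZ k f : integ f -> \int[mu]_x (k * f x) = k * \int[mu]_x f x.
Proof. by move=> *; exact: RintegralZl. Qed.

Lemma intN f : integ f -> \int[mu]_x (- f x) = - \int[mu]_x f x.
Proof.
move=> fi; rewrite -mulN1r -intZ//; apply: eq_Rintegral => x _.
by rewrite mulN1r.
Qed.

Lemma intB f g : integ f -> integ g ->
  \int[mu]_x (f x - g x) = \int[mu]_x f x - \int[mu]_x g x.
Proof. by move=> *; exact: RintegralB. Qed.

Lemma int_le f g : integ f -> integ g -> (forall x, f x <= g x) ->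
  \int[mu]_x f x <= \int[mu]_x g x.
Proof. by move=> *; exact: le_Rintegral. Qed.

Lemma int_norm_le f : integ f -> `|\int[mu]_x f x| <= \int[mu]_x `|f x|.
Proof. by move=> *; exact: le_normr_Rintegral. Qed.

Lemma integ_fin f : integ f -> (\int[mu]_x (f x)%:E)%E = (\int[mu]_x f x)%:E.
Proof. by move=> fi; rewrite fineK//; exact: integrable_fin_num. Qed.

Lemma integ_ae f g : measurable_fun setT g -> {ae mu, forall x, f x = g x} ->
  integ f -> integ g.
Proof.
move=> mg fg fi; apply/integrableP; split; first exact: mEFin.
have /integrableP[_] := fi; apply: le_lt_trans.
rewrite le_eqVlt; apply/orP; left; apply/eqP.
apply: ge0_ae_eq_integral => //=.
- by apply: mEFin; exact: measurableT_comp.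
- by apply: mEFin; apply: measurableT_comp => //; exact: integ_meas.
- by apply: (aeS fg) => x ->.
Qed.

Lemma int_ae f g : measurable_fun setT f -> measurable_fun setT g ->
  {ae mu, forall x, f x = g x} -> \int[mu]_x f x = \int[mu]_x g x.
Proof.
move=> mf mg fg; congr fine; apply: ae_eq_integral => //=.
- exact: mEFin.
- exact: mEFin.
- by apply: (aeS fg) => x ->.
Qed.

Lemma int_le_ae f g : integ f -> integ g -> {ae mu, forall x, f x <= g x} ->
  \int[mu]_x f x <= \int[mu]_x g x.
Proof.
move=> fi gi fg.
have mf := integ_meas fi; have mg := integ_meas gi.
(* The maximum dominates [f] at every point and equals [g] almost everywhere, so pointwise
   monotonicity of the integral is enough. *)
pose h x := Num.max (f x) (g x).
have mh : measurable_fun setT h by exact: measurable_maxr.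
have hg : {ae mu, forall x, g x = h x}.
  by apply: (aeS fg) => x ?; rewrite /h max_r.
rewrite (int_ae mg mh hg); apply: int_le => //; first exact: integ_ae hg gi.
by move=> x; rewrite /h le_max lexx.
Qed.

Lemma int_ge0 f : (forall x, 0 <= f x) -> 0 <= \int[mu]_x f x.
Proof. by move=> f0; apply: Rintegral_ge0. Qed.

Lemma int_eq0_ae f : integ f -> (forall x, 0 <= f x) -> \int[mu]_x f x = 0 ->
  {ae mu, forall x, f x = 0}.
Proof.
move=> fi f0 If0.
have mf : measurable_fun setT (fun x => (f x)%:E) by exact: mEFin (integ_meas fi).
have /(ae_eq_integral_abs mu measurableT mf) : (\int[mu]_x `|(f x)%:E| = 0)%E.
  under eq_integral do rewrite /= ger0_norm//.
  by rewrite integ_fin// If0.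
by move=> h; apply: (aeS h) => x /= /(_ I) [].
Qed.

Lemma fin_integ f : measurable_fun setT f -> (forall x, 0 <= f x) ->
  (\int[mu]_x (f x)%:E < +oo)%E -> integ f.
Proof.
move=> mf f0 h; apply/integrableP; split; first exact/measurable_EFinP.
by under eq_integral do rewrite /= ger0_norm//.
Qed.

Lemma integ_indic (A : set R) f : measurable A ->
  mu.-integrable A (EFin \o f) <-> integ (f \_ A).
Proof.
move=> mA; rewrite integrable_mkcond//.
suff -> : ((EFin \o f) \_ A) = EFin \o (f \_ A) by [].
by rewrite restrict_EFin.
Qed.

End Integrals.

(** * Modulus, real part and imaginary part *)

Section ComplexNorm.
Context {R : realType}.
Implicit Types (x y z : R[i]).
Local Notation re := (@complex.Re R).
Local Notation im := (@complex.Im R).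

Lemma reD x y : re (x + y) = re x + re y. Proof. by case: x; case: y. Qed.
Lemma imD x y : im (x + y) = im x + im y. Proof. by case: x; case: y. Qed.
Lemma reN x : re (- x) = - re x. Proof. by case: x. Qed.
Lemma imN x : im (- x) = - im x. Proof. by case: x. Qed.
Lemma reB x y : re (x - y) = re x - re y. Proof. by rewrite reD reN. Qed.
Lemma imB x y : im (x - y) = im x - im y. Proof. by rewrite imD imN. Qed.
Lemma reM x y : re (x * y) = re x * re y - im x * im y.
Proof. by case: x; case: y. Qed.
Lemma imM x y : im (x * y) = re x * im y + im x * re y.
Proof. by case: x; case: y. Qed.
Lemma reJ x : re (x^*%C) = re x. Proof. by case: x. Qed.
Lemma imJ x : im (x^*%C) = - im x. Proof. by case: x. Qed.
Definition reimE := (reD, imD, reN, imN, reM, imM, reJ, imJ).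

Lemma sqr_mono (a b : R) : 0 <= a -> a <= b -> a ^+ 2 <= b ^+ 2.
Proof. by move=> a0 ab; rewrite ler_pXn2r ?nnegrE ?(le_trans a0). Qed.

Lemma complex_ext x y : re x = re y -> im x = im y -> x = y.
Proof. by case: x => a b; case: y => c e /= -> ->. Qed.

Lemma normcE2 x : normc x ^+ 2 = re x ^+ 2 + im x ^+ 2.
Proof. by case: x => a b /=; rewrite sqr_sqrtr// addr_ge0// sqr_ge0. Qed.

Lemma normc_ge0 x : 0 <= normc x. Proof. by case: x => a b; exact: sqrtr_ge0. Qed.
Hint Resolve normc_ge0 : core.

Lemma normc_sqrt x : normc x = Num.sqrt (re x ^+ 2 + im x ^+ 2).
Proof. by case: x. Qed.

Lemma normcJ' x : normc (x^*%C) = normc x.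
Proof. by rewrite !normc_sqrt reJ imJ sqrrN. Qed.

Lemma normcR (a : R) : normc (a%:C) = `|a|.
Proof. by rewrite /normc /= expr0n addr0 sqrtr_sqr. Qed.

Lemma normc_i : normc ('i%C : R[i]) = 1.
Proof. by rewrite /normc expr0n add0r expr1n sqrtr1. Qed.

Lemma le_normcB x y : normc (x - y) <= normc x + normc y.
Proof. by rewrite (le_trans (le_normcD _ _))// normcN. Qed.

Lemma normc_re x : `|re x| <= normc x.
Proof.
rewrite -(@ler_pXn2r _ 2)// ?nnegrE//.
by rewrite normcE2 real_normK ?num_real// lerDl sqr_ge0.
Qed.

Lemma normc_im x : `|im x| <= normc x.
Proof.
rewrite -(@ler_pXn2r _ 2)// ?nnegrE//.
by rewrite normcE2 real_normK ?num_real// lerDr sqr_ge0.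
Qed.

Lemma normc_le_reim x : normc x <= `|re x| + `|im x|.
Proof.
rewrite -(@ler_pXn2r _ 2)// ?nnegrE ?addr_ge0//.
rewrite normcE2 sqrrD !real_normK ?num_real//.
by rewrite [leRHS]addrAC lerDl mulrn_wge0// mulr_ge0.
Qed.

Lemma normc_dist x y : `|normc x - normc y| <= normc (x - y).
Proof.
rewrite ler_norml; apply/andP; split.
  have := le_normcD (y - x) x; rewrite subrK -[normc (y - x)]normcN opprB; lra.
have := le_normcD (x - y) y; rewrite subrK; lra.
Qed.

Lemma re_conjM x y : re (x * y^*%C) = re x * re y + im x * im y.
Proof. by rewrite reM reJ imJ mulrN opprK. Qed.

Lemma reim_le x y : `|re x * re y + im x * im y| <= normc x * normc y.
Proof. by rewrite -re_conjM (le_trans (normc_re _))// normcM normcJ'. Qed.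

Lemma normc_cis (a : R) : normc (cis a) = 1.
Proof. by rewrite /normc /cis cos2Dsin2 sqrtr1. Qed.

Lemma cisD (a b : R) : cis (a + b) = cis a * cis b.
Proof. by apply: complex_ext; rewrite ?reM ?imM /= ?cosD ?sinD// addrC. Qed.

Lemma cis0 : cis (0 : R) = 1.
Proof. by rewrite /cis cos0 sin0. Qed.

End ComplexNorm.
#[global] Hint Resolve normc_ge0 : core.

Global Arguments normc : simpl never.

(** * Norm and real inner product of $L^2$ *)

Section L2space.
Context {R : realType}.
Local Notation mu := (@lebesgue_measure R).
Local Notation integ f := (mu.-integrable setT (EFin \o (f : R -> R))).
Local Notation re := (@complex.Re R).
Local Notation im := (@complex.Im R).
Implicit Types (f g h : R -> R[i]) (c : R[i]).

Lemma CmeasD f g : Cmeasurable f -> Cmeasurable g ->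
  Cmeasurable (fun x => f x + g x).
Proof.
move=> [fr fi] [gr gi]; split.
- by under eq_fun do rewrite reD; exact: measurable_funD.
- by under eq_fun do rewrite imD; exact: measurable_funD.
Qed.

Lemma CmeasN f : Cmeasurable f -> Cmeasurable (fun x => - f x).
Proof.
move=> [fr fi]; split.
- by under eq_fun do rewrite reN; exact: measurableT_comp.
- by under eq_fun do rewrite imN; exact: measurableT_comp.
Qed.

Lemma CmeasB f g : Cmeasurable f -> Cmeasurable g ->
  Cmeasurable (fun x => f x - g x).
Proof. by move=> mf mg; apply: CmeasD => //; exact: CmeasN. Qed.

Lemma CmeasM f g : Cmeasurable f -> Cmeasurable g ->
  Cmeasurable (fun x => f x * g x).
Proof.
move=> [fr fi] [gr gi]; split.
- by under eq_fun do rewrite reM; apply: measurable_funB; exact: measurable_funM.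
- by under eq_fun do rewrite imM; apply: measurable_funD; exact: measurable_funM.
Qed.

Lemma CmeasJ f : Cmeasurable f -> Cmeasurable (fun x => (f x)^*%C).
Proof.
move=> [fr fi]; split; first by under eq_fun do rewrite reJ.
by under eq_fun do rewrite imJ; exact: measurableT_comp.
Qed.

Lemma Cmeas_cst c : Cmeasurable (fun=> c).
Proof. by split; exact: measurable_cst. Qed.

Lemma Cmeas_real (f : R -> R) : measurable_fun setT f ->
  Cmeasurable (fun x => (f x)%:C).
Proof. by move=> mf; split => //=; exact: measurable_cst. Qed.

Lemma Cmeas_cis (f : R -> R) : measurable_fun setT f ->
  Cmeasurable (fun x => cis (f x)).
Proof.
move=> mf; split => /=.
- by apply: measurableT_comp => //; apply: continuous_measurable_fun; exact: continuous_cos.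
- by apply: measurableT_comp => //; apply: continuous_measurable_fun; exact: continuous_sin.
Qed.

Lemma Cmeas_normc f : Cmeasurable f -> measurable_fun setT (fun x => normc (f x)).
Proof.
move=> [fr fi]; under eq_fun do rewrite normc_sqrt.
apply: (measurableT_comp (continuous_measurable_fun (@sqrt_continuous R))).
by apply: measurable_funD; exact: measurable_funX.
Qed.

Lemma Cmeas_sqr f : Cmeasurable f -> measurable_fun setT (fun x => normc (f x) ^+ 2).
Proof. by move=> mf; apply: measurable_funX; exact: Cmeas_normc. Qed.

Lemma L2normE_pow f : L2norm f = ((\int[mu]_x (normc (f x) ^+ 2)%:E) `^ 2^-1)%E.
Proof.
rewrite /L2norm unlock; congr (_ `^ _)%E; apply: eq_integral => x _.
by rewrite abse_EFin poweR_EFin (ger0_norm (normc_ge0 _)) powR_mulrn ?normc_ge0.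
Qed.

Lemma L2P f : L2 f <-> Cmeasurable f /\ integ (fun x => normc (f x) ^+ 2).
Proof.
split=> [[mf fy]|[mf fi]]; split => //.
  apply: fin_integ; [exact: Cmeas_sqr|by move=> x; exact: sqr_ge0|].
  move: fy; rewrite L2normE_pow => h.
  by apply: lty_poweRy h; rewrite invr_eq0.
rewrite L2normE_pow; apply: poweR_lty; exact: integrable_lty fi.
Qed.

(** Real part of the Hermitian product: $L^2$ is treated as a real Hilbert space. Imaginary parts
    are recovered by putting a factor $i$ into one argument. *)
Definition ip f g : R := \int[mu]_x (re (f x) * re (g x) + im (f x) * im (g x)).

(** Real-valued counterpart of [L2norm]. An infinite integral is turned into 0 here, hence the [L2]
    hypotheses carried along. *)
Definition nr f : R := Num.sqrt (\int[mu]_x (normc (f x) ^+ 2)).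

Lemma nr_ge0 f : 0 <= nr f. Proof. exact: sqrtr_ge0. Qed.
Hint Resolve nr_ge0 : core.

Lemma nr2 f : nr f ^+ 2 = \int[mu]_x (normc (f x) ^+ 2).
Proof. by rewrite sqr_sqrtr// int_ge0// => x; exact: sqr_ge0. Qed.

Lemma ipff f : ip f f = nr f ^+ 2.
Proof. by rewrite nr2; apply: eq_Rintegral => x _; rewrite normcE2 -!expr2. Qed.

Lemma L2normE f : L2 f -> L2norm f = (nr f)%:E.
Proof.
move=> /L2P[mf fi]; rewrite L2normE_pow integ_fin// poweR_EFin.
by rewrite powR12_sqrt// int_ge0// => x; exact: sqr_ge0.
Qed.

Lemma L2meas f : L2 f -> Cmeasurable f. Proof. by case. Qed.

Lemma L2integ f : L2 f -> integ (fun x => normc (f x) ^+ 2).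
Proof. by move=> /L2P[]. Qed.

Lemma L2_le f g : Cmeasurable f -> L2 g ->
  {ae mu, forall x, normc (f x) <= normc (g x)} -> L2 f.
Proof.
move=> mf /L2P[mg gi] fg; apply/L2P; split => //.
pose h x := Num.min (normc (f x) ^+ 2) (normc (g x) ^+ 2).
have mh : measurable_fun setT h by apply: measurable_minr; exact: Cmeas_sqr.
apply: (@integ_ae _ h); first exact: Cmeas_sqr.
  by apply: (aeS fg) => x fgx; rewrite /h min_l// ler_pXn2r// nnegrE.
apply: integ_le gi => // x; rewrite /h ger0_norm ?le_min ?sqr_ge0//.
by rewrite ge_min lexx orbT.
Qed.

Lemma nr_le f g : L2 f -> L2 g ->
  {ae mu, forall x, normc (f x) <= normc (g x)} -> nr f <= nr g.
Proof.
move=> /L2P[mf fi] /L2P[mg gi] fg; apply: ler_wsqrtr; apply: int_le_ae => //.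
apply: (aeS fg) => x fgx; apply: sqr_mono; first exact: normc_ge0.
  exact: fgx.
Qed.

Lemma nr_eq f g : Cmeasurable f -> Cmeasurable g ->
  {ae mu, forall x, normc (f x) = normc (g x)} -> nr f = nr g.
Proof.
move=> mf mg fg; congr Num.sqrt; apply: int_ae; try exact: Cmeas_sqr.
by apply: (aeS fg) => x ->.
Qed.

Lemma nr_ae f g : Cmeasurable f -> Cmeasurable g -> Cae_eq f g -> nr f = nr g.
Proof. by move=> mf mg fg; apply: nr_eq => //; apply: (aeS fg) => x ->. Qed.

Lemma L2_ae f g : L2 f -> Cmeasurable g -> Cae_eq f g -> L2 g.
Proof.
by move=> L2f mg fg; apply: (L2_le mg L2f); apply: (aeS fg) => x ->.
Qed.

Lemma L2D f g : L2 f -> L2 g -> L2 (fun x => f x + g x).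
Proof.
move=> /L2P[mf fi] /L2P[mg gi]; have mfg := CmeasD mf mg.
apply/L2P; split => //.
apply: (integ_le (g := fun x => 2 * (normc (f x) ^+ 2 + normc (g x) ^+ 2))).
- exact: Cmeas_sqr.
- move=> x; rewrite ger0_norm ?sqr_ge0//.
  have : normc (f x + g x) ^+ 2 <= (normc (f x) + normc (g x)) ^+ 2.
    by rewrite ler_pXn2r ?nnegrE ?addr_ge0// le_normcD.
  move=> /le_trans; apply.
  by have := sqr_ge0 (normc (f x) - normc (g x)); rewrite sqrrB sqrrD; lra.
- by apply: integZ; exact: integD.
Qed.

Lemma L2M_bnd (k : R) f g : Cmeasurable f -> L2 g ->
  (forall x, normc (f x) <= k) -> L2 (fun x => f x * g x).
Proof.
move=> mf /L2P[mg gi] fk; have mfg := CmeasM mf mg; apply/L2P; split => //.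
apply: (integ_le (g := fun x => k ^+ 2 * normc (g x) ^+ 2)).
- exact: Cmeas_sqr.
- move=> x; rewrite ger0_norm ?sqr_ge0// normcM exprMn.
  have k0 : 0 <= k by exact: le_trans (normc_ge0 _) (fk x).
  by rewrite ler_wpM2r ?sqr_ge0// sqr_mono ?normc_ge0.
- exact: integZ.
Qed.

Lemma L2Z c f : L2 f -> L2 (fun x => c * f x).
Proof. by move=> ?; apply: (L2M_bnd (k := normc c)) => //; exact: Cmeas_cst. Qed.

Lemma L2N f : L2 f -> L2 (fun x => - f x).
Proof.
move=> fL; apply: (L2_le (CmeasN (L2meas fL)) fL).
by apply: aeT => x; rewrite normcN.
Qed.

Lemma L2B f g : L2 f -> L2 g -> L2 (fun x => f x - g x).
Proof. by move=> *; apply: L2D => //; exact: L2N. Qed.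

Lemma L2J f : L2 f -> L2 (fun x => (f x)^*%C).
Proof.
move=> fL; apply: (L2_le (CmeasJ (L2meas fL)) fL).
by apply: aeT => x; rewrite normcJ'.
Qed.

Lemma L2_0 : L2 (fun=> 0 : R[i]).
Proof.
apply/L2P; split; first exact: Cmeas_cst.
rewrite (_ : (fun=> _) = cst 0); first exact: integrable0.
by apply: funext => x; rewrite normc0 expr0n.
Qed.

Lemma L2cis (a : R -> R) f : measurable_fun setT a -> L2 f ->
  L2 (fun x => cis (a x) * f x).
Proof.
move=> ma fL; apply: (L2M_bnd (k := 1)) => //; first exact: Cmeas_cis.
by move=> x; rewrite normc_cis.
Qed.

Lemma nrZ c f : L2 f -> nr (fun x => c * f x) = normc c * nr f.
Proof.
move=> /L2P[mf fi]; rewrite /nr.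
under eq_Rintegral do rewrite normcM exprMn.
by rewrite intZ// sqrtrM ?sqr_ge0// sqrtr_sqr ger0_norm.
Qed.

Lemma nrN f : nr (fun x => - f x) = nr f.
Proof. by congr Num.sqrt; apply: eq_Rintegral => x _; rewrite normcN. Qed.

Lemma nrJ f : nr (fun x => (f x)^*%C) = nr f.
Proof. by congr Num.sqrt; apply: eq_Rintegral => x _; rewrite normcJ'. Qed.

Lemma nrcis (a : R -> R) f : nr (fun x => cis (a x) * f x) = nr f.
Proof.
by congr Num.sqrt; apply: eq_Rintegral => x _; rewrite normcM normc_cis mul1r.
Qed.

Lemma nr0 : nr (fun=> 0) = 0.
Proof.
rewrite /nr; under eq_Rintegral do rewrite normc0 expr0n/=.
by rewrite Rintegral_cst// mul0r sqrtr0.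
Qed.

Lemma nr_eq0 f : L2 f -> nr f = 0 -> Cae_eq f (fun=> 0).
Proof.
move=> /L2P[mf fi] f0.
have : \int[mu]_x (normc (f x) ^+ 2) = 0 by rewrite -nr2 f0 expr0n.
move=> /(int_eq0_ae fi (fun x => sqr_ge0 _)) h; apply: (aeS h) => x /eqP.
by rewrite sqrf_eq0 => /eqP; exact: eq0_normc.
Qed.

Lemma ip_integ f g : L2 f -> L2 g ->
  integ (fun x => re (f x) * re (g x) + im (f x) * im (g x)).
Proof.
move=> /L2P[mf fi] /L2P[mg gi].
apply: (integ_le (g := fun x => normc (f x) ^+ 2 + normc (g x) ^+ 2)).
- by case: mf mg => ? ? [? ?]; apply: measurable_funD; exact: measurable_funM.
- move=> x; apply: le_trans (reim_le _ _) _.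
  have := sqr_ge0 (normc (f x) - normc (g x)); rewrite sqrrB.
  have := mulr_ge0 (normc_ge0 (f x)) (normc_ge0 (g x)); lra.
- exact: integD.
Qed.

Lemma ipC f g : ip f g = ip g f.
Proof. by apply: eq_Rintegral => x _; rewrite [LHS]addrC addrC mulrC [X in _ + X]mulrC. Qed.

Lemma ipDl f g h : L2 f -> L2 g -> L2 h ->
  ip (fun x => f x + g x) h = ip f h + ip g h.
Proof.
move=> fL gL hL; rewrite -intD; try exact: ip_integ.
by apply: eq_Rintegral => x _; rewrite reD imD; ring.
Qed.

Lemma ipNl f h : L2 f -> L2 h -> ip (fun x => - f x) h = - ip f h.
Proof.
move=> fL hL; rewrite -intN; last exact: ip_integ.
by apply: eq_Rintegral => x _; rewrite reN imN; ring.
Qed.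

Lemma ipBl f g h : L2 f -> L2 g -> L2 h ->
  ip (fun x => f x - g x) h = ip f h - ip g h.
Proof. by move=> fL gL hL; rewrite ipDl ?ipNl//; exact: L2N. Qed.

Lemma ipZl (k : R) f h : L2 f -> L2 h -> ip (fun x => k%:C * f x) h = k * ip f h.
Proof.
move=> fL hL; rewrite -intZ; last exact: ip_integ.
by apply: eq_Rintegral => x _; rewrite reM imM /=; ring.
Qed.

Lemma ipDr f g h : L2 f -> L2 g -> L2 h ->
  ip h (fun x => f x + g x) = ip h f + ip h g.
Proof. by move=> *; rewrite ipC ipDl// ipC [X in _ + X]ipC. Qed.

Lemma ipBr f g h : L2 f -> L2 g -> L2 h ->
  ip h (fun x => f x - g x) = ip h f - ip h g.
Proof. by move=> *; rewrite ipC ipBl// ipC [X in _ - X]ipC. Qed.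

Lemma ipMc c f g : ip (fun x => c * f x) g = ip f (fun x => c^*%C * g x).
Proof. by apply: eq_Rintegral => x _; rewrite !reimE; ring. Qed.

Lemma ipM (a : R -> R[i]) f g :
  ip (fun x => a x * f x) g = ip f (fun x => (a x)^*%C * g x).
Proof. by apply: eq_Rintegral => x _; rewrite !reimE; ring. Qed.

Lemma ip_ael f g h : Cmeasurable f -> Cmeasurable g -> Cmeasurable h ->
  Cae_eq f g -> ip f h = ip g h.
Proof.
move=> [? ?] [? ?] [? ?] fg.
apply: int_ae; try by apply: measurable_funD; exact: measurable_funM.
by apply: (aeS fg) => x ->.
Qed.

Lemma ip_integ_prod f g : L2 f -> L2 g -> integ (fun x => normc (f x) * normc (g x)).
Proof.
move=> /L2P[mf fi] /L2P[mg gi].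
apply: (integ_le (g := fun x => normc (f x) ^+ 2 + normc (g x) ^+ 2)).
- by apply: measurable_funM; exact: Cmeas_normc.
- move=> x; rewrite ger0_norm; last by apply: mulr_ge0; exact: normc_ge0.
  have := sqr_ge0 (normc (f x) - normc (g x)); rewrite sqrrB.
  have := mulr_ge0 (normc_ge0 (f x)) (normc_ge0 (g x)); lra.
- exact: integD.
Qed.

(** Integrate $2|f||g|\le k|f|^2+k^{-1}|g|^2$ and take the optimal $k$, the quotient of the norms.
    The quotient requires both norms to be nonzero, hence the two separate cases. *)
Lemma int_prod_le f g : L2 f -> L2 g ->
  \int[mu]_x (normc (f x) * normc (g x)) <= nr f * nr g.
Proof.
move=> fL gL; have pi := ip_integ_prod fL gL.
have fi := L2integ fL; have gi := L2integ gL.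
have key (k : R) : 0 < k ->
    2 * (\int[mu]_x (normc (f x) * normc (g x))) <=
    k * nr f ^+ 2 + k^-1 * nr g ^+ 2.
  move=> k0; rewrite !nr2 -!intZ// -intD; try exact: integZ.
  apply: int_le; [exact: integZ|by apply: integD; exact: integZ|].
  move=> x; set a := normc (f x); set b := normc (g x).
  have : 0 <= k^-1 * (k * a - b) ^+ 2 by rewrite mulr_ge0 ?sqr_ge0// invr_ge0 ltW.
  rewrite sqrrB !mulrDr exprMn expr2 -!mulrA mulKf ?gt_eqF//.
  rewrite mulrN mulrnAr mulKf ?gt_eqF//; lra.
have [f0|f0] := eqVneq (nr f) 0.
  rewrite f0 mul0r.
  have h := nr_eq0 fL f0.
  rewrite -(_ : \int[mu]_x (0 : R) = 0); last by rewrite Rintegral_cst// mul0r.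
  apply: int_le_ae => //; first exact: (@integrable0 _ _ _ mu setT).
  by apply: (aeS h) => x ->; rewrite normc0 mul0r.
have [g0|g0] := eqVneq (nr g) 0.
  rewrite g0 mulr0.
  have h := nr_eq0 gL g0.
  rewrite -(_ : \int[mu]_x (0 : R) = 0); last by rewrite Rintegral_cst// mul0r.
  apply: int_le_ae => //; first exact: (@integrable0 _ _ _ mu setT).
  by apply: (aeS h) => x ->; rewrite normc0 mulr0.
have fp : 0 < nr f by rewrite lt_neqAle eq_sym f0 /=.
have gp : 0 < nr g by rewrite lt_neqAle eq_sym g0 /=.
have := key (nr g / nr f) (divr_gt0 gp fp).
rewrite invf_div expr2 -!mulrA mulKf// expr2 [X in _ + X]mulrA.
have -> : nr f / nr g * (nr g * nr g) = nr f * nr g by field.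
rewrite [nr g * _]mulrC; lra.
Qed.

Lemma ip_le f g : L2 f -> L2 g -> `|ip f g| <= nr f * nr g.
Proof.
move=> fL gL; apply: le_trans (int_prod_le fL gL).
apply: le_trans (int_norm_le (ip_integ fL gL)) _.
apply: int_le; [exact: integ_norm (ip_integ fL gL)|exact: ip_integ_prod|].
by move=> x; exact: reim_le.
Qed.

Lemma nr2D f g : L2 f -> L2 g ->
  nr (fun x => f x + g x) ^+ 2 = nr f ^+ 2 + 2 * ip f g + nr g ^+ 2.
Proof.
move=> fL gL; have fgL := L2D fL gL.
by rewrite -!ipff ipDl// !ipDr// [ip g f]ipC; ring.
Qed.

Lemma nr2B f g : L2 f -> L2 g ->
  nr (fun x => f x - g x) ^+ 2 = nr f ^+ 2 - 2 * ip f g + nr g ^+ 2.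
Proof.
move=> fL gL; rewrite nr2D//; last exact: L2N.
by rewrite nrN ipC ipNl// ipC; ring.
Qed.

Lemma nrD f g : L2 f -> L2 g -> nr (fun x => f x + g x) <= nr f + nr g.
Proof.
move=> fL gL; rewrite -(@ler_pXn2r _ 2)// ?nnegrE ?addr_ge0//.
rewrite nr2D// sqrrD; have := ip_le fL gL.
by rewrite ler_norml => /andP[_]; rewrite -mulr_natr; lra.
Qed.

Lemma nrB f g : L2 f -> L2 g -> nr (fun x => f x - g x) <= nr f + nr g.
Proof. by move=> fL gL; rewrite (le_trans (nrD fL (L2N gL)))// nrN. Qed.

Lemma nrB_sym f g : nr (fun x => f x - g x) = nr (fun x => g x - f x).
Proof. by rewrite -nrN; congr nr; apply: funext => x; rewrite opprB. Qed.

Lemma nrB_trans f g h : L2 f -> L2 g -> L2 h ->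
  nr (fun x => f x - h x) <= nr (fun x => f x - g x) + nr (fun x => g x - h x).
Proof.
move=> fL gL hL; apply: le_trans (nrD (L2B fL gL) (L2B gL hL)).
by rewrite le_eqVlt; apply/orP; left; apply/eqP; congr nr; apply: funext => x;
  rewrite addrA subrK.
Qed.

Lemma nr_dist f g : L2 f -> L2 g -> `|nr f - nr g| <= nr (fun x => f x - g x).
Proof.
move=> fL gL; rewrite ler_norml; apply/andP; split.
  have := nrD (L2B gL fL) fL; rewrite (_ : (fun x => _) = g); last first.
    by apply: funext => x; rewrite subrK.
  rewrite nrB_sym; lra.
have := nrD (L2B fL gL) gL; rewrite (_ : (fun x => _) = f); last first.
  by apply: funext => x; rewrite subrK.
lra.
Qed.

End L2space.
#[global] Hint Resolve nr_ge0 : core.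

(** * Limits and completeness in $L^2$ *)

Section L2limits.
Context {R : realType}.
Local Notation mu := (@lebesgue_measure R).
Local Notation re := (@complex.Re R).
Local Notation im := (@complex.Im R).
Implicit Types (f g h G : R -> R[i]) (F : nat -> R -> R[i]).

Definition L2lim F G := forall e : R, 0 < e -> exists n0, forall n, (n0 <= n)%N ->
  nr (fun x => F n x - G x) <= e.

Definition L2cauchy F := forall e : R, 0 < e -> exists n0, forall m n, (n0 <= m)%N ->
  (n0 <= n)%N -> nr (fun x => F m x - F n x) <= e.

Lemma L2_dct F G h : (forall n, L2 (F n)) -> L2 G -> L2 h ->
  (forall n x, normc (F n x - G x) <= normc (h x)) ->
  (forall x, (fun n => normc (F n x - G x)) @ \oo --> (0 : R)) -> L2lim F G.
Proof.
move=> FL GL hL Fh FG.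
have mFG n : Cmeasurable (fun x => F n x - G x).
  by apply: CmeasB; apply: L2meas.
have [|||||_ _] := @dominated_convergence _ _ _ mu setT measurableT
  (fun n x => (normc (F n x - G x) ^+ 2)%:E) (fun=> 0%E)
  (fun x => (normc (h x) ^+ 2)%:E).
- by move=> n; exact: mEFin (Cmeas_sqr (mFG n)).
- exact: measurable_cst.
- apply: aeT => x _; apply: cvg_EFin; first exact: nearW.
  have -> : (fine \o (fun n => (normc (F n x - G x) ^+ 2)%:E)) =
    (fun n => normc (F n x - G x) * normc (F n x - G x)).
    by apply: funext => n /=; rewrite expr2.
  by rewrite -(mulr0 (0 : R)); apply: cvgM; exact: FG.
- exact: L2integ hL.
- apply: aeT => x n _; rewrite /= lee_fin ger0_norm ?sqr_ge0//.
  by apply: sqr_mono => //; exact: normc_ge0.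
rewrite integral0 => H.
have {}H : (nr (fun x => F n x - G x)) ^+ 2 @[n --> \oo] --> (0 : R).
  suff /fine_cvgP[_] : (nr (fun x => F n x - G x) ^+ 2)%:E @[n --> \oo] --> 0%E by [].
  apply: cvg_trans H; apply: near_eq_cvg; apply: nearW => n /=.
  by rewrite nr2 integ_fin//; exact: L2integ (L2B (FL n) GL).
move=> e e0; have e20 : 0 < e ^+ 2 by rewrite exprn_gt0.
have /cvgrPdist_lt/(_ _ e20)[n0 _ Hn0] := H.
exists n0 => n n0n; have := Hn0 n n0n; rewrite /= sub0r normrN ger0_norm ?sqr_ge0//.
by move=> /ltW; rewrite ler_pXn2r ?nnegrE ?nr_ge0// ltW.
Qed.

(** Fatou's lemma for the squares. Membership of [G] in $L^2$ is part of the conclusion, since [G]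
    is often known only as a pointwise limit. *)
Lemma L2_fatou F G (e : R) : (forall n, Cmeasurable (F n)) -> Cmeasurable G ->
  {ae mu, forall x, (fun n => normc (F n x - G x)) @ \oo --> (0 : R)} ->
  (forall n, L2 (F n) /\ nr (F n) <= e) -> L2 G /\ nr G <= e.
Proof.
move=> mF mG FG Fe.
have e0 : 0 <= e by have [_] := Fe 0%N; apply: le_trans; exact: nr_ge0.
pose f n x : \bar R := (normc (F n x) ^+ 2)%:E.
have mf n : measurable_fun setT (f n) by apply: mEFin; exact: Cmeas_sqr.
have f0 n x : (0 <= f n x)%E by rewrite lee_fin sqr_ge0.
have H := @fatou _ _ _ mu setT measurableT f mf (fun n x _ => f0 n x).
have mli : measurable_fun setT (fun x => limn_einf (f^~ x)).
  rewrite /limn_einf; apply: measurableT_comp => //.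
  apply: measurable_fun_limn_esup => n; apply: measurableT_comp => //; exact: mf.
have mG2 : measurable_fun setT (fun x => (normc (G x) ^+ 2)%:E).
  by apply: mEFin; exact: Cmeas_sqr.
have HG : (\int[mu]_x (normc (G x) ^+ 2)%:E <= (e ^+ 2)%:E)%E.
  apply: (@le_trans _ _ (\int[mu]_x limn_einf (f^~ x))%E).
    apply: ae_ge0_le_integral => //.
    - by move=> x _; rewrite lee_fin sqr_ge0.
    - move=> x _; rewrite limn_einf_lim; apply: lime_ge.
        exact: is_cvg_einfs.
      by apply: nearW => n; apply: le_ereal_inf_tmp => _ [k _ <-].
    apply: (aeS FG) => x Fx _.
    suff /cvg_limn_einf_sup[-> _] : f^~ x @ \oo --> (normc (G x) ^+ 2)%:E by [].
    apply: cvg_EFin; first exact: nearW.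
    have -> : (fine \o f^~ x) = (fun n => normc (F n x) ^+ 2) by [].
    suff h : (fun n => normc (F n x)) @ \oo --> normc (G x).
      by rewrite expr2; under eq_fun do rewrite expr2; apply: cvgM.
    apply/cvgrPdist_le => d d0.
    have /cvgrPdist_le/(_ _ d0) := Fx; apply: filterS => n.
    rewrite sub0r normrN (ger0_norm (normc_ge0 _)) distrC; apply: le_trans.
    exact: normc_dist.
  apply: le_trans H _; rewrite limn_einf_lim; apply: lime_le.
    exact: is_cvg_einfs.
  apply: nearW => n; apply: ereal_inf_le; exists (\int[mu]_x f n x)%E.
    by exists n => /=.
  have [FL Fn] := Fe n.
  by rewrite integ_fin ?lee_fin; [rewrite -nr2 sqr_mono ?nr_ge0|exact: L2integ].
have GL : L2 G.
  apply/L2P; split => //; apply: fin_integ; [exact: Cmeas_sqr| |].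
    by move=> x; exact: sqr_ge0.
  by apply: le_lt_trans HG _; exact: ltry.
split => //; move: HG; rewrite integ_fin ?lee_fin; last exact: L2integ.
by rewrite -nr2 ler_pXn2r ?nnegrE ?nr_ge0.
Qed.

(** With [n] fixed, [L2_fatou] applied to the sequence [F n - F m] in [m] carries the Cauchy bound
    over to [F n - G]. *)
Lemma L2cauchy_pt F G : (forall n, L2 (F n)) -> L2cauchy F -> Cmeasurable G ->
  {ae mu, forall x, (fun n => normc (F n x - G x)) @ \oo --> (0 : R)} ->
  L2 G /\ L2lim F G.
Proof.
move=> FL Fc mG FG.
have H e : 0 < e -> exists n0, forall n, (n0 <= n)%N ->
    L2 (fun x => F n x - G x) /\ nr (fun x => F n x - G x) <= e.
  move=> e0; have [n0 Hn0] := Fc _ e0; exists n0 => n n0n.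
  apply: (@L2_fatou (fun m x => F n x - F (n0 + m)%N x)).
  - by move=> m; apply: CmeasB; exact: L2meas.
  - by apply: CmeasB => //; exact: L2meas.
  - apply: (aeS FG) => x; rewrite -(cvg_shiftn n0) => h.
    suff -> : (fun m => normc (F n x - F (n0 + m)%N x - (F n x - G x))) =
      (fun m => normc (F (m + n0)%N x - G x)) by exact: h.
    apply: funext => m; rewrite addnC -normcN; congr normc; ring.
  - move=> m; split; first exact: L2B.
    by apply: Hn0 => //; rewrite leq_addr.
have [n0 /(_ n0 (leqnn _))[DL _]] := H 1 ltr01.
have GL : L2 G.
  by have := L2B (FL n0) DL; congr L2; apply: funext => x; ring.
split => // e e0; have [n1 Hn1] := H e e0; exists n1 => n n1n.
by have [] := Hn1 n n1n.
Qed.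

Lemma geo_cvg (u : nat -> R) (C : R) :
  (forall k, `|u k.+1 - u k| <= C * 2^-1 ^+ k) -> cvgn u.
Proof.
move=> uC.
have C0 : 0 <= C by have := uC 0%N; rewrite expr0 mulr1; apply: le_trans.
have h : cvgn (series (fun k => u k.+1 - u k)).
  apply: normed_cvg.
  apply: (@series_le_cvg _ _ (geometric C 2^-1)).
  - by move=> n; exact: normr_ge0.
  - by move=> n; rewrite /geometric /= mulr_ge0// exprn_ge0// invr_ge0.
  - by move=> n; exact: uC.
  - by apply: is_cvg_geometric_series; rewrite ger0_norm ?invr_ge0// invf_lt1 ?ltr1n.
have -> : u = (fun n => u 0%N + series (fun k => u k.+1 - u k) n).
  apply: funext => n; rewrite /series /=; rewrite telescope_sumr//; ring.
by apply: is_cvgD => //; exact: is_cvg_cst.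
Qed.

(** The weight $4^k$ splits the decay $8^{-k}$: the series of $4^k|F_{k+1}-F_k|^2$ has integral at
    most $\sum 2^{-k}$, hence is finite almost everywhere, and a finite sum $S$ bounds each
    increment by $\sqrt S\,2^{-k}$. *)
Lemma L2_fast_cvg F : (forall n, L2 (F n)) ->
  (forall k, nr (fun x => F k.+1 x - F k x) ^+ 2 <= 8^-1 ^+ k) ->
  {ae mu, forall x, exists C : R, forall k, normc (F k.+1 x - F k x) <= C * 2^-1 ^+ k}.
Proof.
move=> FL Fk.
pose D k x := (4 ^+ k * normc (F k.+1 x - F k x) ^+ 2)%:E.
have mD k : measurable_fun setT (D k).
  apply: mEFin; apply: measurable_funM => //.
  by apply: Cmeas_sqr; apply: CmeasB; exact: L2meas.
have D0 k x : (0 <= D k x)%E by rewrite lee_fin mulr_ge0 ?sqr_ge0// exprn_ge0.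
have ID k : (\int[mu]_x D k x <= (2^-1 ^+ k)%:E)%E.
  have DL := L2B (FL k.+1) (FL k).
  rewrite /D integ_fin; last exact: integZ (L2integ DL).
  rewrite lee_fin intZ ?(L2integ DL)// -nr2.
  have h : 4 ^+ k * nr (fun x => F k.+1 x - F k x) ^+ 2 <= 4 ^+ k * 8^-1 ^+ k.
    by rewrite ler_wpM2l ?exprn_ge0.
  apply: le_trans h _; by rewrite -exprMn (_ : 4 * 8^-1 = 2^-1 :> R)//; field.
have HS : (\int[mu]_x (\sum_(k <oo) D k x) <= 2%:E)%E.
  rewrite integral_nneseries//.
  apply: le_trans (_ : (\sum_(k <oo) (2^-1 ^+ k)%:E <= _)%E).
    apply: lee_nneseries => [k _ _|k _]; last exact: ID.
    by apply: integral_ge0 => x _; exact: D0.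
  have := @cvg_geometric_eseries_half R 2 0%N.
  rewrite (_ : (fun _ => _) = (fun k => (2^-1 ^+ k)%:E)); last first.
    apply: funext => k; congr EFin.
    by rewrite addn1 natrX exprS invfM mulrA divff// mul1r exprVn.
  by rewrite expr0 divr1 => /cvg_lim ->.
have IS : mu.-integrable setT (fun x => \sum_(k <oo) D k x)%E.
  apply/integrableP; split.
    by apply: ge0_emeasurable_sum => [k x|k]; [move=> *; exact: D0|move=> _; exact: mD].
  under eq_integral do rewrite gee0_abs ?nneseries_ge0//.
  by apply: le_lt_trans HS _; exact: ltry.
have H := integrable_ae measurableT IS.
apply: (aeS H) => x /(_ I) Sx.
pose S := fine (\sum_(k <oo) D k x)%E.
have Dk k : 4 ^+ k * normc (F k.+1 x - F k x) ^+ 2 <= S.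
  rewrite -lee_fin /S fineK//; apply: le_trans (nneseries_lim_ge k.+1 _).
    by rewrite big_nat_recr//= leeDr// sume_ge0.
  by move=> n _ _; exact: D0.
have S0 : 0 <= S by apply: le_trans (Dk 0%N); rewrite expr0 mul1r sqr_ge0.
exists (Num.sqrt S) => k.
rewrite -(@ler_pXn2r _ 2)// ?nnegrE ?mulr_ge0 ?sqrtr_ge0// ?exprn_ge0 ?invr_ge0//.
rewrite exprMn sqr_sqrtr// -exprM mulnC exprM expr2.
rewrite -(ler_pM2l (_ : 0 < 4 ^+ k)) ?exprn_gt0//.
apply: le_trans (Dk k) _; rewrite mulrCA -exprMn.
by rewrite (_ : 4 * (2^-1 * 2^-1) = 1 :> R) ?expr1n ?mulr1//; field.
Qed.

Lemma L2_complete F : (forall n, L2 (F n)) -> L2cauchy F ->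
  exists2 G, L2 G & L2lim F G.
Proof.
move=> FL Fc.
have /choice[N HN] : forall k, exists n0, forall m n, (n0 <= m)%N -> (n0 <= n)%N ->
    nr (fun x => F m x - F n x) ^+ 2 <= 8^-1 ^+ k.
  move=> k; have [|n0 H] := Fc (Num.sqrt (8^-1 ^+ k)).
    by rewrite sqrtr_gt0 exprn_gt0// invr_gt0.
  exists n0 => m n hm hn; have := sqr_mono (nr_ge0 _) (H m n hm hn).
  by move/le_trans; apply; rewrite sqr_sqrtr ?exprn_ge0 ?invr_ge0.
(* The maxima give three properties at once: the index is beyond [N k], nondecreasing, and at least
   [k]. *)
pose M := fix M k := if k is k'.+1 then maxn (M k') (maxn (N k'.+1) k) else N 0%N.
have MN k : (N k <= M k)%N by case: k => //= k; rewrite leq_max leq_max leqnn orbT.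
have MS k : (M k <= M k.+1)%N by rewrite /= leq_maxl.
have Mk k : (k <= M k)%N by case: k => //= k; rewrite !leq_max leqnn !orbT.
pose H k := F (M k).
have HL k : L2 (H k) by exact: FL.
have Hf k : nr (fun x => H k.+1 x - H k x) ^+ 2 <= 8^-1 ^+ k.
  by apply: HN => //; exact: leq_trans (MN k) (MS k).
have Hae := L2_fast_cvg HL Hf.
(* The upper limit is measurable and defined at every point, and it is the limit wherever the fast
   subsequence converges. *)
pose G x : R[i] := fine (limn_esup (fun k => (re (H k x))%:E)) +i*
                   fine (limn_esup (fun k => (im (H k x))%:E)).
have mG : Cmeasurable G.
  split => /=; (apply: (measurableT_comp (@fine_measurable _ setT measurableT)) || idtac).
    apply: measurable_fun_limn_esup => k; apply: mEFin.
    by have [[]] := HL k.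
  apply: measurable_fun_limn_esup => k; apply: mEFin.
  by have [[]] := HL k.
have HG : {ae mu, forall x, (fun n => normc (H n x - G x)) @ \oo --> (0 : R)}.
  apply: (aeS Hae) => x [C HC].
  have cr : cvgn (fun k => re (H k x)).
    apply: (@geo_cvg _ C) => k; apply: le_trans (HC k).
    by rewrite -reB normc_re.
  have ci : cvgn (fun k => im (H k x)).
    apply: (@geo_cvg _ C) => k; apply: le_trans (HC k).
    by rewrite -imB normc_im.
  have er : re (G x) = limn (fun k => re (H k x)).
    rewrite /G /=; have /cvg_limn_einf_sup[_ ->] // :
      (fun k => (re (H k x))%:E) @ \oo --> (limn (fun k => re (H k x)))%:E.
    by apply: cvg_EFin => //; exact: nearW.
  have ei : im (G x) = limn (fun k => im (H k x)).
    rewrite /G /=; have /cvg_limn_einf_sup[_ ->] // :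
      (fun k => (im (H k x))%:E) @ \oo --> (limn (fun k => im (H k x)))%:E.
    by apply: cvg_EFin => //; exact: nearW.
  have c0 : (fun k => `|re (H k x) - re (G x)| + `|im (H k x) - im (G x)|) @ \oo
     --> (0 : R).
    rewrite -(addr0 (0 : R)); apply: cvgD.
      rewrite -(normr0 R); apply: cvg_norm; rewrite -(subrr (re (G x))).
      by apply: cvgB; [rewrite er; exact: cr|exact: cvg_cst].
    rewrite -(normr0 R); apply: cvg_norm; rewrite -(subrr (im (G x))).
    by apply: cvgB; [rewrite ei; exact: ci|exact: cvg_cst].
  apply: (squeeze_cvgr _ (cvg_cst 0) c0); apply: nearW => k.
  by rewrite normc_ge0 /= (le_trans (normc_le_reim _))// reB imB.
have Hc : L2cauchy H.
  move=> e e0; have [n0 Hn0] := Fc e e0; exists n0 => m n hm hn.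
  by apply: Hn0; [apply: leq_trans (Mk m)|apply: leq_trans (Mk n)].
have [GL HGl] := L2cauchy_pt HL Hc mG HG.
exists G => // e e0.
have e20 : 0 < e / 2 by rewrite divr_gt0.
have [n0 Hn0] := Fc _ e20; have [n1 Hn1] := HGl _ e20.
exists n0 => n n0n; pose m := maxn n0 n1.
apply: le_trans (nrB_trans (FL n) (HL m) GL) _.
rewrite [leRHS]splitr; apply: lerD; last by apply: Hn1; rewrite leq_maxr.
by apply: Hn0 => //; apply: leq_trans (Mk m); rewrite leq_maxl.
Qed.

Lemma L2lim_nr F G : (forall n, L2 (F n)) -> L2 G -> L2lim F G ->
  (fun n => nr (F n)) @ \oo --> nr G.
Proof.
move=> FL GL FG; apply/cvgrPdist_le => e e0.
have [n0 H] := FG e e0; exists n0 => // n n0n /=.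
by rewrite distrC (le_trans (nr_dist (FL n) GL))// H.
Qed.

Lemma L2lim_ip F G h : (forall n, L2 (F n)) -> L2 G -> L2 h -> L2lim F G ->
  (fun n => ip (F n) h) @ \oo --> ip G h.
Proof.
move=> FL GL hL FG; apply/cvgrPdist_le => e e0.
have p : 0 < nr h + 1 by rewrite ltr_wpDl// nr_ge0.
have [n0 H] := FG (e / (nr h + 1)) (divr_gt0 e0 p); exists n0 => // n n0n /=.
rewrite distrC -ipBl//; apply: le_trans (ip_le (L2B (FL n) GL) hL) _.
apply: (@le_trans _ _ (e / (nr h + 1) * (nr h + 1))); last by rewrite divfK ?gt_eqF.
apply: ler_pM; rewrite ?nr_ge0//; first exact: H.
by rewrite lerDl.
Qed.

Lemma L2lim_uniq F G H : (forall n, L2 (F n)) -> L2 G -> L2 H ->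
  L2lim F G -> L2lim F H -> Cae_eq G H.
Proof.
move=> FL GL HL FG FH.
have DL := L2B GL HL.
suff D0 : nr (fun x => G x - H x) = 0.
  by apply: (aeS (nr_eq0 DL D0)) => x /eqP; rewrite subr_eq0 => /eqP.
apply/eqP; rewrite eq_le nr_ge0 andbT; apply/ler_addgt0Pl => e e0; rewrite addr0.
have e20 : 0 < e / 2 by rewrite divr_gt0.
have [n0 H0] := FG _ e20; have [n1 H1] := FH _ e20.
pose n := maxn n0 n1.
apply: le_trans (nrB_trans GL (FL n) HL) _; rewrite nrB_sym [leRHS]splitr.
by apply: lerD; [apply: H0; rewrite leq_maxl|apply: H1; rewrite leq_maxr].
Qed.

Lemma L2limP F G : (forall n, L2 (F n)) -> L2 G ->
  L2norm (F n \- G) @[n --> \oo] --> 0%E <-> L2lim F G.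
Proof.
move=> FL GL.
have E n : L2norm (F n \- G) = (nr (fun x => F n x - G x))%:E.
  by rewrite L2normE//; exact: L2B.
split.
- move=> /fine_cvgP[_ /cvgrPdist_le H] e /H[n0 _ {}H]; exists n0 => n /H /=.
  by rewrite E /= sub0r normrN ger0_norm ?nr_ge0.
- move=> H; apply/fine_cvgP; split; first by apply: nearW => n; rewrite E.
  apply/cvgrPdist_le => e /H[n0 {}H]; exists n0 => // n /H /=.
  by rewrite E /= sub0r normrN ger0_norm ?nr_ge0.
Qed.

End L2limits.

(** * Fourier transform *)

Section ChangeVar.
Context {R : realType}.
Local Notation mu := (@lebesgue_measure R).
Local Notation integ f := (mu.-integrable setT (EFin \o (f : R -> R))).

(** Uniqueness of Lebesgue measure: $t$ times its image under $x\mapsto tx$ gives every half-open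
    interval its length. *)
Lemma ge0_integral_scale (t : R) (f : R -> R) : 0 < t -> measurable_fun setT f ->
  (forall x, 0 <= f x) ->
  (\int[mu]_x (f (t * x))%:E = (t^-1)%:E * \int[mu]_x (f x)%:E)%E.
Proof.
move=> t0 mf f0.
have ti0 : 0 <= t^-1 by rewrite invr_ge0 ltW.
pose phi : R -> measurableTypeR R := fun x => t * x.
have mphi : measurable_fun setT phi.
  by apply: measurable_funM => //; exact: measurable_cst.
pose nu : {measure set (measurableTypeR R) -> \bar R} :=
  mscale (NngNum (ltW t0)) (@measure_function_pushforward__canonical__measure_function_Measure _ _ _ _ _ mu phi mphi).
have E A : measurable A -> mu A = nu A.
  apply: lebesgue_measure_unique => //= _ [[a b]] _ <-.
  rewrite /nu /mscale /= /pushforward /=.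
  rewrite (_ : _ @^-1` _ = `](a / t), (b / t)]%classic); last first.
    apply/seteqP; split => x /=; rewrite !in_itv /= ltr_pdivrMr// ler_pdivlMr//
      [x * t]mulrC//.
  rewrite !lebesgue_measure_itv /= !lte_fin ltr_pM2r ?invr_gt0//.
  case: ifP => // _; last by rewrite mule0.
  by rewrite -!EFinB -EFinM; congr EFin; field; rewrite gt_eqF.
have -> : (\int[mu]_x (f x)%:E = \int[nu]_x (f x)%:E)%E.
  by apply: eq_measure_integral => A mA _; exact: E.
rewrite ge0_integral_mscale//=; first last.
- by move=> x _; rewrite lee_fin.
- exact: mEFin.
rewrite muleA -EFinM mulVf ?gt_eqF// mul1e.
rewrite ge0_integral_pushforward//=.
- exact: mEFin.
- by move=> x _; rewrite lee_fin.
Qed.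

Lemma ge0_integral_reflect (f : R -> R) : measurable_fun setT f ->
  (forall x, 0 <= f x) ->
  (\int[mu]_x (f (- x))%:E = \int[mu]_x (f x)%:E)%E.
Proof.
move=> mf f0.
pose phi : R -> measurableTypeR R := -%R.
have mphi : measurable_fun setT phi by exact: oppr_measurable.
have -> : (\int[mu]_x (f x)%:E = \int[pushforward mu phi]_x (f x)%:E)%E.
  by apply: eq_measure_integral => A mA _; rewrite [RHS]lebesgue_measureN.
rewrite ge0_integral_pushforward//=.
- exact: mEFin.
- by move=> x _; rewrite lee_fin.
Qed.

Lemma integ_reflect (f : R -> R) : integ f -> integ (fun x => f (- x)).
Proof.
move=> fi; have mf := integ_meas fi.
have mfN : measurable_fun setT (fun x : R => f (- x)).
  by apply: measurableT_comp => //; exact: oppr_measurable.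
apply/integrableP; split; first exact: mEFin.
have /integrableP[_] := fi; congr (_ < _)%E => /=.
rewrite -(@ge0_integral_reflect (fun x => `|f x|))//.
exact: measurableT_comp.
Qed.

Lemma int_reflect (f : R -> R) : integ f -> \int[mu]_x f (- x) = \int[mu]_x f x.
Proof.
move=> fi; have mf := integ_meas fi.
have ni := integ_norm fi.
have si := integD ni fi.
(* The nonnegative case is applied to $|f|+f$ and to $|f|$, and the results are subtracted. *)
have e1 : \int[mu]_x (`|f (- x)| + f (- x)) = \int[mu]_x (`|f x| + f x).
  congr fine; rewrite -(@ge0_integral_reflect (fun x => `|f x| + f x))//.
  - by apply: measurable_funD => //; exact: measurableT_comp.
  - by move=> x; have := ler_norm (- f x); rewrite normrN; lra.
have e2 : \int[mu]_x `|f (- x)| = \int[mu]_x `|f x|.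
  congr fine; rewrite -(@ge0_integral_reflect (fun x => `|f x|))//.
  exact: measurableT_comp.
have := e1; rewrite (intD (integ_reflect ni) (integ_reflect fi)) (intD ni fi) e2.
exact: addrI.
Qed.

End ChangeVar.

(** * Plancherel's identity for step functions *)

Section FourierStep.
Context {R : realType}.
Local Notation mu := (@lebesgue_measure R).
Local Notation integ f := (mu.-integrable setT (EFin \o (f : R -> R))).
Local Notation re := (@complex.Re R).
Local Notation im := (@complex.Im R).
Implicit Types (f g h : R -> R[i]).

Lemma normr_sin_le (x : R) : `|sin x| <= `|x|.
Proof.
have pos (y : R) : 0 < y -> `|sin y| <= y.
  move=> y0.
  have [|c _] := @MVT R sin cos 0 y y0 (fun z _ => is_derive_sin z).
    by apply: continuous_subspaceT => z; exact: continuous_sin.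
  rewrite sin0 !subr0 => ->; rewrite normrM (ger0_norm (ltW y0)).
  by apply: ler_piMl; [exact: ltW|rewrite ler_norml cos_geN1 cos_le1].
have [x0|x0|->] := ltgtP x 0; last by rewrite sin0 normr0.
- rewrite -[`|sin x|]normrN -sinN (ltr0_norm x0); apply: pos; by rewrite oppr_gt0.
- by rewrite (gtr0_norm x0) pos.
Qed.

Lemma cos_lb (x : R) : 2 - 2 * cos x <= x ^+ 2.
Proof.
have -> : cos x = 1 - 2 * sin (x / 2) ^+ 2.
  have -> : x = x / 2 + x / 2 by rewrite -splitr.
  rewrite cosD -splitr; have := cos2Dsin2 (x / 2); rewrite !expr2; lra.
have : sin (x / 2) ^+ 2 <= (x / 2) ^+ 2.
  rewrite -[leLHS]real_normK ?num_real// -[leRHS]real_normK ?num_real//.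
  by apply: sqr_mono => //; exact: normr_sin_le.
rewrite expr_div_n; lra.
Qed.

Lemma integ_oneDsqrV : integ (fun x : R => (1 + x ^+ 2)^-1).
Proof.
have c : continuous (fun x : R => (1 + x ^+ 2)^-1).
  exact: (@continuous_oneDsqrV R).
have m := continuous_measurable_fun c.
have p (x : R) : 0 <= (1 + x ^+ 2)^-1.
  by rewrite invr_ge0 addr_ge0// sqr_ge0.
apply: fin_integ => //.
rewrite ge0_symfun_integralT//; last by move=> x /=; rewrite sqrrN.
rewrite lte_mul_pinfty//.
rewrite (_ : [set x : R | 0 <= x] = `[0, +oo[%classic); last first.
  by apply/seteqP; split => x /=; rewrite in_itv /= andbT.
apply: (@le_lt_trans _ _ ((pi : R) / 2)%:E); last exact: ltry.
have := @ge0_cvgn_integral R mu (fun x : R => (1 + x ^+ 2)^-1) p m.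
move/cvg_lim => <- //.
apply: lime_le.
  apply: ereal_nondecreasing_is_cvgn => n k nk.
  apply: ge0_subset_integral => //.
  - by apply: measurable_funTS; exact: mEFin.
  - by move=> x _; rewrite lee_fin.
  - by apply: subset_itvl; rewrite bnd_simp ler_nat.
apply: nearW => n.
have ci : mu.-integrable `[0, n%:R] (EFin \o (fun x : R => (1 + x ^+ 2)^-1)).
  apply: continuous_compact_integrable; first exact: segment_compact.
  exact: continuous_subspaceT.
rewrite -[leLHS]fineK; last exact: integrable_fin_num.
rewrite lee_fin; have := @integral0_oneDsqr R n%:R (ler0n _ _).
rewrite /Rintegral /oneDsqr => ->; exact/ltW/atan_ltpi2.
Qed.

(** Uses $x^{-1}=x\,(x^2)^{-1}$ with the inner inverse taken as a real power, which is measurable;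
    at 0 both sides are 0. *)
Lemma measurable_inv : measurable_fun setT (fun x : R => x^-1).
Proof.
rewrite (_ : (fun _ => _) = fun x => x * (x ^+ 2) `^ (-1)).
  apply: measurable_funM => //.
  apply: (measurableT_comp (f := fun y : R => y `^ (-1))); first exact: measurable_powR.
  exact: measurable_funX.
apply: funext => x; rewrite powR_inv1 ?sqr_ge0//.
have [->|x0] := eqVneq x 0; first by rewrite invr0 mul0r.
by field.
Qed.

(** Squared modulus of the Fourier transform of the indicator of $[0,1]$, up to the value at 0. *)
Definition fejer (x : R) : R := (2 - 2 * cos x) / x ^+ 2.

Lemma fejer_ge0 x : 0 <= fejer x.
Proof.
rewrite divr_ge0 ?sqr_ge0//; have := cos_le1 x; lra.
Qed.

Lemma fejer_meas : measurable_fun setT fejer.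
Proof.
apply: measurable_funM.
  apply: continuous_measurable_fun => x; apply: cvgB; first exact: cvg_cst.
  by apply: cvgM; [exact: cvg_cst|exact: continuous_cos].
apply: (measurableT_comp measurable_inv); exact: measurable_funX.
Qed.

Lemma fejer_integ : integ fejer.
Proof.
(* The constant: $(1+x^2)$ times the kernel is the kernel, at most 1 by [cos_lb], plus its
   numerator, at most 4. *)
apply: (integ_le fejer_meas (g := fun x => 5 * (1 + x ^+ 2)^-1)); last first.
  exact: integZ integ_oneDsqrV.
move=> x; rewrite ger0_norm ?fejer_ge0// /fejer.
have x2 := sqr_ge0 x.
have p : 0 < 1 + x ^+ 2 by lra.
rewrite ler_pdivlMr// mulrDr mulr1.
have [->|x0] := eqVneq x 0.
  by rewrite expr0n /= invr0 !mulr0 addr0.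
rewrite divfK ?sqrf_eq0//.
have h1 : (2 - 2 * cos x) / x ^+ 2 <= 1.
  by rewrite ler_pdivrMr ?mul1r ?cos_lb// exprn_even_gt0.
have := cos_geN1 x; lra.
Qed.

(* Equal to [2 pi], but only its positivity is used. *)
Definition cF : R := \int[mu]_x fejer x.

Lemma cF_gt0 : 0 < cF.
Proof.
rewrite lt_neqAle int_ge0 ?andbT; last exact: fejer_ge0.
apply/negP => /eqP/esym h.
have H := int_eq0_ae fejer_integ fejer_ge0 h.
(* The interval lies in $(0,\pi)$, where $\sin>0$ forces $\cos<1$, so the kernel has no zero on it;
   its length is positive. *)
have : ~ mu.-negligible `[(1 : R), 3 / 2].
  move=> Hn; have := @measure_negligible _ _ _ mu _
    (measurable_itv `[(1 : R), 3 / 2] : measurable (_ : set (measurableTypeR R))) Hn.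
  have h32 : (1 : R) < 3 / 2 by lra.
  rewrite -[X in X = _ -> _]/(mu `[(1:R), 3 / 2]%classic) lebesgue_measure_itv /=.
  by rewrite lte_fin h32 -EFinB => -[]; lra.
apply; apply: negligibleS H => x /=; rewrite in_itv /= => /andP[x1 x2] fx.
have x0 : 0 < x by lra.
have : 2 - 2 * cos x = 0.
  apply/eqP; move/eqP : fx; rewrite /fejer mulf_eq0 invr_eq0 sqrf_eq0 (gt_eqF x0).
  by rewrite orbF.
have s0 : 0 < sin x.
  by apply: sin_gt0_pi; rewrite x0 /=; have := pi_ge2 R; lra.
have := cos2Dsin2 x; have := exprn_gt0 2 s0 => s2 cs c2.
have c1 : cos x = 1 by lra.
by move: cs; rewrite c1 expr1n; lra.
Qed.

Lemma cF_ge0 : 0 <= cF. Proof. exact: ltW cF_gt0. Qed.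

(* [chi a] is the signed indicator of the interval between 0 and [a], and [Ech a] its Fourier
   transform, except at 0, where division makes [Ech a] vanish.  Both are curves whose squared
   [L^2] increments are proportional to [|a - b|] (for [Ech] by scaling), so by polarization
   their increments have proportional Gram matrices.  This gives Plancherel's identity for
   step functions. *)
Definition chi (a x : R) : R[i] := ((x < a)%R%:R - (x < 0)%R%:R)%:C.
Definition Ech (a x : R) : R[i] := (sin (a * x) / x) +i* ((cos (a * x) - 1) / x).

Lemma meas_lt (a : R) : measurable_fun setT (fun x : R => ((x < a)%R%:R : R)).
Proof.
rewrite (_ : (fun _ => _) = \1_(`]-oo, a[%classic)).
  exact: measurable_indic.
by apply: funext => x; rewrite indicE mem_setE in_itv.
Qed.

Lemma chi_meas a : Cmeasurable (chi a).
Proof. by apply: Cmeas_real; apply: measurable_funB; exact: meas_lt. Qed.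

Lemma chi_diff a b x : a <= b -> chi b x - chi a x = ((a <= x < b)%R%:R)%:C.
Proof.
move=> ab; rewrite /chi -rmorphB /=; congr (_%:C).
rewrite opprB addrA subrK; case: (ltP x a) => xa /=.
  by rewrite (lt_le_trans xa ab) subrr.
by rewrite subr0.
Qed.

Lemma chi_diff_norm a b x : a <= b ->
  normc (chi b x - chi a x) ^+ 2 = \1_(`[a, b[%classic) x.
Proof.
move=> ab; rewrite chi_diff// normcR indicE mem_setE in_itv /=.
by case: (_ <= _ < _); rewrite /= ?normr1 ?normr0 ?expr1n ?expr0n.
Qed.

Lemma chi0 : chi 0 = fun=> 0.
Proof. by apply: funext => x; rewrite /chi subrr. Qed.

Lemma chi_L2_diff a b : a <= b -> L2 (fun x => chi b x - chi a x) /\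
  nr (fun x => chi b x - chi a x) ^+ 2 = b - a.
Proof.
move=> ab; split.
  apply/L2P; split; first by apply: CmeasB; exact: chi_meas.
  under eq_fun do rewrite chi_diff_norm//.
  exact: integrable_indic_itv.
rewrite nr2; under eq_Rintegral do rewrite chi_diff_norm//.
rewrite /Rintegral integral_indic// setIT.
rewrite -[LHS]/(fine (mu `[a, b[%classic)) lebesgue_measure_itv /= lte_fin.
by move: ab; rewrite le_eqVlt => /predU1P[->|->//]; rewrite ltxx subrr.
Qed.

Lemma chi_L2 a : L2 (chi a).
Proof.
have [a0|a0] := leP 0 a.
  have [+ _] := chi_L2_diff a0; congr L2; apply: funext => x.
  by rewrite chi0 subr0.
have [/L2N + _] := chi_L2_diff (ltW a0); congr L2; apply: funext => x.
by rewrite chi0 sub0r opprK.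
Qed.

Lemma chi_dist a b : nr (fun x => chi a x - chi b x) ^+ 2 = 1 * `|a - b|.
Proof.
rewrite mul1r; have [ab|ab] := leP a b.
  rewrite nrB_sym distrC; have [_ ->] := chi_L2_diff ab.
  by rewrite ger0_norm ?subr_ge0.
have [_ ->] := chi_L2_diff (ltW ab).
by rewrite ger0_norm ?subr_ge0// ltW.
Qed.

Lemma Ech_meas a : Cmeasurable (Ech a).
Proof.
have ma : measurable_fun setT (fun x : R => a * x).
  by apply: measurable_funM => //; exact: measurable_cst.
split => /=; apply: measurable_funM; try exact: measurable_inv.
  apply: (measurableT_comp (f := sin)) => //.
  by apply: continuous_measurable_fun; exact: continuous_sin.
apply: (measurable_funB (f := fun x => cos (a * x)) (g := fun=> 1)); last exact: measurable_cst.
apply: (measurableT_comp (f := cos)) => //.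
by apply: continuous_measurable_fun; exact: continuous_cos.
Qed.

Lemma Ech_diff_norm a b x :
  normc (Ech a x - Ech b x) ^+ 2 = (2 - 2 * cos ((a - b) * x)) / x ^+ 2.
Proof.
rewrite normcE2 reB imB /= -!mulrBl !exprMn -mulrDl exprVn; congr (_ / _).
rewrite mulrBl cosB; have := cos2Dsin2 (a * x); have := cos2Dsin2 (b * x).
set ca := cos (a * x); set cb := cos (b * x); set sa := sin (a * x).
set sb := sin (b * x) => h1 h2.
transitivity (ca ^+ 2 + sa ^+ 2 + (cb ^+ 2 + sb ^+ 2) - 2 * (ca * cb + sa * sb)).
  ring.
by rewrite h1 h2; ring.
Qed.

Lemma Ech_diff_norm_scale a b x : a != b ->
  normc (Ech a x - Ech b x) ^+ 2 = `|a - b| ^+ 2 * fejer (`|a - b| * x).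
Proof.
move=> ab; rewrite Ech_diff_norm /fejer.
have -> : cos (`|a - b| * x) = cos ((a - b) * x).
  by case: (ger0P (a - b)) => // _; rewrite mulNr cosN.
have [->|x0] := eqVneq x 0; first by rewrite !mulr0 expr0n /= invr0 !mulr0.
have : `|a - b| != 0 by rewrite normr_eq0 subr_eq0.
by move: `|a - b| => t t0; field; rewrite x0 t0.
Qed.

Lemma Ech0 : Ech 0 = fun=> 0.
Proof.
by apply: funext => x; rewrite /Ech mul0r sin0 cos0 subrr mul0r.
Qed.

Lemma fejer_scale t : 0 < t -> integ (fun x => fejer (t * x)) /\
  \int[mu]_x fejer (t * x) = t^-1 * cF.
Proof.
move=> t0.
have E := @ge0_integral_scale R t fejer t0 fejer_meas fejer_ge0.
have mt : measurable_fun setT (fun x => fejer (t * x)).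
  apply: (measurableT_comp fejer_meas).
  by apply: measurable_funM => //; exact: measurable_cst.
rewrite (integ_fin fejer_integ) -EFinM in E.
split.
  by apply: fin_integ => //; [move=> x; exact: fejer_ge0|rewrite E ltry].
by rewrite /Rintegral E.
Qed.

Lemma Ech_L2_diff a b : L2 (fun x => Ech a x - Ech b x) /\
  nr (fun x => Ech a x - Ech b x) ^+ 2 = cF * `|a - b|.
Proof.
have mE : Cmeasurable (fun x => Ech a x - Ech b x) by apply: CmeasB; exact: Ech_meas.
have [->|ab] := eqVneq a b.
  rewrite (_ : (fun x => _) = fun=> 0); last by apply: funext => x; rewrite subrr.
  by rewrite subrr normr0 mulr0 nr0 expr0n; split => //; exact: L2_0.
have t0 : 0 < `|a - b| by rewrite normr_gt0 subr_eq0.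
have [fi fE] := fejer_scale t0.
split.
  apply/L2P; split => //; under eq_fun do rewrite Ech_diff_norm_scale//.
  exact: integZ.
rewrite nr2; under eq_Rintegral do rewrite Ech_diff_norm_scale//.
by rewrite intZ// fE; field; rewrite gt_eqF.
Qed.

Lemma Ech_L2 a : L2 (Ech a).
Proof.
have [+ _] := Ech_L2_diff a 0; congr L2; apply: funext => x.
by rewrite Ech0 subr0.
Qed.

Lemma polarization (X : R -> R -> R[i]) (k : R) : (forall a, L2 (X a)) ->
  (forall a b, nr (fun x => X a x - X b x) ^+ 2 = k * `|a - b|) ->
  forall a b c d, ip (fun x => X b x - X a x) (fun x => X d x - X c x) =
    k * ((`|b - c| + `|a - d| - `|b - d| - `|a - c|) / 2).
Proof.
move=> XL H a b c d.
rewrite ipBl ?ipBr//; last exact: L2B.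
have arith (bc ad bd ac na nb nc nd pbc pad pbd pac : R) :
    nb - 2 * pbc + nc = k * bc -> na - 2 * pad + nd = k * ad ->
    nb - 2 * pbd + nd = k * bd -> na - 2 * pac + nc = k * ac ->
    pbd - pbc - (pad - pac) = k * ((bc + ad - bd - ac) / 2).
  move=> h1 h2 h3 h4; rewrite mulrA !mulrBr mulrDr -h1 -h2 -h3 -h4; by field.
by apply: (arith _ _ _ _ (nr (X a) ^+ 2) (nr (X b) ^+ 2) (nr (X c) ^+ 2) (nr (X d) ^+ 2));
  rewrite -nr2B//; exact: H.
Qed.

(** [Ech a (- x)] is the conjugate of [Ech a x], so the integrand is odd. This supplies the
    imaginary parts of inner products, which polarization of real norms does not see. *)
Lemma Ech_odd a b : ip (fun x => 'i%C * Ech a x) (Ech b) = 0.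
Proof.
have fi : integ (fun x => re ('i%C * Ech a x) * re (Ech b x) +
                          im ('i%C * Ech a x) * im (Ech b x)).
  by apply: ip_integ; [apply: L2Z|]; exact: Ech_L2.
have := int_reflect fi.
rewrite (_ : (fun x => _) = fun x => - (re ('i%C * Ech a x) * re (Ech b x) +
                          im ('i%C * Ech a x) * im (Ech b x))); last first.
  apply: funext => x; rewrite !reM !imM /= !mulrN !cosN !sinN invrN; ring.
rewrite intN// /ip => h; lra.
Qed.

(** Reduces products with complex coefficients to the two real numbers $\langle f,g\rangle$ and
    $\langle if,g\rangle$, which [ip_gen] compares for [chi] and [Ech]. *)
Lemma ipMM (c c' : R[i]) f g : L2 f -> L2 g ->
  ip (fun x => c * f x) (fun x => c' * g x) =
  re (c * c'^*%C) * ip f g + im (c * c'^*%C) * ip (fun x => 'i%C * f x) g.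
Proof.
move=> fL gL; rewrite -!intZ; try (apply: ip_integ => //; exact: L2Z).
rewrite -intD; try (apply: integZ; apply: ip_integ => //; exact: L2Z).
by apply: eq_Rintegral => x _; rewrite !reimE /=; ring.
Qed.

(* [stepf B f g]: [f] is a step function supported in [[-B, B]], with Fourier transform [g]. *)
Inductive stepf (B : R) : (R -> R[i]) -> (R -> R[i]) -> Prop :=
| stepf0 : stepf B (fun=> 0) (fun=> 0)
| stepfS c a b f g : - B <= a -> a <= b -> b <= B -> stepf B f g ->
    stepf B (fun x => c * (chi b x - chi a x) + f x)
            (fun x => c * (Ech b x - Ech a x) + g x).

Lemma stepf_L2 B f g : stepf B f g -> L2 f /\ L2 g.
Proof.
elim=> [|c a b {}f {}g _ _ _ _ [fL gL]]; first by split; exact: L2_0.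
split; apply: L2D => //; apply: L2Z; apply: L2B; (exact: chi_L2 || exact: Ech_L2).
Qed.

Lemma stepf_supp B f g : stepf B f g -> forall x, B < `|x| -> f x = 0.
Proof.
elim=> [//|c a b {}f {}g Ba ab bB _ IH] x Bx.
rewrite IH// addr0 chi_diff//.
case: (boolP (_ <= _ < _)) => [/andP[ax xb]|_]; last by rewrite mulr0.
by exfalso; move: Bx; rewrite ltNge ler_norml (le_trans Ba ax) (ltW (lt_le_trans xb bB)).
Qed.

Lemma ip_gen a b c d : let u X := fun x : R => X b x - X a x in
  let v X := fun x : R => X d x - X c x in
  ip (u Ech) (v Ech) = cF * ip (u chi) (v chi) /\
  ip (fun x => 'i%C * u Ech x) (v Ech) = 0 /\
  ip (fun x => 'i%C * u chi x) (v chi) = 0.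
Proof.
move=> u v; split.
  rewrite /u /v (@polarization Ech cF)//; [|exact: Ech_L2|by move=> a' b'; have [] := Ech_L2_diff a' b'].
  by rewrite (@polarization chi 1) ?mul1r//; [exact: chi_L2|exact: chi_dist].
split.
  rewrite /u /v.
  rewrite (_ : (fun x => _) = (fun x => 'i%C * Ech b x - 'i%C * Ech a x)); last first.
    by apply: funext => x; rewrite mulrBr.
  rewrite ipBl; [|exact: L2Z (Ech_L2 _)|exact: L2Z (Ech_L2 _)|apply: L2B; exact: Ech_L2].
  rewrite !ipBr; try (exact: L2Z (Ech_L2 _) || exact: Ech_L2).
  by rewrite !Ech_odd; ring.
rewrite /ip (_ : (fun x => _) = fun=> 0); first by rewrite Rintegral_cst// mul0r.
by apply: funext => x; rewrite /u /v /chi !reimE /=; ring.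
Qed.

Lemma stepf_ip B f g f' g' : stepf B f g -> stepf B f' g' ->
  ip g g' = cF * ip f f'.
Proof.
have ip0l h : ip (fun=> 0) h = 0.
  rewrite /ip (_ : (fun x => _) = fun=> 0); first by rewrite Rintegral_cst// mul0r.
  by apply: funext => x /=; ring.
move=> s s'; elim: s => [|c a b {}f {}g Ba ab bB s IH]; first by rewrite !ip0l mulr0.
have [fL gL] := stepf_L2 s; have [f'L g'L] := stepf_L2 s'.
have uE : L2 (fun x => Ech b x - Ech a x) by apply: L2B; exact: Ech_L2.
have uC : L2 (fun x => chi b x - chi a x) by apply: L2B; exact: chi_L2.
rewrite ipDl//; last exact: L2Z.
rewrite ipDl//; last exact: L2Z.
rewrite IH mulrDr; congr (_ + _).
elim: s' {IH f'L g'L} => [|c' a' b' {}f' {}g' Ba' ab' bB' s' IH].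
  by rewrite ipC ip0l ipC ip0l mulr0.
have [f'L g'L] := stepf_L2 s'.
have uE' : L2 (fun x => Ech b' x - Ech a' x) by apply: L2B; exact: Ech_L2.
have uC' : L2 (fun x => chi b' x - chi a' x) by apply: L2B; exact: chi_L2.
rewrite ipDr//; try exact: L2Z.
rewrite ipDr//; try exact: L2Z.
rewrite IH mulrDr; congr (_ + _).
rewrite !ipMM//; have /= [-> [-> ->]] := ip_gen a b a' b'.
by ring.
Qed.

Lemma stepf_nr B f g : stepf B f g -> nr g = Num.sqrt cF * nr f.
Proof.
move=> s; have := stepf_ip s s; rewrite !ipff => h.
apply/eqP; rewrite -(@eqrXn2 _ 2)// ?mulr_ge0 ?nr_ge0 ?sqrtr_ge0//.
by rewrite h exprMn (sqr_sqrtr cF_ge0).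
Qed.

End FourierStep.

(** * Uniform continuity on compact intervals *)

Section Heine.
Context {R : realType}.

(** Stated for a function [d] of two times with a triangle inequality, so that it serves both
    $|f(s)-f(t)|$ and norms of differences of curves of functions. *)
Lemma heine (d : R -> R -> R) (A B : R) :
  (forall s t x, A <= s <= B -> A <= t <= B -> A <= x <= B ->
    d s t <= d s x + d t x) ->
  (forall x, A <= x <= B -> forall e, 0 < e -> exists2 del : R, 0 < del &
    forall s, A <= s <= B -> `|s - x| < del -> d s x <= e) ->
  forall e, 0 < e -> exists2 del : R, 0 < del &
    forall s t, A <= s <= B -> A <= t <= B -> `|s - t| < del -> d s t <= e.
Proof.
move=> tri cont e e0.
have cK : compact `[A, B] by exact: segment_compact.
(* Compactness in its near-covering form, with the filter of small positive radii as parameter,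
   turns the local radii into a common one. *)
have /compact_near_coveringP/(_ R (0^'+) (fun del s => A <= s <= B -> forall t, A <= t <= B ->
  `|s - t| < del -> d s t <= e)) := cK.
case.
  move=> x; rewrite /= in_itv /= => xAB.
  have [del del0 H] := cont x xAB _ (divr_gt0 e0 (ltr0n _ 2)).
  have d20 : 0 < del / 2 by rewrite divr_gt0.
  exists (ball x (del / 2), [set r | r < del / 2]).
    split; first exact: nbhsx_ballx.
    exact: nbhs_right_lt.
  move=> [s r] /= [xs rd] sAB t tAB str.
  have sx : `|s - x| < del / 2 by move: xs; rewrite /ball /= distrC.
  apply: le_trans (tri s t x sAB tAB xAB) _.
  rewrite [leRHS]splitr; apply: lerD; first by apply: H => //; lra.
  apply: H => //.
  rewrite (_ : t - x = (s - x) - (s - t)); last by ring.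
  apply: le_lt_trans (ler_normB _ _) _; lra.
move=> r /= r0 Hr; exists (r / 2); first by rewrite divr_gt0.
move=> s t sAB tAB st; apply: (Hr (r / 2)) => //=.
- by rewrite sub0r normrN gtr0_norm ?divr_gt0//; lra.
- by rewrite divr_gt0.
Qed.

End Heine.

(** * Fourier integrals of compactly supported functions *)

Section FourierL2.
Context {R : realType}.
Local Notation mu := (@lebesgue_measure R).
Local Notation integ f := (mu.-integrable setT (EFin \o (f : R -> R))).
Local Notation re := (@complex.Re R).
Local Notation im := (@complex.Im R).
Implicit Types (f g h : R -> R[i]).

Definition Cinteg f := Cmeasurable f /\ integ (fun x => normc (f x)).

Lemma Cinteg_re f : Cinteg f -> integ (fun x => re (f x)).
Proof. by move=> [[mf _] fi]; apply: integ_le fi => // x; exact: normc_re. Qed.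

Lemma Cinteg_im f : Cinteg f -> integ (fun x => im (f x)).
Proof. by move=> [[_ mf] fi]; apply: integ_le fi => // x; exact: normc_im. Qed.

Lemma CintegD f g : Cinteg f -> Cinteg g -> Cinteg (fun x => f x + g x).
Proof.
move=> [mf fi] [mg gi]; have mfg := CmeasD mf mg; split => //.
apply: (integ_le (Cmeas_normc mfg) _ (integD fi gi)) => x.
by rewrite ger0_norm ?normc_ge0// le_normcD.
Qed.

Lemma Cinteg_bnd (k : R) g f : Cmeasurable g -> (forall x, normc (g x) <= k) ->
  Cinteg f -> Cinteg (fun x => g x * f x).
Proof.
move=> mg gk [mf fi]; have mfg := CmeasM mg mf; split => //.
apply: (integ_le (Cmeas_normc mfg) _ (integZ k fi)) => x.
by rewrite ger0_norm ?normc_ge0// normcM ler_wpM2r ?normc_ge0.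
Qed.

Lemma CintegZ c f : Cinteg f -> Cinteg (fun x => c * f x).
Proof. by apply: (Cinteg_bnd (k := normc c)) => //; exact: Cmeas_cst. Qed.

Lemma CintD f g : Cinteg f -> Cinteg g ->
  Cintegral setT (fun x => f x + g x) = Cintegral setT f + Cintegral setT g.
Proof.
move=> fi gi; apply: complex_ext; rewrite ?reD ?imD /=.
  rewrite -intD; [|exact: Cinteg_re..].
  by apply: eq_Rintegral => x _; rewrite reD.
rewrite -intD; [|exact: Cinteg_im..].
by apply: eq_Rintegral => x _; rewrite imD.
Qed.

Lemma CintZ c f : Cinteg f ->
  Cintegral setT (fun x => c * f x) = c * Cintegral setT f.
Proof.
move=> fi; have fr := Cinteg_re fi; have fm := Cinteg_im fi.
apply: complex_ext; rewrite ?reM ?imM /=.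
  rewrite -!intZ// -intB; [|exact: integZ..].
  by apply: eq_Rintegral => x _; rewrite reM.
rewrite -!intZ// -intD; [|exact: integZ..].
by apply: eq_Rintegral => x _; rewrite imM.
Qed.

(** Real and imaginary parts are bounded separately, which costs the factor 2; it enters only
    continuity and convergence arguments, never Plancherel's constant. *)
Lemma Cint_le f : Cinteg f ->
  normc (Cintegral setT f) <= 2 * \int[mu]_x normc (f x).
Proof.
move=> fi; have fr := Cinteg_re fi; have fm := Cinteg_im fi; case: (fi) => _ ni.
apply: le_trans (normc_le_reim _) _; rewrite /= mulr_natl mulr2n.
apply: lerD.
  apply: le_trans (int_norm_le fr) _; apply: int_le => //; first exact: integ_norm.
  by move=> x; exact: normc_re.
apply: le_trans (int_norm_le fm) _; apply: int_le => //; first exact: integ_norm.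
by move=> x; exact: normc_im.
Qed.

Definition supp (B : R) f := forall x, B < `|x| -> f x = 0.

Definition box (B x : R) : R[i] := ((`|x| <= B)%R%:R)%:C.

Lemma boxE B x : box B x = if `|x| <= B then 1 else 0.
Proof. by rewrite /box; case: ifP. Qed.

Lemma box_meas B : Cmeasurable (box B).
Proof.
apply: Cmeas_real.
rewrite (_ : (fun _ => _) = \1_(`[- B, B]%classic)).
  exact: measurable_indic.
by apply: funext => x; rewrite indicE mem_setE in_itv ler_norml.
Qed.

Lemma box_le1 B x : normc (box B x) <= 1.
Proof. by rewrite normcR; case: (`|x| <= B); rewrite /= ?normr0 ?normr1. Qed.

Lemma box_L2 B : L2 (box B).
Proof.
apply/L2P; split; first exact: box_meas.
rewrite (_ : (fun _ => _) = \1_(`[- B, B]%classic)).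
  exact: integrable_indic_itv.
apply: funext => x; rewrite indicE mem_setE in_itv /box normcR ler_norml.
by case: (_ <= _ <= _); rewrite /= ?normr0 ?normr1 ?expr0n ?expr1n.
Qed.

Lemma box_supp B f : supp B f -> f = fun x => box B x * f x.
Proof.
move=> fs; apply: funext => x; rewrite /box; case: leP => xB; first by rewrite mul1r.
by rewrite fs// mulr0.
Qed.

Lemma supp_box B f : supp B (fun x => box B x * f x).
Proof. by move=> x xB; rewrite /box leNgt xB mul0r. Qed.

Lemma L2_box B f : L2 f -> L2 (fun x => box B x * f x).
Proof. by move=> fL; apply: (L2M_bnd (k := 1)) => //; [exact: box_meas|exact: box_le1]. Qed.

Lemma suppD B f g : supp B f -> supp B g -> supp B (fun x => f x + g x).
Proof. by move=> fs gs x xB; rewrite fs// gs// addr0. Qed.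

Lemma suppN B f : supp B f -> supp B (fun x => - f x).
Proof. by move=> fs x xB; rewrite fs// oppr0. Qed.

Lemma suppW B B' f : B <= B' -> supp B f -> supp B' f.
Proof. by move=> BB fs x xB; apply: fs; exact: le_lt_trans xB. Qed.

(** Cauchy-Schwarz against the indicator of the interval. *)
Lemma supp_Cinteg B f : L2 f -> supp B f -> Cinteg f /\
  \int[mu]_x normc (f x) <= nr (box B) * nr f.
Proof.
move=> fL fs; have E x : normc (f x) = normc (box B x) * normc (f x).
  by rewrite -normcM -(congr1 (fun h => h x) (box_supp fs)).
have bL := box_L2 B.
split; first split; first exact: L2meas.
  by under eq_fun do rewrite E; exact: ip_integ_prod.
by under eq_Rintegral do rewrite E; exact: int_prod_le.
Qed.

Definition ft f (xi : R) : R[i] := Cintegral setT (fun x => f x * cis (- (x * xi))).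

Lemma cis_meas xi : Cmeasurable (fun x : R => cis (- (x * xi))).
Proof.
apply: Cmeas_cis; apply: measurableT_comp => //.
by apply: measurable_funM => //; exact: measurable_cst.
Qed.

Lemma Cinteg_cis xi f : Cinteg f -> Cinteg (fun x => f x * cis (- (x * xi))).
Proof.
move=> fi; under eq_fun do rewrite mulrC.
apply: (Cinteg_bnd (k := 1)) => //; first exact: cis_meas.
by move=> x; rewrite normc_cis.
Qed.

Lemma ftD f g xi : Cinteg f -> Cinteg g ->
  ft (fun x => f x + g x) xi = ft f xi + ft g xi.
Proof.
move=> fi gi; rewrite /ft -CintD; [|exact: Cinteg_cis..].
by congr Cintegral; apply: funext => x; rewrite mulrDl.
Qed.

Lemma ftZ c f xi : Cinteg f -> ft (fun x => c * f x) xi = c * ft f xi.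
Proof.
move=> fi; rewrite /ft -CintZ; last exact: Cinteg_cis.
by congr Cintegral; apply: funext => x; rewrite mulrA.
Qed.

Lemma ftB f g xi : Cinteg f -> Cinteg g ->
  ft (fun x => f x - g x) xi = ft f xi - ft g xi.
Proof.
move=> fi gi; rewrite -[- ft g xi]mulN1r -ftZ// -ftD//; last exact: CintegZ.
by congr ft; apply: funext => x; rewrite mulN1r.
Qed.

Lemma ft_le f xi : Cinteg f -> normc (ft f xi) <= 2 * \int[mu]_x normc (f x).
Proof.
move=> fi; apply: le_trans (Cint_le (Cinteg_cis xi fi)) _.
rewrite le_eqVlt; apply/orP; left; apply/eqP; congr (_ * _).
by apply: eq_Rintegral => x _; rewrite normcM normc_cis mulr1.
Qed.

Lemma cis_lip (a b : R) : normc (cis a - cis b) <= `|a - b|.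
Proof.
rewrite -(@ler_pXn2r _ 2)// ?nnegrE ?normc_ge0// real_normK ?num_real//.
apply: le_trans (cos_lb (a - b)); rewrite normcE2 reB imB /= cosB.
have := cos2Dsin2 a; have := cos2Dsin2 b; nra.
Qed.

(** Compact support bounds $|x|$ by $B$, and the kernel is Lipschitz in the frequency with constant
    $|x|$; so the transform is Lipschitz, hence continuous. *)
Lemma ft_meas B f : L2 f -> supp B f -> Cmeasurable (ft f).
Proof.
move=> fL fs; have [fi _] := supp_Cinteg fL fs.
have [_ ni] := fi.
pose K := 2 * (B * \int[mu]_x normc (f x)).
have lip xi eta : normc (ft f xi - ft f eta) <= K * `|xi - eta|.
  pose g x := f x * (cis (- (x * xi)) - cis (- (x * eta))).
  have gi : Cinteg g.
    rewrite (_ : g = fun x => f x * cis (- (x * xi)) + (-1) * (f x * cis (- (x * eta)))).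
      by apply: CintegD; [|apply: CintegZ]; exact: Cinteg_cis.
    by apply: funext => x; rewrite /g; ring.
  have -> : ft f xi - ft f eta = Cintegral setT g.
    rewrite -[- ft f eta]mulN1r /ft -CintZ; last exact: Cinteg_cis.
    rewrite -CintD; [|exact: Cinteg_cis|by apply: CintegZ; exact: Cinteg_cis].
    by congr Cintegral; apply: funext => x; rewrite /g; ring.
  apply: le_trans (Cint_le gi) _.
  rewrite /K -!mulrA ler_wpM2l// [_ * `|_|]mulrC mulrA -intZ//.
  case: gi => _ gi; apply: int_le => //; first exact: integZ.
  move=> x; rewrite /g normcM mulrC.
  have [xB|xB] := leP `|x| B; last by rewrite fs// normc0 !mulr0.
  rewrite ler_wpM2r ?normc_ge0//; apply: le_trans (cis_lip _ _) _.
  by rewrite opprK addrC -mulrBr normrM distrC ler_wpM2r.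
have K0 : 0 <= K.
  have := lip 1 0; rewrite subr0 normr1 mulr1; apply: le_trans; exact: normc_ge0.
have cont (F : R -> R) : (forall xi eta, `|F xi - F eta| <= K * `|xi - eta|) ->
    measurable_fun setT F.
  move=> FK; apply: continuous_measurable_fun => x.
  have K1 : 0 < K + 1 by rewrite ltr_wpDl.
  apply/cvgrPdist_le => e e0; exists (e / (K + 1)); first by rewrite /= divr_gt0.
  move=> y /= xy; apply: le_trans (FK _ _) _.
  apply: (@le_trans _ _ ((K + 1) * (e / (K + 1)))); last first.
    by rewrite mulrC divfK ?gt_eqF.
  by apply: ler_pM => //; [rewrite lerDl|exact: ltW].
split; apply: cont => xi eta; (apply: le_trans (lip xi eta)).
  by rewrite -reB normc_re.
by rewrite -imB normc_im.
Qed.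

Lemma int_cos (a b xi : R) : a <= b -> xi != 0 ->
  \int[mu]_(x in `[a, b]) cos (x * xi) = (sin (b * xi) - sin (a * xi)) / xi /\
  \int[mu]_(x in `[a, b]) sin (x * xi) = (cos (a * xi) - cos (b * xi)) / xi.
Proof.
rewrite le_eqVlt => /predU1P[->|ab] xi0.
  by rewrite !set_itv1 !Rintegral_set1 !subrr !mul0r.
have dm (x : R) : is_derive x 1 (fun x : R => x * xi) xi.
  by apply: is_derive_eq; rewrite /= scaler0 add0r /GRing.scale /= mulr1.
have ds (x : R) : is_derive x 1 (fun x : R => sin (x * xi) / xi) (cos (x * xi)).
  by apply: is_derive_eq; rewrite /GRing.scale /=; field.
have dc (x : R) : is_derive x 1 (fun x : R => - cos (x * xi) / xi) (sin (x * xi)).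
  by apply: is_derive_eq; rewrite /GRing.scale /=; field.
have cm : continuous (fun x : R => x * xi).
  by move=> x; apply: cvgM; [exact: cvg_id|exact: cvg_cst].
have cs : continuous (fun x : R => sin (x * xi)).
  by move=> x; apply: continuous_comp; [exact: cm|exact: continuous_sin].
have cc : continuous (fun x : R => cos (x * xi)).
  by move=> x; apply: continuous_comp; [exact: cm|exact: continuous_cos].
have LR (F F' : R -> R) : (forall x : R, is_derive x 1 F (F' x)) ->
    derivable_oo_LRcontinuous F a b.
  move=> dF; have cF x : {for x, continuous F}.
    by apply: differentiable_continuous; apply/derivable1_diffP; have [] := dF x.
  split.
  - by move=> x _; have [] := dF x.
  - by apply: cvg_at_right_filter; exact: cF.
  - by apply: cvg_at_left_filter; exact: cF.
split.
  have := @continuous_FTC2 R (fun x => cos (x * xi)) (fun x => sin (x * xi) / xi) a b ab.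
  rewrite /Rintegral => -> /=; first by rewrite mulrBl.
  - exact: continuous_subspaceT.
  - exact: LR ds.
  - by move=> x _; rewrite derive1E; have [_ ->] := ds x.
have := @continuous_FTC2 R (fun x => sin (x * xi)) (fun x => - cos (x * xi) / xi) a b ab.
rewrite /Rintegral => -> /=; first by rewrite -mulrBl opprK addrC.
- exact: continuous_subspaceT.
- exact: LR dc.
- by move=> x _; rewrite derive1E; have [_ ->] := dc x.
Qed.

Lemma ft_chi a b xi : a <= b -> xi != 0 ->
  ft (fun x => chi b x - chi a x) xi = Ech b xi - Ech a xi.
Proof.
move=> ab xi0; have [ic isn] := int_cos ab xi0.
have E x : chi b x - chi a x = (\1_(`[a, b[%classic) x)%:C.
  by rewrite chi_diff// indicE mem_setE in_itv.
have cm : continuous (fun x : R => x * xi).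
  by move=> x; apply: cvgM; [exact: cvg_id|exact: cvg_cst].
have key (F : R -> R) : continuous F ->
    \int[mu]_x (\1_(`[a, b[%classic) x * F (x * xi)) = \int[mu]_(x in `[a, b]) F (x * xi).
  move=> cF; rewrite -Rintegral_itv_bndo_bndc; last first.
    apply: (@integrableS _ _ _ mu `[a, b]) => //.
      by apply: subset_itvl; rewrite bnd_simp.
    apply: continuous_compact_integrable; first exact: segment_compact.
    apply: continuous_subspaceT => x; apply: continuous_comp; [exact: cm|exact: cF].
  rewrite [RHS]Rintegral_mkcond; apply: eq_Rintegral => x _.
  rewrite patchE indicE; case: (x \in _); by rewrite ?mul1r ?mul0r.
rewrite /ft (_ : (fun x => _ * _) = fun x => (\1_(`[a, b[%classic) x)%:C * cis (- (x * xi))); last first.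
  by apply: funext => x; rewrite E.
apply: complex_ext; rewrite ?reB ?imB /=.
  under eq_Rintegral do rewrite mul0r subr0 cosN.
  by rewrite key ?ic ?mulrBl//; exact: continuous_cos.
under eq_Rintegral do rewrite mul0r addr0 sinN mulrN.
rewrite intN; last first.
  apply: (integ_le (g := \1_(`[a, b[%classic))); last exact: integrable_indic_itv.
    apply: measurable_funM; first exact: measurable_indic.
    apply: continuous_measurable_fun => x.
    by apply: continuous_comp; [exact: cm|exact: continuous_sin].
  move=> x; rewrite indicE; case: (x \in _); rewrite ?mul0r ?normr0// mul1r.
  by rewrite ler_norml sin_geN1 sin_le1.
rewrite key ?isn; last exact: continuous_sin.
by rewrite -!mulrBl -mulNr; congr (_ / _); ring.
Qed.

Lemma ft0 xi : ft (fun=> 0) xi = 0.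
Proof.
rewrite /ft (_ : (fun _ => _) = fun=> 0); last by apply: funext => x; rewrite mul0r.
by apply: complex_ext => /=; rewrite Rintegral_cst// mul0r.
Qed.

Lemma stepf_ft B f g xi : stepf B f g -> xi != 0 -> ft f xi = g xi.
Proof.
move=> s xi0; elim: s => [|c a b {}f {}g Ba ab bB s IH]; first by rewrite ft0.
have [fL _] := stepf_L2 s; have fs := stepf_supp s.
have [fi _] := supp_Cinteg fL fs.
have s' := stepfS 1 Ba ab bB (@stepf0 R B).
have uE : (fun x => 1 * (chi b x - chi a x) + 0) = fun x => chi b x - chi a x.
  by apply: funext => x; rewrite mul1r addr0.
have us := stepf_supp s'; have [uL _] := stepf_L2 s'; move: us uL; rewrite -/(supp B _) uE => us uL.
have [ui _] := supp_Cinteg uL us.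
by rewrite ftD// ?ftZ// ?IH ?ft_chi//; exact: CintegZ.
Qed.

Lemma stepf_dist B f g f' g' : stepf B f g -> stepf B f' g' ->
  nr (fun x => g x - g' x) = Num.sqrt cF * nr (fun x => f x - f' x).
Proof.
move=> s s'; have [fL gL] := stepf_L2 s; have [f'L g'L] := stepf_L2 s'.
have h : nr (fun x => g x - g' x) ^+ 2 = cF * nr (fun x => f x - f' x) ^+ 2.
  rewrite (nr2B gL g'L) (nr2B fL f'L) -(ipff f) -(ipff f') -(ipff g) -(ipff g').
  rewrite (stepf_ip s s) (stepf_ip s s') (stepf_ip s' s').
  by move: (ip f f) (ip f f') (ip f' f') => a b c; ring.
apply/eqP; rewrite -(@eqrXn2 _ 2)// ?mulr_ge0 ?nr_ge0 ?sqrtr_ge0//.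
by rewrite h exprMn (sqr_sqrtr cF_ge0).
Qed.

End FourierL2.

(** * Density of step functions in $L^2$ *)

Section Density.
Context {R : realType}.
Local Notation mu := (@lebesgue_measure R).
Local Notation integ f := (mu.-integrable setT (EFin \o (f : R -> R))).
Local Notation re := (@complex.Re R).
Local Notation im := (@complex.Im R).

Lemma stepfD B (f g f' g' : R -> R[i]) : stepf B f g -> stepf B f' g' ->
  stepf B (fun x => f x + f' x) (fun x => g x + g' x).
Proof.
move=> s s'; elim: s => [|c a b {}f {}g Ba ab bB s IH].
  by under eq_fun do rewrite add0r; under [X in stepf _ _ X]eq_fun do rewrite add0r.
under eq_fun do rewrite -addrA; under [X in stepf _ _ X]eq_fun do rewrite -addrA.
exact: stepfS.
Qed.

Lemma stepfZ B k (f g : R -> R[i]) : stepf B f g ->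
  stepf B (fun x => k * f x) (fun x => k * g x).
Proof.
elim=> [|c a b {}f {}g Ba ab bB s IH].
  rewrite (_ : (fun=> _) = fun=> 0); first exact: stepf0.
  by apply: funext => x; rewrite mulr0.
under eq_fun do rewrite mulrDr mulrA.
under [X in stepf _ _ X]eq_fun do rewrite mulrDr mulrA.
exact: stepfS.
Qed.

Lemma stepf_dense_cont (h : R -> R) (B e : R) : 0 < B -> continuous h -> 0 < e ->
  exists s t, [/\ stepf B s t,
    forall x, - B <= x < B -> normc ((h x)%:C - s x) <= e &
    forall x, ~~ (- B <= x < B) -> s x = 0].
Proof.
move=> B0 ch e0.
have [|//|del del0 H] := @heine R (fun s t => `|h s - h t|) (- B) B _ _ e e0.
- move=> s t x _ _ _; rewrite [`|h t - h x|]distrC.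
  by rewrite (_ : h s - h t = h s - h x + (h x - h t)) ?ler_normD//; ring.
- move=> x _ d d0; have /cvgrPdist_le/(_ _ d0) := ch x.
  move=> [r /= r0 Hr]; exists r => // s _ sx.
  by rewrite distrC; apply: Hr => /=; rewrite distrC.
have d20 : 0 < del / 2 by rewrite divr_gt0.
(* Induction on the number of cells of length [del / 2] counted from [- B]; on the last cell the
   step function takes the value of [h] at the left end. *)
have key n : forall c, - B <= c <= B -> c <= - B + n%:R * (del / 2) ->
    exists s t, [/\ stepf B s t,
    forall x, - B <= x < c -> normc ((h x)%:C - s x) <= e &
    forall x, ~~ (- B <= x < c) -> s x = 0].
  elim: n => [|n IH] c /andP[Bc cB] cn.
    exists (fun=> 0), (fun=> 0); split => //; first exact: stepf0.
    move=> x /andP[Bx xc]; exfalso; move: cn; rewrite mul0r addr0; lra.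
  pose c' := - B + n%:R * (del / 2).
  have [cc'|c'c] := leP c c'; first by apply: IH => //; rewrite Bc cB.
  have Bc' : - B <= c' by rewrite lerDl mulr_ge0// ltW.
  have c'B : c' <= B by exact: le_trans (ltW c'c) cB.
  have [s [t [st Hs s0]]] := IH c' (introT andP (conj Bc' c'B)) (lexx _).
  exists (fun x => (h c')%:C * (chi c x - chi c' x) + s x).
  exists (fun x => (h c')%:C * (Ech c x - Ech c' x) + t x).
  have cn' : c <= c' + del / 2.
    by apply: le_trans cn _; rewrite /c' -natr1 mulrDl mul1r addrA.
  split.
  - by apply: stepfS => //; exact: ltW.
  - move=> x /andP[Bx xc]; rewrite (chi_diff _ (ltW c'c)).
    have [xc'|c'x] := ltP x c'.
      by rewrite /= mulr0 add0r Hs// Bx.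
    rewrite xc /= mulr1 s0 ?addr0; last by rewrite Bx /= -leNgt.
    rewrite -rmorphB normcR; apply: H.
    + by rewrite Bx /= (le_trans (ltW xc)).
    + by rewrite Bc' c'B.
    + rewrite ger0_norm ?subr_ge0//; lra.
  - move=> x; rewrite negb_and -ltNge -leNgt => xo.
    rewrite (chi_diff _ (ltW c'c)) (_ : (c' <= x < c) = false).
      rewrite mulr0 add0r s0// negb_and -ltNge -leNgt.
      by case/orP: xo => [->//|cx]; rewrite (le_trans (ltW c'c) cx) orbT.
    apply/negP => /andP[c'x xc]; case/orP: xo => [xB|cx].
      by move: (lt_le_trans xB Bc'); rewrite ltNge c'x.
    by move: xc; rewrite ltNge cx.
have := key (Num.truncn ((B - - B) / (del / 2))).+1 B.
apply; first by rewrite lexx andbT; lra.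
rewrite -lerBlDl -ler_pdivrMr//; apply/ltW.
have h0 : 0 <= (B - - B) / (del / 2) by apply: divr_ge0; lra.
by have /andP[_] := truncn_itv h0.
Qed.

(** Approximation by a continuous [h] is available in $L^1$. Clipping [h] to $[-M,M]$ does not
    increase its distance to [g] and bounds the difference by $2M$, so the squared $L^2$ distance is
    at most a constant times the $L^1$ distance. *)
Lemma stepf_dense_bounded (g : R -> R) (M B e : R) : 0 < B -> measurable_fun setT g ->
  (forall x, `|g x| <= M) -> (forall x, ~~ (- B <= x < B) -> g x = 0) -> 0 < e ->
  exists s t, stepf B s t /\ nr (fun x => (g x)%:C - s x) <= e.
Proof.
move=> B0 mg gM g0 e0.
have M0 : 0 <= M by exact: le_trans (gM 0).
have muB : (mu `[(- B)%R, B]%classic < +oo)%E.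
  by rewrite lebesgue_measure_itv /=; case: ifP => _; rewrite -?EFinB ltry.
have gi : mu.-integrable `[- B, B] (EFin \o g).
  apply: measurable_bounded_integrable; [exact: measurable_itv|exact: muB| |].
  - exact: measurable_funTS.
  - by exists M; split; rewrite ?num_real// => y My x _; exact: le_trans (gM x) (ltW My).
have [|g_ [cg ig cvg]] := @approximation_continuous_integrable R `[- B, B] g _ muB gi => //.
pose L := 2 * M + 1.
have L0 : 0 < L by rewrite /L; lra.
(* Chosen so that $L\eta=(e/2)^2$, where [L] bounds the difference of [g] and the clipped
   function. *)
pose eta := (e / 2) ^+ 2 / L.
have eta0 : 0 < eta by rewrite divr_gt0// exprn_gt0// divr_gt0.
have [h [ch hi hlt]] : exists h : R -> R, [/\ continuous h,
    mu.-integrable `[- B, B] (EFin \o h) &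
    (\int[mu]_(z in `[(- B)%R, B]) `|(g z - h z)%:E| < eta%:E)%E].
  move/fine_cvgP : cvg => [[n0 _ Hfin] /cvgrPdist_lt/(_ _ eta0)[n1 _ Hlt]].
  pose n := maxn n0 n1; exists (g_ n); split => //.
  have fn := Hfin n (leq_maxl _ _); have := Hlt n (leq_maxr _ _).
  rewrite /= sub0r normrN; rewrite -[X in (X < _)%E]fineK// lte_fin.
  by apply: le_lt_trans; exact: ler_norm.
pose k x := Num.max (- M) (Num.min M (h x)).
have ck : continuous k.
  move=> x; apply: (@continuous_max _ _ (fun=> - M) (fun x => Num.min M (h x))).
    exact: cvg_cst.
  by apply: (@continuous_min _ _ (fun=> M) h); [exact: cvg_cst|exact: ch].
have kM x : `|k x| <= M.
  by rewrite ler_norml /k le_max lexx /= ge_max ge_min lexx /= andbT; lra.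
have kh x : `|g x - k x| <= `|g x - h x|.
  have /andP[g1 g2] : - M <= g x <= M by rewrite -ler_norml.
  have n1 := ler_norm (g x - h x); have n2 := ler_norm (- (g x - h x)).
  rewrite normrN in n2.
  rewrite /k; case: (leP M (h x)) => hM.
    rewrite max_r; last lra.
    rewrite ler_norml; lra.
  by case: (leP (- M) (h x)) => hM'; rewrite ?ler_norml; [lra|lra].
have e20 : 0 < e / 2 by rewrite divr_gt0.
pose c := Num.sqrt (B - - B) + 1.
have c0 : 0 < c by rewrite ltr_wpDl// sqrtr_ge0.
have [s [t [st sk s0]]] := stepf_dense_cont B0 ck (divr_gt0 e20 c0).
exists s, t; split => //.
have BB : - B <= B by lra.
have [uL un] := chi_L2_diff BB.
pose u x : R[i] := chi B x - chi (- B) x.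
have uE x : u x = ((- B <= x < B)%R%:R)%:C by rewrite /u chi_diff.
have u1 x : normc (u x) <= 1.
  by rewrite uE normcR; case: (_ <= _ < _); rewrite /= ?normr0 ?normr1.
have mk := continuous_measurable_fun ck.
have kuL : L2 (fun x => (k x)%:C * u x).
  by apply: (L2M_bnd (k := M)); [exact: Cmeas_real|exact: uL|move=> x; rewrite normcR].
have gL : L2 (fun x => (g x)%:C).
  have : L2 (fun x => (g x)%:C * u x).
    by apply: (L2M_bnd (k := M)); [exact: Cmeas_real|exact: uL|move=> x; rewrite normcR].
  congr L2; apply: funext => x; rewrite uE.
  by case: (boolP (_ <= _ < _)) => [_|/g0 ->]; rewrite ?mulr1// mul0r.
have [sL _] := stepf_L2 st.
apply: le_trans (nrB_trans gL kuL sL) _; rewrite [leRHS]splitr; apply: lerD.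
  rewrite -(@ler_pXn2r _ 2)// ?nnegrE ?nr_ge0 ?(ltW e20)//.
  have ghi : mu.-integrable `[- B, B] (EFin \o (fun x => g x - h x)).
    by rewrite (_ : EFin \o _ = (EFin \o g) \- (EFin \o h))%E//; exact: integrableB.
  have ghi' := integrable_norm ghi.
  have ghi2 : integ ((fun x => `|g x - h x|) \_ `[- B, B]).
    exact: (integ_indic (fun x => `|g x - h x|) (measurable_itv `[- B, B])).1 ghi'.
  rewrite nr2.
  apply: (@le_trans _ _ (\int[mu]_x (L * ((fun x => `|g x - h x|) \_ `[- B, B]) x))).
    apply: int_le; [exact: L2integ (L2B gL kuL)|exact: integZ|].
    move=> x; rewrite uE patchE mem_setE in_itv /=.
    case: (boolP (- B <= x < B)) => [/andP[Bx xB]|xo].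
      rewrite Bx (ltW xB) mulr1 -rmorphB normcR expr2 /=.
      apply: ler_pM => //; rewrite /L.
      apply: le_trans (ler_normB _ _) _; have := gM x; have := kM x; lra.
    rewrite (g0 _ xo) mulr0 subrr normc0 expr0n /= mulr_ge0 ?(ltW L0)//.
    by case: ifP.
  rewrite intZ// -[leRHS](mulfVK (lt0r_neq0 L0)) mulrC ler_pM2r// -lee_fin.
  apply: le_trans (ltW hlt); rewrite -integ_fin//.
  rewrite [X in (_ <= X)%E]integral_mkcond le_eqVlt; apply/orP; left; apply/eqP.
  by apply: eq_integral => x _; rewrite !patchE; case: ifP.
apply: (@le_trans _ _ (nr (fun x => ((e / 2 / c)%:C) * u x))).
  apply: nr_le; [exact: L2B|exact: L2Z|apply: aeT => x].
  rewrite normcM uE; case: (boolP (- B <= x < B)) => [xi|xo].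
    rewrite /= !mulr1 normc1 mulr1 normcR ger0_norm; first exact: sk.
    by rewrite divr_ge0 ?ltW.
  by rewrite s0// mulr0 subr0 normc0 mulr0.
rewrite nrZ// normcR ger0_norm ?(divr_ge0 (ltW e20) (ltW c0))//.
rewrite -[leRHS](divfK (lt0r_neq0 c0)) ler_wpM2l ?(divr_ge0 (ltW e20) (ltW c0))//.
by rewrite -[nr u](ger0_norm (nr_ge0 _)) -sqrtr_sqr un /c lerDl.
Qed.

(** Cutting [f] off where $|f|>n$ and splitting into real and imaginary parts reduces to bounded
    real functions. The radius [B + 1] is positive, and its half-open interval contains the closed
    interval $[-B,B]$. *)
Lemma stepf_dense (f : R -> R[i]) (B e : R) : 0 <= B -> L2 f -> supp B f -> 0 < e ->
  exists s t, stepf (B + 1) s t /\ nr (fun x => f x - s x) <= e.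
Proof.
move=> B0 fL fs e0; have B1 : 0 < B + 1 by lra.
pose p (n : nat) x : R[i] := ((normc (f x) <= n%:R)%R%:R)%:C.
have mp n : Cmeasurable (p n).
  apply: Cmeas_real.
  rewrite (_ : (fun _ => _) = \1_([set x | normc (f x) <= n%:R])).
    apply: measurable_indic; rewrite -[X in measurable X]setTI.
    have mn := Cmeas_normc (L2meas fL).
    have := mn measurableT `]-oo, (n%:R : R)]%classic (measurable_itv _).
    by rewrite (_ : _ @^-1` _ = [set x | normc (f x) <= n%:R])//;
      apply/seteqP; split => x /=; rewrite in_itv.
  by apply: funext => x; rewrite indicE mem_setE.
have p1 n x : normc (p n x) <= 1.
  by rewrite normcR; case: (normc (f x) <= n%:R); rewrite /= ?normr0 ?normr1.
have FL n : L2 (fun x => p n x * f x) by exact: (L2M_bnd (k := 1)).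
have Flim : L2lim (fun n x => p n x * f x) f.
  apply: (L2_dct FL fL fL).
    move=> n x; rewrite -[X in _ - X]mul1r -mulrBl normcM.
    rewrite ler_piMl ?normc_ge0// /p; case: (normc (f x) <= n%:R).
      by rewrite subrr normc0.
    by rewrite sub0r normcN normc1.
  move=> x; apply: cvg_near_cst; near=> n.
  rewrite /p (_ : (_ <= _) = true) ?mul1r ?subrr ?normc0//.
  by near: n; exact: nbhs_infty_ger.
have e20 : 0 < e / 2 by rewrite divr_gt0.
have [n0 /(_ n0 (leqnn _)) Hn0] := Flim _ e20.
have e40 : 0 < e / 2 / 2 by rewrite divr_gt0.
pose g x := p n0 x * f x; have [mgr mgi] : Cmeasurable g by exact: L2meas (FL n0).
have gb x : normc (g x) <= n0%:R.
  rewrite /g /p; case: (boolP (normc (f x) <= n0%:R)) => [h|_]; first by rewrite mul1r.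
  by rewrite mul0r normc0.
have gz x : ~~ (- (B + 1) <= x < B + 1) -> g x = 0.
  move=> xo; rewrite /g fs ?mulr0// ltNge ler_norml; apply: contra xo => /andP[? ?].
  by apply/andP; split; lra.
have [|x|s [t [st Hs]]] := @stepf_dense_bounded (fun x => re (g x)) n0%:R (B + 1) (e / 2 / 2) B1 mgr _ _ e40.
- by move=> x; apply: le_trans (gb x); exact: normc_re.
- by move=> /gz ->.
have [|x|s' [t' [st' Hs']]] := @stepf_dense_bounded (fun x => im (g x)) n0%:R (B + 1) (e / 2 / 2) B1 mgi _ _ e40.
- by move=> x; apply: le_trans (gb x); exact: normc_im.
- by move=> /gz ->.
exists (fun x => s x + 'i%C * s' x), (fun x => t x + 'i%C * t' x).
have S := stepfD st (stepfZ 'i%C st'); split => //.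
have [SL _] := stepf_L2 S; have [sL _] := stepf_L2 st; have [s'L _] := stepf_L2 st'.
apply: le_trans (nrB_trans fL (FL n0) SL) _; rewrite [leRHS]splitr.
apply: lerD; first by rewrite nrB_sym.
have grL : L2 (fun x => (re (g x))%:C).
  apply: (L2_le (Cmeas_real mgr) (FL n0)); apply: aeT => x.
  by rewrite normcR normc_re.
have giL : L2 (fun x => (im (g x))%:C).
  apply: (L2_le (Cmeas_real mgi) (FL n0)); apply: aeT => x.
  by rewrite normcR normc_im.
rewrite (_ : (fun x => _) = fun x => ((re (g x))%:C - s x) + 'i%C * ((im (g x))%:C - s' x)).
  apply: le_trans (nrD (L2B grL sL) (L2Z _ (L2B giL s'L))) _.
  by rewrite [leRHS]splitr lerD// nrZ ?normc_i ?mul1r//; exact: L2B.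
apply: funext => x; rewrite -/(g x) {1}[g x]complexE; ring.
Unshelve. all: end_near.
Qed.

End Density.

(** * The Fourier transform on $L^2$: existence and Plancherel's identity *)

Section FourierTransform.
Context {R : realType}.
Local Notation mu := (@lebesgue_measure R).
Implicit Types (f g h : R -> R[i]).

Lemma ae_neq0 : {ae mu, forall x : R, x != 0}.
Proof.
have : mu.-negligible [set (0 : R)].
  exists [set 0]; split => //; exact: lebesgue_measure_set1.
by apply: negligibleS => x /= /negP/negPn/eqP.
Qed.

(** Step functions with supports in a common interval approximate [f] in $L^2$. Their transforms are
    Cauchy in $L^2$ by [stepf_dist], and converge to [ft f] at every nonzero frequency because on a
    bounded interval $L^2$ convergence implies $L^1$ convergence. *)
Lemma ft_L2 B f : 0 <= B -> L2 f -> supp B f -> L2 (ft f) /\ nr (ft f) = Num.sqrt cF * nr f.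
Proof.
move=> B0 fL fs; have B1 : B <= B + 1 by lra.
have fs1 := suppW B1 fs; have [fi _] := supp_Cinteg fL fs1.
have /choice[S HS] : forall n : nat, exists st : (R -> R[i]) * (R -> R[i]),
    stepf (B + 1) st.1 st.2 /\ nr (fun x => f x - st.1 x) <= n.+1%:R^-1.
  move=> n; have [|s [t H]] := @stepf_dense R f B n.+1%:R^-1 B0 fL fs; first by rewrite invr_gt0.
  by exists (s, t).
pose s n := (S n).1; pose g n := (S n).2.
have sg n : stepf (B + 1) (s n) (g n) by have [] := HS n.
have sf n : nr (fun x => f x - s n x) <= n.+1%:R^-1 by have [] := HS n.
have sL n : L2 (s n) by have [] := stepf_L2 (sg n).
have gL n : L2 (g n) by have [] := stepf_L2 (sg n).
have inv_small (e : R) : 0 < e -> exists n0, forall n, (n0 <= n)%N -> n.+1%:R^-1 <= e.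
  move=> e0; exists (Num.truncn e^-1) => n hn.
  rewrite -[leRHS]invrK lef_pV2 ?posrE ?invr_gt0//.
  have e1 : 0 <= e^-1 by rewrite invr_ge0 ltW.
  have /andP[_ h] := truncn_itv e1.
  by apply: le_trans (ltW h) _; rewrite ler_nat ltnS.
have slim : L2lim s f.
  move=> e /inv_small[n0 H]; exists n0 => n /H h; rewrite nrB_sym.
  exact: le_trans (sf n) h.
have scau : L2cauchy g.
  move=> e e0; pose k := Num.sqrt cF + 1 : R.
  have k0 : 0 < k by rewrite ltr_wpDl// sqrtr_ge0.
  have [n0 H] := slim _ (divr_gt0 (divr_gt0 e0 k0) (ltr0n _ 2)).
  exists n0 => m n hm hn; rewrite (stepf_dist (sg m) (sg n)).
  have h1 : nr (fun x => s m x - s n x) <= e / k.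
    apply: le_trans (nrB_trans (sL m) fL (sL n)) _; rewrite [leRHS]splitr lerD//.
      exact: H.
    by rewrite nrB_sym; exact: H.
  rewrite -[leRHS](divfK (lt0r_neq0 k0)) mulrC.
  by apply: ler_pM; rewrite ?nr_ge0 ?sqrtr_ge0// lerDl.
have mft := ft_meas fL fs.
have aelim : {ae mu, forall xi, (fun n => normc (g n xi - ft f xi)) @ \oo --> (0 : R)}.
  apply: (aeS ae_neq0) => xi xi0.
  have ss n := stepf_supp (sg n); have si n := (supp_Cinteg (sL n) (ss n)).1.
  pose C := 2 * nr (box (B + 1)) : R.
  have C0 : 0 <= C by rewrite mulr_ge0 ?nr_ge0.
  have bound n : normc (g n xi - ft f xi) <= C * nr (fun x => s n x - f x).
    rewrite -(stepf_ft (sg n) xi0) -ftB//.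
    have dL := L2B (sL n) fL; have dsupp := suppD (ss n) (suppN fs1).
    have [di dle] := supp_Cinteg dL dsupp.
    by apply: le_trans (ft_le xi di) _; rewrite /C -mulrA ler_wpM2l.
  apply/cvgrPdist_le => e e0.
  have C1 : 0 < C + 1 by rewrite ltr_wpDl.
  have [n0 H] := slim _ (divr_gt0 e0 C1); exists n0 => // n /H h /=.
  rewrite sub0r normrN ger0_norm ?normc_ge0//; apply: le_trans (bound n) _.
  rewrite -[leRHS](divfK (lt0r_neq0 C1)) mulrC.
  by apply: ler_pM => //; rewrite ?nr_ge0// lerDl.
have [ftL glim] := L2cauchy_pt gL scau mft aelim; split => //.
apply: (@cvg_unique _ _ ((fun n => nr (g n)) @ \oo)); first exact: Rhausdorff.
  exact: L2lim_nr.
rewrite (_ : (fun n => _) = (fun n => Num.sqrt cF * nr (s n))).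
  by apply: cvgM; [exact: cvg_cst|exact: L2lim_nr].
by apply: funext => n; rewrite (stepf_nr (sg n)).
Qed.

Lemma trunc_ft n f : fourier_trunc n f = ft (fun x => box n%:R x * f x).
Proof.
apply: funext => xi; rewrite /fourier_trunc /ft /Cintegral.
have E (x : R) : (x \in `[- n%:R, n%:R]%classic) = (`|x| <= n%:R)%R.
  by rewrite mem_setE in_itv /= ler_norml.
by congr (_ +i* _); rewrite Rintegral_mkcond; apply: eq_Rintegral => x _;
  rewrite patchE E boxE; case: (_ <= _); rewrite ?mul1r// !mul0r.
Qed.

Lemma box_lim f : L2 f -> L2lim (fun n x => box n%:R x * f x) f.
Proof.
move=> fL; apply: (@L2_dct _ _ _ f) => //.
- by move=> n; exact: L2_box.
- move=> n x; rewrite -[X in _ - X]mul1r -mulrBl normcM ler_piMl ?normc_ge0//.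
  rewrite boxE; case: ifP => _; first by rewrite subrr normc0 ler01.
  by rewrite sub0r normcN normc1.
- move=> x; apply: cvg_near_cst; near=> n.
  rewrite /box (_ : (_ <= _) = true) ?mul1r ?subrr ?normc0//.
  by near: n; exact: nbhs_infty_ger.
Unshelve. all: end_near.
Qed.

Lemma trunc_L2 n f : L2 f -> L2 (fourier_trunc n f) /\
  nr (fourier_trunc n f) = Num.sqrt cF * nr (fun x => box n%:R x * f x).
Proof.
by move=> fL; rewrite trunc_ft; apply: ft_L2 (@supp_box _ n%:R f);
  rewrite ?ler0n//; exact: L2_box.
Qed.

Lemma trunc_dist m n f : L2 f ->
  nr (fun x => fourier_trunc m f x - fourier_trunc n f x) =
  Num.sqrt cF * nr (fun x => box m%:R x * f x - box n%:R x * f x).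
Proof.
move=> fL; pose B : R := (maxn m n)%:R.
have bL k := L2_box (k%:R : R) fL.
have sm : supp B (fun x => box m%:R x * f x).
  by apply: suppW (@supp_box _ _ _); rewrite ler_nat leq_maxl.
have sn : supp B (fun x => box n%:R x * f x).
  by apply: suppW (@supp_box _ _ _); rewrite ler_nat leq_maxr.
have [_ <-] := ft_L2 (ler0n _ _) (L2B (bL m) (bL n)) (suppD sm (suppN sn)).
congr nr; apply: funext => xi; rewrite !trunc_ft ftB//.
  exact: (supp_Cinteg (bL m) sm).1.
exact: (supp_Cinteg (bL n) sn).1.
Qed.

(** Differences of truncations are again compactly supported, so Plancherel's identity makes the
    truncated transforms a Cauchy sequence. *)
Lemma fourier_exists f : L2 f -> exists2 g, is_fourier f g &
  nr g = Num.sqrt cF * nr f.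
Proof.
move=> fL; have TL n : L2 (fourier_trunc n f) by have [] := trunc_L2 n fL.
have bL n := L2_box (n%:R : R) fL; have blim := box_lim fL.
have [|g gL glim] := @L2_complete _ (fun n => fourier_trunc n f) TL.
  move=> e e0; pose k := Num.sqrt cF + 1 : R.
  have k0 : 0 < k by rewrite ltr_wpDl// sqrtr_ge0.
  have [n0 H] := blim _ (divr_gt0 (divr_gt0 e0 k0) (ltr0n _ 2)).
  exists n0 => m n hm hn; rewrite trunc_dist//.
  have h1 : nr (fun x => box m%:R x * f x - box n%:R x * f x) <= e / k.
    apply: le_trans (nrB_trans (bL m) fL (bL n)) _; rewrite [leRHS]splitr lerD//.
      exact: H.
    by rewrite nrB_sym; exact: H.
  rewrite -[leRHS](divfK (lt0r_neq0 k0)) mulrC.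
  by apply: ler_pM; rewrite ?nr_ge0 ?sqrtr_ge0// lerDl.
exists g.
  by split => //; apply/(L2limP TL gL).
apply: (@cvg_unique _ _ ((fun n => nr (fourier_trunc n f)) @ \oo)); first exact: Rhausdorff.
  exact: L2lim_nr.
rewrite (_ : (fun n => _) = (fun n => Num.sqrt cF * nr (fun x => box n%:R x * f x))).
  by apply: cvgM; [exact: cvg_cst|exact: L2lim_nr].
by apply: funext => n; have [] := trunc_L2 n fL.
Qed.

End FourierTransform.

(** * Inversion and surjectivity of the Fourier transform *)

Section FourierInversion.
Context {R : realType}.
Local Notation mu := (@lebesgue_measure R).
Local Notation integ f := (mu.-integrable setT (EFin \o (f : R -> R))).
Local Notation re := (@complex.Re R).
Local Notation im := (@complex.Im R).
Implicit Types (f g h : R -> R[i]).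

Lemma cF_neq0 : (cF : R) != 0. Proof. by rewrite gt_eqF// cF_gt0. Qed.

Lemma sqrt_cF_gt0 : 0 < Num.sqrt (cF : R). Proof. by rewrite sqrtr_gt0 cF_gt0. Qed.

Lemma trunc_ae n f g : Cmeasurable f -> Cmeasurable g -> Cae_eq f g ->
  fourier_trunc n f = fourier_trunc n g.
Proof.
move=> mf mg fg; rewrite !trunc_ft; apply: funext => xi.
have mF h : Cmeasurable h -> Cmeasurable (fun x => box n%:R x * h x * cis (- (x * xi))).
  by move=> mh; apply: CmeasM; [apply: CmeasM => //; exact: box_meas|exact: cis_meas].
have [fr fi] := mF _ mf; have [gr gi] := mF _ mg.
by apply: complex_ext => /=; apply: int_ae => //; apply: (aeS fg) => x ->.
Qed.

Lemma trunc_lin n c f g xi : L2 f -> L2 g ->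
  fourier_trunc n (fun x => c * f x + g x) xi =
  c * fourier_trunc n f xi + fourier_trunc n g xi.
Proof.
move=> fL gL; rewrite !trunc_ft.
have fi := (supp_Cinteg (L2_box n%:R fL) (@supp_box _ n%:R f)).1.
have gi := (supp_Cinteg (L2_box n%:R gL) (@supp_box _ n%:R g)).1.
rewrite -ftZ// -ftD//; last exact: CintegZ.
by congr ft; apply: funext => x; ring.
Qed.

Lemma fourier_ae f g f' g' : is_fourier f g -> L2 f' -> L2 g' ->
  Cae_eq f f' -> Cae_eq g g' -> is_fourier f' g'.
Proof.
move=> [fL gL lim] f'L g'L ff' gg'.
have TL n : L2 (fourier_trunc n f) by have [] := trunc_L2 n fL.
have E n : fourier_trunc n f' = fourier_trunc n f.
  by apply: trunc_ae; try exact: L2meas; exact: ae_eq_sym.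
split => //; apply/L2limP => //; first by move=> n; rewrite E.
move/(L2limP TL gL) : lim => lim e /lim[n0 H]; exists n0 => n /H; rewrite E.
apply: le_trans; rewrite le_eqVlt; apply/orP; left; apply/eqP.
apply: nr_ae; try (apply: L2meas; exact: L2B).
by apply: (aeS gg') => x ->.
Qed.

Lemma fourier_uniq f g f' g' : is_fourier f g -> is_fourier f' g' -> Cae_eq f f' ->
  Cae_eq g g'.
Proof.
move=> [fL gL lim] [f'L g'L lim'] ff'.
have TL n : L2 (fourier_trunc n f) by have [] := trunc_L2 n fL.
have E n : fourier_trunc n f' = fourier_trunc n f.
  by apply: trunc_ae; try exact: L2meas; exact: ae_eq_sym.
have TL' n : L2 (fourier_trunc n f') by rewrite E.
move/(L2limP TL gL) : lim => lim; move/(L2limP TL' g'L) : lim' => lim'.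
apply: (L2lim_uniq TL gL g'L lim) => e /lim'[n0 H]; exists n0 => n /H.
by rewrite E.
Qed.

Lemma fourier_lin c f g f' g' : is_fourier f g -> is_fourier f' g' ->
  is_fourier (fun x => c * f x + f' x) (fun x => c * g x + g' x).
Proof.
move=> [fL gL lim] [f'L g'L lim'].
have TL n : L2 (fourier_trunc n f) by have [] := trunc_L2 n fL.
have TL' n : L2 (fourier_trunc n f') by have [] := trunc_L2 n f'L.
have cfL := L2D (L2Z c fL) f'L; have cgL := L2D (L2Z c gL) g'L.
split => //; apply/L2limP => //; first by move=> n; have [] := trunc_L2 n cfL.
move/(L2limP TL gL) : lim => lim; move/(L2limP TL' g'L) : lim' => lim' e e0.
pose k := normc c + 1; have k0 : 0 < k by rewrite ltr_wpDl ?normc_ge0.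
have e20 : 0 < e / 2 by rewrite divr_gt0.
have [n0 H0] := lim _ (divr_gt0 e20 k0); have [n1 H1] := lim' _ e20.
exists (maxn n0 n1) => n; rewrite geq_max => /andP[/H0 h0 /H1 h1].
rewrite (_ : (fun x => _) = fun x => c * (fourier_trunc n f x - g x) +
  (fourier_trunc n f' x - g' x)); last first.
  by apply: funext => x; rewrite trunc_lin//; ring.
apply: le_trans (nrD (L2Z c (L2B (TL n) gL)) (L2B (TL' n) g'L)) _.
rewrite [leRHS]splitr lerD// nrZ; last exact: L2B.
rewrite -[leRHS](divfK (lt0r_neq0 k0)) mulrC.
by apply: ler_pM; rewrite ?nr_ge0 ?normc_ge0// lerDl.
Qed.

Definition FT f : R -> R[i] := xget (fun=> 0) [set g | is_fourier f g].

Lemma FTP f : L2 f -> is_fourier f (FT f).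
Proof.
by move=> fL; have [g fg _] := fourier_exists fL; exact: (xgetPex (fun=> 0) (ex_intro _ g fg)).
Qed.

Lemma FT_L2 f : L2 f -> L2 (FT f). Proof. by move=> /FTP[]. Qed.

Lemma fourier_FT f g : is_fourier f g -> Cae_eq (FT f) g.
Proof. by move=> fg; have [fL _ _] := fg; exact: fourier_uniq (FTP fL) fg (ae_eq_refl _). Qed.

Lemma fourier_nr f g : is_fourier f g -> nr g = Num.sqrt cF * nr f.
Proof.
move=> fg; have [fL gL _] := fg; have [g' fg' <-] := fourier_exists fL.
have [_ g'L _] := fg'.
by apply: nr_ae; [exact: L2meas..|exact: fourier_uniq fg fg' (ae_eq_refl _)].
Qed.

Lemma fourierZ c f g : is_fourier f g -> is_fourier (fun x => c * f x) (fun x => c * g x).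
Proof.
move=> fg; have [fL gL _] := fg.
have f0 : is_fourier (fun=> 0 : R[i]) (fun x => (-1) * g x + g x).
  have := fourier_lin (-1) fg fg.
  by congr is_fourier; apply: funext => x; rewrite mulN1r addNr.
have := fourier_lin c fg f0; congr is_fourier; apply: funext => x; ring.
Qed.

Lemma fourierD f g f' g' : is_fourier f g -> is_fourier f' g' ->
  is_fourier (fun x => f x + f' x) (fun x => g x + g' x).
Proof.
move=> fg fg'; have := fourier_lin 1 fg fg'.
by congr is_fourier; apply: funext => x; rewrite mul1r.
Qed.

Lemma fourierB f g f' g' : is_fourier f g -> is_fourier f' g' ->
  is_fourier (fun x => f x - f' x) (fun x => g x - g' x).
Proof.
move=> fg fg'; have := fourierD fg (fourierZ (-1) fg').
by congr is_fourier; apply: funext => x; rewrite mulN1r.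
Qed.

Lemma fourier_ip f g f' g' : is_fourier f g -> is_fourier f' g' ->
  ip g g' = cF * ip f f'.
Proof.
move=> fg fg'; have [fL gL _] := fg; have [f'L g'L _] := fg'.
have n1 := fourier_nr fg; have n2 := fourier_nr fg'.
have n3 := fourier_nr (fourierD fg fg').
have := nr2D gL g'L; rewrite n1 n2 n3 !exprMn (sqr_sqrtr cF_ge0) (nr2D fL f'L).
by move: (nr f ^+ 2) (nr f' ^+ 2) (ip f f') (ip g g') => a b c d; lra.
Qed.

Lemma fourier_inj f g f' g' : is_fourier f g -> is_fourier f' g' -> Cae_eq g g' ->
  Cae_eq f f'.
Proof.
move=> fg fg' gg'; have [fL gL _] := fg; have [f'L g'L _] := fg'.
have : nr (fun x => f x - f' x) = 0.
  apply: (mulfI (lt0r_neq0 sqrt_cF_gt0)); rewrite mulr0 -(fourier_nr (fourierB fg fg')).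
  rewrite -[RHS](@nr0 R); apply: nr_ae; [apply: L2meas; exact: L2B|exact: Cmeas_cst|].
  by apply: (aeS gg') => x ->; rewrite subrr.
move=> /(nr_eq0 (L2B fL f'L)) h; apply: (aeS h) => x /eqP.
by rewrite subr_eq0 => /eqP.
Qed.

(** Fubini's theorem for $f(x)g(y)e^{-ixy}$, dominated by $|f(x)||g(y)|$. The conjugations undo the
    one built into [ip], so that both sides are the real part of a bilinear integral. *)
Lemma mult_box (B : R) f g : L2 f -> L2 g -> supp B f -> supp B g ->
  ip (ft f) (fun x => (g x)^*%C) = ip f (fun x => (ft g x)^*%C).
Proof.
move=> fL gL fs gs.
have [fi _] := supp_Cinteg fL fs; have [gi _] := supp_Cinteg gL gs.
pose k (x y : R) : R := re (f x * g y * cis (- (x * y))).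
have kle x y : `|k x y| <= normc (f x) * normc (g y).
  by rewrite (le_trans (normc_re _))// !normcM normc_cis mulr1.
have [[mfr mfi] nfi] := fi; have [[mgr mgi] ngi] := gi.
have mfst (h : R -> R) : measurable_fun setT h ->
    measurable_fun setT (fun z : measurableTypeR R * measurableTypeR R => h z.1).
  by move=> mh; exact: (measurableT_comp (f := h)).
have msnd (h : R -> R) : measurable_fun setT h ->
    measurable_fun setT (fun z : measurableTypeR R * measurableTypeR R => h z.2).
  by move=> mh; exact: (measurableT_comp (f := h)).
have mxy : measurable_fun setT (fun z : measurableTypeR R * measurableTypeR R => - (z.1 * z.2) : R).
  apply: measurableT_comp => //; apply: measurable_funM.
    exact: (mfst id).
  exact: (msnd id).
have mk : measurable_fun setT (fun z : measurableTypeR R * measurableTypeR R => k z.1 z.2).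
  rewrite /k; under eq_fun do rewrite !(reM, imM) /=.
  have mc : measurable_fun setT (fun z : measurableTypeR R * measurableTypeR R => cos (- (z.1 * z.2)) : R).
    by apply: (measurableT_comp (f := cos)) => //; apply: continuous_measurable_fun; exact: continuous_cos.
  have ms : measurable_fun setT (fun z : measurableTypeR R * measurableTypeR R => sin (- (z.1 * z.2)) : R).
    by apply: (measurableT_comp (f := sin)) => //; apply: continuous_measurable_fun; exact: continuous_sin.
  have m1 := mfst _ mfr; have m2 := mfst _ mfi.
  have m3 := msnd _ mgr; have m4 := msnd _ mgi.
  apply: measurable_funB; apply: measurable_funM => //.
    by apply: measurable_funB; apply: measurable_funM.
  by apply: measurable_funD; apply: measurable_funM.
have kx x : integ (k x).
  apply: (integ_le (g := fun y => normc (f x) * normc (g y))); last exact: integZ.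
    apply: integ_meas; rewrite /k.
    have := Cinteg_re (Cinteg_cis x (CintegZ (f x) gi)).
    by congr (_.-integrable _ _); apply: funext => y /=; rewrite [y * x]mulrC.
  exact: kle.
have ky y : integ (k^~ y).
  apply: (integ_le (g := fun x => normc (g y) * normc (f x))); last exact: integZ.
    apply: integ_meas; rewrite /k.
    have := Cinteg_re (Cinteg_cis y (CintegZ (g y) fi)).
    by congr (_.-integrable _ _); apply: funext => x /=; rewrite [g y * _]mulrC.
  by move=> x; rewrite [leRHS]mulrC; exact: kle.
have E1 y : re (ft f y) * re ((g y)^*%C) + im (ft f y) * im ((g y)^*%C) = \int[mu]_x k x y.
  rewrite -re_conjM conjcK mulrC -CintZ; last exact: Cinteg_cis.
  by apply: eq_Rintegral => x _; rewrite /k mulrA [g y * _]mulrC.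
have E2 x : re (f x) * re ((ft g x)^*%C) + im (f x) * im ((ft g x)^*%C) = \int[mu]_y k x y.
  rewrite -re_conjM conjcK -CintZ; last exact: Cinteg_cis.
  by apply: eq_Rintegral => y _; rewrite /k mulrA [y * x]mulrC.
transitivity (\int[mu]_y (\int[mu]_x k x y)).
  by apply: eq_Rintegral => y _; exact: E1.
transitivity (\int[mu]_x (\int[mu]_y k x y)); last first.
  by apply: eq_Rintegral => x _; rewrite -E2.
have kp : (mu \x mu)%E.-integrable setT
    (fun z : measurableTypeR R * measurableTypeR R => (k z.1 z.2)%:E).
  apply/integrable12ltyP; first exact/measurable_EFinP.
  apply: (@le_lt_trans _ _ (\int[mu]_x (normc (f x) * \int[mu]_y normc (g y))%:E)%E).
    apply: ge0_le_integral => //.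
    - by move=> x _; apply: integral_ge0.
    - apply: (@measurable_fun_fubini_tonelli_F _ _ (measurableTypeR R) (measurableTypeR R) R mu
        (fun z : measurableTypeR R * measurableTypeR R => `|(k z.1 z.2)%:E|%E)); last by move=> z; exact: abse_ge0.
      by apply: measurableT_comp => //; exact/measurable_EFinP.
    - by apply: mEFin; apply: measurable_funM; [exact: integ_meas|exact: measurable_cst].
    move=> x _ /=.
    rewrite (_ : (\int[mu]_y `|k x y|%:E = (\int[mu]_y `|k x y|)%:E)%E); last first.
      by rewrite integ_fin//; exact: integ_norm (kx x).
    rewrite lee_fin -intZ//; apply: int_le; [exact: integ_norm (kx x)|exact: integZ|].
    by move=> y; exact: kle.
  rewrite integ_fin ?ltry//.
  by under eq_fun do rewrite mulrC; exact: integZ.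
have F := Fubini kp; congr fine.
transitivity (\int[mu]_y \int[mu]_x (k x y)%:E)%E.
  by apply: eq_integral => y _; rewrite integ_fin.
apply: (etrans (esym F)); apply: eq_integral => x _; exact: integ_fin (kx x).
Qed.

Lemma fourier_mult f g f' g' : is_fourier f g -> is_fourier f' g' ->
  ip g (fun x => (f' x)^*%C) = ip f (fun x => (g' x)^*%C).
Proof.
move=> [fL gL lim] [f'L g'L lim'].
have TL n : L2 (fourier_trunc n f) by have [] := trunc_L2 n fL.
have TL' n : L2 (fourier_trunc n f') by have [] := trunc_L2 n f'L.
have bL n : L2 (fun x => box n%:R x * f x) by exact: L2_box.
have bL' n : L2 (fun x => box n%:R x * f' x) by exact: L2_box.
move/(L2limP TL gL) : lim => lim; move/(L2limP TL' g'L) : lim' => lim'.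
have J0 (F : nat -> R -> R[i]) G : L2lim F G -> L2lim (fun n x => (F n x)^*%C) (fun x => (G x)^*%C).
  move=> FG e /FG[n0 H]; exists n0 => n /H; congr (_ <= _).
  by rewrite -nrJ; congr nr; apply: funext => x; rewrite rmorphB.
have E n : ip (fourier_trunc n f) (fun x => (box n%:R x * f' x)^*%C) =
           ip (fun x => box n%:R x * f x) (fun x => (fourier_trunc n f' x)^*%C).
  by rewrite !trunc_ft; apply: (@mult_box n%:R) => //; exact: supp_box.
have two (F : nat -> R -> R[i]) G (H : nat -> R -> R[i]) K : (forall n, L2 (F n)) -> (forall n, L2 (H n)) -> L2 G -> L2 K ->
    L2lim F G -> L2lim H K -> (fun n => ip (F n) (H n)) @ \oo --> ip G K.
  move=> FL HL GL KL FG HK.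
  have l1 := L2lim_ip FL GL KL FG.
  have : (fun n => ip (F n) (fun x => H n x - K x)) @ \oo --> (0 : R).
    apply/cvgrPdist_le => e e0.
    have p : 0 < nr G + 1 by rewrite ltr_wpDl ?nr_ge0.
    have [n0 H0] := HK _ (divr_gt0 e0 p); have [n1 H1] := FG 1 ltr01.
    exists (maxn n0 n1) => // n /=; rewrite geq_max => /andP[/H0 h0 /H1 h1].
    rewrite sub0r normrN; apply: le_trans (ip_le (FL n) (L2B (HL n) KL)) _.
    rewrite -[leRHS](divfK (lt0r_neq0 p)) [leRHS]mulrC.
    apply: ler_pM; rewrite ?nr_ge0//.
    have := nr_dist (FL n) GL; rewrite ler_norml => /andP[_]; lra.
  move=> l2; rewrite -[ip G K]addr0.
  rewrite (_ : (fun n => _) = (fun n => ip (F n) K + ip (F n) (fun x => H n x - K x))).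
    exact: cvgD.
  by apply: funext => n; rewrite ipBr//; ring.
apply: (@cvg_unique _ _ ((fun n => ip (fourier_trunc n f) (fun x => (box n%:R x * f' x)^*%C)) @ \oo)).
- exact: Rhausdorff.
- apply: two => //; [by move=> n; apply: L2J|exact: L2J|].
  by apply: (J0 (fun n x => box n%:R x * f' x)); exact: box_lim.
- rewrite (_ : (fun n => _) = (fun n => ip (fun x => box n%:R x * f x) (fun x => (fourier_trunc n f' x)^*%C))); last first.
    by apply: funext => n; exact: E.
  apply: two => //; [by move=> n; apply: L2J|exact: L2J|exact: box_lim|].
  exact: (J0 (fun n => fourier_trunc n f')).
Qed.

Lemma ipJJ f g : ip (fun x => (f x)^*%C) (fun x => (g x)^*%C) = ip f g.
Proof. by apply: eq_Rintegral => x _; rewrite !reJ !imJ mulrNN. Qed.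

(** Up to the factor [cF], conjugation after the Fourier transform is an involution; in this form no
    reflection of the variable occurs. The defect is orthogonal to itself: the multiplication
    formula moves the outer transform to the other argument, and Plancherel's identity then removes
    both transforms. *)
Lemma fourier_inv f g : is_fourier f g ->
  is_fourier (fun x => (g x)^*%C) (fun x => cF%:C * (f x)^*%C).
Proof.
move=> fg; have [fL gL _] := fg; have JgL := L2J gL; have JfL := L2Z (cF%:C) (L2J fL).
have Fh := FTP JgL; set h := FT _ in Fh; have [_ hL _] := Fh.
apply: (fourier_ae Fh) => //; first exact: ae_eq_refl.
have DL := L2B hL JfL.
pose phi x := (h x - cF%:C * (f x)^*%C)^*%C.
have phiL : L2 phi by exact: L2J.
have Fp := FTP phiL.
have e1 := fourier_mult Fh Fp.
have e2 := fourier_ip fg Fp.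
have JpE : (fun x => (phi x)^*%C) = (fun x => h x - cF%:C * (f x)^*%C).
  by apply: funext => x; rewrite /phi conjcK.
rewrite ipJJ e2 in e1.
have : ip (fun x => h x - cF%:C * (f x)^*%C) (fun x => (phi x)^*%C) = 0.
  rewrite ipBl//; last exact: L2J.
  rewrite e1 ipZl; [|exact: L2J|exact: L2J].
  by rewrite ipJJ subrr.
rewrite JpE ipff => /eqP; rewrite sqrf_eq0 => /eqP /(nr_eq0 DL) H.
by apply: (aeS H) => x /eqP; rewrite subr_eq0 => /eqP.
Qed.

(** The involution exhibits a preimage: the conjugate of the transform of the conjugate of [h],
    divided by [cF]. *)
Lemma fourier_surj h : L2 h -> exists g, is_fourier g h.
Proof.
move=> hL; have := fourierZ (cF^-1)%:C (fourier_inv (FTP (L2J hL))).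
set g := (fun x => (cF^-1)%:C * (FT _ x)^*%C) => H; exists g.
have [gL _ _] := H; apply: (fourier_ae H) => //; first exact: ae_eq_refl.
by apply: aeT => x; rewrite conjcK mulrA -rmorphM mulVf ?cF_neq0// mul1r.
Qed.

End FourierInversion.

(** * The Schroedinger group on L^2 *)

Section SchrodingerGroup.
Context {R : realType}.
Implicit Types (f g h : R -> R[i]) (s t : R).

(** If continuity failed, there would be times within $1/(n+1)$ of [t] at which the distance exceeds
    [e], contrary to dominated convergence along that sequence. *)
Lemma L2_dct_cont (F : R -> R -> R[i]) h t : (forall s, L2 (F s)) -> L2 h ->
  (forall s x, normc (F s x - F t x) <= normc (h x)) ->
  (forall x, (fun s => normc (F s x - F t x)) @ t --> (0 : R)) ->
  forall e, 0 < e -> exists2 del : R, 0 < del & forall s, `|s - t| < del ->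
    nr (fun x => F s x - F t x) <= e.
Proof.
move=> FL hL Fh Fc e e0; apply: contrapT => H.
have {}H n : exists s, `|s - t| < n.+1%:R^-1 /\ e < nr (fun x => F s x - F t x).
  apply: contrapT => H'; apply: H; exists n.+1%:R^-1; first by rewrite invr_gt0.
  by move=> s st; rewrite leNgt; apply/negP => he; apply: H'; exists s.
have /choice[u Hu] := H.
have ut : u @ \oo --> t.
  apply/cvgrPdist_lt => d d0; near=> n; rewrite distrC.
  have [/lt_trans + _] := Hu n; apply.
  near: n; have := near_infty_natSinv_lt (PosNum d0).
  by apply: filterS => n /=; exact.
have [||n0 /(_ n0 (leqnn _))] := L2_dct (F := fun n => F (u n)) (fun n => FL _) (FL t) hL _ _ e0.
- by move=> n x; exact: Fh.
- by move=> x; apply: (cvg_comp _ _ ut (Fc x)).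
by rewrite leNgt; have [_ ->] := Hu n0.
Unshelve. all: end_near.
Qed.

Lemma meas_tsq t : measurable_fun setT (fun xi : R => - (t * xi ^+ 2)).
Proof.
apply: measurableT_comp => //; apply: measurable_funM; first exact: measurable_cst.
exact: measurable_funX.
Qed.

(** Surjectivity of the Fourier transform makes the set in the definition of [schrodinger] nonempty,
    so its default value is never taken on $L^2$. *)
Lemma S_spec t f : L2 f ->
  is_fourier (schrodinger t f) (fun xi => cis (- (t * xi ^+ 2)) * FT f xi).
Proof.
move=> fL; have hL := L2cis (meas_tsq t) (FT_L2 fL).
have [g Hg] := fourier_surj hL.
have [fh Hf Hs] := @xgetPex _ (fun=> 0) [set g | exists2 fh, is_fourier f fh &
   is_fourier g (fun xi => cis (- (t * xi ^+ 2)) * fh xi)]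
   (ex_intro _ g (ex_intro2 _ _ _ (FTP fL) Hg)).
rewrite -/(schrodinger t f) in Hs.
have [sL _ _] := Hs; apply: (fourier_ae Hs) => //; first exact: ae_eq_refl.
by apply: (aeS (fourier_FT Hf)) => x ->.
Qed.

Lemma S_L2 t f : L2 f -> L2 (schrodinger t f).
Proof. by move=> /(S_spec t)[]. Qed.

(** Injectivity of the Fourier transform. The algebraic rules of the group are read off from this on
    the Fourier side. *)
Lemma S_char t f g h : is_fourier f h ->
  is_fourier g (fun xi => cis (- (t * xi ^+ 2)) * h xi) -> Cae_eq (schrodinger t f) g.
Proof.
move=> fh gk; have [fL _ _] := fh; apply: fourier_inj (S_spec t fL) gk _.
by apply: (aeS (fourier_FT fh)) => x ->.
Qed.

Lemma S_nr t f : L2 f -> nr (schrodinger t f) = nr f.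
Proof.
move=> fL; apply: (mulfI (lt0r_neq0 (@sqrt_cF_gt0 R))).
by rewrite -(fourier_nr (S_spec t fL)) nrcis -(fourier_nr (FTP fL)).
Qed.

Lemma S_ae t f g : L2 f -> L2 g -> Cae_eq f g ->
  Cae_eq (schrodinger t f) (schrodinger t g).
Proof.
move=> fL gL fg; apply: fourier_inj (S_spec t fL) (S_spec t gL) _.
by apply: (aeS (fourier_uniq (FTP fL) (FTP gL) fg)) => x ->.
Qed.

Lemma S_lin t c f g : L2 f -> L2 g ->
  Cae_eq (schrodinger t (fun x => c * f x + g x))
         (fun x => c * schrodinger t f x + schrodinger t g x).
Proof.
move=> fL gL; apply: S_char (fourier_lin c (FTP fL) (FTP gL)) _.
have := fourier_lin c (S_spec t fL) (S_spec t gL).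
by congr is_fourier; apply: funext => x; rewrite ?mulrDr ?mulrBr // mulrCA.
Qed.

Lemma S_Z t c f : L2 f ->
  Cae_eq (schrodinger t (fun x => c * f x)) (fun x => c * schrodinger t f x).
Proof.
move=> fL; apply: S_char (fourierZ c (FTP fL)) _.
have := fourierZ c (S_spec t fL).
by congr is_fourier; apply: funext => x; rewrite mulrCA.
Qed.

Lemma S_D t f g : L2 f -> L2 g ->
  Cae_eq (schrodinger t (fun x => f x + g x))
         (fun x => schrodinger t f x + schrodinger t g x).
Proof.
move=> fL gL; apply: S_char (fourierD (FTP fL) (FTP gL)) _.
have := fourierD (S_spec t fL) (S_spec t gL).
by congr is_fourier; apply: funext => x; rewrite mulrDr.
Qed.

Lemma S_B t f g : L2 f -> L2 g ->
  Cae_eq (schrodinger t (fun x => f x - g x))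
         (fun x => schrodinger t f x - schrodinger t g x).
Proof.
move=> fL gL; apply: S_char (fourierB (FTP fL) (FTP gL)) _.
have := fourierB (S_spec t fL) (S_spec t gL).
by congr is_fourier; apply: funext => x; rewrite mulrBr.
Qed.

Lemma S_group t s f : L2 f ->
  Cae_eq (schrodinger t (schrodinger s f)) (schrodinger (t + s) f).
Proof.
move=> fL; apply: S_char (S_spec s fL) _.
have := S_spec (t + s) fL; congr is_fourier; apply: funext => x.
by rewrite mulrA -cisD; congr (cis _ * _); ring.
Qed.

Lemma S_0 f : L2 f -> Cae_eq (schrodinger 0 f) f.
Proof.
move=> fL; apply: S_char (FTP fL) _.
have := FTP fL; congr is_fourier; apply: funext => x.
by rewrite mul0r oppr0 cis0 mul1r.
Qed.

Lemma S_NK t f : L2 f -> Cae_eq (schrodinger t (schrodinger (- t) f)) f.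
Proof.
by move=> fL; apply: ae_eq_trans (S_group _ _ fL) _; rewrite subrr; exact: S_0.
Qed.

Lemma S_KN t f : L2 f -> Cae_eq (schrodinger (- t) (schrodinger t f)) f.
Proof.
by move=> fL; apply: ae_eq_trans (S_group _ _ fL) _; rewrite addNr; exact: S_0.
Qed.

(** Plancherel's identity reduces the claim to dominated convergence of the multipliers, with
    majorant $2|\hat f|$. *)
Lemma S_cont f t : L2 f -> forall e, 0 < e -> exists2 del : R, 0 < del &
  forall s, `|s - t| < del ->
    nr (fun x => schrodinger s f x - schrodinger t f x) <= e.
Proof.
move=> fL e e0; have hL := FT_L2 fL.
have c0 := @sqrt_cF_gt0 R.
pose F s xi : R[i] := cis (- (s * xi ^+ 2)) * FT f xi.
have [||||del del0 H] := @L2_dct_cont F (fun x => 2%:C * FT f x) t _ _ _ _ _ (mulr_gt0 c0 e0).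
- by move=> s; exact: L2cis (meas_tsq s) hL.
- exact: L2Z.
- move=> s x; rewrite /F -mulrBl !normcM ler_wpM2r ?normc_ge0//.
  rewrite normcR ger0_norm//.
  by apply: le_trans (le_normcB _ _) _; rewrite !normc_cis.
- move=> x; apply: (@squeeze_cvgr _ _ _ _ (fun=> 0)
    (fun s => `|s - t| * (x ^+ 2 * normc (FT f x)))).
  + apply: nearW => s; rewrite normc_ge0 /= /F -mulrBl normcM [leRHS]mulrA.
    rewrite ler_wpM2r ?normc_ge0//; apply: le_trans (cis_lip _ _) _.
    rewrite opprK addrC -mulrBl normrM distrC (ger0_norm (sqr_ge0 x)).
    exact: lexx.
  + exact: cvg_cst.
  + have : (fun s => `|s - t| * (x ^+ 2 * normc (FT f x))) @ t -->
        `|t - t| * (x ^+ 2 * normc (FT f x)).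
      apply: cvgM; last exact: cvg_cst.
      by apply: cvg_norm; apply: cvgB; [exact: cvg_id|exact: cvg_cst].
    by rewrite subrr normr0 mul0r.
exists del => // s /H; rewrite (fourier_nr (fourierB (S_spec s fL) (S_spec t fL))).
by rewrite ler_pM2l.
Qed.

End SchrodingerGroup.

(** * Absolutely continuous functions and weak derivatives *)

Section AbsolutelyContinuous.
Context {R : realType}.
Local Notation mu := (@lebesgue_measure R).
Local Notation integ f := (mu.-integrable setT (EFin \o (f : R -> R))).
Implicit Types (f g h p q u v : R -> R) (a b c s t x : R).

Definition locint g := forall a b, mu.-integrable `[a, b] (EFin \o g).

Lemma locintD f g : locint f -> locint g -> locint (fun x => f x + g x).
Proof. by move=> fi gi a b; exact: (integrableD _ (fi a b) (gi a b)). Qed.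

Lemma locintZ k f : locint f -> locint (fun x => k * f x).
Proof. by move=> fi a b; exact: (integrableZl _ _ (fi a b)). Qed.

Lemma locintN f : locint f -> locint (fun x => - f x).
Proof.
move=> fi; rewrite (_ : (fun x => _) = fun x => (-1) * f x); first exact: locintZ.
by apply: funext => x; rewrite mulN1r.
Qed.

Lemma locintB f g : locint f -> locint g -> locint (fun x => f x - g x).
Proof. by move=> fi gi; apply: locintD => //; exact: locintN. Qed.

Lemma locint_norm f : locint f -> locint (fun x => `|f x|).
Proof. by move=> fi a b; exact: (integrable_norm (fi a b)). Qed.

Lemma locint_integ f : integ f -> locint f.
Proof. by move=> fi a b; apply: integrableS fi. Qed.

Lemma locint_cont f : continuous f -> locint f.
Proof.
move=> cf a b; apply: continuous_compact_integrable; first exact: segment_compact.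
exact: continuous_subspaceT.
Qed.

Lemma locint_meas f : locint f -> measurable_fun setT f.
Proof.
move=> fi; rewrite (_ : setT = \bigcup_n `[- (n%:R : R), n%:R]%classic).
  apply/measurable_fun_bigcup => // n.
  by have /measurable_int/measurable_EFinP := fi (- n%:R) n%:R.
apply/esym/seteqP; split => // x _; exists (Num.truncn `|x|).+1 => //=.
by rewrite in_itv /= -ler_norml; apply/ltW/truncnS_gt.
Qed.

Lemma locint_contM g f : locint g -> continuous f -> locint (fun x => f x * g x).
Proof.
move=> gi cf a b.
have mf := continuous_measurable_fun cf.
have [M HM] : exists M, forall x, x \in `[a, b]%R -> `|f x| <= M.
  have [ab|ba] := leP a b; last first.
    by exists 0 => x; rewrite in_itv /= => /andP[ax xb]; exfalso; lra.
  have [|c _ Hc] := @EVT_max R (fun x => `|f x|) a b ab.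
    by apply: continuous_subspaceT => x; apply: cvg_norm; exact: cf.
  by exists `|f c| => x xab; exact: Hc.
apply: (@le_integrable _ _ _ mu `[a, b]%classic _ (EFin \o (fun x => f x * g x)) (fun x => (M * g x)%:E)) => //.
- apply/measurable_EFinP; apply: measurable_funM; first exact: measurable_funTS.
  by have /measurable_int/measurable_EFinP := gi a b.
- move=> x /= xab; rewrite lee_fin !normrM ler_wpM2r//.
  by apply: le_trans (HM x xab) _; exact: ler_norm.
- exact: (integrableZl _ _ (gi a b)).
Qed.

Lemma intab_split g a b c : locint g -> a <= b -> b <= c ->
  \int[mu]_(x in `[a, c]) g x = \int[mu]_(x in `[a, b]) g x + \int[mu]_(x in `[b, c]) g x.
Proof.
move=> gi ab bc.
have := @Rintegral_itvB R g (BLeft a) (BRight c) b (gi a c).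
rewrite !bnd_simp => /(_ ab bc).
rewrite (_ : \int[mu]_(x in [set` Interval (BRight b) (BRight c)]) g x =
   \int[mu]_(x in `[b, c]) g x).
  by move=> <-; ring.
apply: Rintegral_itv_obnd_cbnd; apply: integrableS (gi b c) => //.
by apply: subset_itvr; rewrite bnd_simp.
Qed.

Lemma intab_le g h a b : locint g -> locint h -> (forall x, a <= x <= b -> g x <= h x) ->
  \int[mu]_(x in `[a, b]) g x <= \int[mu]_(x in `[a, b]) h x.
Proof.
by move=> gi hi gh; apply: (le_Rintegral _ (gi a b) (hi a b)).
Qed.

Lemma intabD g h a b : locint g -> locint h ->
  \int[mu]_(x in `[a, b]) (g x + h x) =
  \int[mu]_(x in `[a, b]) g x + \int[mu]_(x in `[a, b]) h x.
Proof. by move=> gi hi; exact: (RintegralD _ (gi a b) (hi a b)). Qed.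

Lemma intabZ k g a b : locint g ->
  \int[mu]_(x in `[a, b]) (k * g x) = k * \int[mu]_(x in `[a, b]) g x.
Proof. by move=> gi; apply: RintegralZl => //; exact: gi. Qed.

Lemma intabB g h a b : locint g -> locint h ->
  \int[mu]_(x in `[a, b]) (g x - h x) =
  \int[mu]_(x in `[a, b]) g x - \int[mu]_(x in `[a, b]) h x.
Proof. by move=> gi hi; exact: (RintegralB _ (gi a b) (hi a b)). Qed.

Lemma intab_norm g a b : locint g ->
  `|\int[mu]_(x in `[a, b]) g x| <= \int[mu]_(x in `[a, b]) `|g x|.
Proof. by move=> gi; apply: le_normr_Rintegral => //; exact: gi. Qed.

Lemma intab_cst k a b : a <= b -> \int[mu]_(x in `[a, b]) k = k * (b - a).
Proof.
move=> ab; rewrite Rintegral_cst// -[X in fine X]/(mu `[a, b]%classic).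
rewrite lebesgue_measure_itv /= lte_fin.
by move: ab; rewrite le_eqVlt => /predU1P[->|->//]; rewrite ltxx subrr.
Qed.

(* Substitute for absolute continuity arguments: an additive interval function which is
   [o(m)] on small intervals, for an additive [m], vanishes. *)
Lemma additive_small (E : R -> R -> R) (m : R -> R -> R) a b : a <= b ->
  (forall s t r, a <= s -> s <= t -> t <= r -> r <= b -> E s r = E s t + E t r) ->
  (forall s t r, a <= s -> s <= t -> t <= r -> r <= b -> m s r = m s t + m t r) ->
  (forall e, 0 < e -> exists2 del : R, 0 < del & forall s t, a <= s -> s <= t ->
     t <= b -> t - s <= del -> `|E s t| <= e * m s t) ->
  E a b = 0.
Proof.
move=> ab Ea ma small.
have bnd e : 0 < e -> `|E a b| <= e * m a b.
  move=> e0; have [del del0 H] := small e e0.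
  have key n : forall t, a <= t -> t <= b -> t <= a + n%:R * del -> `|E a t| <= e * m a t.
    elim: n => [|n IH] t at_ tb tn.
      by apply: H => //; rewrite mul0r addr0 in tn; lra.
    have [h|h] := leP t (a + n%:R * del); first exact: IH.
    pose r := a + n%:R * del; have ar : a <= r by rewrite lerDl mulr_ge0// ltW.
    have rt : r <= t by exact: ltW.
    rewrite (Ea a r t)// (ma a r t)// mulrDr.
    apply: le_trans (ler_normD _ _) _; apply: lerD.
      by apply: IH => //; exact: le_trans tb.
    apply: H => //; move: tn; rewrite -natr1 mulrDl mul1r /r; lra.
  apply: (key (Num.truncn ((b - a) / del)).+1) => //.
  rewrite -lerBlDl -ler_pdivrMr//; apply/ltW.
  have h0 : 0 <= (b - a) / del by apply: divr_ge0; lra.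
  by have /andP[_] := truncn_itv h0.
have m0 : 0 <= m a b by have := bnd 1 ltr01; rewrite mul1r; apply: le_trans.
apply/eqP; rewrite -normr_le0; apply/ler_addgt0Pl => e e0; rewrite addr0.
have m1 : 0 < m a b + 1 by rewrite ltr_wpDl.
apply: le_trans (bnd _ (divr_gt0 e0 m1)) _.
rewrite -[leRHS](divfK (lt0r_neq0 m1)); apply: ler_wpM2l.
  by rewrite divr_ge0 ?ltW.
by rewrite lerDl.
Qed.

(** Local absolute continuity, encoded by the integral identity: [g] is the almost everywhere
    derivative, and no pointwise derivative of [f] is mentioned. *)
Definition AC f g := [/\ continuous f, locint g &
  forall a b, a <= b -> f b - f a = \int[mu]_(x in `[a, b]) g x].

Lemma unif_cont f a b e : continuous f -> 0 < e -> exists2 del : R, 0 < del &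
  forall s t, a <= s <= b -> a <= t <= b -> `|s - t| <= del -> `|f s - f t| <= e.
Proof.
move=> cf e0; have [||del del0 H] := @heine R (fun s t => `|f s - f t|) a b _ _ e e0.
- move=> s t x _ _ _; rewrite [`|f t - f x|]distrC.
  by rewrite (_ : f s - f t = f s - f x + (f x - f t)) ?ler_normD//; ring.
- move=> x _ d d0; have /cvgrPdist_le/(_ _ d0) := cf x.
  move=> [r /= r0 Hr]; exists r => // s _ sx.
  by rewrite distrC; apply: Hr => /=; rewrite distrC.
exists (del / 2); first by rewrite divr_gt0.
by move=> s t sab tab st; apply: H => //; lra.
Qed.

Lemma cont_bounded f a b : continuous f -> exists2 M : R, 0 <= M &
  forall x, a <= x <= b -> `|f x| <= M.
Proof.
move=> cf; have [ab|ba] := leP a b; last first.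
  by exists 0 => // x /andP[ax xb]; exfalso; lra.
have [|c _ Hc] := @EVT_max R (fun x => `|f x|) a b ab.
  by apply: continuous_subspaceT => x; apply: cvg_norm; exact: cf.
by exists `|f c| => // x xab; apply: Hc; rewrite in_itv.
Qed.

(* Chain rule: the error of the first order expansion of [phi] along [(u, v)] is quadratic in
   the increments, hence [o] of the integral of [|p| + |q|]. *)
Lemma AC_chain (phi phi1 phi2 : R -> R -> R) u v p q :
  AC u p -> AC v q ->
  continuous (fun x => phi (u x) (v x)) ->
  continuous (fun x => phi1 (u x) (v x)) ->
  continuous (fun x => phi2 (u x) (v x)) ->
  (forall a b, exists2 C : R, 0 <= C & forall s t, a <= s <= b -> a <= t <= b ->
     `|phi (u t) (v t) - phi (u s) (v s) - phi1 (u s) (v s) * (u t - u s)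
       - phi2 (u s) (v s) * (v t - v s)| <=
     C * (`|u t - u s| + `|v t - v s|) ^+ 2) ->
  AC (fun x => phi (u x) (v x))
     (fun x => phi1 (u x) (v x) * p x + phi2 (u x) (v x) * q x).
Proof.
move=> [cu pi up] [cv qi vq] cphi c1 c2 taylor.
have i1 := locint_contM pi c1; have i2 := locint_contM qi c2.
have gi := locintD i1 i2.
split => // a b ab.
pose G x := phi1 (u x) (v x) * p x + phi2 (u x) (v x) * q x.
pose E s t := phi (u t) (v t) - phi (u s) (v s) - \int[mu]_(x in `[s, t]) G x.
pose w x := `|p x| + `|q x|.
have wi : locint w by apply: locintD; exact: locint_norm.
pose m s t := \int[mu]_(x in `[s, t]) w x.
suff : E a b = 0 by move/eqP; rewrite subr_eq0 => /eqP.
apply: (@additive_small E m) => //.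
- by move=> s t r _ st tr _; rewrite /E (intab_split gi st tr); ring.
- by move=> s t r _ st tr _; rewrite /m (intab_split wi st tr).
move=> e e0.
have [C C0 HC] := taylor a b.
have C1 : 0 < 4 * (C + 1) by lra.
have e20 : 0 < e / 2 by rewrite divr_gt0.
have [d1 d10 H1] := @unif_cont u a b _ cu (divr_gt0 e0 C1).
have [d2 d20 H2] := @unif_cont v a b _ cv (divr_gt0 e0 C1).
have [d3 d30 H3] := @unif_cont _ a b _ c1 e20.
have [d4 d40 H4] := @unif_cont _ a b _ c2 e20.
exists (Num.min (Num.min d1 d2) (Num.min d3 d4)).
  by rewrite !lt_min d10 d20 d30 d40.
move=> s t as_ st tb; rewrite !le_min => /andP[/andP[t1 t2] /andP[t3 t4]].
have sab : a <= s <= b by rewrite as_ (le_trans st).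
have tab : a <= t <= b by rewrite tb (le_trans as_).
have ts d : t - s <= d -> `|t - s| <= d by move=> h; rewrite ger0_norm ?subr_ge0.
have du : `|u t - u s| <= e / (4 * (C + 1)) by apply: H1 => //; exact: ts.
have dv : `|v t - v s| <= e / (4 * (C + 1)) by apply: H2 => //; exact: ts.
have P : \int[mu]_(x in `[s, t]) p x = u t - u s by rewrite up.
have Q : \int[mu]_(x in `[s, t]) q x = v t - v s by rewrite vq.
have nu : `|u t - u s| <= \int[mu]_(x in `[s, t]) `|p x| by rewrite -P intab_norm.
have nv : `|v t - v s| <= \int[mu]_(x in `[s, t]) `|q x| by rewrite -Q intab_norm.
have mE : m s t = \int[mu]_(x in `[s, t]) `|p x| + \int[mu]_(x in `[s, t]) `|q x|.
  by rewrite /m intabD//; exact: locint_norm.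
pose T := phi (u t) (v t) - phi (u s) (v s) - phi1 (u s) (v s) * (u t - u s)
           - phi2 (u s) (v s) * (v t - v s).
have TE : `|T| <= e / 2 * m s t.
  apply: le_trans (HC _ _ sab tab) _.
  have S1 : `|u t - u s| + `|v t - v s| <= m s t by rewrite mE lerD.
  have S2 : `|u t - u s| + `|v t - v s| <= e / (2 * (C + 1)).
    have -> : e / (2 * (C + 1)) = e / (4 * (C + 1)) + e / (4 * (C + 1)).
      by field; rewrite gt_eqF//; lra.
    exact: lerD.
  have S0 : 0 <= `|u t - u s| + `|v t - v s| by rewrite addr_ge0.
  rewrite expr2 mulrA; apply: ler_pM => //; first by rewrite mulr_ge0.
  apply: le_trans (ler_wpM2l C0 S2) _.
  have -> : C * (e / (2 * (C + 1))) = e / 2 * (C / (C + 1)).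
    by field; rewrite gt_eqF//; lra.
  apply: ler_piMr; first exact: ltW.
  rewrite ler_pdivrMr ?mul1r; lra.
pose k1 := phi1 (u s) (v s); pose k2 := phi2 (u s) (v s).
have EE : E s t = T + \int[mu]_(x in `[s, t])
   ((k1 * p x + k2 * q x) - G x).
  rewrite intabB//; last by apply: locintD; exact: locintZ.
  rewrite intabD; [|exact: locintZ|exact: locintZ].
  by rewrite !intabZ// P Q /E /T -/k1 -/k2; ring.
rewrite EE; apply: le_trans (ler_normD _ _) _.
rewrite [X in X * _]splitr mulrDl; apply: lerD => //.
have Di : locint (fun x => k1 * p x + k2 * q x - G x).
  by apply: locintB => //; apply: locintD; exact: locintZ.
apply: le_trans (intab_norm _ _ Di) _; rewrite /m -intabZ//.
apply: intab_le; [exact: locint_norm|exact: locintZ|].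
move=> x /andP[sx xt].
have xab : a <= x <= b by rewrite (le_trans as_ sx) (le_trans xt tb).
have sx' d : t - s <= d -> `|s - x| <= d.
  by move=> h; rewrite ler0_norm ?subr_le0//; lra.
rewrite (_ : _ - G x = (k1 - phi1 (u x) (v x)) * p x + (k2 - phi2 (u x) (v x)) * q x).
  apply: le_trans (ler_normD _ _) _; rewrite /w mulrDr !normrM.
  by apply: lerD; rewrite ler_wpM2r//; [apply: H3|apply: H4] => //; exact: sx'.
by rewrite /G; ring.
Qed.

Lemma AC_mul u v p q : AC u p -> AC v q ->
  AC (fun x => u x * v x) (fun x => v x * p x + u x * q x).
Proof.
move=> U V; have [cu _ _] := U; have [cv _ _] := V.
apply: (@AC_chain (fun x y => x * y) (fun x y => y) (fun x y => x)) => //.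
  by move=> x; apply: cvgM; [exact: cu|exact: cv].
move=> a b; exists 1 => // s t _ _; move: (u t) (u s) (v t) (v s) => x' x y' y.
rewrite (_ : _ - _ - _ - _ = (x' - x) * (y' - y)); last by ring.
rewrite normrM mul1r sqrrD.
by have := sqr_ge0 `|x' - x|; have := sqr_ge0 `|y' - y|;
  have : 0 <= `|x' - x| * `|y' - y| by [rewrite mulr_ge0]; rewrite mulr2n; lra.
Qed.

Lemma AC_comp (h h1 : R -> R) u p : AC u p -> continuous (fun x => h (u x)) ->
  continuous (fun x => h1 (u x)) ->
  (forall a b, exists2 C : R, 0 <= C & forall s t, a <= s <= b -> a <= t <= b ->
     `|h (u t) - h (u s) - h1 (u s) * (u t - u s)| <= C * (u t - u s) ^+ 2) ->
  AC (fun x => h (u x)) (fun x => h1 (u x) * p x).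
Proof.
move=> U ch ch1 T; have c0 : continuous (fun _ : R => 0 : R) by move=> x; exact: cvg_cst.
have := @AC_chain (fun x _ => h x) (fun x _ => h1 x) (fun _ _ => 0) u u p p U U ch ch1 c0.
move=> H; have {}H := H _; have E : (fun x => h1 (u x) * p x + 0 * p x) = fun x => h1 (u x) * p x.
  by apply: funext => x; rewrite mul0r addr0.
rewrite -E; apply: H => a b; have [C C0 HC] := T a b; exists C => // s t sab tab.
rewrite mul0r subr0; apply: le_trans (HC s t sab tab) _; apply: ler_wpM2l => //.
rewrite -real_normK ?num_real//; apply: sqr_mono; first exact: normr_ge0.
by rewrite lerDl.
Qed.

Lemma ACD u v p q : AC u p -> AC v q -> AC (fun x => u x + v x) (fun x => p x + q x).
Proof.
move=> [cu pi up] [cv qi vq]; split.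
- by move=> x; apply: cvgD; [exact: cu|exact: cv].
- exact: locintD.
- by move=> a b ab; rewrite intabD// -up// -vq//; ring.
Qed.

Lemma ACZ k u p : AC u p -> AC (fun x => k * u x) (fun x => k * p x).
Proof.
move=> [cu pi up]; split.
- by move=> x; apply: cvgM; [exact: cvg_cst|exact: cu].
- exact: locintZ.
- by move=> a b ab; rewrite intabZ// -up//; ring.
Qed.

Lemma AC_cst k : AC (fun=> k) (fun=> 0).
Proof.
split; [by move=> x; exact: cvg_cst|apply: locint_cont => x; exact: cvg_cst|].
by move=> a b ab; rewrite intab_cst// mul0r subrr.
Qed.

Lemma AC_C1 f g : (forall x : R, is_derive x 1 f (g x)) -> continuous g -> AC f g.
Proof.
move=> df cg; have cf : continuous f.
  move=> x; apply: differentiable_continuous; apply/derivable1_diffP.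
  by have [] := df x.
split => //; first exact: locint_cont.
move=> a b; rewrite le_eqVlt => /predU1P[->|ab].
  by rewrite set_itv1 Rintegral_set1 subrr.
have := @continuous_FTC2 R g f a b ab; rewrite /Rintegral => -> //=.
- exact: continuous_subspaceT.
- split.
  + by move=> x _; have [] := df x.
  + by apply: cvg_at_right_filter; exact: cf.
  + by apply: cvg_at_left_filter; exact: cf.
- by move=> x _; rewrite derive1E; have [_ ->] := df x.
Qed.

Lemma AC_zero f : AC f (fun=> 0) -> forall x y, f x = f y.
Proof.
move=> [_ _ H] x y; wlog xy : x y / x <= y.
  by have [xy|/ltW yx] := leP x y; [apply|move=> h; apply/esym; exact: h].
by apply/esym/eqP; rewrite -subr_eq0 H// intab_cst// mul0r.
Qed.

Lemma AC_primitive g : locint g -> exists f, AC f g.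
Proof.
move=> gi.
pose f x := if 0 <= x then \int[mu]_(y in `[0, x]) g y else - \int[mu]_(y in `[x, 0]) g y.
have H a b : a <= b -> f b - f a = \int[mu]_(x in `[a, b]) g x.
  move=> ab; rewrite /f; case: (leP 0 a) => [a0|a0].
    by rewrite (le_trans a0 ab) (intab_split gi a0 ab); ring.
  case: (leP 0 b) => b0.
    by rewrite (intab_split gi (ltW a0) b0); ring.
  by rewrite (intab_split gi ab (ltW b0)); ring.
exists f; split => // x.
have cw : {within `[x - 1, x + 1], continuous (fun y => \int[mu]_(z in `[x - 1, y]) g z)}.
  by apply: parameterized_integral_continuous; [lra|exact: gi].
have E : {in `](x - 1), (x + 1)[, f =1 fun y => f (x - 1) + \int[mu]_(z in `[x - 1, y]) g z}.
  by move=> y; rewrite in_itv /= => /andP[xy yx]; rewrite -H; [ring|exact: ltW].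
have xin : x \in `](x - 1), (x + 1)[ by rewrite in_itv /=; lra.
have c2 : {for x, continuous (fun y => f (x - 1) + \int[mu]_(z in `[x - 1, y]) g z)}.
  apply: cvgD; first exact: cvg_cst.
  move/continuous_within_itvP : cw => /(_ _) [|ci _ _]; first lra.
  exact: ci.
apply: cvg_trans (_ : (fun y => f (x - 1) + \int[mu]_(z in `[x - 1, y]) g z) @ x --> f x).
  apply: near_eq_cvg; have := near_in_itvoo xin; apply: filterS => y yin.
  by rewrite /= (E y yin).
by rewrite (E x xin); exact: c2.
Qed.

(** Lebesgue's differentiation theorem: the primitive from $-n$ vanishes identically, and its
    derivative is $g$ almost everywhere to the right of $-n$. Countably many $n$ exhaust the
    line. *)
Lemma AC_int0 g : locint g -> (forall a b, a <= b -> \int[mu]_(x in `[a, b]) g x = 0) ->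
  {ae mu, forall x, g x = 0}.
Proof.
move=> gi g0.
have lg : locally_integrable setT g.
  split; [exact: locint_meas|exact: openT|move=> K _ cK].
  have [M [_ HM]] := compact_bounded cK.
  have sub : K `<=` `[- (`|M| + 1), `|M| + 1].
    move=> x Kx; rewrite /= in_itv /= -ler_norml; apply: HM => //.
    by rewrite (le_lt_trans (ler_norm _))// ltrDl.
  have : mu.-integrable K (EFin \o g).
    by apply: integrableS (gi _ _) => //; [exact: compact_measurable|exact: sub].
  by move=> /integrableP[_].
have key n : {ae mu, forall x, - n%:R < x -> g x = 0}.
  pose a : R := - n%:R.
  have H := @FTC1 R g (BLeft a) (fun y => gi a y) lg.
  apply: (aeS H) => x Hx ax.
  have [|_ <-] := Hx; first exact: ax.
  have E : \forall y \near x, (fun y => \int[mu]_(t in `[a, y]) g t) y = 0.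
    have xin : x \in `]a, (x + 1)[ by rewrite in_itv /= ax ltrDl ltr01.
    have := near_in_itvoo xin; apply: filterS => y; rewrite in_itv /= => /andP[ay _].
    by rewrite g0// ltW.
  rewrite derive1E (near_eq_derive _ E) ?oner_eq0//.
  exact: derive_cst.
have : {ae mu, forall x, forall n : nat, - n%:R < x -> g x = 0}.
  exact/ae_foralln.
move=> H; apply: (aeS H) => x /(_ (Num.truncn `|x|).+1); apply.
rewrite ltrNl; apply: (le_lt_trans (ler_norm _)); rewrite normrN.
exact: truncnS_gt.
Qed.

End AbsolutelyContinuous.

(** * Smooth bump functions *)

Section Smooth.
Context {R : realType}.
Implicit Types (f g : R -> R) (x a b l : R).

(** Carrying the derivatives as witnesses turns the closure properties into plain inductions;
    [Cn_derive1n] converts to the iterated derivatives of [test_function]. *)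
Fixpoint Cn n f : Prop := if n is n'.+1 then
  exists f', (forall x : R, is_derive x 1 f (f' x)) /\ Cn n' f' else True.

Lemma CnW n f : Cn n.+1 f -> Cn n f.
Proof.
elim: n f => [//|n IH] f [f' [df Cf]]; exists f'; split => //; exact: IH.
Qed.

Lemma CnD n f g : Cn n f -> Cn n g -> Cn n (fun x => f x + g x).
Proof.
elim: n f g => [//|n IH] f g [f' [df Cf]] [g' [dg Cg]].
exists (fun x => f' x + g' x); split; last exact: IH.
by move=> x; apply: is_deriveD.
Qed.

Lemma CnZ n k f : Cn n f -> Cn n (fun x => k * f x).
Proof.
elim: n f => [//|n IH] f [f' [df Cf]].
exists (fun x => k * f' x); split; last exact: IH.
by move=> x; apply: is_deriveZ.
Qed.

Lemma CnM n f g : Cn n f -> Cn n g -> Cn n (fun x => f x * g x).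
Proof.
elim: n f g => [//|n IH] f g Cf Cg; have Cf1 := CnW Cf; have Cg1 := CnW Cg.
case: Cf => f' [df Cf]; case: Cg => g' [dg Cg].
exists (fun x => f x * g' x + g x * f' x); split.
  by move=> x; apply: is_deriveM.
by apply: CnD; exact: IH.
Qed.

Lemma Cn_affine n a b f : Cn n f -> Cn n (fun x => f (a * x + b)).
Proof.
elim: n f => [//|n IH] f [f' [df Cf]].
exists (fun x => a * f' (a * x + b)); split; last by apply: CnZ; exact: IH.
move=> x.
have dl : is_derive x 1 (fun x => a * x + b) a.
  by apply: is_derive_eq; rewrite /GRing.scale /= mulr1 addr0.
have := @is_derive1_comp R f (fun x => a * x + b) x (f' (a * x + b)) a (df _) dl.
by rewrite /GRing.scale /= mulrC.
Qed.

Lemma Cn_derive1n n f : Cn n.+1 f -> forall x, derivable (derive1n n f) x 1.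
Proof.
elim: n f => [|n IH] f [f' [df Cf]] x /=; first by have [] := df x.
have -> : derive1 (derive1n n f) = derive1n n f'.
  rewrite -[LHS]/(derive1n n.+1 f) /derive1n iterSr; congr (iter _ _ _).
  by apply: funext => y; rewrite derive1E; have [_ ->] := df y.
exact: IH.
Qed.

Lemma is_derive_sq f (C x : R) : (forall y, `|f y - f x| <= C * (y - x) ^+ 2) ->
  is_derive x 1 f 0.
Proof.
move=> fC.
have C0 : 0 <= C.
  by have := fC (x + 1); rewrite addrAC subrr add0r expr1n mulr1; apply: le_trans.
have H : (fun h => h^-1 *: ((f \o shift x) (h *: 1) - f x)) @ 0^' --> (0 : R).
  apply/cvgrPdist_le => e e0.
  have C1 : 0 < C + 1 by lra.
  exists (e / (C + 1)); first by rewrite /= divr_gt0.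
  move=> h /= hd hn0; rewrite sub0r normrN /GRing.scale /= mulr1.
  rewrite normrM normfV ler_pdivrMl ?normr_gt0//.
  apply: le_trans (fC _) _; rewrite addrK.
  have -> : h ^+ 2 = `|h| * `|h| by rewrite -expr2 real_normK ?num_real.
  rewrite mulrCA ler_wpM2l//.
  move: hd; rewrite sub0r normrN => /ltW hd.
  apply: (@le_trans _ _ ((C + 1) * (e / (C + 1)))); last by rewrite mulrC divfK ?gt_eqF.
  by apply: ler_pM => //; rewrite lerDl.
by apply: DeriveDef; [apply/cvg_ex; exists 0|apply/cvg_lim].
Qed.

(* Closed under differentiation up to linear combinations, which makes [flat l 0] smooth. *)
Definition flat l k x := if 0 < x then x^-1 ^+ k * expR (- (l / x)) else 0.

(** With $m=k+2$, $e^{l/x}=(e^{l/(mx)})^m\ge(l/(mx))^m$, so $m$ powers of $x$ are gained and $k$ are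
    lost. The quadratic bound yields the derivative at the origin. *)
Lemma flat_sq l k : 0 < l -> exists C, forall x, `|flat l k x| <= C * x ^+ 2.
Proof.
move=> l0; pose m := k.+2; exists ((m%:R / l) ^+ m) => x; rewrite /flat.
have m0 : 0 < m%:R / l by rewrite divr_gt0.
case: ltP => [x0|_]; last by rewrite normr0 mulr_ge0 ?sqr_ge0// exprn_ge0// ltW.
rewrite ger0_norm; last by rewrite mulr_ge0 ?expR_ge0// exprn_ge0// invr_ge0 ltW.
rewrite expRN ler_pdivrMr ?expR_gt0//.
rewrite exprVn -[X in X <= _]mulr1 ler_pdivrMl ?exprn_gt0//.
have -> : l / x = m%:R * (l / x / m%:R) by rewrite mulrCA divff ?mulr1// pnatr_eq0.
rewrite expRM_natl.
have e (A E : R) : x ^+ k * (A ^+ m * x ^+ 2 * E ^+ m) = (A * x * E) ^+ m.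
  by rewrite /m -addn2 !exprMn !exprD; ring.
rewrite e.
apply: exprn_ege1.
apply: le_trans (_ : m%:R / l * x * (l / x / m%:R) <= _).
  by rewrite le_eqVlt; apply/orP; left; apply/eqP; field; rewrite !gt_eqF.
apply: ler_wpM2l; first by rewrite mulr_ge0// ltW.
by apply: le_trans (expR_ge1Dx _); rewrite lerDr.
Qed.

Lemma flat_derive l k x : 0 < l ->
  is_derive x 1 (flat l k) (l * flat l k.+2 x - k%:R * flat l k.+1 x).
Proof.
move=> l0; have [x0|x0|->] := ltgtP x 0.
- rewrite /flat (lt_gtF x0) !mulr0 subr0.
  have near0 : \forall y \near x, (fun=> 0 : R) y = flat l k y.
    near=> y; have y0 : y < 0 by near: y; exact: (cvgr_lt x (@cvg_id _ (nbhs x)) 0 x0).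
    by rewrite /flat (lt_gtF y0).
  exact: (near_eq_is_derive near0).
- have nearE : \forall y \near x, y^-1 ^+ k * expR (- (l / y)) = flat l k y.
    near=> y; have y0 : 0 < y by near: y; exact: (cvgr_gt x (@cvg_id _ (nbhs x)) 0 x0).
    by rewrite /flat y0.
  apply: (near_eq_is_derive nearE); rewrite /flat x0.
  have xn0 : x != 0 by rewrite gt_eqF.
  have dV : is_derive x 1 (fun y : R => y^-1) (- x ^- 2).
    have := @is_deriveV R id x 1 1 xn0 (is_derive_id _ _).
    by rewrite /GRing.scale /= mulr1.
  have dX : is_derive x 1 (fun y : R => y^-1 ^+ k) (- (k%:R * x^-1 ^+ k.+1)).
    case: k {nearE} => [|k].
      rewrite mul0r oppr0 (_ : (fun y => _) = cst 1); first exact: is_derive_cst.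
      by apply: funext.
    have h := @is_deriveX R _ (fun y : R => y^-1) k.+1 x 1 _ dV.
    rewrite (_ : (fun y => _) = (fun y : R => y^-1) ^+ k.+1); last by rewrite exprfctE.
    apply: (is_derive_eq h).
    rewrite /GRing.scale /= -mulr_natl -!exprVn !exprS expr0; ring.
  have dE : is_derive x 1 (fun y : R => expR (- (l / y))) (l / x ^+ 2 * expR (- (l / x))).
    have dl : is_derive x 1 (fun y : R => - (l / y)) (l / x ^+ 2).
      have dZ := @is_deriveZ R _ _ (fun y : R => y^-1) l x 1 _ dV.
      have dN := @is_deriveN R _ _ _ x 1 _ dZ.
      apply: (is_derive_eq dN); rewrite /GRing.scale /=; ring.
    have := @is_derive1_comp R expR (fun y => - (l / y)) x _ _ (is_derive_expR _) dl.
    by rewrite /GRing.scale /= mulrC.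
  have dM := @is_deriveM R _ _ _ x 1 _ _ dX dE.
  apply: (is_derive_eq dM); rewrite /GRing.scale /= -!exprVn !exprS expr0; ring.
- have [C HC] := flat_sq k l0.
  rewrite {2 3}/flat ltxx !mulr0 subr0; apply: (@is_derive_sq _ C) => y.
  by rewrite {2}/flat ltxx !subr0.
Unshelve. all: by end_near.
Qed.

Lemma Cn_flat n l k : 0 < l -> Cn n (flat l k).
Proof.
move=> l0; elim: n k => [//|n IH] k.
exists (fun x => l * flat l k.+2 x - k%:R * flat l k.+1 x); split.
  by move=> x; exact: flat_derive.
have := CnD (CnZ l (IH k.+2)) (CnZ (- k%:R) (IH k.+1)).
by congr Cn; apply: funext => x; rewrite mulNr.
Qed.

(** As [l] tends to 0 these functions converge to the indicator of the open interval, so test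
    functions approximate indicators without mollification. *)
Definition bump l a b x := flat l 0 (x - a) * flat l 0 (b - x).

Lemma Cn_bump n l a b : 0 < l -> Cn n (bump l a b).
Proof.
move=> l0; apply: CnM.
  have := Cn_affine 1 (- a) (Cn_flat n 0 l0).
  by congr Cn; apply: funext => x; rewrite mul1r.
have := Cn_affine (-1) b (Cn_flat n 0 l0).
by congr Cn; apply: funext => x; rewrite mulN1r addrC.
Qed.

Lemma flat_bnd l x : 0 < l -> 0 <= flat l 0 x <= 1.
Proof.
move=> l0; rewrite /flat; case: ltP => [x0|_]; last by rewrite lexx ler01.
rewrite expr0 mul1r expR_ge0 -(expR0 R) ler_expR oppr_le0.
by rewrite divr_ge0// ltW.
Qed.

Lemma bump_bnd l a b x : 0 < l -> 0 <= bump l a b x <= 1.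
Proof.
move=> l0; rewrite /bump.
have /andP[p1 p2] := flat_bnd (x - a) l0; have /andP[q1 q2] := flat_bnd (b - x) l0.
by rewrite mulr_ge0//= mulr_ile1.
Qed.

Lemma bump_out l a b x : ~~ (a < x < b) -> bump l a b x = 0.
Proof.
rewrite negb_and -!leNgt /bump /flat => /orP[h|h].
  by rewrite [0 < x - a]subr_gt0 ltNge h /= mul0r.
by rewrite [0 < b - x]subr_gt0 [x < b]ltNge h /= mulr0.
Qed.

Lemma flat_cvg x : 0 < x -> (fun n : nat => flat n.+1%:R^-1 0 x) @ \oo --> (1 : R).
Proof.
move=> x0; have h : (fun n : nat => - (n.+1%:R^-1 / x)) @ \oo --> (0 : R).
  by have := cvgN (cvgM (@cvg_harmonic R) (cvg_cst x^-1)); rewrite mul0r oppr0; exact.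
have H : (fun n : nat => expR (- (n.+1%:R^-1 / x))) @ \oo --> (expR 0 : R).
  by apply: continuous_cvg; [exact: continuous_expR|exact: h].
rewrite expR0 in H.
apply: cvg_trans H; apply: near_eq_cvg; apply: nearW => n /=.
by rewrite /flat x0 expr0 mul1r.
Qed.

Lemma bump_cvg a b x : (fun n : nat => bump n.+1%:R^-1 a b x) @ \oo -->
  ((a < x < b)%R%:R : R).
Proof.
case: (boolP (a < x < b)) => [/andP[ax xb]|h]; last first.
  by under eq_fun do rewrite bump_out//; exact: cvg_cst.
rewrite -subr_gt0 in ax; rewrite -subr_gt0 in xb.
by have := cvgM (flat_cvg ax) (flat_cvg xb); rewrite mulr1; exact.
Qed.

Lemma test_of_Cn f : (forall n, Cn n f) ->
  (exists M : R, forall x, M < `|x| -> f x = 0) -> test_function f.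
Proof. by move=> Cf Mf; split => // n x; exact: Cn_derive1n. Qed.

Lemma out_abs a b x : `|a| + `|b| < `|x| -> ~~ (a < x < b).
Proof.
move=> h; apply/negP => /andP[ax xb].
have : `|x| <= `|a| + `|b|.
  have := ler_norm b; have := ler_norm (- a); rewrite normrN => h1 h2.
  have := normr_ge0 a; have := normr_ge0 b; rewrite ler_norml; lra.
by rewrite leNgt h.
Qed.

Lemma test_bump l a b : 0 < l -> test_function (bump l a b).
Proof.
move=> l0; apply: test_of_Cn; first by move=> n; exact: Cn_bump.
by exists (`|a| + `|b|) => x /out_abs; exact: bump_out.
Qed.

End Smooth.

(** * Weak derivatives of real functions *)

Section WeakDerivative.
Context {R : realType}.
Local Notation mu := (@lebesgue_measure R).
Local Notation integ f := (mu.-integrable setT (EFin \o (f : R -> R))).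
Implicit Types (f g m phi : R -> R) (F G H : R -> R[i]).

Lemma Cn_cont f : Cn 1 f -> continuous f.
Proof.
move=> [f' [df _]] x; apply: differentiable_continuous; apply/derivable1_diffP.
by have [] := df x.
Qed.

Lemma cpt_integ g phi (M : R) : locint g -> continuous phi ->
  (forall x, M < `|x| -> phi x = 0) ->
  integ (fun x => g x * phi x) /\
  \int[mu]_x (g x * phi x) = \int[mu]_(x in `[- M, M]) (g x * phi x).
Proof.
move=> gi cp p0.
have gp : locint (fun x => g x * phi x).
  by under eq_fun do rewrite mulrC; exact: locint_contM.
have E : (fun x => g x * phi x) = (fun x => g x * phi x) \_ `[- M, M].
  apply: funext => x; rewrite patchE mem_setE in_itv /= -ler_norml.
  by case: leP => // h; rewrite p0 ?mulr0.
split; last by rewrite [in LHS]E [RHS]Rintegral_mkcond.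
by rewrite E; apply/(integ_indic _ (measurable_itv _)); exact: gp.
Qed.

(** Dominated convergence with [l] tending to 0 gives vanishing integrals over all intervals, and
    [AC_int0] concludes. *)
Lemma bump_ae0 g : locint g -> (forall l a b, 0 < l -> a <= b ->
  \int[mu]_x (g x * bump l a b x) = 0) -> {ae mu, forall x, g x = 0}.
Proof.
move=> gi H; apply: AC_int0 => // a b ab.
have mg := locint_meas gi.
have l0 n : (0 : R) < n.+1%:R^-1 by rewrite invr_gt0.
have cb n : continuous (bump (n.+1%:R^-1 : R) a b) by exact: Cn_cont (Cn_bump 1 a b (l0 n)).
have [_ _] : [/\ mu.-integrable setT (fun x => (g x * (a < x < b)%R%:R)%:E),
   [sequence (\int[mu]_x `|(g x * bump n.+1%:R^-1 a b x)%:E - (g x * (a < x < b)%R%:R)%:E|)%E]_n @ \oo --> 0%E &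
   [sequence (\int[mu]_x (g x * bump n.+1%:R^-1 a b x)%:E)%E]_n @ \oo -->
     (\int[mu]_x (g x * (a < x < b)%R%:R)%:E)%E].
  apply: (@dominated_convergence _ _ _ mu setT measurableT
    (fun n x => (g x * bump n.+1%:R^-1 a b x)%:E) _
    (EFin \o ((fun x => `|g x|) \_ `[a, b]))).
  - move=> n; apply: mEFin; apply: measurable_funM => //.
    exact: continuous_measurable_fun.
  - apply: mEFin; apply: measurable_funM => //.
    rewrite (_ : (fun _ => _) = \1_(`]a, b[%classic)); first exact: measurable_indic.
    by apply: funext => x; rewrite indicE mem_setE in_itv.
  - apply: aeT => x _; apply: cvg_EFin; first exact: nearW.
    rewrite (_ : fine \o _ = fun n => g x * bump n.+1%:R^-1 a b x)//.
    by apply: cvgM; [exact: cvg_cst|exact: bump_cvg].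
  - by apply/(integ_indic (fun x => `|g x|) (measurable_itv _)); exact: locint_norm gi a b.
  - apply: aeT => x n _; rewrite /= lee_fin patchE mem_setE in_itv /= normrM.
    have /andP[b0 b1] := bump_bnd a b x (l0 n).
    case: (boolP (a < x < b)) => [/andP[ax xb]|h].
      by rewrite (ltW ax) (ltW xb) /= ler_piMr// ger0_norm.
    by rewrite (bump_out _ h) normr0 mulr0; case: ifP.
rewrite (_ : [sequence _]_n = fun=> 0%E); last first.
  apply: funext => n /=; rewrite integ_fin; first by rewrite H.
  by have [] := @cpt_integ g _ (`|a| + `|b|) gi (cb n) (fun x h => bump_out _ (out_abs h)).
move=> /cvg_lim; rewrite lim_cst// => /(_ (@ereal_hausdorff R)) e0.
rewrite -Rintegral_itv_bndo_bndc; last first.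
  by apply: integrableS (gi a b) => //; apply: subset_itvl; rewrite bnd_simp.
rewrite -Rintegral_itv_obnd_cbnd; last first.
  by apply: integrableS (gi a b) => //; move=> x /=; rewrite !in_itv /= => /andP[/ltW -> /ltW ->].
rewrite Rintegral_mkcond /Rintegral -[RHS]/(fine 0) e0; congr fine.
apply: eq_integral => x _; rewrite patchE mem_setE in_itv /=.
by case: (_ < _ < _); rewrite ?mulr1 ?mulr0.
Qed.

Lemma AC_derive f g : AC f g -> continuous g -> forall x : R, is_derive x 1 f (g x).
Proof.
move=> [cf gi H] cg x.
have gi' : mu.-integrable `[x - 1, x + 1] (EFin \o g) by exact: gi.
have x1 : x - 1 < x by lra.
have xx : x < x + 1 by lra.
have [dF dE] := @continuous_FTC1_closed R g (x - 1) x (x + 1) xx gi' x1 (cg x).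
have E : \forall y \near x, f (x - 1) + \int[mu]_(t in `[x - 1, y]) g t = f y.
  have xin : x \in `](x - 1), (x + 1)[ by rewrite in_itv /=; lra.
  have := near_in_itvoo xin; apply: filterS => y; rewrite in_itv /= => /andP[xy yx].
  by rewrite -H; [ring|exact: ltW].
apply: (near_eq_is_derive E).
have d2 : is_derive x 1 (fun y => \int[mu]_(t in `[x - 1, y]) g t) (g x).
  by apply: DeriveDef; [exact: dF|rewrite -derive1E; exact: dE].
have := @is_deriveD R _ _ (fun=> f (x - 1)) (fun y => \int[mu]_(t in `[x - 1, y]) g t)
  x 1 0 (g x) (is_derive_cst _ _ _) d2.
by rewrite add0r.
Qed.

Definition wder f g := forall phi, test_function phi ->
  \int[mu]_x (f x * derive1 phi x) = - \int[mu]_x (g x * phi x).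

Lemma test_C1 phi : test_function phi -> continuous phi /\ continuous (derive1 phi) /\
  (forall x : R, is_derive x 1 phi (derive1 phi x)) /\
  exists M, (forall x, M < `|x| -> phi x = 0) /\ (forall x, M < `|x| -> derive1 phi x = 0).
Proof.
move=> [dp [M p0]].
have dc (h : R -> R) : (forall x, derivable h x 1) -> continuous h.
  by move=> dh x; apply: differentiable_continuous; exact/derivable1_diffP.
split; first exact: dc (dp 0%N).
split; first exact: dc (dp 1%N).
split.
  by move=> x; apply: DeriveDef; [exact: dp 0%N x|rewrite derive1E].
exists M; split => // x Mx.
have E : \forall y \near x, phi y = (fun=> 0) y.
  have cn : (fun y : R => `|y|) @ x --> `|x| by apply: cvg_norm; exact: cvg_id.
  near=> y; apply: p0; near: y; exact: (cvgr_gt _ cn _ Mx).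
by rewrite derive1E (near_eq_derive _ E); exact: derive_cst.
Unshelve. all: by end_near.
Qed.

Lemma AC_wder f g : AC f g -> wder f g.
Proof.
move=> Afg phi tp; have [cf gi _] := Afg.
have [cp [cp' [dp [M [p0 p0']]]]] := test_C1 tp.
(* Strictly beyond the support, so that [phi] vanishes at both endpoints and the boundary terms drop
   out. *)
pose M1 := `|M| + 1; have M1M : M < M1 by have := ler_norm M; rewrite /M1; lra.
have M10 : 0 <= M1 by rewrite /M1; have := normr_ge0 M; lra.
have P := AC_mul Afg (AC_C1 dp cp').
have q0 x : M1 < `|x| -> phi x = 0 by move=> h; apply: p0; exact: lt_trans h.
have q0' x : M1 < `|x| -> derive1 phi x = 0 by move=> h; apply: p0'; exact: lt_trans h.
have [i1 e1] := cpt_integ gi cp q0; have [i2 e2] := cpt_integ (locint_cont cf) cp' q0'.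
have [_ _ /(_ (- M1) M1)] := P.
have -> : phi M1 = 0 by apply: p0; rewrite ger0_norm.
have -> : phi (- M1) = 0 by apply: p0; rewrite normrN ger0_norm.
rewrite !mulr0 subr0 => /(_ _)/esym; rewrite intabD; last 2 first.
- exact: locint_contM.
- by apply: locint_contM => //; exact: locint_cont.
rewrite e1 e2 => h; apply/eqP; rewrite -addr_eq0 addrC; apply/eqP.
rewrite -[RHS]h; last lra.
by congr (_ + _); apply: eq_Rintegral => x _; rewrite mulrC.
Qed.

(** A test function of integral zero is the derivative of a test function. Subtracting a multiple of
    the fixed bump [b0] from an arbitrary bump makes its integral zero, so [m] minus a constant
    annihilates every bump. *)
Lemma wder0_cst m : locint m -> wder m (fun=> 0) -> exists c, {ae mu, forall x, m x = c}.
Proof.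
move=> mi m0.
have b0c := Cn_cont (Cn_bump 1 0 1 (@ltr01 R)); set b0 := bump 1 0 1 in b0c.
have out0 (x : R) : `|(0 : R)| + `|(1 : R)| < `|x| -> b0 x = 0.
  by move=> /out_abs; exact: bump_out.
have i1 : locint (fun=> 1 : R) by apply: locint_cont => x; exact: cvg_cst.
have intb (l a b : R) : 0 < l -> integ (bump l a b).
  move=> l0; have := (@cpt_integ (fun=> 1) (bump l a b) (`|a| + `|b|) i1
    (Cn_cont (Cn_bump 1 a b l0)) (fun x h => bump_out _ (out_abs h))).1.
  by under eq_fun do rewrite mul1r.
have intmb (l a b : R) : 0 < l -> integ (fun x => m x * bump l a b x).
  move=> l0; exact: (@cpt_integ m (bump l a b) (`|a| + `|b|) mi
    (Cn_cont (Cn_bump 1 a b l0)) (fun x h => bump_out _ (out_abs h))).1.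
pose I0 := \int[mu]_x b0 x.
have I0n : I0 != 0.
  apply/eqP => /(int_eq0_ae (intb 1 0 1 ltr01)) h.
  have {}h := h (fun x => (andP (bump_bnd 0 1 x ltr01)).1).
  have hn : mu.-negligible (`](0 : R), 1[ : set (measurableTypeR R)).
    apply: negligibleS h => x /=; rewrite in_itv /= => /andP[x0 x1] /eqP.
    rewrite /bump /flat !subr_gt0 x0 x1 !expr0 !mul1r mulf_eq0.
    by rewrite !gt_eqF ?expR_gt0.
  have := @measure_negligible _ _ _ mu _ (measurable_itv `](0 : R), 1[) hn.
  rewrite -[X in X = _ -> _]/(mu `](0:R), 1[%classic) lebesgue_measure_itv /=.
  by rewrite lte_fin ltr01 sube0 => -[]; apply/eqP; rewrite oner_eq0.
(* The only possible constant: the mean of [m] against [b0]. *)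
pose c := (\int[mu]_x (m x * b0 x)) / I0; exists c.
have ci : locint (fun x => m x - c).
  by apply: locintB => //; apply: locint_cont => x; exact: cvg_cst.
suff : {ae mu, forall x, m x - c = 0}.
  by move=> h; apply: (aeS h) => x /eqP; rewrite subr_eq0 => /eqP.
apply: bump_ae0 => // l a b l0 ab.
(* Chosen so that [th] has integral zero; its primitive from the left end then vanishes again at the
   right end and is compactly supported. *)
pose k := (\int[mu]_x bump l a b x) / I0.
pose th x := bump l a b x + (- k) * b0 x.
have Cth n : Cn n th by apply: CnD; [exact: Cn_bump|apply: CnZ; exact: Cn_bump].
have cth := Cn_cont (Cth 1%N).
pose M := `|a| + `|b| + 2 : R.
have M0 : 0 <= M by rewrite /M; have := normr_ge0 a; have := normr_ge0 b; lra.
have thM x : M < `|x| -> th x = 0.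
  move=> h; rewrite /th bump_out ?out0 ?mulr0 ?addr0//.
    by rewrite normr0 normr1; move: h; rewrite /M; have := normr_ge0 a; have := normr_ge0 b; lra.
  by apply: out_abs; move: h; rewrite /M; lra.
have I_th : \int[mu]_x th x = 0.
  rewrite intD; [|exact: intb|apply: integZ; exact: intb].
  by rewrite intZ; [rewrite -/I0 /k mulNr divfK// subrr|exact: intb].
have [P0 AP0] := AC_primitive (locint_cont cth).
pose P x := P0 x + (- P0 (- M)).
have AP : AC P th by have := ACD AP0 (AC_cst (- P0 (- M))); congr AC; apply: funext => x; rewrite addr0.
have dP := AC_derive AP cth.
have [_ thi PE] := AP.
have zero_int s t : s <= t -> (forall x, s < x < t -> th x = 0) -> P t - P s = 0.
  move=> st z; rewrite PE// -(Rintegral_set0 mu th).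
  have -> : \int[mu]_(x in `[s, t]) th x = \int[mu]_(x in `]s, t[) th x.
    rewrite -Rintegral_itv_bndo_bndc; last first.
      by apply: integrableS (thi s t) => //; apply: subset_itvl; rewrite bnd_simp.
    rewrite -Rintegral_itv_obnd_cbnd//.
    by apply: integrableS (thi s t) => // x /=; rewrite !in_itv /= => /andP[/ltW -> /ltW ->].
  rewrite Rintegral_set0 (_ : \int[mu]_(x in `]s, t[) th x = \int[mu]_(x in `]s, t[) (fun=> 0) x).
    by rewrite Rintegral_cst// mul0r.
  by apply: eq_Rintegral => x; rewrite mem_setE in_itv /=; exact: z.
have PM : P (- M) = 0 by rewrite /P subrr.
have PM' : P M = 0.
  have := PE (- M) M; rewrite PM subr0 => ->; last lra.
  have [_] := @cpt_integ (fun=> 1) th M i1 cth thM.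
  under eq_Rintegral do rewrite mul1r; rewrite I_th => ->.
  by apply: eq_Rintegral => x _; rewrite mul1r.
have Pout x : M < `|x| -> P x = 0.
  move=> h; have [x0|x0] := leP 0 x.
    rewrite ger0_norm// in h; rewrite -PM'; apply/eqP; rewrite -subr_eq0; apply/eqP.
    apply: zero_int; first exact: ltW.
    by move=> y /andP[My _]; apply: thM; rewrite ger0_norm// ltW// (le_lt_trans M0).
  rewrite ltr0_norm// in h; rewrite -PM; apply/eqP; rewrite eq_sym -subr_eq0; apply/eqP.
  apply: zero_int; first lra.
  move=> y /andP[_ yM]; apply: thM; rewrite ler0_norm; lra.
have tP : test_function P.
  apply: test_of_Cn; last by exists M.
  case=> [//|n]; exists th; split => //; exact: Cth.
have := m0 P tP.
rewrite (_ : derive1 P = th); last first.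
  by apply: funext => x; rewrite derive1E; have [_ ->] := dP x.
under [X in _ = - X -> _]eq_Rintegral do rewrite mul0r.
rewrite Rintegral_cst// mul0r oppr0 => h.
have eq1 : \int[mu]_x (m x * th x) =
    \int[mu]_x (m x * bump l a b x) - k * \int[mu]_x (m x * b0 x).
  rewrite -intZ; last exact: intmb.
  rewrite -intB; [|exact: intmb|apply: integZ; exact: intmb].
  by apply: eq_Rintegral => x _; rewrite /th; ring.
have eq2 : \int[mu]_x ((m x - c) * bump l a b x) =
    \int[mu]_x (m x * bump l a b x) - c * \int[mu]_x bump l a b x.
  rewrite -intZ; last exact: intb.
  rewrite -intB; [|exact: intmb|apply: integZ; exact: intb].
  by apply: eq_Rintegral => x _; ring.
rewrite eq2; move: eq1; rewrite h /k /c => /esym <-.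
by rewrite -/I0; move: (Rintegral _ _ _) (Rintegral _ _ _) (I0^-1) => p q r; ring.
Qed.

(** The difference of [f] and a primitive of [g] has weak derivative zero, hence is almost
    everywhere constant. *)
Lemma wder_AC f g : locint f -> locint g -> wder f g ->
  exists F : R -> R, AC F g /\ {ae mu, forall x, f x = F x}.
Proof.
move=> fi gi fg; have [G AG] := AC_primitive gi; have [cG _ _] := AG.
have Gi := locint_cont cG.
have [c Hc] : exists c, {ae mu, forall x, f x - G x = c}.
  apply: wder0_cst; first exact: locintB.
  move=> phi tp; have [cp [cp' [dp [M [p0 p0']]]]] := test_C1 tp.
  have [i1 _] := cpt_integ fi cp' p0'; have [i2 _] := cpt_integ Gi cp' p0'.
  under eq_Rintegral do rewrite mulrBl.
  rewrite intB// fg// (AC_wder AG)// subrr.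
  under eq_Rintegral do rewrite mul0r.
  by rewrite Rintegral_cst// mul0r oppr0.
exists (fun x => G x + c); split.
  by have := ACD AG (AC_cst c); congr AC; apply: funext => x; rewrite addr0.
by apply: (aeS Hc) => x <-; rewrite addrC subrK.
Qed.

End WeakDerivative.

(** * $H^1$ through pairs of a function and its derivative *)

Section WeakH1.
Context {R : realType}.
Local Notation mu := (@lebesgue_measure R).
Local Notation re := (@complex.Re R).
Local Notation im := (@complex.Im R).
Implicit Types (f g h F G : R -> R[i]) (u v p : R -> R) (c : R[i]).

Lemma locint_loc u : locint u <-> locally_integrable setT u.
Proof.
split=> [ui|[mu_ _ H] a b].
  split; [exact: locint_meas|exact: openT|move=> K _ cK].
  have [M [_ HM]] := compact_bounded cK.
  have sub : K `<=` `[- (`|M| + 1), `|M| + 1].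
    move=> x Kx; rewrite /= in_itv /= -ler_norml; apply: HM => //.
    by rewrite (le_lt_trans (ler_norm _))// ltrDl.
  have : mu.-integrable K (EFin \o u).
    by apply: integrableS (ui _ _) => //; [exact: compact_measurable|exact: sub].
  by move=> /integrableP[_].
apply/integrableP; split; first by apply/measurable_EFinP; exact: measurable_funTS.
by apply: H => //; exact: segment_compact.
Qed.

Lemma L2_locint f : L2 f -> locint (fun x => re (f x)) /\ locint (fun x => im (f x)).
Proof.
move=> fL; have [[mr mi] fi] := (L2P f).1 fL.
have H u : measurable_fun setT u -> (forall x, `|u x| <= normc (f x)) -> locint u.
  move=> um uf a b.
  have i1 : locint (fun x => 1 + normc (f x) ^+ 2).
    by apply: locintD; [apply: locint_cont => x; exact: cvg_cst|exact: locint_integ].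
  apply: (@le_integrable _ _ _ mu `[a, b]%classic _ (EFin \o u) (EFin \o (fun x => 1 + normc (f x) ^+ 2))) => //.
    by apply/measurable_EFinP; exact: measurable_funTS.
  move=> x _; rewrite lee_fin (le_trans (uf x))// ger0_norm ?addr_ge0 ?sqr_ge0//.
  by have := sqr_ge0 (normc (f x) - 1); rewrite sqrrB expr1n mulr1 mulr2n;
    have := normc_ge0 (f x); lra.
split; apply: H => // x; [exact: normc_re|exact: normc_im].
Qed.

Lemma re_MR (z : R[i]) (a : R) : re (z * a%:C) = re z * a.
Proof. by rewrite reM /= mulr0 subr0. Qed.

Lemma im_MR (z : R[i]) (a : R) : im (z * a%:C) = im z * a.
Proof. by rewrite imM /= mulr0 add0r. Qed.

Lemma weakP f g : is_weak_derivative f g <->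
  [/\ (locint (fun x => re (f x)) /\ locint (fun x => im (f x))),
      (locint (fun x => re (g x)) /\ locint (fun x => im (g x))),
      wder (fun x => re (f x)) (fun x => re (g x)) &
      wder (fun x => im (f x)) (fun x => im (g x))].
Proof.
have E (h : R -> R[i]) (u : R -> R) : Cintegral setT (fun x => h x * (u x)%:C) =
    (\int[mu]_x (re (h x) * u x)) +i* (\int[mu]_x (im (h x) * u x)).
  by rewrite /Cintegral; congr Complex; apply: eq_Rintegral => x _; rewrite ?re_MR ?im_MR.
split.
- move=> [[/locint_loc fr /locint_loc fi] [/locint_loc gr /locint_loc gi] H].
  by split => // phi tp; have := H phi tp; rewrite !E => -[].
- move=> [[fr fi] [gr gi] Hr Hi]; split.
  + by split; apply/locint_loc.
  + by split; apply/locint_loc.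
  + by move=> phi tp; rewrite !E (Hr _ tp) (Hi _ tp).
Qed.

(** The derivative is carried as data, any of its almost everywhere equal versions being allowed;
    rules of calculus then involve no chosen representative. *)
Definition WD f g := [/\ L2 f, L2 g & is_weak_derivative f g].

Lemma wder_uniq u p q : locint p -> locint q -> wder u p -> wder u q ->
  {ae mu, forall x, p x = q x}.
Proof.
move=> pi qi up uq.
have : {ae mu, forall x, p x - q x = 0}.
  apply: bump_ae0; first exact: locintB.
  move=> l a b l0 ab; have tb := test_bump a b l0.
  have [cp [_ [_ [M [p0 _]]]]] := test_C1 tb.
  have [i1 _] := cpt_integ pi cp p0; have [i2 _] := cpt_integ qi cp p0.
  under eq_Rintegral do rewrite mulrBl.
  by rewrite intB//; apply/eqP; rewrite subr_eq0 -eqr_opp -up// -uq.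
by move=> h; apply: (aeS h) => x /eqP; rewrite subr_eq0 => /eqP.
Qed.

Lemma weak_uniq f g g' : is_weak_derivative f g -> is_weak_derivative f g' -> Cae_eq g g'.
Proof.
move=> /weakP[_ [gr gi] r i] /weakP[_ [gr' gi'] r' i'].
apply: (aeS2 (wder_uniq gr gr' r r') (wder_uniq gi gi' i i')) => x.
exact: complex_ext.
Qed.

Definition cAC F g := AC (fun x => re (F x)) (fun x => re (g x)) /\
  AC (fun x => im (F x)) (fun x => im (g x)).

Lemma WD_rep f g : WD f g -> exists F, cAC F g /\ Cae_eq f F.
Proof.
move=> [_ _ /weakP[[fr fi] [gr gi] Hr Hi]].
have [U [AU eU]] := wder_AC fr gr Hr; have [V [AV eV]] := wder_AC fi gi Hi.
exists (fun x => U x +i* V x); split; first by split.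
by apply: (aeS2 eU eV) => x h1 h2; apply: complex_ext.
Qed.

Lemma rep_WD f g F : L2 f -> L2 g -> cAC F g -> Cae_eq f F -> WD f g.
Proof.
move=> fL gL [Ar Ai] e; split => //; apply/weakP.
have fl := L2_locint fL; have gl := L2_locint gL; split => //.
- move=> phi tp; have [cp [cp' [dp [M [p0 p0']]]]] := test_C1 tp.
  rewrite -(AC_wder Ar tp); have [cr _ _] := Ar; apply: int_ae.
  + exact: integ_meas (cpt_integ fl.1 cp' p0').1.
  + exact: integ_meas (cpt_integ (locint_cont cr) cp' p0').1.
  + by apply: (aeS e) => x ->.
- move=> phi tp; have [cp [cp' [dp [M [p0 p0']]]]] := test_C1 tp.
  rewrite -(AC_wder Ai tp); have [ci _ _] := Ai; apply: int_ae.
  + exact: integ_meas (cpt_integ fl.2 cp' p0').1.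
  + exact: integ_meas (cpt_integ (locint_cont ci) cp' p0').1.
  + by apply: (aeS e) => x ->.
Qed.

Lemma cont_L2 u (M : R) : continuous u -> (forall x, M < `|x| -> u x = 0) ->
  L2 (fun x => (u x)%:C).
Proof.
move=> cu u0; apply/L2P; split; first by apply: Cmeas_real; exact: continuous_measurable_fun.
have := (cpt_integ (locint_cont cu) cu u0).1; congr (_.-integrable _ _).
by apply: funext => x /=; rewrite normcR real_normK ?num_real// expr2.
Qed.

Lemma ip_test f c u (M : R) : L2 f -> continuous u -> (forall x, M < `|x| -> u x = 0) ->
  ip f (fun x => c * (u x)%:C) = re c * \int[mu]_x (re (f x) * u x) +
                                 im c * \int[mu]_x (im (f x) * u x).
Proof.
move=> fL cu u0; have [fr fi] := L2_locint fL.
have [i1 _] := cpt_integ fr cu u0; have [i2 _] := cpt_integ fi cu u0.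
rewrite -!intZ// -intD; [|exact: integZ|exact: integZ].
by apply: eq_Rintegral => x _; rewrite re_MR im_MR; ring.
Qed.

(** Turns the weak derivative into relations in the real Hilbert space, which survive $L^2$ limits
    and can be transformed by Plancherel's identity. The multiples [c = 1] and [c = i] recover real
    and imaginary parts. *)
Lemma WDP f g : L2 f -> L2 g -> WD f g <-> (forall phi c, test_function phi ->
  ip f (fun x => c * (derive1 phi x)%:C) = - ip g (fun x => c * (phi x)%:C)).
Proof.
move=> fL gL; split.
  move=> [_ _ /weakP[_ _ Hr Hi]] phi c tp.
  have [cp [cp' [dp [M [p0 p0']]]]] := test_C1 tp.
  by rewrite (ip_test c fL cp' p0') (ip_test c gL cp p0) (Hr _ tp) (Hi _ tp); ring.
move=> H; split => //; apply/weakP; split; [exact: L2_locint|exact: L2_locint| |];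
  move=> phi tp; have [cp [cp' [dp [M [p0 p0']]]]] := test_C1 tp.
  have := H phi 1 tp; rewrite (ip_test 1 fL cp' p0') (ip_test 1 gL cp p0) /=.
  by rewrite !mul1r !mul0r !addr0.
have := H phi 'i%C tp; rewrite (ip_test 'i%C fL cp' p0') (ip_test 'i%C gL cp p0) /=.
by rewrite !mul1r !mul0r !add0r.
Qed.

Lemma test_L2 phi c : test_function phi -> L2 (fun x => c * (phi x)%:C) /\
  L2 (fun x => c * (derive1 phi x)%:C).
Proof.
move=> tp; have [cp [cp' [dp [M [p0 p0']]]]] := test_C1 tp.
by split; apply: L2Z; apply: cont_L2; eassumption.
Qed.

Lemma WD_ae f g f' g' : WD f g -> L2 f' -> L2 g' -> Cae_eq f f' -> Cae_eq g g' -> WD f' g'.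
Proof.
move=> W f'L g'L ff gg; have [fL gL _] := W; apply/WDP => // phi c tp.
have [t1 t2] := test_L2 c tp.
rewrite -(ip_ael (L2meas fL) (L2meas f'L) (L2meas t2) ff).
rewrite -(ip_ael (L2meas gL) (L2meas g'L) (L2meas t1) gg).
by move/WDP : W; apply.
Qed.

Lemma WD_lin c f g f' g' : WD f g -> WD f' g' ->
  WD (fun x => c * f x + f' x) (fun x => c * g x + g' x).
Proof.
move=> W W'; have [fL gL _] := W; have [fL' gL' _] := W'.
apply/WDP => [||phi a tp].
- by apply: L2D => //; exact: L2Z.
- by apply: L2D => //; exact: L2Z.
have [t1 t2] := test_L2 a tp.
rewrite (ipDl (L2Z c fL) fL' t2) (ipDl (L2Z c gL) gL' t1) (ipMc c f) (ipMc c g).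
have E u : (fun x => c^*%C * (a * (u x)%:C)) = fun x => c^*%C * a * (u x)%:C.
  by apply: funext => x; rewrite mulrA.
rewrite (E (derive1 phi)) (E phi).
move/WDP : W => /(_ fL gL) -> //; move/WDP : W' => /(_ fL' gL') -> //.
by rewrite opprD.
Qed.

Lemma WD0 : WD (fun=> 0) (fun=> 0).
Proof.
apply/WDP; [exact: L2_0|exact: L2_0|].
have z f : ip (fun=> 0) f = 0.
  rewrite /ip (_ : \int[mu]_x _ = \int[mu]_x (cst 0 x)); last first.
    by apply: eq_Rintegral => x _; rewrite /= !mul0r addr0.
  by rewrite Rintegral_cst// mul0r.
by move=> phi c tp; rewrite !z oppr0.
Qed.

Lemma WDZ c f g : WD f g -> WD (fun x => c * f x) (fun x => c * g x).
Proof.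
move=> W; have := WD_lin c W WD0.
by congr WD; apply: funext => x; rewrite addr0.
Qed.

Lemma WDD f g f' g' : WD f g -> WD f' g' ->
  WD (fun x => f x + f' x) (fun x => g x + g' x).
Proof.
move=> W W'; have := WD_lin 1 W W'.
by congr WD; apply: funext => x; rewrite mul1r.
Qed.

Lemma WDB f g f' g' : WD f g -> WD f' g' ->
  WD (fun x => f x - f' x) (fun x => g x - g' x).
Proof.
move=> W W'; have := WD_lin (-1) W' W.
by congr WD; apply: funext => x; rewrite mulN1r addrC.
Qed.

Lemma WDJ f g : WD f g -> WD (fun x => (f x)^*%C) (fun x => (g x)^*%C).
Proof.
move=> [fL gL /weakP[[fr fi] [gr gi] Hr Hi]].
split; [exact: L2J|exact: L2J|apply/weakP].
have fl := L2_locint (L2J fL); have gl := L2_locint (L2J gL).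
split => // phi tp.
  by under eq_Rintegral do rewrite reJ; under [in RHS]eq_Rintegral do rewrite reJ; exact: Hr.
under eq_Rintegral do rewrite imJ mulNr; under [in RHS]eq_Rintegral do rewrite imJ mulNr.
have [cp [cp' [dp [M [p0 p0']]]]] := test_C1 tp.
have [i1 _] := cpt_integ fi cp' p0'; have [i2 _] := cpt_integ gi cp p0.
by rewrite !intN// Hi.
Qed.

Lemma WD_uniq f g f' g' : WD f g -> WD f' g' -> Cae_eq f f' -> Cae_eq g g'.
Proof.
move=> W W' e; have [fL gL w] := W; have [fL' gL' w'] := W'.
have [_ _ w2] := WD_ae W' fL gL' (ae_eq_sym e) (@ae_eq_refl _ _ g').
exact: weak_uniq w w2.
Qed.

Lemma WD_lim (f g : nat -> R -> R[i]) F G : (forall n, WD (f n) (g n)) -> L2 F -> L2 G ->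
  L2lim f F -> L2lim g G -> WD F G.
Proof.
move=> W FL GL fF gG; have fL n : L2 (f n) by have [] := W n.
have gL n : L2 (g n) by have [] := W n.
apply/WDP => // phi c tp; have [t1 t2] := test_L2 c tp.
have l1 := L2lim_ip fL FL t2 fF; have l2 := L2lim_ip gL GL t1 gG.
have l2' : (fun n => ip (f n) (fun x => c * (derive1 phi x)%:C)) @ \oo -->
    - ip G (fun x => c * (phi x)%:C).
  rewrite (_ : (fun n => _) = fun n => - ip (g n) (fun x => c * (phi x)%:C)); first exact: cvgN.
  by apply: funext => n; move/WDP : (W n) => /(_ (fL n) (gL n)) ->.
exact: (cvg_unique _ l1 l2').
Qed.

Lemma H1P f : H1 f <-> exists g, WD f g.
Proof.
split=> [[fL [g gL w]]|[g [fL gL w]]]; first by exists g.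
by split => //; exists g.
Qed.

(** Chosen among the square integrable versions, so that [WD f (D f)] is immediate; [weak_uniq]
    identifies it almost everywhere with [weak_derivative]. *)
Definition D f : R -> R[i] := xget (fun=> 0) [set g | WD f g].

Lemma WD_D f : H1 f -> WD f (D f).
Proof. by move=> /H1P[g W]; exact: (xgetPex (fun=> 0) (ex_intro _ g W)). Qed.

Lemma WD_H1 f g : WD f g -> H1 f.
Proof. by move=> W; apply/H1P; exists g. Qed.

Lemma D_eq f g : WD f g -> Cae_eq (D f) g.
Proof.
by move=> W; apply: WD_uniq (WD_D (WD_H1 W)) W _; exact: ae_eq_refl.
Qed.

Lemma H1normE f g : WD f g -> H1norm f = (Num.sqrt (nr f ^+ 2 + nr g ^+ 2))%:E.
Proof.
move=> W; have [fL gL w] := W.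
rewrite /H1norm; case: asboolP => [_|]; last by case; exact: WD_H1 W.
have w' : is_weak_derivative f (weak_derivative f) := xgetPex (fun=> 0) (ex_intro _ g w).
have e := weak_uniq w w'.
have m' : Cmeasurable (weak_derivative f).
  by have [_ [[m1 _ _] [m2 _ _]] _] := w'.
have gL' := L2_ae gL m' e.
rewrite !L2normE// -(nr_ae (L2meas gL) m' e) !poweR_EFin !powR_mulrn ?nr_ge0//.
by rewrite powR12_sqrt// addr_ge0// sqr_ge0.
Qed.

End WeakH1.

(** * Derivatives and multiplication by $x$ under the Fourier transform; Agmon's inequality *)

Section FourierDerivative.
Context {R : realType}.
Local Notation mu := (@lebesgue_measure R).
Local Notation integ f := (mu.-integrable setT (EFin \o (f : R -> R))).
Local Notation re := (@complex.Re R).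
Local Notation im := (@complex.Im R).
Implicit Types (f g h F G : R -> R[i]) (u v p phi : R -> R) (c : R[i]).

Lemma supp_fourier (B : R) f : 0 <= B -> L2 f -> supp B f -> is_fourier f (ft f).
Proof.
move=> B0 fL fs; have [tL _] := ft_L2 B0 fL fs; split => //.
apply/L2limP => //; first by move=> n; have [] := trunc_L2 n fL.
move=> e e0; exists (Num.truncn B).+1 => n Bn.
rewrite trunc_ft -(_ : f = fun x => box n%:R x * f x).
  rewrite (_ : (fun x => _) = fun=> 0) ?nr0 ?(ltW e0)//.
  by apply: funext => x; rewrite subrr.
apply: box_supp; apply: suppW fs; apply/ltW.
by apply: lt_le_trans (truncnS_gt B) _; rewrite ler_nat.
Qed.

Lemma ft_real u (M xi : R) : continuous u -> (forall x, M < `|x| -> u x = 0) ->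
  ft (fun x => (u x)%:C) xi =
  (\int[mu]_x (cos (xi * x) * u x)) +i* (- \int[mu]_x (sin (xi * x) * u x)).
Proof.
move=> cu u0.
have cs : continuous (fun x : R => sin (xi * x)).
  move=> x; apply: continuous_comp; last exact: continuous_sin.
  by apply: cvgM; [exact: cvg_cst|exact: cvg_id].
have [i2 _] := cpt_integ (locint_cont cs) cu u0.
rewrite /ft /Cintegral; congr Complex.
  by apply: eq_Rintegral => x _; rewrite reM /= mul0r subr0 cosN mulrC [x * xi]mulrC.
rewrite -intN//; apply: eq_Rintegral => x _.
by rewrite imM /= mul0r addr0 sinN mulrN mulrC [x * xi]mulrC.
Qed.

Lemma ft_test phi (xi : R) : test_function phi ->
  ft (fun x => (derive1 phi x)%:C) xi = 'i%C * xi%:C * ft (fun x => (phi x)%:C) xi.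
Proof.
move=> tp; have [cp [cp' [dp [M [p0 p0']]]]] := test_C1 tp.
rewrite (ft_real xi cp' p0') (ft_real xi cp p0).
have lin (x : R) : is_derive x 1 (fun x : R => xi * x) xi.
  have := @is_deriveZ R _ _ id xi x 1 1 (is_derive_id _ _).
  by rewrite /GRing.scale /= mulr1.
have cl : continuous (fun x : R => xi * x).
  by move=> x; apply: cvgM; [exact: cvg_cst|exact: cvg_id].
have cs : continuous (fun x : R => sin (xi * x)).
  by move=> x; apply: continuous_comp; [exact: cl|exact: continuous_sin].
have cc : continuous (fun x : R => cos (xi * x)).
  by move=> x; apply: continuous_comp; [exact: cl|exact: continuous_cos].
have dc (x : R) : is_derive x 1 (fun x : R => cos (xi * x)) (- xi * sin (xi * x)).
  have := @is_derive1_comp R cos (fun x => xi * x) x _ _ (is_derive_cos _) (lin x).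
  by rewrite /GRing.scale /= => h; apply: (is_derive_eq h); rewrite !mulNr mulrC.
have ds (x : R) : is_derive x 1 (fun x : R => sin (xi * x)) (xi * cos (xi * x)).
  have := @is_derive1_comp R sin (fun x => xi * x) x _ _ (is_derive_sin _) (lin x).
  by rewrite /GRing.scale /= => h; apply: (is_derive_eq h); rewrite mulrC.
have k1 : continuous (fun x : R => - xi * sin (xi * x)).
  by move=> x; apply: cvgM; [exact: cvg_cst|exact: cs].
have k2 : continuous (fun x : R => xi * cos (xi * x)).
  by move=> x; apply: cvgM; [exact: cvg_cst|exact: cc].
rewrite (AC_wder (AC_C1 dc k1) tp) (AC_wder (AC_C1 ds k2) tp).
have [i1 _] := cpt_integ (locint_cont cc) cp p0.
have [i2 _] := cpt_integ (locint_cont cs) cp p0.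
have -> : \int[mu]_x (- xi * sin (xi * x) * phi x) = - xi * \int[mu]_x (sin (xi * x) * phi x).
  by rewrite -intZ//; apply: eq_Rintegral => x _; rewrite mulrA.
have -> : \int[mu]_x (xi * cos (xi * x) * phi x) = xi * \int[mu]_x (cos (xi * x) * phi x).
  by rewrite -intZ//; apply: eq_Rintegral => x _; rewrite mulrA.
by apply: complex_ext; rewrite !(reM, imM) /=; ring.
Qed.

Lemma fourier_test phi : test_function phi ->
  is_fourier (fun x => (phi x)%:C) (ft (fun x => (phi x)%:C)) /\
  is_fourier (fun x => (derive1 phi x)%:C)
             (fun xi => 'i%C * xi%:C * ft (fun x => (phi x)%:C) xi).
Proof.
move=> tp; have [cp [cp' [dp [M [p0 p0']]]]] := test_C1 tp.
have M0 : 0 <= Num.max M 0 by rewrite le_max lexx orbT.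
split.
  apply: (supp_fourier M0); first exact: cont_L2 cp p0.
  by move=> x h; rewrite p0//; apply: le_lt_trans h; rewrite le_max lexx.
have -> : (fun xi => 'i%C * xi%:C * ft (fun x => (phi x)%:C) xi) =
  ft (fun x => (derive1 phi x)%:C) by apply: funext => xi; rewrite ft_test.
apply: (supp_fourier M0); first exact: cont_L2 cp' p0'.
by move=> x h; rewrite p0'//; apply: le_lt_trans h; rewrite le_max lexx.
Qed.

Lemma fourier_WD f g fh gh : is_fourier f fh -> is_fourier g gh ->
  Cae_eq gh (fun xi => 'i%C * xi%:C * fh xi) -> WD f g.
Proof.
move=> Ff Fg E; have [fL fhL _] := Ff; have [gL ghL _] := Fg.
apply/WDP => // phi c tp; have [F1 F2] := fourier_test tp.
have {}F1 := fourierZ c F1; have {}F2 := fourierZ c F2.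
apply: (mulfI (lt0r_neq0 (@cF_gt0 R))).
rewrite mulrN -(fourier_ip Ff F2) -(fourier_ip Fg F1).
set k := ft _ in F1 F2 *; have [_ L1 _] := F1; have [_ L2' _] := F2.
have EL : L2 (fun xi => 'i%C * xi%:C * fh xi).
  apply: (L2_ae ghL _ E).
  apply: CmeasM; last exact: L2meas.
  by apply: CmeasM; [exact: Cmeas_cst|apply: Cmeas_real; exact: measurable_id].
rewrite (ip_ael (L2meas ghL) (L2meas EL) (L2meas L1) E) (ipM (fun xi => 'i%C * xi%:C)).
rewrite (_ : (fun xi => _^*%C * _) = fun xi => - (c * ('i%C * xi%:C * k xi))).
  by rewrite [in RHS]ipC ipNl// opprK ipC.
apply: funext => xi; rewrite (_ : ('i%C * xi%:C)^*%C = - ('i%C * xi%:C)); last first.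
  by apply: complex_ext; rewrite !reimE /=; ring.
by rewrite mulNr mulrCA.
Qed.

Lemma oneDix (x : R) : normc (1 + 'i%C * x%:C) ^+ 2 = 1 + x ^+ 2.
Proof. by rewrite normcE2 !reimE /=; ring. Qed.

Lemma oneDix_neq0 (x : R) : 1 + 'i%C * x%:C != 0.
Proof.
apply/eqP => h; have := oneDix x; rewrite h normc0 expr0n /= => /esym/eqP.
by rewrite gt_eqF// ltr_pwDl// sqr_ge0.
Qed.

Lemma ix_meas : Cmeasurable (fun x : R => 'i%C * x%:C).
Proof. by apply: CmeasM; [exact: Cmeas_cst|apply: Cmeas_real; exact: measurable_id]. Qed.

Lemma inv_meas : Cmeasurable (fun x : R => (1 + 'i%C * x%:C)^-1).
Proof.
have mV : measurable_fun setT (fun x : R => (1 + x ^+ 2)^-1).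
  by apply: continuous_measurable_fun; exact: (@continuous_oneDsqrV R).
rewrite (_ : (fun x => _) = fun x => (1 - 'i%C * x%:C) * ((1 + x ^+ 2)^-1)%:C).
  apply: CmeasM; last exact: Cmeas_real.
  by apply: CmeasB; [exact: Cmeas_cst|exact: ix_meas].
apply: funext => x; apply: (mulfI (oneDix_neq0 x)); rewrite divff ?oneDix_neq0// mulrA.
have n0 : 1 + x ^+ 2 != 0 by rewrite gt_eqF// ltr_pwDl// sqr_ge0.
apply: complex_ext; rewrite !reimE /=; last by ring.
by rewrite !(mul0r, mul1r, mulr0, addr0, add0r, subr0, sub0r, oppr0, mulrN, mulNr, opprK) -expr2 divff.
Qed.

(** On $[-n,0]$ the exponential is at least 1, so the square integral is at least $C^2n$ for every
    $n$. *)
Lemma exp_not_L2 (m : R -> R) (C : R) : integ (fun x => m x ^+ 2) ->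
  {ae mu, forall x, m x = C * expR (- x)} -> C = 0.
Proof.
move=> mi E; apply/eqP; apply: contrapT => /negP C0.
have C2 : 0 < C ^+ 2 by rewrite exprn_even_gt0.
have bnd (n : nat) : C ^+ 2 * n%:R <= \int[mu]_x (m x ^+ 2).
  have i1 : integ (cst (C ^+ 2) \_ `[(- n%:R : R), 0]).
    apply/(integ_indic (cst (C ^+ 2)) (measurable_itv _)); apply: (@locint_cont R (cst (C ^+ 2))) => x; exact: cvg_cst.
  have -> : C ^+ 2 * n%:R = \int[mu]_x (cst (C ^+ 2) \_ `[(- n%:R : R), 0]) x.
    by rewrite -Rintegral_mkcond intab_cst ?sub0r ?opprK// oppr_le0.
  apply: int_le_ae => //; apply: (aeS E) => x ->; rewrite patchE mem_setE in_itv /=.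
  case: ifP => [/andP[_ x0]|_]; last exact: sqr_ge0.
  rewrite exprMn ler_peMr ?(ltW C2)// exprn_ege1// -(expR0 R) ler_expR; lra.
pose I := \int[mu]_x (m x ^+ 2); have I0 : 0 <= I / C ^+ 2.
  by rewrite divr_ge0 ?(ltW C2)// int_ge0// => x; exact: sqr_ge0.
have := bnd (Num.truncn (I / C ^+ 2)).+1; rewrite leNgt -/I.
by rewrite -ltr_pdivrMl// mulrC truncnS_gt.
Qed.

Lemma AC_exp (m p : R -> R) : AC m p -> {ae mu, forall x, p x = - m x} ->
  exists C, forall x, m x = C * expR (- x).
Proof.
move=> A E; have [cm pi H] := A.
have dE (x : R) : is_derive x 1 expR (expR x) by exact: is_derive_expR.
have [cq qi Hq] := AC_mul A (AC_C1 dE (@continuous_expR R)).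
exists (m 0) => x; apply: (mulIf (lt0r_neq0 (expR_gt0 x))).
rewrite -mulrA -expRD addNr expR0 mulr1.
have : AC (fun x => m x * expR x) (fun=> 0).
  split => //; first by apply: locint_cont => y; exact: cvg_cst.
  move=> a b ab; rewrite Hq// intab_cst// mul0r.
  rewrite (_ : \int[mu]_(x in _) _ = \int[mu]_(x in `[a, b]) 0); first by rewrite intab_cst// mul0r.
  congr fine; apply: ae_eq_integral => //.
  - by have /measurable_int := qi a b.
  - by apply: (aeS E) => y -> _ /=; rewrite mulrN mulrC addNr.
by move=> /AC_zero/(_ x 0) ->; rewrite expR0 mulr1.
Qed.

(* Without reference to distributions, [FT f'] is identified with [i xi FT f] by showing that
   an [L^2] function with [m' = - m] is zero. *)
Lemma WD_neg (m : R -> R[i]) : WD m (fun x => - m x) -> Cae_eq m (fun=> 0).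
Proof.
move=> W; have [mL _ _] := W; have [M [[Ar Ai] e]] := WD_rep W.
have [mm mi] := (L2P m).1 mL.
have mi1 : integ (fun x => re (m x) ^+ 2).
  apply: integ_le mi; first by apply: measurable_funX; have [] := mm.
  by move=> x; rewrite ger0_norm ?sqr_ge0// normcE2 lerDl sqr_ge0.
have mi2 : integ (fun x => im (m x) ^+ 2).
  apply: integ_le mi; first by apply: measurable_funX; have [] := mm.
  by move=> x; rewrite ger0_norm ?sqr_ge0// normcE2 lerDr sqr_ge0.
have [|C1 H1] := AC_exp Ar; first by apply: (aeS e) => x <-; rewrite reN.
have [|C2 H2] := AC_exp Ai; first by apply: (aeS e) => x <-; rewrite imN.
have c1 : C1 = 0 by apply: (exp_not_L2 mi1); apply: (aeS e) => x ->.
have c2 : C2 = 0 by apply: (exp_not_L2 mi2); apply: (aeS e) => x ->.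
apply: (aeS e) => x ->; apply: complex_ext => /=; first by rewrite H1 c1 mul0r.
by rewrite H2 c2 mul0r.
Qed.

(** Dividing $\hat f+\hat g$ by $1+i\xi$ produces $k$ with derivative $j$ and $k+j=f+g$. The
    difference $f-k$ then satisfies $m'=-m$ and vanishes by [WD_neg], which gives $g=j$ as well. *)
Lemma WD_fourier f g : WD f g -> Cae_eq (FT g) (fun xi => 'i%C * xi%:C * FT f xi).
Proof.
move=> W; have [fL gL _] := W; have Ff := FTP fL; have Fg := FTP gL.
have hL := L2D (FT_L2 fL) (FT_L2 gL).
pose kh xi := (1 + 'i%C * xi%:C)^-1 * (FT f xi + FT g xi).
have n1 (x : R) : 1 <= normc (1 + 'i%C * x%:C).
  by rewrite -(@ler_pXn2r _ 2)// ?nnegrE// oneDix expr1n lerDl sqr_ge0.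
have nx (x : R) : normc ('i%C * x%:C) <= normc (1 + 'i%C * x%:C).
  rewrite -(@ler_pXn2r _ 2)// ?nnegrE// oneDix normcM normc_i mul1r normcR.
  by rewrite real_normK ?num_real// lerDr.
have VI (x : R) : normc ((1 + 'i%C * x%:C)^-1) = (normc (1 + 'i%C * x%:C))^-1.
  have n0 : normc (1 + 'i%C * x%:C) != 0 by rewrite gt_eqF// (lt_le_trans ltr01).
  by apply: (mulfI n0); rewrite -normcM !divff ?oneDix_neq0 ?normc1.
have khL : L2 kh.
  apply: (@L2M_bnd _ 1) => //; first exact: inv_meas.
  by move=> x; rewrite VI invf_le1// (lt_le_trans ltr01).
have ikhL : L2 (fun xi => 'i%C * xi%:C * kh xi).
  rewrite (_ : (fun xi => _) = fun xi : R => ('i%C * xi%:C * (1 + 'i%C * xi%:C)^-1) * (FT f xi + FT g xi)).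
    apply: (@L2M_bnd _ 1) => //; first by apply: CmeasM; [exact: ix_meas|exact: inv_meas].
    move=> x; rewrite normcM VI ler_pdivrMr ?mul1r; first exact: nx.
    by rewrite (lt_le_trans ltr01).
  by apply: funext => x; rewrite /kh mulrA.
have [k Fk] := fourier_surj khL; have [j Fj] := fourier_surj ikhL.
have Wk : WD k j := fourier_WD Fk Fj (@ae_eq_refl _ _ _).
have [kL jL _] := Wk.
have E : Cae_eq (fun x => k x + j x) (fun x => f x + g x).
  apply: fourier_inj (fourierD Fk Fj) (fourierD Ff Fg) _; apply: aeT => x.
  by rewrite /kh -{1}[_^-1 * _]mul1r -mulrDl mulrA divff ?mul1r ?oneDix_neq0.
have Wm := WDB W Wk.
have e0 : Cae_eq (fun x => f x - k x) (fun=> 0).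
  apply: WD_neg; apply: WD_ae Wm _ _ _ _.
  - exact: L2B.
  - by apply: L2N; exact: L2B.
  - exact: ae_eq_refl.
  - apply: (aeS E) => x h; apply/eqP; rewrite -subr_eq0 opprK; apply/eqP.
    by rewrite addrACA -opprD [g x + _]addrC [j x + _]addrC h subrr.
have efk : Cae_eq f k by apply: (aeS e0) => x /eqP; rewrite subr_eq0 => /eqP.
have egj : Cae_eq g j by apply: (aeS2 efk E) => x -> /addrI.
have h1 := fourier_uniq Ff Fk efk; have h2 := fourier_uniq Fg Fj egj.
by apply: (aeS2 h1 h2) => x -> ->.
Qed.

(** Inversion exchanges the two sides of the transform, so this is the derivative rule [fourier_WD]
    read after conjugation. *)
Lemma fourier_xmul f g : is_fourier f g -> L2 (fun x => x%:C * f x) ->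
  WD g (FT (fun x => - 'i%C * (x%:C * f x))).
Proof.
move=> Ffg xfL; have Fh := FTP (L2Z (- 'i%C) xfL); set h := FT _ in Fh *.
have I1 := fourier_inv Ffg; have I2 := fourier_inv Fh.
have JJ (k : R -> R[i]) : (fun x => (k x)^*%C^*%C) = k.
  by apply: funext => x; rewrite conjcK.
rewrite -(JJ g) -(JJ h); apply: WDJ; apply: fourier_WD I1 I2 _; apply: aeT => x.
by apply: complex_ext; rewrite !reimE /=; ring.
Qed.

Lemma WD_xmul f g h : is_fourier f g -> WD g h ->
  L2 (fun x => x%:C * f x) /\ is_fourier (fun x => - 'i%C * (x%:C * f x)) h.
Proof.
move=> Ffg W; have [fL gL _] := Ffg; have [_ hL _] := W.
have I1 := fourier_inv Ffg; have WJ := WDJ W.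
have E1 := WD_fourier WJ; have e2 := fourier_FT I1.
have c0 := lt0r_neq0 (@cF_gt0 R).
have [k Fk] := fourier_surj hL; have [kL _ _] := Fk.
have I2 := fourier_FT (fourier_inv Fk).
have E : Cae_eq k (fun x => - 'i%C * (x%:C * f x)).
  have c0C : cF%:C != 0 :> R[i] by apply/eqP => -[/eqP]; exact/negP.
  apply: (aeS2 (ae_eq_trans (ae_eq_sym E1) I2) e2) => x h1 h2.
  apply: (can_inj (@conjcK R)); apply: (mulfI c0C); rewrite -h1 h2.
  by apply: complex_ext; rewrite !reimE /=; ring.
have xfL : L2 (fun x => x%:C * f x).
  have mx : Cmeasurable (fun x => x%:C * f x).
    by apply: CmeasM; [apply: Cmeas_real; exact: measurable_id|exact: L2meas].
  apply: (L2_ae (L2Z 'i%C kL) mx); apply: (aeS E) => x ->.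
  by apply: complex_ext; rewrite !reimE /=; ring.
split => //; apply: (fourier_ae Fk) => //; [exact: L2Z|exact: ae_eq_refl].
Qed.

Lemma cis_sq_AC (k : R) : let s x := sin (k * x ^+ 2) in let c x := cos (k * x ^+ 2) in
  AC c (fun x => - (2 * k * x) * s x) /\ AC s (fun x => 2 * k * x * c x).
Proof.
move=> s c.
have dq (x : R) : is_derive x 1 (fun x : R => k * x ^+ 2) (2 * k * x).
  have h2 : is_derive x 1 (fun x : R => x * x) (x * 1 + x * 1).
    by apply: is_deriveM.
  have h := @is_deriveZ R _ _ (fun x : R => x * x) k x 1 _ h2.
  apply: (is_derive_eq h); rewrite /GRing.scale /=; ring.
have cq : continuous (fun x : R => k * x ^+ 2).
  by move=> x; apply: cvgM; [exact: cvg_cst|exact: exprn_continuous].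
have cs : continuous s.
  by move=> x; apply: continuous_comp; [exact: cq|exact: continuous_sin].
have cc : continuous c.
  by move=> x; apply: continuous_comp; [exact: cq|exact: continuous_cos].
have cl : continuous (fun x : R => 2 * k * x).
  by move=> x; apply: cvgM; [exact: cvg_cst|exact: cvg_id].
split; apply: AC_C1.
- move=> x; have h := @is_derive1_comp R cos (fun x => k * x ^+ 2) x _ _ (is_derive_cos _) (dq x).
  by apply: (is_derive_eq h); rewrite /GRing.scale /= mulrC mulrN mulNr.
- by move=> x; apply: cvgM; [apply: cvgN; exact: cl|exact: cs].
- move=> x; have h := @is_derive1_comp R sin (fun x => k * x ^+ 2) x _ _ (is_derive_sin _) (dq x).
  by apply: (is_derive_eq h); rewrite /GRing.scale /= mulrC.
- by move=> x; apply: cvgM; [exact: cl|exact: cc].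
Qed.

Lemma meas_sq (k : R) : measurable_fun setT (fun x : R => k * x ^+ 2).
Proof. by apply: measurable_funM; [exact: measurable_cst|exact: measurable_funX]. Qed.

Lemma WD_chirp (k : R) f g : WD f g -> L2 (fun x => (k * x)%:C * f x) ->
  WD (fun x => cis (k * x ^+ 2) * f x)
     (fun x => cis (k * x ^+ 2) * (g x + 'i%C * (2 * (k * x))%:C * f x)).
Proof.
move=> W xL; have [fL gL _] := W; have [F [[Ar Ai] e]] := WD_rep W.
have [Ac As] := cis_sq_AC k.
have GL : L2 (fun x => cis (k * x ^+ 2) * (g x + 'i%C * (2 * (k * x))%:C * f x)).
  apply: (L2cis (meas_sq k)); apply: L2D => //.
  have := L2Z ('i%C * 2%:C) xL; congr L2; apply: funext => x.
  by apply: complex_ext; rewrite !reimE /=; ring.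
have kL := L2cis (meas_sq k) fL.
(* The density for [cAC] has to be written with the continuous representative [F]; it is replaced by
   the version with [f] only up to a null set. *)
pose H x := cis (k * x ^+ 2) * (g x + 'i%C * (2 * (k * x))%:C * F x).
have eH : Cae_eq H (fun x => cis (k * x ^+ 2) * (g x + 'i%C * (2 * (k * x))%:C * f x)).
  by apply: (aeS e) => x ->.
have HL : L2 H.
  apply: (L2_ae GL _ (ae_eq_sym eH)).
  have cF : Cmeasurable F.
    by have [c1 _ _] := Ar; have [c2 _ _] := Ai; split; exact: continuous_measurable_fun.
  apply: CmeasM; first by apply: Cmeas_cis; exact: meas_sq.
  apply: CmeasD; first exact: L2meas.
  apply: CmeasM => //; apply: CmeasM; first exact: Cmeas_cst.
  apply: Cmeas_real; apply: measurable_funM; first exact: measurable_cst.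
  by apply: measurable_funM; [exact: measurable_cst|exact: measurable_id].
apply: (@WD_ae _ _ H) => //; last exact: ae_eq_refl.
apply: (@rep_WD _ _ _ (fun x => cis (k * x ^+ 2) * F x)) => //; last first.
  by apply: (aeS e) => x ->.
split.
- have := ACD (AC_mul Ac Ar) (ACZ (-1) (AC_mul As Ai)).
  by congr AC; apply: funext => x; rewrite !reimE /=; ring.
- have := ACD (AC_mul Ac Ai) (AC_mul As Ar).
  by congr AC; apply: funext => x; rewrite !reimE /=; ring.
Qed.

(** The oscillation of $|F|^2$ between any two points is at most $2\int|F||g|\le2|f||g|$. If the
    bound failed at some $x$, then $|F|^2$ would stay above a positive constant on the whole line,
    contrary to $F\in L^2$. *)
Lemma sobolev f g F : WD f g -> cAC F g -> Cae_eq f F ->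
  forall x, normc (F x) ^+ 2 <= 2 * (nr f * nr g).
Proof.
move=> W [Ar Ai] e x; have [fL gL _] := W.
have A2 := ACD (AC_mul Ar Ar) (AC_mul Ai Ai).
have cF : Cmeasurable F.
  by have [c1 _ _] := Ar; have [c2 _ _] := Ai; split; exact: continuous_measurable_fun.
have FL := L2_ae fL cF e.
have nF : nr F = nr f by apply/esym/nr_ae => //; exact: L2meas.
set q := (X in AC _ X) in A2; have [_ qi Hq] := A2.
pose w y := 2 * (normc (F y) * normc (g y)).
have wi : integ w by apply: integZ; exact: ip_integ_prod.
have qw y : `|q y| <= w y.
  have := reim_le (F y) (g y); rewrite /q /w => h.
  rewrite [X in `|X|](_ : _ = 2 * (re (F y) * re (g y) + im (F y) * im (g y))); last by ring.
  by rewrite normrM ger0_norm// ler_wpM2l.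
have Iw : \int[mu]_y w y <= 2 * (nr f * nr g).
  rewrite /w intZ; last exact: ip_integ_prod.
  by rewrite ler_wpM2l// -nF; exact: int_prod_le.
have w0 y : 0 <= w y by rewrite /w !mulr_ge0.
have sub (a b : R) : \int[mu]_(y in `[a, b]) w y <= \int[mu]_y w y.
  rewrite Rintegral_mkcond; apply: int_le => //.
    by apply/(integ_indic w (measurable_itv _)); exact: locint_integ wi a b.
  by move=> y; rewrite patchE; case: ifP => // _; rewrite w0.
have key a b : a <= b -> `|normc (F b) ^+ 2 - normc (F a) ^+ 2| <= 2 * (nr f * nr g).
  move=> ab; have := Hq a b ab; rewrite -!expr2 -!normcE2 => ->.
  apply: le_trans (intab_norm a b qi) _; apply: le_trans Iw; apply: le_trans (sub a b).
  by apply: intab_le; [exact: locint_norm|exact: locint_integ|move=> y _; exact: qw].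
set K := 2 * _ in key *; rewrite leNgt; apply/negP => h.
pose d := normc (F x) ^+ 2 - K; have d0 : 0 < d by rewrite subr_gt0.
have lb y : d <= normc (F y) ^+ 2.
  have [xy|/ltW yx] := leP x y.
    by have := key _ _ xy; rewrite /d ler_norml => /andP[]; lra.
  by have := key _ _ yx; rewrite /d ler_norml => /andP[_]; lra.
pose I := \int[mu]_y (normc (F y) ^+ 2).
have bnd (n : nat) : d * n%:R <= I.
  have i1 : integ (cst d \_ `[(0 : R), n%:R]).
    apply/(integ_indic (cst d) (measurable_itv _)); apply: (@locint_cont R (cst d)) => y; exact: cvg_cst.
  have -> : d * n%:R = \int[mu]_y (cst d \_ `[(0 : R), n%:R]) y.
    by rewrite -Rintegral_mkcond intab_cst ?subr0.
  apply: int_le => //; first exact: L2integ.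
  by move=> y; rewrite patchE; case: ifP => _ //; exact: sqr_ge0.
have I0 : 0 <= I / d by rewrite divr_ge0 ?(ltW d0)// int_ge0// => y; exact: sqr_ge0.
have := bnd (Num.truncn (I / d)).+1; rewrite leNgt.
by rewrite -ltr_pdivrMl// mulrC truncnS_gt.
Qed.

End FourierDerivative.

(** * The Schroedinger group on weighted H^1 *)

Section SchrodingerH1.
Context {R : realType}.
Local Notation mu := (@lebesgue_measure R).
Implicit Types (f g h F G : R -> R[i]) (c : R[i]) (b s t : R).

Lemma S_WD t f g : WD f g -> WD (schrodinger t f) (schrodinger t g).
Proof.
move=> W; have [fL gL _] := W.
apply: (fourier_WD (S_spec t fL) (S_spec t gL)).
by apply: (aeS (WD_fourier W)) => xi ->; rewrite mulrCA.
Qed.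

Lemma x_meas b f : Cmeasurable f -> Cmeasurable (fun x => (b * x)%:C * f x).
Proof.
move=> fm; apply: CmeasM => //; apply: Cmeas_real.
by apply: measurable_funM; [exact: measurable_cst|exact: measurable_id].
Qed.

(** On the Fourier side multiplication by $x$ is $i\,d/d\xi$. Differentiating the multiplier
    $e^{-it\xi^2}$ brings down $-2it\xi$, and $\xi\hat f$ is $-i$ times the transform of $f'$. *)
Lemma S_x t f g : WD f g -> L2 (fun x => x%:C * f x) ->
  L2 (fun x => x%:C * schrodinger t f x) /\
  Cae_eq (fun x => x%:C * schrodinger t f x)
    (fun x => schrodinger t (fun x => x%:C * f x) x -
              ('i%C * (2 * t)%:C) * schrodinger t g x).
Proof.
move=> W xL; have [fL gL _] := W; have Ff := FTP fL; have fhL := FT_L2 fL.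
have W1 := fourier_xmul Ff xL.
have L1 : L2 (fun xi => (- t * xi)%:C * FT f xi).
  have mx := x_meas (- t) (L2meas fhL).
  apply: (L2_ae (L2Z ('i%C * t%:C) (FT_L2 gL)) mx).
  by apply: (aeS (WD_fourier W)) => xi ->; apply: complex_ext; rewrite !reimE /=; ring.
have W2 := WD_chirp W1 L1.
have FS : is_fourier (schrodinger t f) (fun xi => cis (- t * xi ^+ 2) * FT f xi).
  by have := S_spec t fL; congr is_fourier; apply: funext => xi; rewrite mulNr.
have [xSL F1] := WD_xmul FS W2; split => //.
have F2 := fourierB (fourierZ (- 'i%C) (S_spec t xL)) (fourierZ (2 * t)%:C (S_spec t gL)).
have e1 := fourier_uniq (FTP (L2Z (- 'i%C) xL)) (fourierZ (- 'i%C) (FTP xL)) (@ae_eq_refl _ _ _).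
have E := fourier_inj F1 F2 _.
have alg (c p q : R[i]) (xi : R) :
    c * (- 'i%C * p + 'i%C * (2 * (- t * xi))%:C * q) =
    - 'i%C * (c * p) - (2 * t)%:C * (c * ('i%C * xi%:C * q)).
  case: c => c1 c2; case: p => p1 p2; case: q => q1 q2.
  by apply: complex_ext; rewrite !reimE /=; ring.
have alg2 (p q : R[i]) :
    - 'i%C * p - (2 * t)%:C * q = - 'i%C * (p - ('i%C * (2 * t)%:C) * q).
  case: p => p1 p2; case: q => q1 q2.
  by apply: complex_ext; rewrite !reimE /=; ring.
have {}E : Cae_eq (fun x => - 'i%C * (x%:C * schrodinger t f x))
   (fun x => - 'i%C * schrodinger t (fun x0 => x0%:C * f x0) x - (2 * t)%:C * schrodinger t g x).
  apply: E; apply: (aeS2 e1 (WD_fourier W)) => xi -> ->; rewrite mulNr; exact: alg.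
apply: (aeS E) => x h.
have i0 : - 'i%C != 0 :> R[i] by rewrite oppr_eq0; apply/eqP => -[/eqP]; rewrite oner_eq0.
by apply: (mulfI i0); rewrite h alg2.
Qed.

(** The weight is [b * x] rather than [x] so that [b = 0] gives plain $H^1$; that case is separated
    because $xf\in L^2$ can be recovered only by dividing by [b]. *)
Lemma S_bx b t f g : WD f g -> L2 (fun x => (b * x)%:C * f x) ->
  L2 (fun x => (b * x)%:C * schrodinger t f x) /\
  Cae_eq (fun x => (b * x)%:C * schrodinger t f x)
    (fun x => schrodinger t (fun x => (b * x)%:C * f x) x -
              ('i%C * (2 * (b * t))%:C) * schrodinger t g x).
Proof.
move=> W bL; have [fL gL _] := W; have SL := S_L2 t fL.
have [b0|b0] := eqVneq b 0.
  subst b.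
  have z h : (fun x => (0 * x)%:C * h x) = fun=> 0 :> R[i].
    by apply: funext => x; rewrite mul0r mul0r.
  rewrite !z; split; first exact: L2_0.
  have := S_Z t 0 (@L2_0 R); rewrite (_ : (fun x : R => 0 * 0) = fun=> 0); last first.
    by apply: funext => x; rewrite mulr0.
  by move=> h; apply: (aeS h) => x ->; rewrite !mul0r mulr0 mulr0 mul0r subr0.
have xL : L2 (fun x => x%:C * f x).
  have := L2Z (b^-1)%:C bL; congr L2; apply: funext => x.
  by rewrite mulrA -rmorphM mulrA mulVf// mul1r.
have [xSL E] := S_x t W xL.
have q h : (fun x => (b * x)%:C * h x) = fun x => b%:C * (x%:C * h x).
  by apply: funext => x; rewrite rmorphM mulrA.
rewrite !q; split; first exact: L2Z.
have alg (p r : R[i]) :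
    b%:C * (p - 'i%C * (2 * t)%:C * r) = b%:C * p - 'i%C * (2 * (b * t))%:C * r.
  case: p => p1 p2; case: r => r1 r2.
  by apply: complex_ext; rewrite !reimE /=; ring.
by apply: (aeS2 E (S_Z t b%:C xL)) => x -> ->; exact: alg.
Qed.

(* [J] is conjugate to [d/dx] under [e^(i b x^2 / 4)], and [e^(i kap t x^2)] is the phase for
   which it is conjugate to [(1 + b t) d/dx] after the flow [e^(it d_x^2)].  [P b] is the
   domain of the norm [nu b]; the norm [wn b] is equivalent to it for fixed [b], and is
   handier when uniformity in [b] does not matter. *)
Definition P b f := H1 f /\ L2 (fun x => (b * x)%:C * f x).
Definition J b f x := D f x - 'i%C * (2^-1)%:C * ((b * x)%:C * f x).
Definition nu b f := nr f + nr (J b f) + (1 + b)^-1 * nr (D f).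
Definition kap b t := - b / (4 * (1 + b * t)).
Definition wn b f := nr f + nr (D f) + nr (fun x => (b * x)%:C * f x).

Lemma P_L2 b f : P b f -> L2 f. Proof. by case => -[]. Qed.
Lemma P_D b f : P b f -> WD f (D f). Proof. by case => /WD_D. Qed.
Lemma D_L2 f : H1 f -> L2 (D f). Proof. by move=> /WD_D[]. Qed.
Lemma P_DL2 b f : P b f -> L2 (D f). Proof. by case => /D_L2. Qed.
Lemma P_xL2 b f : P b f -> L2 (fun x => (b * x)%:C * f x). Proof. by case. Qed.

Lemma J_L2 b f : P b f -> L2 (J b f).
Proof. by move=> [/D_L2 ? ?]; apply: L2B => //; exact: L2Z. Qed.

Lemma P0 f : P 0 f <-> H1 f.
Proof.
split=> [[]//|Hf]; split => //.
rewrite (_ : (fun x => _) = fun=> 0); first exact: L2_0.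
by apply: funext => x; rewrite mul0r mul0r.
Qed.

Lemma D_ae f g : H1 f -> Cae_eq f g -> L2 g -> Cae_eq (D g) (D f) /\ H1 g.
Proof.
move=> Hf e gL; have W := WD_D Hf; have [fL DL _] := W.
have W' := WD_ae W gL DL e (@ae_eq_refl _ _ _).
by split; [exact: D_eq|exact: WD_H1 W'].
Qed.

Lemma P_ae b f g : P b f -> Cae_eq f g -> L2 g -> P b g.
Proof.
move=> [Hf xL] e gL; have [_ Hg] := D_ae Hf e gL; split => //.
by apply: (L2_ae xL (x_meas b (L2meas gL))); apply: (aeS e) => x ->.
Qed.

Lemma J_ae b f g : P b f -> Cae_eq f g -> L2 g -> Cae_eq (J b g) (J b f).
Proof.
move=> [Hf xL] e gL; have [e' _] := D_ae Hf e gL.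
by apply: (aeS2 e e') => x; rewrite /J => -> ->.
Qed.

Lemma nu_ae b f g : P b f -> Cae_eq f g -> L2 g -> nu b g = nu b f.
Proof.
move=> Pf e gL; have Pg := P_ae Pf e gL; have [e' Hg] := D_ae Pf.1 e gL.
have eJ := J_ae Pf e gL.
rewrite /nu (nr_ae (L2meas gL) (L2meas (P_L2 Pf)) (ae_eq_sym e)).
rewrite (nr_ae (L2meas (J_L2 Pg)) (L2meas (J_L2 Pf)) eJ).
by rewrite (nr_ae (L2meas (P_DL2 Pg)) (L2meas (P_DL2 Pf)) e').
Qed.

Lemma P_lin b c f g : P b f -> P b g -> P b (fun x => c * f x + g x).
Proof.
move=> Pf Pg; split.
  by apply: (@WD_H1 _ _ (fun x => c * D f x + D g x)); apply: WD_lin; [exact: P_D Pf|exact: P_D Pg].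
have := L2D (L2Z c (P_xL2 Pf)) (P_xL2 Pg); congr L2; apply: funext => x.
by rewrite mulrDr [X in _ = X + _]mulrCA.
Qed.

Lemma P_zero b : P b (fun=> 0).
Proof.
split; first by apply: WD_H1; exact: WD0.
rewrite (_ : (fun x => _) = fun=> 0); first exact: L2_0.
by apply: funext => x; rewrite mulr0.
Qed.

Lemma PZ b c f : P b f -> P b (fun x => c * f x).
Proof.
move=> Pf; have := P_lin c Pf (P_zero b).
by congr P; apply: funext => x; rewrite addr0.
Qed.

Lemma PD b f g : P b f -> P b g -> P b (fun x => f x + g x).
Proof.
move=> Pf Pg; have := P_lin 1 Pf Pg.
by congr P; apply: funext => x; rewrite mul1r.
Qed.

Lemma PB b f g : P b f -> P b g -> P b (fun x => f x - g x).
Proof.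
move=> Pf Pg; have := P_lin (-1) Pg Pf.
by congr P; apply: funext => x; rewrite mulN1r addrC.
Qed.

Lemma D_Z c f : H1 f -> Cae_eq (D (fun x => c * f x)) (fun x => c * D f x).
Proof. by move=> /WD_D Wf; apply: D_eq; exact: WDZ. Qed.

Lemma D_B f g : H1 f -> H1 g ->
  Cae_eq (D (fun x => f x - g x)) (fun x => D f x - D g x).
Proof. by move=> /WD_D Wf /WD_D Wg; apply: D_eq; exact: WDB. Qed.

Lemma D_D f g : H1 f -> H1 g ->
  Cae_eq (D (fun x => f x + g x)) (fun x => D f x + D g x).
Proof. by move=> /WD_D Wf /WD_D Wg; apply: D_eq; exact: WDD. Qed.

Lemma nr_aeL f g : L2 f -> L2 g -> Cae_eq f g -> nr f = nr g.
Proof. by move=> fL gL; apply: nr_ae; exact: L2meas. Qed.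

Lemma nr_ae_le f g (r : R) : L2 f -> L2 g -> Cae_eq f g -> nr g <= r -> nr f <= r.
Proof. by move=> fL gL /(nr_aeL fL gL) ->. Qed.

Lemma nuZ b c f : P b f -> nu b (fun x => c * f x) = normc c * nu b f.
Proof.
move=> Pf; have PZf := PZ c Pf; have e := D_Z c Pf.1.
have eJ : Cae_eq (J b (fun x => c * f x)) (fun x => c * J b f x).
  apply: (aeS e) => x; rewrite /J => ->.
  by rewrite mulrBr; congr (_ - _); rewrite (mulrCA c); congr (_ * _); rewrite mulrCA.
rewrite /nu (nr_aeL (J_L2 PZf) (L2Z c (J_L2 Pf)) eJ).
rewrite (nr_aeL (P_DL2 PZf) (L2Z c (P_DL2 Pf)) e).
rewrite !nrZ; [|exact: P_DL2 Pf|exact: J_L2 Pf|exact: P_L2 Pf].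
by rewrite !mulrDr mulrCA.
Qed.

Lemma nu_ge0 b f : 0 <= b -> 0 <= nu b f.
Proof. by move=> b0; rewrite /nu !addr_ge0 ?nr_ge0// mulr_ge0 ?nr_ge0// invr_ge0 addr_ge0. Qed.

Lemma nuD b f g : 0 <= b -> P b f -> P b g -> nu b (fun x => f x + g x) <= nu b f + nu b g.
Proof.
move=> b0 Pf Pg; have Pfg := PD Pf Pg; have e := D_D Pf.1 Pg.1.
have eJ : Cae_eq (J b (fun x => f x + g x)) (fun x => J b f x + J b g x).
  apply: (aeS e) => x; rewrite /J => ->.
  by rewrite addrACA -opprD -mulrDr -[in RHS]mulrDr.
rewrite /nu (nr_aeL (J_L2 Pfg) (L2D (J_L2 Pf) (J_L2 Pg)) eJ).
rewrite (nr_aeL (P_DL2 Pfg) (L2D (P_DL2 Pf) (P_DL2 Pg)) e).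
rewrite addrACA [X in _ <= X + _]addrACA -mulrDr; apply: lerD; first apply: lerD.
- exact: nrD (P_L2 Pf) (P_L2 Pg).
- exact: nrD (J_L2 Pf) (J_L2 Pg).
- apply: ler_wpM2l; first by rewrite invr_ge0 addr_ge0.
  exact: nrD (P_DL2 Pf) (P_DL2 Pg).
Qed.

Lemma nuN b f : P b f -> nu b (fun x => - f x) = nu b f.
Proof.
move=> Pf; have := nuZ (-1) Pf; rewrite normcN normc1 mul1r => <-.
by congr nu; apply: funext => x; rewrite mulN1r.
Qed.

Lemma nuB b f g : 0 <= b -> P b f -> P b g -> nu b (fun x => f x - g x) <= nu b f + nu b g.
Proof.
move=> b0 Pf Pg; rewrite -(nuN Pg); apply: nuD => //.
by have := PZ (-1) Pg; congr P; apply: funext => x; rewrite mulN1r.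
Qed.

Lemma nuB_sym b f g : P b f -> P b g -> nu b (fun x => f x - g x) = nu b (fun x => g x - f x).
Proof.
move=> Pf Pg; rewrite -(nuN (PB Pf Pg)).
by congr nu; apply: funext => x; rewrite opprB.
Qed.

Lemma nuB_trans b f g h : 0 <= b -> P b f -> P b g -> P b h ->
  nu b (fun x => f x - h x) <= nu b (fun x => f x - g x) + nu b (fun x => g x - h x).
Proof.
move=> b0 Pf Pg Ph; have := nuD b0 (PB Pf Pg) (PB Pg Ph).
by rewrite (_ : (fun x => _ + _) = fun x => f x - h x)//; apply: funext => x; rewrite addrA subrK.
Qed.

Lemma nu0 b : nu b (fun=> 0) = 0.
Proof.
by have := nuZ 0 (P_zero b); rewrite normc0 !mul0r.
Qed.

Lemma nr_nu b f : 0 <= b -> [/\ nr f <= nu b f, nr (J b f) <= nu b f &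
  nr (D f) <= (1 + b) * nu b f].
Proof.
move=> b0; have b1 : 0 < 1 + b by rewrite ltr_pwDl.
have d0 : 0 <= (1 + b)^-1 * nr (D f) by rewrite mulr_ge0 ?nr_ge0// invr_ge0 ltW.
have n1 := nr_ge0 f; have n2 := nr_ge0 (J b f).
split; rewrite /nu; [lra|lra|].
by rewrite -ler_pdivrMl//; lra.
Qed.

Lemma nu_eq0 b f : 0 <= b -> P b f -> nu b f = 0 -> Cae_eq f (fun=> 0).
Proof.
move=> b0 Pf n0; apply: nr_eq0; first exact: P_L2 Pf.
by apply/eqP; rewrite eq_le nr_ge0 andbT -n0; have [] := nr_nu f b0.
Qed.

Lemma nuB_eq0 b f g : 0 <= b -> P b f -> P b g -> nu b (fun x => f x - g x) = 0 -> Cae_eq f g.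
Proof.
move=> b0 Pf Pg /(nu_eq0 b0 (PB Pf Pg)) h.
by apply: (aeS h) => x /eqP; rewrite subr_eq0 => /eqP.
Qed.

Lemma nr_x b f : P b f -> nr (fun x => (b * x)%:C * f x) <= 2 * (nr (D f) + nr (J b f)).
Proof.
move=> Pf; have DL := P_DL2 Pf; have JL := J_L2 Pf.
rewrite (_ : (fun x => _) = fun x => (- 'i%C * 2%:C) * (D f x - J b f x)); last first.
  by apply: funext => x; rewrite /J; apply: complex_ext; rewrite !reimE /=; field.
rewrite nrZ; last exact: L2B.
rewrite normcM normcN normc_i mul1r normcR ger0_norm// ler_wpM2l//.
exact: nrB.
Qed.

Lemma nu_wn b f : 0 <= b -> P b f -> nu b f <= 2 * wn b f.
Proof.
move=> b0 Pf; have xL := P_xL2 Pf; have DL := P_DL2 Pf.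
have h : nr (J b f) <= nr (D f) + 2^-1 * nr (fun x => (b * x)%:C * f x).
  apply: le_trans (nrB DL (L2Z _ xL)) _; rewrite nrZ// normcM normc_i mul1r normcR.
  by rewrite ger0_norm ?invr_ge0.
have h2 : (1 + b)^-1 * nr (D f) <= nr (D f).
  by apply: ler_piMl; [exact: nr_ge0|rewrite invf_le1 ?lerDl// ltr_pwDl].
rewrite /nu /wn; have := nr_ge0 f; have := nr_ge0 (fun x => (b * x)%:C * f x).
have := nr_ge0 (D f); move: h h2.
move: ((1 + b)^-1 * nr (D f)) (nr f) (nr (J b f)) (nr (D f)) (nr (fun x => _)) => u p q r s; lra.
Qed.

Lemma wn_nu b f : 0 <= b -> P b f -> wn b f <= (6 + 3 * b) * nu b f.
Proof.
move=> b0 Pf; have [h1 h2 h3] := nr_nu f b0; have := nr_x Pf; rewrite /wn.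
move: h1 h2 h3; move: (nr f) (nr (J b f)) (nr (D f)) (nr (fun x => _)) (nu b f) => p q r s u; lra.
Qed.

Lemma wn_ge0 b f : 0 <= wn b f. Proof. by rewrite /wn !addr_ge0 ?nr_ge0. Qed.

Lemma wn_x0 f : wn 0 f = nr f + nr (D f).
Proof.
rewrite /wn (_ : (fun x => _) = fun=> 0) ?nr0 ?addr0//.
by apply: funext => x; rewrite mul0r mul0r.
Qed.

Lemma wnD b f g : P b f -> P b g -> wn b (fun x => f x + g x) <= wn b f + wn b g.
Proof.
move=> Pf Pg; have Pfg := PD Pf Pg; rewrite /wn.
rewrite (nr_aeL (P_DL2 Pfg) (L2D (P_DL2 Pf) (P_DL2 Pg)) (D_D Pf.1 Pg.1)).
rewrite (_ : (fun x => _ * (_ + _)) = fun x => (b * x)%:C * f x + (b * x)%:C * g x); last first.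
  by apply: funext => x; rewrite mulrDr.
rewrite [leRHS]addrACA [X in _ <= X + _]addrACA.
apply: lerD (nrD (P_xL2 Pf) (P_xL2 Pg)).
exact: lerD (nrD (P_L2 Pf) (P_L2 Pg)) (nrD (P_DL2 Pf) (P_DL2 Pg)).
Qed.

(** Functions, derivatives and weighted functions converge separately in $L^2$. Closedness of the
    derivative identifies the second limit; the third is identified by localization. *)
Lemma nu_complete b (F : nat -> R -> R[i]) : 0 <= b -> (forall n, P b (F n)) ->
  (forall e, 0 < e -> exists n0, forall m n, (n0 <= m)%N -> (n0 <= n)%N ->
     nu b (fun x => F m x - F n x) <= e) ->
  exists2 G, P b G & forall e, 0 < e -> exists n0, forall n, (n0 <= n)%N ->
     nu b (fun x => F n x - G x) <= e.
Proof.
move=> b0 PF Fc; pose K := 6 + 3 * b; have K0 : 0 < K by rewrite /K; lra.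
have wc e : 0 < e -> exists n0, forall m n, (n0 <= m)%N -> (n0 <= n)%N ->
    wn b (fun x => F m x - F n x) <= e.
  move=> e0; have [n0 H] := Fc (e / K) (divr_gt0 e0 K0); exists n0 => m n hm hn.
  apply: le_trans (wn_nu b0 (PB (PF m) (PF n))) _.
  by rewrite mulrC -ler_pdivlMr//; exact: H.
have [|G1 L1 l1] := @L2_complete _ F (fun n => P_L2 (PF n)).
  move=> e /wc[n0 H]; exists n0 => m n hm hn; apply: le_trans (H m n hm hn).
  by rewrite /wn -addrA lerDl addr_ge0 ?nr_ge0.
have [|G2 L2' l2] := @L2_complete _ (fun n => D (F n)) (fun n => P_DL2 (PF n)).
  move=> e /wc[n0 H]; exists n0 => m n hm hn; apply: le_trans (H m n hm hn).
  rewrite -(nr_aeL (P_DL2 (PB (PF m) (PF n))) (L2B (P_DL2 (PF m)) (P_DL2 (PF n))) (D_B (PF m).1 (PF n).1)).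
  by rewrite /wn addrAC lerDr addr_ge0 ?nr_ge0.
have W := WD_lim (fun n => P_D (PF n)) L1 L2' l1 l2.
have [|G3 L3 l3] := @L2_complete _ (fun n x => (b * x)%:C * F n x) (fun n => P_xL2 (PF n)).
  move=> e /wc[n0 H]; exists n0 => m n hm hn; apply: le_trans (H m n hm hn).
  rewrite /wn (_ : (fun x => (b * x)%:C * F m x - _) = fun x => (b * x)%:C * (F m x - F n x)); last first.
    by apply: funext => x; rewrite mulrBr.
  by rewrite lerDr addr_ge0 ?nr_ge0.
have mx := x_meas b (L2meas L1).
have E3 : Cae_eq G3 (fun x => (b * x)%:C * G1 x).
  have mul_lim (B : R) : L2lim (fun n x => box B x * F n x) (fun x => box B x * G1 x).
    move=> e e0; have [n0 H] := l1 e e0; exists n0 => n hn; apply: le_trans (H n hn).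
    apply: nr_le; [by apply: L2B; apply: L2_box => //; exact: P_L2 (PF n)|by apply: L2B => //; exact: P_L2 (PF n)|].
    apply: aeT => x; rewrite -mulrBr normcM; apply: ler_piMl => //; exact: box_le1.
  (* On a bounded interval multiplication by $bx$ is bounded on $L^2$, so the limits agree there;
     integer radii exhaust the line. *)
  have box_ae (B : nat) : {ae mu, forall x, box B%:R x * G3 x = box B%:R x * ((b * x)%:C * G1 x)}.
    pose Y h x : R[i] := box B%:R x * ((b * x)%:C * h x).
    have Yle h x : normc (Y h x) <= b * B%:R * normc (h x).
      rewrite /Y boxE; case: ifP => [xB|_]; last first.
        by rewrite mul0r normc0 !mulr_ge0.
      by rewrite mul1r normcM normcR normrM (ger0_norm b0) ler_wpM2r// ler_wpM2l.
    have YL h : L2 h -> L2 (Y h).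
      move=> hL; apply: (@L2_le _ _ (fun x => (b * B%:R)%:C * h x)).
      - by apply: CmeasM; [exact: box_meas|apply: x_meas; exact: L2meas].
      - exact: L2Z.
      - by apply: aeT => x; rewrite [leRHS]normcM normcR ger0_norm ?mulr_ge0//; exact: Yle.
    have YB h k x : Y h x - Y k x = Y (fun x => h x - k x) x.
      by rewrite /Y !mulrBr.
    apply: (@L2lim_uniq _ (fun n => Y (F n))).
    - by move=> n; apply: YL; exact: P_L2 (PF n).
    - exact: L2_box.
    - exact: YL.
    - move=> e e0; have [n0 H] := l3 e e0; exists n0 => n hn; apply: le_trans (H n hn).
      apply: nr_le.
      + by apply: L2B; [apply: YL; exact: P_L2 (PF n)|exact: L2_box].
      + by apply: L2B => //; exact: P_xL2 (PF n).
      + apply: aeT => x; rewrite /Y -mulrBr normcM; apply: ler_piMl => //; exact: box_le1.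
    - move=> e e0; have B1 : 0 < b * B%:R + 1 by rewrite ltr_wpDl// mulr_ge0.
      have [n0 H] := l1 _ (divr_gt0 e0 B1); exists n0 => n hn.
      under eq_fun do rewrite YB.
      have dL := L2B (P_L2 (PF n)) L1.
      apply: (@le_trans _ _ (nr (fun x => (b * B%:R)%:C * (F n x - G1 x)))).
        apply: nr_le; [exact: YL|exact: L2Z|].
        by apply: aeT => x; rewrite [leRHS]normcM normcR ger0_norm ?mulr_ge0//; exact: Yle.
      rewrite nrZ// normcR ger0_norm ?mulr_ge0//.
      apply: (@le_trans _ _ ((b * B%:R + 1) * (e / (b * B%:R + 1)))).
        by apply: ler_pM; [exact: mulr_ge0|exact: nr_ge0|rewrite lerDl|exact: H].
      by rewrite mulrC divfK// gt_eqF.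
  have /ae_foralln H : forall n : nat, {ae mu, forall x, box n%:R x * G3 x = box n%:R x * ((b * x)%:C * G1 x)}.
    by move=> n; exact: box_ae.
  apply: (aeS H) => x /(_ (Num.truncn `|x|).+1); rewrite boxE.
  by rewrite (ltW (truncnS_gt _)) !mul1r.
have PG : P b G1 by split; [exact: WD_H1 W|exact: (L2_ae L3 mx E3)].
exists G1 => // e e0; have e6 : 0 < e / 6 by rewrite divr_gt0.
have [n1 H1'] := l1 _ e6; have [n2 H2] := l2 _ e6; have [n3 H3] := l3 _ e6.
exists (n1 + n2 + n3)%N => n hn; have PFG := PB (PF n) PG.
apply: le_trans (nu_wn b0 PFG) _.
have q1 : nr (fun x => F n x - G1 x) <= e / 6.
  by apply: H1'; apply: leq_trans hn; rewrite -addnA leq_addr.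
have q2 : nr (D (fun x => F n x - G1 x)) <= e / 6.
  rewrite (nr_aeL (P_DL2 PFG) (L2B (P_DL2 (PF n)) L2')).
    by apply: H2; apply: leq_trans hn; rewrite addnAC leq_addl.
  by apply: D_eq; apply: WDB => //; exact: P_D (PF n).
have q3 : nr (fun x => (b * x)%:C * (F n x - G1 x)) <= e / 6.
  rewrite (nr_aeL (P_xL2 PFG) (L2B (P_xL2 (PF n)) L3)).
    by apply: H3; apply: leq_trans hn; rewrite leq_addl.
  by apply: (aeS E3) => x ->; rewrite mulrBr.
rewrite /wn; move: q1 q2 q3.
by move: (nr _) (nr _) (nr _) => p q r; lra.
Qed.

Lemma S_P b t f : P b f -> P b (schrodinger t f).
Proof.
move=> Pf; have W := P_D Pf; split; first by apply: WD_H1; exact: S_WD W.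
by have [] := S_bx t W (P_xL2 Pf).
Qed.

Lemma D_S t f : H1 f -> Cae_eq (D (schrodinger t f)) (schrodinger t (D f)).
Proof. by move=> /WD_D W; apply: D_eq; exact: S_WD. Qed.

Lemma nr_DS t f : H1 f -> nr (D (schrodinger t f)) = nr (D f).
Proof.
move=> Hf; have DL := D_L2 Hf; rewrite -(S_nr t DL).
apply: nr_aeL (D_S t Hf); last exact: S_L2.
by apply: D_L2; apply: WD_H1 (S_WD t (WD_D Hf)).
Qed.

Lemma wn_S b t f : 0 <= b -> P b f -> wn b (schrodinger t f) <= (1 + 2 * (b * `|t|)) * wn b f.
Proof.
move=> b0 Pf; have [SL E] := S_bx t (P_D Pf) (P_xL2 Pf); have DL := P_DL2 Pf.
have xL := P_xL2 Pf.
rewrite /wn (S_nr _ (P_L2 Pf)) (nr_DS t Pf.1).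
have h : nr (fun x => (b * x)%:C * schrodinger t f x) <=
    nr (fun x => (b * x)%:C * f x) + 2 * (b * `|t|) * nr (D f).
  rewrite (nr_aeL SL (L2B (S_L2 t xL) (L2Z _ (S_L2 t DL))) E).
  apply: le_trans (nrB (S_L2 t xL) (L2Z _ (S_L2 t DL))) _.
  rewrite nrZ; last exact: S_L2.
  rewrite (S_nr _ xL) (S_nr _ DL) normcM normc_i mul1r normcR !normrM ger0_norm//.
  by rewrite (ger0_norm b0).
have : 0 <= 2 * (b * `|t|) by rewrite !mulr_ge0.
move: h; have := nr_ge0 f; have := nr_ge0 (D f); have := nr_ge0 (fun x => (b * x)%:C * f x).
move: (2 * _) (nr (fun x => _ * schrodinger _ _ _)) => k q.
move: (nr f) (nr (D f)) (nr _) => p1 p2 p3 h3 h2 h1 h k0.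
have : 0 <= k * p1 by exact: mulr_ge0.
have : 0 <= k * p3 by exact: mulr_ge0.
by rewrite mulrDl mul1r !mulrDr; lra.
Qed.

Lemma S_contP b t f : 0 <= b -> P b f -> forall e, 0 < e -> exists2 del : R, 0 < del &
  forall s, `|s - t| < del ->
    wn b (fun x => schrodinger s f x - schrodinger t f x) <= e.
Proof.
move=> b0 Pf e e0; have e5 : 0 < e / 5 by rewrite divr_gt0.
have e5E : e = e / 5 + e / 5 + (e / 5 + e / 5 + e / 5) by field.
have DL := P_DL2 Pf; have xL := P_xL2 Pf.
have kt : 0 < 2 * (b * (`|t| + 1)) + 1 by rewrite ltr_wpDl// !mulr_ge0// addr_ge0.
have kd : 0 < 2 * (b * (nr (D f) + 1)) + 1 by rewrite ltr_wpDl// !mulr_ge0// addr_ge0 ?nr_ge0.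
have [d1 d10 H1'] := S_cont t (P_L2 Pf) e5.
have [d2 d20 H2] := S_cont t DL (divr_gt0 e5 kt).
have [d3 d30 H3] := S_cont t xL e5.
pose d4 := e / 5 / (2 * (b * (nr (D f) + 1)) + 1).
have d40 : 0 < d4 by rewrite divr_gt0.
exists (Num.min (Num.min d1 d2) (Num.min d3 d4)); first by rewrite !lt_min d10 d20 d30 d40.
move=> s; rewrite !lt_min => /andP[/andP[h1 h2] /andP[h3 h4]].
have {}H1' := H1' s h1; have {}H2 := H2 s h2; have {}H3 := H3 s h3.
have PS := PB (S_P s Pf) (S_P t Pf).
have eD : nr (D (fun x => schrodinger s f x - schrodinger t f x)) =
    nr (fun x => schrodinger s (D f) x - schrodinger t (D f) x).
  apply: (nr_aeL (P_DL2 PS)); first by apply: L2B; exact: S_L2.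
  by apply: D_eq; apply: WDB; apply: S_WD; exact: P_D Pf.
have [SsL Es] := S_bx s (P_D Pf) xL; have [StL Et] := S_bx t (P_D Pf) xL.
pose A x := schrodinger s (fun x => (b * x)%:C * f x) x - schrodinger t (fun x => (b * x)%:C * f x) x.
pose B1 x := 'i%C * (2 * (b * (s - t)))%:C * schrodinger s (D f) x.
pose B2 x := 'i%C * (2 * (b * t))%:C * (schrodinger s (D f) x - schrodinger t (D f) x).
have AL : L2 A by apply: L2B; exact: S_L2.
have B1L : L2 B1 by apply: L2Z; exact: S_L2.
have B2L : L2 B2 by apply: L2Z; apply: L2B; exact: S_L2.
have ex : nr (fun x => (b * x)%:C * (schrodinger s f x - schrodinger t f x)) <= nr A + nr B1 + nr B2.
  apply: (nr_ae_le (P_xL2 PS) (L2B (L2B AL B1L) B2L)); last first.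
    by apply: le_trans (nrB (L2B AL B1L) B2L) _; rewrite lerD2r; exact: nrB.
  have alg (p q u v : R[i]) :
      p - 'i%C * (2 * (b * s))%:C * u - (q - 'i%C * (2 * (b * t))%:C * v) =
      p - q - 'i%C * (2 * (b * (s - t)))%:C * u - 'i%C * (2 * (b * t))%:C * (u - v).
    case: p => p1 p2; case: q => q1 q2; case: u => u1 u2; case: v => v1 v2.
    by apply: complex_ext; rewrite !reimE /=; ring.
  by apply: (aeS2 Es Et) => x hs ht; rewrite mulrBr hs ht; exact: alg.
have n1 : nr B1 <= e / 5.
  rewrite /B1 nrZ; last exact: S_L2.
  rewrite (S_nr _ DL) normcM normc_i mul1r normcR !normrM ger0_norm// (ger0_norm b0).
  apply: (@le_trans _ _ (d4 * (2 * (b * (nr (D f) + 1)) + 1))); last by rewrite /d4 divfK ?gt_eqF.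
  rewrite (_ : 2 * _ * _ = `|s - t| * (2 * (b * nr (D f)))); last by ring.
  apply: ler_pM => //; [by rewrite !mulr_ge0 ?nr_ge0|exact: ltW|].
  apply: (@le_trans _ _ (2 * (b * (nr (D f) + 1)))); last by rewrite lerDl.
  by apply: ler_wpM2l => //; apply: ler_wpM2l => //; rewrite lerDl.
have n2 : nr B2 <= e / 5.
  rewrite /B2 nrZ; last by apply: L2B; exact: S_L2.
  rewrite normcM normc_i mul1r normcR !normrM ger0_norm// (ger0_norm b0).
  apply: (@le_trans _ _ ((2 * (b * (`|t| + 1)) + 1) * (e / 5 / (2 * (b * (`|t| + 1)) + 1)))).
    apply: ler_pM; [by rewrite !mulr_ge0|exact: nr_ge0| |exact: H2].
    apply: (@le_trans _ _ (2 * (b * (`|t| + 1)))); last by rewrite lerDl.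
    by apply: ler_wpM2l => //; apply: ler_wpM2l => //; rewrite lerDl.
  by rewrite mulrC divfK ?gt_eqF.
have n3 : nr (fun x => schrodinger s (D f) x - schrodinger t (D f) x) <= e / 5.
  apply: le_trans H2 _; rewrite ler_pdivrMr//; apply: ler_peMr; first exact: ltW.
  by rewrite lerDr !mulr_ge0// addr_ge0 ?nr_ge0.
rewrite [leRHS]e5E /wn eD.
apply: lerD; first exact: lerD H1' n3.
by apply: le_trans ex _; apply: lerD n2; exact: lerD H3 n1.
Qed.

(** With $s=1+bt$ the phase contributes $-\frac{i}{2s}bx\,S(t)f$, and [S_bx] replaces $bx\,S(t)f$ by
    $S(t)(bxf)-2ibt\,S(t)f'$. The coefficient of $S(t)f'$ becomes $1-bt/s=1/s$, that of $S(t)(bxf)$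
    is $-i/(2s)$; together they give $s^{-1}S(t)Jf$. This is the lens, or pseudoconformal,
    transformation. *)
Lemma lens b t f : P b f -> 0 < 1 + b * t -> exists v,
  WD (fun x => cis (kap b t * x ^+ 2) * schrodinger t f x) v /\
  nr v = (1 + b * t)^-1 * nr (J b f).
Proof.
move=> Pf s0; have sn0 := lt0r_neq0 s0; have W := P_D Pf; have xL := P_xL2 Pf.
have [SL E] := S_bx t W xL; have DL := P_DL2 Pf.
have kL : L2 (fun x => (kap b t * x)%:C * schrodinger t f x).
  have := L2Z (- (4 * (1 + b * t))^-1)%:C SL; congr L2; apply: funext => x.
  by rewrite mulrA -rmorphM /kap; congr (_%:C * _); ring.
have W2 := WD_chirp (S_WD t W) kL; have [_ vL _] := W2.
eexists; split; first exact: W2.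
have e1 := S_B t DL (L2Z ('i%C * (2^-1)%:C) xL).
have e2 := S_Z t ('i%C * (2^-1)%:C) xL.
have JL := J_L2 Pf; have SJ := S_L2 t JL.
rewrite -(S_nr t JL) -[(1 + b * t)^-1]ger0_norm ?invr_ge0 ?ltW// -normcR -nrZ//.
rewrite -[RHS](nrcis (fun x => kap b t * x ^+ 2)).
apply: (nr_aeL vL); first by apply: L2cis; [exact: meas_sq|exact: L2Z].
have alg (p q : R[i]) (u : R) : u != 0 ->
    p + 'i%C * (- (2 * u)^-1)%:C * (q - 'i%C * (2 * (u - 1))%:C * p) =
    (u^-1)%:C * (p - 'i%C * (2^-1)%:C * q).
  by case: p => p1 p2; case: q => q1 q2 u0; apply: complex_ext; rewrite !reimE /=; field.
have e3 : Cae_eq (schrodinger t (J b f)) (fun x => schrodinger t (D f) x -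
    'i%C * (2^-1)%:C * schrodinger t (fun x => (b * x)%:C * f x) x).
  by apply: (aeS2 e1 e2) => x; rewrite /J => -> ->.
apply: (aeS2 E e3) => x h ->.
congr (_ * _); rewrite -alg// -(_ : b * t = 1 + b * t - 1); last by ring.
have kE : (2 * (kap b t * x))%:C = (- (2 * (1 + b * t))^-1)%:C * (b * x)%:C :> R[i].
  by rewrite -rmorphM; congr (_%:C); rewrite /kap; field.
by congr (_ + _); rewrite kE [in LHS]mulrA -[LHS]mulrA; congr (_ * _); exact: h.
Qed.

End SchrodingerH1.

(** * The nonlinearity *)

Section PowerDerivative.
Context {R : realType}.
Local Notation re := (@complex.Re R).
Local Notation im := (@complex.Im R).
Implicit Types (f g h F G : R -> R[i]) (z w : R[i]) (a m q : R).

Lemma powR_le a (r s : R) : 0 <= a -> 0 <= r -> r <= s -> r `^ a <= s `^ a.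
Proof.
by move=> a0 r0 rs; apply: ge0_ler_powR => //; rewrite nnegrE// (le_trans r0).
Qed.

(** Mean value theorem, with the endpoint 0 treated apart, where the real power need not be
    differentiable from both sides; $a\ge1$ makes the derivative monotone. *)
Lemma powR_lip a m (r s : R) : 1 <= a -> 0 < m -> 0 <= r <= m -> 0 <= s <= m ->
  `|r `^ a - s `^ a| <= a * m `^ (a - 1) * `|r - s|.
Proof.
move=> a1 m0; have a0 : 0 < a by lra.
have mono (x : R) : 0 <= x <= m -> x `^ (a - 1) <= m `^ (a - 1).
  by move=> /andP[x0 xm]; apply: powR_le; rewrite ?subr_ge0.
wlog sr : r s / s <= r.
  move=> H rm sm; have [sr|/ltW rs] := leP s r; first exact: H.
  by rewrite distrC [`|r - s|]distrC; exact: H.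
move=> /andP[r0 rm] /andP[s0 sm]; move: sr; rewrite le_eqVlt => /predU1P[->|sr].
  by rewrite !subrr normr0 mulr0.
have [s00|s00] := eqVneq s 0.
  rewrite s00 powR0 ?gt_eqF// !subr0 !ger0_norm ?powR_ge0//.
  rewrite -(mulr_powRB1 r0 a0) mulrC; apply: ler_wpM2r => //.
  apply: le_trans (mono r _) _; first by rewrite r0.
  by apply: ler_peMl => //; exact: powR_ge0.
have sp : 0 < s by rewrite lt_neqAle eq_sym s00.
have [||c cin ->] := @MVT R (fun x => x `^ a) (fun x => a * x `^ (a - 1)) s r sr.
- by move=> x; rewrite in_itv /= => /andP[sx _]; apply: is_derive1_powR; lra.
- apply: derivable_within_continuous => x; rewrite in_itv /= => /andP[sx _].
  by apply: derivable_powR; rewrite in_itv /= andbT; lra.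
move: cin; rewrite in_itv /= => /andP[sc cr].
rewrite normrM ler_wpM2r// ger0_norm ?mulr_ge0 ?powR_ge0 ?(ltW a0)//.
by rewrite ler_pM2l//; apply: mono; lra.
Qed.

(** Two mean value steps on an interval away from 0. This is the quadratic error bound that the
    chain rule [AC_comp] asks for. *)
Lemma powR_taylor q (c M : R) : 0 < c -> exists2 C : R, 0 <= C & forall r s,
  c <= r <= M -> c <= s <= M ->
  `|s `^ q - r `^ q - q * r `^ (q - 1) * (s - r)| <= C * (s - r) ^+ 2.
Proof.
(* The exponent $q-2$ may have either sign, so the values at both ends of the interval are added. *)
move=> c0; pose B := `|q * (q - 1)| * (c `^ (q - 1 - 1) + M `^ (q - 1 - 1)).
have B0 : 0 <= B by rewrite mulr_ge0// addr_ge0// powR_ge0.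
have bd (x : R) : c <= x <= M -> `|q * ((q - 1) * x `^ (q - 1 - 1))| <= B.
  move=> /andP[cx xM]; rewrite mulrA normrM ler_wpM2l// ger0_norm ?powR_ge0//.
  have [k0|k0] := leP 0 (q - 1 - 1).
    apply: (@le_trans _ _ (M `^ (q - 1 - 1))); last by rewrite lerDr powR_ge0.
    by apply: powR_le => //; lra.
  apply: (@le_trans _ _ (c `^ (q - 1 - 1))); last by rewrite lerDl powR_ge0.
  have x0 : 0 < x by lra.
  rewrite -[q - 1 - 1]opprK (powRN x) (powRN c) lef_pV2 ?posrE ?powR_gt0//.
  by apply: powR_le => //; lra.
have mvt (p : R) (x y : R) : c <= x -> x < y -> exists2 z, x <= z <= y &
    y `^ p - x `^ p = p * z `^ (p - 1) * (y - x).
  move=> cx xy; have [||z zin zE] := @MVT R (fun x => x `^ p) (fun x => p * x `^ (p - 1)) x y xy.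
  - by move=> u; rewrite in_itv /= => /andP[sx _]; apply: is_derive1_powR; lra.
  - apply: derivable_within_continuous => u; rewrite in_itv /= => /andP[sx _].
    by apply: derivable_powR; rewrite in_itv /= andbT; lra.
  by exists z => //; move: zin; rewrite in_itv /= => /andP[/ltW -> /ltW ->].
have mvt2 (p : R) (x y : R) : c <= x -> c <= y -> exists2 z,
    (Num.min x y <= z <= Num.max x y) & y `^ p - x `^ p = p * z `^ (p - 1) * (y - x).
  move=> cx cy; have [xy|yx|->] := ltgtP x y.
  - by have [z zin zE] := mvt p x y cx xy; exists z.
  - have [z zin zE] := mvt p y x cy yx; exists z => //.
    by rewrite -opprB zE -mulrN opprB.
  - by exists y; rewrite ?lexx// !subrr mulr0.
exists B => // r s /andP[cr rM] /andP[cs sM].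
have [z zin zE] := mvt2 q r s cr cs; rewrite zE -mulrBl -mulrBr.
have cz : c <= z by move: zin => /andP[+ _]; apply: le_trans; rewrite le_min cr.
have zM : z <= M by move: zin => /andP[_]/le_trans; apply; rewrite ge_max rM.
have zr : `|z - r| <= `|s - r|.
  move: zin; case: (leP r s) => rs /andP[h1 h2].
    by rewrite !ger0_norm ?subr_ge0// lerB.
  rewrite !ler0_norm ?subr_le0//; lra.
have [y yin yE] := mvt2 (q - 1) r z cr cz; rewrite yE.
have cy : c <= y by move: yin => /andP[+ _]; apply: le_trans; rewrite le_min cr.
have yM : y <= M by move: yin => /andP[_]/le_trans; apply; rewrite ge_max rM.
have -> : (s - r) ^+ 2 = `|s - r| * `|s - r| by rewrite -expr2 real_normK ?num_real.
rewrite normrM [in leRHS]mulrA ler_wpM2r// mulrA normrM.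
by apply: ler_pM => //; apply: bd; rewrite cy.
Qed.

(* [dpow a z w] is the differential of [z |-> |z|^a z] at [z] applied to [w]; its second part
   [Bq] has the right value [0] at [z = 0], whatever the power of [0] there. *)
Definition pow a z := (normc z `^ a)%:C * z.
Definition Bq a z w := ((normc z ^+ 2) `^ (a / 2 - 1) * (re z * re w + im z * im w))%:C * z.
Definition dpow a z w := (normc z `^ a)%:C * w + a%:C * Bq a z w.

Lemma sqr_powR a z : 0 < a -> (normc z ^+ 2) `^ (a / 2) = normc z `^ a.
Proof.
by move=> a0; rewrite -(powR_mulrn 2 (normc_ge0 z)) -powRrM; congr (_ `^ _); field.
Qed.

(** Away from 0 the operator is $|z|^a$ times the orthogonal projection onto the direction $z/|z|$,
    which makes bounds and increments visible. *)
Lemma Bq_unit a z w : 0 < a -> z != 0 ->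
  Bq a z w = (normc z `^ a * (re (z * ((normc z)^-1)%:C) * re w + im (z * ((normc z)^-1)%:C) * im w))%:C
             * (z * ((normc z)^-1)%:C).
Proof.
move=> a0 z0; have n0 : normc z != 0 by apply/eqP => /eq0_normc/eqP; exact/negP.
have n2 : normc z ^+ 2 != 0 by rewrite expf_neq0.
rewrite /Bq powRB; last by rewrite n2 implybT.
rewrite sqr_powR// powRr1 ?sqr_ge0//.
case: z z0 n0 n2 => u v _; move: (normc _) => n n0 n2.
by apply: complex_ext; rewrite !reimE /=; field.
Qed.

Lemma normc_neq0 z : z != 0 -> normc z != 0.
Proof. by move=> z0; apply/eqP => /eq0_normc/eqP; exact/negP. Qed.

Lemma normc_unit z : z != 0 -> normc (z * ((normc z)^-1)%:C) = 1.
Proof.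
move=> z0; rewrite normcM normcR ger0_norm; last by rewrite invr_ge0 normc_ge0.
by rewrite divff// normc_neq0.
Qed.

Lemma unit_le z w : normc z = 1 -> `|re z * re w + im z * im w| <= normc w.
Proof. by move=> z1; apply: le_trans (reim_le z w) _; rewrite z1 mul1r. Qed.

Lemma Bq_le a z w : 0 < a -> normc (Bq a z w) <= normc z `^ a * normc w.
Proof.
move=> a0; have [->|z0] := eqVneq z 0.
  by rewrite /Bq mulr0 normc0 mulr_ge0 ?normc_ge0 ?powR_ge0.
have n0 : normc z != 0 by apply/eqP => /eq0_normc/eqP; exact/negP.
have e1 := normc_unit z0.
rewrite Bq_unit// normcM e1 mulr1 normcR normrM ger0_norm ?powR_ge0//.
by rewrite ler_wpM2l ?powR_ge0//; exact: unit_le.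
Qed.

Lemma unit_dist z z' : z != 0 -> z' != 0 ->
  normc (z * ((normc z)^-1)%:C - z' * ((normc z')^-1)%:C) <= 2 * (normc (z - z') / normc z').
Proof.
move=> z0 z0'.
have n0 : normc z != 0 by apply/eqP => /eq0_normc/eqP; exact/negP.
have n0' : normc z' != 0 by apply/eqP => /eq0_normc/eqP; exact/negP.
have p : 0 < normc z by rewrite lt_neqAle eq_sym n0 normc_ge0.
have p' : 0 < normc z' by rewrite lt_neqAle eq_sym n0' normc_ge0.
have -> : z * ((normc z)^-1)%:C - z' * ((normc z')^-1)%:C =
   (z - z') * ((normc z')^-1)%:C + z * ((normc z)^-1 - (normc z')^-1)%:C.
  by rewrite rmorphB /= mulrBr mulrBl; ring.
apply: le_trans (le_normcD _ _) _; rewrite !normcM !normcR mulr_natl mulr2n.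
apply: lerD; first by rewrite ger0_norm ?invr_ge0 ?normc_ge0.
rewrite (_ : (normc z)^-1 - (normc z')^-1 = (normc z' - normc z) / (normc z * normc z')); last first.
  by field; rewrite n0 n0'.
rewrite normrM (ger0_norm (_ : 0 <= (normc z * normc z')^-1)); last by rewrite invr_ge0 mulr_ge0 ?normc_ge0.
rewrite (_ : normc z * _ = `|normc z' - normc z| / normc z'); last by field; rewrite n0 n0'.
by rewrite ler_wpM2r ?invr_ge0 ?normc_ge0// distrC; exact: normc_dist.
Qed.

(** The direction $z/|z|$ varies at rate $2/|z'|$, which one power of $|z'|$ compensates; the
    remaining power $a-1\ge0$ is bounded by $m$. The direction occurs twice, hence 4; the summand
    $a$ comes from the variation of $|z|^a$. *)
Lemma Bq_lip a m z z' w : 1 <= a -> 0 < m -> normc z <= m -> normc z' <= m ->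
  normc (Bq a z w - Bq a z' w) <= (a + 4) * (m `^ (a - 1) * (normc (z - z') * normc w)).
Proof.
move=> a1 m0 zm zm'; have a0 : 0 < a by lra.
have mono (x : R) : 0 <= x -> x <= m -> x `^ (a - 1) <= m `^ (a - 1).
  by move=> x0 xm; apply: powR_le; rewrite ?subr_ge0.
have one x : normc x <= m -> normc (Bq a x w) <= m `^ (a - 1) * (normc x * normc w).
  move=> xm; apply: le_trans (Bq_le x w a0) _; rewrite -(mulr_powRB1 (normc_ge0 x) a0).
  rewrite [normc x * normc x `^ _]mulrC -mulrA; apply: ler_wpM2r; first by rewrite mulr_ge0 ?normc_ge0.
  by apply: mono => //; exact: normc_ge0.
have big x : 0 <= m `^ (a - 1) * (x : R) -> m `^ (a - 1) * x <= (a + 4) * (m `^ (a - 1) * x).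
  by move=> h; apply: ler_peMl => //; lra.
have [->|z0] := eqVneq z 0.
  rewrite (_ : Bq a 0 w = 0) ?sub0r ?normcN; last by rewrite /Bq mulr0.
  apply: le_trans (one _ zm') _; apply: big; by rewrite !mulr_ge0 ?normc_ge0 ?powR_ge0.
have [->|z0'] := eqVneq z' 0.
  rewrite (_ : Bq a 0 w = 0) ?subr0; last by rewrite /Bq mulr0.
  by apply: le_trans (one _ zm) _; apply: big; rewrite !mulr_ge0 ?normc_ge0 ?powR_ge0.
have n0 : normc z != 0 by apply/eqP => /eq0_normc/eqP; exact/negP.
have n0' : normc z' != 0 by apply/eqP => /eq0_normc/eqP; exact/negP.
have ud := unit_dist z0 z0'.
rewrite !Bq_unit//; set e := z * _ in ud *; set e' := z' * _ in ud *.
have e1 : normc e = 1 by exact: normc_unit.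
have e1' : normc e' = 1 by exact: normc_unit.
clearbody e e'; pose Q x := (re x * re w + im x * im w)%:C * x.
have -> : (normc z `^ a * (re e * re w + im e * im w))%:C * e -
   (normc z' `^ a * (re e' * re w + im e' * im w))%:C * e' =
   (normc z `^ a - normc z' `^ a)%:C * Q e + (normc z' `^ a)%:C * (Q e - Q e').
  rewrite /Q; move: (normc z `^ a) (normc z' `^ a) (re e * _ + _) (re e' * _ + _) => p p' s s'.
  by rewrite !rmorphM rmorphB /=; ring.
apply: le_trans (le_normcD _ _) _; rewrite (normcM _ (Q e)) (normcM _ (Q e - Q e')) !normcR.
rewrite [_ + 4]addrC mulrDl addrC; apply: lerD.
  rewrite (ger0_norm (powR_ge0 _ _)).
  have hQ : normc (Q e - Q e') <= 4 * (normc (z - z') / normc z') * normc w.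
    have -> : Q e - Q e' = (re (e - e') * re w + im (e - e') * im w)%:C * e +
        (re e' * re w + im e' * im w)%:C * (e - e').
      by rewrite /Q; apply: complex_ext; rewrite !reimE /=; ring.
    apply: le_trans (le_normcD _ _) _; rewrite (normcM _ e) (normcM _ (e - e')) !normcR e1 mulr1.
    have h1 := reim_le (e - e') w; have h2 := unit_le w e1'.
    have h3 : `|re e' * re w + im e' * im w| * normc (e - e') <= normc (e - e') * normc w.
      by rewrite mulrC ler_wpM2l ?normc_ge0.
    apply: le_trans (lerD h1 h3) _; rewrite -mulrDl ler_wpM2r ?normc_ge0//.
    by move: ud; move: (normc _) (normc _ / _) => p q; lra.
  apply: le_trans (ler_wpM2l (powR_ge0 _ _) hQ) _.
  rewrite -(mulr_powRB1 (normc_ge0 z') a0).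
  rewrite (_ : normc z' * _ * _ = normc z' `^ (a - 1) * (4 * (normc (z - z') * normc w))).
    rewrite [in leRHS]mulrCA; apply: ler_wpM2r; first by rewrite !mulr_ge0 ?invr_ge0 ?normc_ge0.
    by apply: mono => //; exact: normc_ge0.
  by field.
have hq : normc (Q e) <= normc w.
  by rewrite normcM normcR e1 mulr1; exact: unit_le.
have hp := @powR_lip a m (normc z) (normc z') a1 m0.
apply: le_trans (ler_pM _ _ (hp _ _) hq) _; rewrite ?normc_ge0 ?zm ?zm'//.
rewrite -!mulrA ler_pM2l// ler_wpM2l ?powR_ge0// ler_wpM2r ?normc_ge0//; exact: normc_dist.
Qed.

(** One constant for both Lipschitz bounds: it majorizes $1+a$ and $a+a(a+4)$, the coefficients in
    [dpow_lip]. *)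
Definition cpow a := a ^+ 2 + 5 * a + 1.

Lemma pow_lip a m z z' : 1 <= a -> 0 < m -> normc z <= m -> normc z' <= m ->
  normc (pow a z - pow a z') <= cpow a * (m `^ a * normc (z - z')).
Proof.
move=> a1 m0 zm zm'; have a0 : 0 < a by lra.
have -> : pow a z - pow a z' = (normc z `^ a)%:C * (z - z') + (normc z `^ a - normc z' `^ a)%:C * z'.
  by rewrite /pow rmorphB /=; move: (_%:C) (_%:C) => p q; ring.
apply: le_trans (le_normcD _ _) _; rewrite !normcM !normcR (ger0_norm (powR_ge0 _ _)).
have h1 : normc z `^ a * normc (z - z') <= m `^ a * normc (z - z').
  by rewrite ler_wpM2r ?normc_ge0//; apply: powR_le; rewrite ?normc_ge0// ltW.
have h2 : `|normc z `^ a - normc z' `^ a| * normc z' <= a * (m `^ a * normc (z - z')).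
  have hp := @powR_lip a m (normc z) (normc z') a1 m0.
  apply: le_trans (ler_pM _ _ (hp _ _) zm') _; rewrite ?normc_ge0 ?zm ?zm'//.
  rewrite -(mulr_powRB1 (ltW m0) a0) -!mulrA ler_pM2l// [m * _]mulrC -!mulrA.
  rewrite ler_wpM2l ?powR_ge0// ler_pM2r//; exact: normc_dist.
have X0 : 0 <= m `^ a * normc (z - z') by rewrite mulr_ge0 ?normc_ge0 ?powR_ge0.
have a20 : 0 <= a ^+ 2 by exact: sqr_ge0.
apply: le_trans (lerD h1 h2) _; rewrite /cpow; move: X0; move: (m `^ a * _) => X X0.
rewrite -[X in X + _]mul1r -mulrDl; apply: ler_wpM2r => //; lra.
Qed.

Lemma dpow_lip a m z z' w w' : 1 <= a -> 0 < m -> normc z <= m -> normc z' <= m ->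
  normc (dpow a z w - dpow a z' w') <=
  cpow a * (m `^ a * normc (w - w') + m `^ (a - 1) * (normc (z - z') * normc w')).
Proof.
move=> a1 m0 zm zm'; have a0 : 0 < a by lra.
have BD (x y : R[i]) : Bq a z x - Bq a z y = Bq a z (x - y).
  by rewrite /Bq -mulrBl -rmorphB /= -mulrBr !reB; congr ((_ * _)%:C * _); ring.
have -> : dpow a z w - dpow a z' w' =
   (normc z `^ a)%:C * (w - w') + a%:C * Bq a z (w - w') +
   ((normc z `^ a - normc z' `^ a)%:C * w' + a%:C * (Bq a z w' - Bq a z' w')).
  rewrite -BD /dpow rmorphB /=; move: (_%:C) (_%:C) (_%:C) (Bq _ _ _) (Bq _ _ _) (Bq _ _ _) => *; ring.
have mz : normc z `^ a <= m `^ a by apply: powR_le; rewrite ?normc_ge0// ltW.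
have h1 : normc ((normc z `^ a)%:C * (w - w') + a%:C * Bq a z (w - w')) <=
    (1 + a) * (m `^ a * normc (w - w')).
  apply: le_trans (le_normcD _ _) _; rewrite (normcM _ (w - w')) (normcM _ (Bq a z _)) !normcR (ger0_norm (powR_ge0 _ _)) (ger0_norm (ltW a0)).
  rewrite mulrDl mul1r; apply: lerD; first by rewrite ler_wpM2r ?normc_ge0.
  rewrite ler_pM2l//; apply: le_trans (Bq_le z _ a0) _; by rewrite ler_wpM2r ?normc_ge0.
have h2 : normc ((normc z `^ a - normc z' `^ a)%:C * w' + a%:C * (Bq a z w' - Bq a z' w')) <=
    (a + a * (a + 4)) * (m `^ (a - 1) * (normc (z - z') * normc w')).
  apply: le_trans (le_normcD _ _) _; rewrite (normcM _ w') (normcM _ (_ - _)) !normcR (ger0_norm (ltW a0)).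
  rewrite mulrDl -[a * (a + 4) * _]mulrA; apply: lerD.
    have hp := @powR_lip a m (normc z) (normc z') a1 m0.
    apply: le_trans (ler_wpM2r (normc_ge0 w') (hp _ _)) _; rewrite ?normc_ge0 ?zm ?zm'//.
    by rewrite -!mulrA ler_pM2l// ler_wpM2l ?powR_ge0// ler_wpM2r ?normc_ge0//; exact: normc_dist.
  by rewrite ler_pM2l//; exact: Bq_lip.
apply: le_trans (le_normcD _ _) _; apply: le_trans (lerD h1 h2) _.
have X0 : 0 <= m `^ a * normc (w - w') by rewrite mulr_ge0 ?normc_ge0 ?powR_ge0.
have Y0 : 0 <= m `^ (a - 1) * (normc (z - z') * normc w') by rewrite !mulr_ge0 ?normc_ge0 ?powR_ge0.
rewrite /cpow [leRHS]mulrDr; have a20 : 0 <= a ^+ 2 by exact: sqr_ge0.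
by apply: lerD; apply: ler_wpM2r => //; rewrite ?mulrDr -?expr2; lra.
Qed.

End PowerDerivative.

(** * The chain rule for $|f|^af$ in $H^1$ *)

Section PowerWeakDerivative.
Context {R : realType}.
Local Notation mu := (@lebesgue_measure R).
Local Notation re := (@complex.Re R).
Local Notation im := (@complex.Im R).
Implicit Types (f g h F G : R -> R[i]) (z w : R[i]) (a m q : R).

Lemma powR_cont q (r : R) : 0 < r -> {for r, continuous (fun s : R => s `^ q)}.
Proof.
move=> r0; apply: differentiable_continuous; apply/derivable1_diffP.
by have [] := is_derive1_powR q r0.
Qed.

Lemma powR_cvgn q (r : R) (u : nat -> R) : 0 < q -> 0 <= r -> (forall n, 0 <= u n) ->
  u @ \oo --> r -> (fun n => u n `^ q) @ \oo --> r `^ q.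
Proof.
move=> q0; rewrite le_eqVlt => /predU1P[<-|r0] u0 ur; last first.
  exact: (cvg_comp _ _ ur (powR_cont (q := q) r0)).
rewrite powR0 ?gt_eqF//; apply/cvgrPdist_le => e e0.
have d0 : 0 < e `^ q^-1 by rewrite powR_gt0.
have /cvgrPdist_le/(_ _ d0) := ur; apply: filterS => n.
rewrite !sub0r !normrN !ger0_norm ?powR_ge0// => h.
apply: le_trans (powR_le (ltW q0) (u0 n) h) _.
by rewrite -powRrM mulVf ?gt_eqF// powRr1// ltW.
Qed.

Lemma Cmeas_pow a f : Cmeasurable f -> Cmeasurable (fun x => pow a (f x)).
Proof.
move=> fm; apply: CmeasM => //; apply: Cmeas_real.
by apply: (measurableT_comp (@measurable_powR R a)); exact: Cmeas_normc.
Qed.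

Lemma Cmeas_dpow a f g : Cmeasurable f -> Cmeasurable g -> Cmeasurable (fun x => dpow a (f x) (g x)).
Proof.
move=> fm gm; have [fr fi] := fm; have [gr gi] := gm.
apply: CmeasD.
  apply: CmeasM => //; apply: Cmeas_real.
  by apply: (measurableT_comp (@measurable_powR R a)); exact: Cmeas_normc.
apply: CmeasM; first exact: Cmeas_cst.
apply: CmeasM => //; apply: Cmeas_real; apply: measurable_funM.
  by apply: (measurableT_comp (@measurable_powR R _)); exact: Cmeas_sqr.
by apply: measurable_funD; exact: measurable_funM.
Qed.

Lemma dpow_le a m z w : 1 <= a -> 0 <= m -> normc z <= m ->
  normc (dpow a z w) <= (1 + a) * m `^ a * normc w.
Proof.
move=> a1 m0 zm; have a0 : 0 < a by lra.
have mz : normc z `^ a <= m `^ a by apply: powR_le; rewrite ?normc_ge0// ltW.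
apply: le_trans (le_normcD _ _) _; rewrite (normcM _ w) (normcM _ (Bq a z w)) !normcR.
rewrite (ger0_norm (powR_ge0 _ _)) (ger0_norm (ltW a0)) -mulrA mulrDl mul1r.
apply: lerD; first by rewrite ler_wpM2r ?normc_ge0.
rewrite ler_pM2l//; apply: le_trans (Bq_le z w a0) _.
by rewrite ler_wpM2r ?normc_ge0.
Qed.

Lemma pow_le a m z : 0 <= a -> 0 <= m -> normc z <= m -> normc (pow a z) <= m `^ a * normc z.
Proof.
move=> a0 m0 zm; rewrite normcM normcR ger0_norm ?powR_ge0// ler_wpM2r ?normc_ge0//.
by apply: powR_le; rewrite ?normc_ge0.
Qed.

Lemma pow_L2 a m f : 0 <= a -> 0 <= m -> L2 f -> {ae mu, forall x, normc (f x) <= m} ->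
  L2 (fun x => pow a (f x)).
Proof.
move=> a0 m0 fL fm; apply: (@L2_le _ _ (fun x => (m `^ a)%:C * f x)).
- by apply: Cmeas_pow; exact: L2meas.
- exact: L2Z.
- apply: (aeS fm) => x h; apply: le_trans (pow_le a0 m0 h) _.
  by rewrite normcM normcR ger0_norm ?powR_ge0.
Qed.

Lemma dpow_L2 a m f g : 1 <= a -> 0 <= m -> L2 f -> L2 g -> {ae mu, forall x, normc (f x) <= m} ->
  L2 (fun x => dpow a (f x) (g x)).
Proof.
move=> a1 m0 fL gL fm; apply: (@L2_le _ _ (fun x => ((1 + a) * m `^ a)%:C * g x)).
- by apply: Cmeas_dpow; exact: L2meas.
- exact: L2Z.
- apply: (aeS fm) => x h; apply: le_trans (dpow_le _ a1 m0 h) _.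
  by rewrite normcM normcR ger0_norm ?mulr_ge0 ?powR_ge0//; lra.
Qed.

(* [|z|^a] is replaced by [(|z|^2 + e)^(a/2)], which is smooth; then [e] tends to 0. *)
Lemma reg_WD a m (e : R) f g F : 1 <= a -> 0 <= m -> 0 < e -> e <= 1 -> WD f g -> cAC F g ->
  Cae_eq f F -> (forall x, normc (F x) <= m) ->
  let s x := normc (F x) ^+ 2 + e in
  WD (fun x => (s x `^ (a / 2))%:C * F x)
     (fun x => (s x `^ (a / 2))%:C * g x +
       (a / 2 * s x `^ (a / 2 - 1) * (2 * (re (F x) * re (g x) + im (F x) * im (g x))))%:C * F x).
Proof.
move=> a1 m0 e0 e1 W [Ar Ai] eF Fm s; have [fL gL _] := W.
have a20 : 0 < a / 2 by lra.
have cF : Cmeasurable F.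
  by have [c1 _ _] := Ar; have [c2 _ _] := Ai; split; exact: continuous_measurable_fun.
have FL := L2_ae fL cF eF.
have As : AC s (fun x => 2 * (re (F x) * re (g x) + im (F x) * im (g x))).
  have := ACD (ACD (AC_mul Ar Ar) (AC_mul Ai Ai)) (AC_cst e).
  by congr AC; apply: funext => x; rewrite /s ?normcE2; ring.
have [cs si _] := As.
have s0 x : 0 < s x by rewrite /s ltr_wpDl ?sqr_ge0.
have cp p : continuous (fun x => s x `^ p).
  move=> x; apply: (continuous_comp (g := fun r : R => r `^ p)); first exact: cs.
  exact: powR_cont.
have Aw : AC (fun x => s x `^ (a / 2)) (fun x => (a / 2 * s x `^ (a / 2 - 1)) *
   (2 * (re (F x) * re (g x) + im (F x) * im (g x)))).
  apply: (AC_comp (h := fun r => r `^ (a / 2)) (h1 := fun r => a / 2 * r `^ (a / 2 - 1)) As (cp _)).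
    by move=> x; apply: cvgM; [exact: cvg_cst|exact: cp].
  move=> x y; have [M M0 HM] := @cont_bounded R s x y cs.
  have [C C0 HC] := @powR_taylor R (a / 2) e M e0; exists C => // u v uin vin.
  apply: HC.
  - rewrite /s lerDr sqr_ge0 /=; apply: le_trans (HM u uin); exact: ler_norm.
  - rewrite /s lerDr sqr_ge0 /=; apply: le_trans (HM v vin); exact: ler_norm.
have sK x : s x `^ (a / 2) <= (m ^+ 2 + 1) `^ (a / 2).
  apply: powR_le; [exact: ltW|exact: ltW|rewrite /s].
  by apply: lerD => //; apply: sqr_mono; rewrite ?normc_ge0.
pose K := (m ^+ 2 + 1) `^ (a / 2).
have ms p : measurable_fun setT (fun x => s x `^ p).
  by apply: continuous_measurable_fun; exact: cp.
have L1 : L2 (fun x => (s x `^ (a / 2))%:C * F x).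
  apply: (@L2M_bnd _ K) => //; first exact: Cmeas_real.
  by move=> x; rewrite normcR ger0_norm ?powR_ge0.
have [Fr Fi] := cF; have [[gr gi] _] := gL.
have L2' : L2 (fun x => (a / 2 * s x `^ (a / 2 - 1) *
      (2 * (re (F x) * re (g x) + im (F x) * im (g x))))%:C * F x).
  apply: (@L2_le _ _ (fun x => (a * K)%:C * g x)).
  - apply: CmeasM => //; apply: Cmeas_real; apply: measurable_funM.
      by apply: measurable_funM; [exact: measurable_cst|exact: ms].
    apply: measurable_funM; first exact: measurable_cst.
    by apply: measurable_funD; exact: measurable_funM.
  - exact: L2Z.
  apply: aeT => x; have K0 : 0 <= K by exact: powR_ge0.
  rewrite !normcM !normcR [`|a * K|]ger0_norm; last by rewrite mulr_ge0//; lra.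
  rewrite (_ : a / 2 * _ * _ = a * (s x `^ (a / 2 - 1) *
     (re (F x) * re (g x) + im (F x) * im (g x)))); last by field.
  rewrite !normrM (ger0_norm (powR_ge0 _ _)) ger0_norm; last lra.
  rewrite -!mulrA; apply: ler_wpM2l; first lra.
  have h := reim_le (F x) (g x).
  apply: (@le_trans _ _ (s x `^ (a / 2 - 1) * (s x * normc (g x)))); last first.
    by rewrite mulrA ler_wpM2r ?normc_ge0// mulrC (mulr_powRB1 (ltW (s0 x)) a20).
  apply: ler_wpM2l; first exact: powR_ge0.
  apply: le_trans (ler_wpM2r (normc_ge0 _) h) _.
  rewrite mulrAC -expr2 ler_wpM2r ?normc_ge0// /s lerDl; exact: ltW.
have GL := L2D (@L2M_bnd _ K _ _ (Cmeas_real (ms (a / 2))) gL (fun x => _)) L2'.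
have {}GL : L2 (fun x => (s x `^ (a / 2))%:C * g x +
       (a / 2 * s x `^ (a / 2 - 1) * (2 * (re (F x) * re (g x) + im (F x) * im (g x))))%:C * F x).
  by apply: GL => x; rewrite normcR ger0_norm ?powR_ge0.
apply: (rep_WD L1 GL _ (@ae_eq_refl _ _ _)); split.
- have := AC_mul Aw Ar; congr AC; apply: funext => x; rewrite !reimE /=; ring.
- have := AC_mul Aw Ai; congr AC; apply: funext => x; rewrite !reimE /=; ring.
Qed.

Lemma WD_pow a f g : 1 <= a -> WD f g ->
  WD (fun x => pow a (f x)) (fun x => dpow a (f x) (g x)).
Proof.
move=> a1 W; have [fL gL _] := W; have [F [AF eF]] := WD_rep W.
have a0 : 0 < a by lra. have a20 : 0 < a / 2 by lra.
pose m := Num.sqrt (2 * (nr f * nr g)).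
have m0 : 0 <= m by exact: sqrtr_ge0.
have k0 : 0 <= 2 * (nr f * nr g) by rewrite !mulr_ge0 ?nr_ge0.
have Fm x : normc (F x) <= m.
  rewrite -(@ler_pXn2r _ 2)// ?nnegrE ?normc_ge0// sqr_sqrtr//.
  exact: sobolev W AF eF x.
have cF : Cmeasurable F.
  by have [[c1 _ _] [c2 _ _]] := AF; split; exact: continuous_measurable_fun.
have FL := L2_ae fL cF eF.
pose e n : R := n.+1%:R^-1.
have e0 n : 0 < e n by rewrite invr_gt0.
have e1 n : e n <= 1 by rewrite invf_le1// ler1n.
have ec : e @ \oo --> (0 : R) by exact: cvg_harmonic.
pose s n x := normc (F x) ^+ 2 + e n.
have s0 n x : 0 < s n x by rewrite ltr_wpDl ?sqr_ge0.
have sc x : (fun n => s n x) @ \oo --> normc (F x) ^+ 2.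
  by rewrite -[X in _ --> X]addr0; apply: cvgD => //; exact: cvg_cst.
pose K := (m ^+ 2 + 1) `^ (a / 2); have K0 : 0 <= K by exact: powR_ge0.
have sK n x : s n x `^ (a / 2) <= K.
  apply: powR_le; [exact: ltW|exact: ltW|rewrite /s].
  by apply: lerD => //; apply: sqr_mono; rewrite ?normc_ge0.
have FK x : normc (F x) `^ a <= K.
  rewrite -sqr_powR//; apply: powR_le; [exact: ltW|exact: sqr_ge0|].
  rewrite -[X in X <= _]addr0; apply: lerD => //; apply: sqr_mono => //; exact: normc_ge0.
have wc x : (fun n => s n x `^ (a / 2)) @ \oo --> normc (F x) `^ a.
  rewrite -sqr_powR//; apply: powR_cvgn => //; first exact: sqr_ge0.
  by move=> n; exact: ltW.
pose ip1 x := re (F x) * re (g x) + im (F x) * im (g x).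
pose X n x : R[i] := (s n x `^ (a / 2))%:C * F x.
pose Y n x : R[i] := (s n x `^ (a / 2))%:C * g x +
       (a / 2 * s n x `^ (a / 2 - 1) * (2 * ip1 x))%:C * F x.
have WX n : WD (X n) (Y n) := reg_WD a1 m0 (e0 n) (e1 n) W AF eF Fm.
have pL : L2 (fun x => pow a (F x)) by apply: (@pow_L2 a m) => //; [exact: ltW|exact: aeT].
have dL : L2 (fun x => dpow a (F x) (g x)) by apply: (@dpow_L2 a m) => //; exact: aeT.
have d1 x n : `|s n x `^ (a / 2) - normc (F x) `^ a| <= K.
  have h1 := sK n x; have h2 := FK x.
  have h3 := powR_ge0 (s n x) (a / 2); have h4 := powR_ge0 (normc (F x)) a.
  by rewrite ler_norml; lra.
have q1 x n : X n x - pow a (F x) = (s n x `^ (a / 2) - normc (F x) `^ a)%:C * F x.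
  by rewrite /X /pow rmorphB /= mulrBl.
have c1 x : (fun n => `|s n x `^ (a / 2) - normc (F x) `^ a|) @ \oo --> (0 : R).
  rewrite -(normr0 R) -(subrr (normc (F x) `^ a)); apply: cvg_norm.
  by apply: cvgB => //; exact: cvg_cst.
have l1 : L2lim X (fun x => pow a (F x)).
  apply: (@L2_dct _ _ _ (fun x => K%:C * F x)) => //.
  - by move=> n; have [] := WX n.
  - exact: L2Z.
  - move=> n x; rewrite q1 !normcM !normcR ler_wpM2r ?normc_ge0//.
    by rewrite (ger0_norm K0); exact: d1.
  - move=> x; under eq_fun do rewrite q1 normcM normcR.
    by rewrite -(mul0r (normc (F x))); apply: cvgM; [exact: c1|exact: cvg_cst].
have q2 x n : Y n x - dpow a (F x) (g x) = (s n x `^ (a / 2) - normc (F x) `^ a)%:C * g x +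
   a%:C * ((s n x `^ (a / 2 - 1) * ip1 x)%:C * F x - Bq a (F x) (g x)).
  rewrite /Y /dpow rmorphB /=.
  have -> : a / 2 * s n x `^ (a / 2 - 1) * (2 * ip1 x) = a * (s n x `^ (a / 2 - 1) * ip1 x) by field.
  rewrite (rmorphM _ a) /=.
  move: (Bq _ _ _) ((s n x `^ (a / 2))%:C) ((normc (F x) `^ a)%:C) (_%:C) (_%:C) => *; ring.
(* For $a<2$ the power $s^{a/2-1}$ is unbounded as $F$ tends to 0; the two factors $F$ restore
   $s^{a/2}$ because $|F|^2\le s$. *)
have b1 n x : normc ((s n x `^ (a / 2 - 1) * ip1 x)%:C * F x) <= K * normc (g x).
  rewrite normcM normcR normrM (ger0_norm (powR_ge0 _ _)).
  have h := reim_le (F x) (g x).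
  apply: (@le_trans _ _ (s n x `^ (a / 2 - 1) * (s n x * normc (g x)))); last first.
    rewrite mulrA ler_wpM2r ?normc_ge0// mulrC (mulr_powRB1 (ltW (s0 n x)) a20); exact: sK.
  rewrite -mulrA; apply: ler_wpM2l; first exact: powR_ge0.
  apply: le_trans (ler_wpM2r (normc_ge0 _) h) _.
  rewrite mulrAC -expr2 ler_wpM2r ?normc_ge0// /s lerDl; exact: ltW.
have b2 x : normc (Bq a (F x) (g x)) <= K * normc (g x).
  by apply: le_trans (Bq_le _ _ a0) _; rewrite ler_wpM2r ?normc_ge0.
(* At a zero of [F] both terms vanish for every [n]; elsewhere the power is continuous at the
   positive number $|F|^2$. *)
have c2 x : (fun n => normc ((s n x `^ (a / 2 - 1) * ip1 x)%:C * F x - Bq a (F x) (g x)))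
    @ \oo --> (0 : R).
  have [F0|F0] := eqVneq (F x) 0.
    rewrite (_ : (fun n => _) = fun=> 0); first exact: cvg_cst.
    by apply: funext => n; rewrite /Bq F0 !mulr0 subrr normc0.
  have p : 0 < normc (F x) ^+ 2.
    by rewrite exprn_gt0// lt_neqAle eq_sym normc_neq0// normc_ge0.
  rewrite (_ : (fun n => _) = fun n => `|s n x `^ (a / 2 - 1) - (normc (F x) ^+ 2) `^ (a / 2 - 1)| * (`|ip1 x| * normc (F x))).
    rewrite -(mul0r (`|ip1 x| * normc (F x))); apply: cvgM; last exact: cvg_cst.
    rewrite -(normr0 R) -(subrr ((normc (F x) ^+ 2) `^ (a / 2 - 1))); apply: cvg_norm.
    apply: cvgB; last exact: cvg_cst.
    exact: (cvg_comp _ _ (sc x) (powR_cont (q := a / 2 - 1) p)).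
  apply: funext => n; rewrite /Bq -mulrBl -rmorphB /= -mulrBl normcM normcR normrM mulrA.
  by [].
have l2 : L2lim Y (fun x => dpow a (F x) (g x)).
  apply: (@L2_dct _ _ _ (fun x => ((1 + 2 * a) * K)%:C * g x)) => //.
  - by move=> n; have [] := WX n.
  - exact: L2Z.
  - move=> n x; rewrite q2; apply: le_trans (le_normcD _ _) _.
    rewrite (normcM _ (g x)) (normcM _ (_ - _)) [leRHS]normcM !normcR (ger0_norm (ltW a0)).
    rewrite [`|_ * K|]ger0_norm; last by rewrite mulr_ge0//; lra.
    rewrite -mulrA mulrDl mul1r; apply: lerD; first by rewrite ler_wpM2r ?normc_ge0.
    rewrite -mulrA mulrCA ler_wpM2l//; first lra.
    by apply: le_trans (le_normcB _ _) _; rewrite mulr_natl mulr2n; apply: lerD.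
  - move=> x; apply: (@squeeze_cvgr _ _ _ _ (fun=> 0)
      (fun n => `|s n x `^ (a / 2) - normc (F x) `^ a| * normc (g x) +
        a * normc ((s n x `^ (a / 2 - 1) * ip1 x)%:C * F x - Bq a (F x) (g x)))).
    + apply: nearW => n; rewrite normc_ge0 /= q2; apply: le_trans (le_normcD _ _) _.
      by rewrite (normcM _ (g x)) (normcM _ (_ - _)) !normcR (ger0_norm (ltW a0)).
    + exact: cvg_cst.
    + rewrite -(addr0 (0 : R)); apply: cvgD.
        by rewrite -(mul0r (normc (g x))); apply: cvgM; [exact: c1|exact: cvg_cst].
      by rewrite -(mulr0 a); apply: cvgM; [exact: cvg_cst|exact: c2].
have WL := WD_lim WX pL dL l1 l2.
have mf := L2meas fL.
apply: (WD_ae WL).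
- by apply: (L2_ae pL (Cmeas_pow a mf)); apply: (aeS eF) => x ->.
- by apply: (L2_ae dL (Cmeas_dpow a mf (L2meas gL))); apply: (aeS eF) => x ->.
- by apply: (aeS eF) => x ->.
- by apply: (aeS eF) => x ->.
Qed.

Lemma sup_H1 f g : WD f g -> {ae mu, forall x, normc (f x) <= Num.sqrt (2 * (nr f * nr g))}.
Proof.
move=> W; have [F [AF eF]] := WD_rep W; apply: (aeS eF) => x ->.
have k0 : 0 <= 2 * (nr f * nr g) by rewrite !mulr_ge0 ?nr_ge0.
rewrite -(@ler_pXn2r _ 2)// ?nnegrE ?normc_ge0 ?sqrtr_ge0// sqr_sqrtr//.
exact: sobolev W AF eF x.
Qed.

End PowerWeakDerivative.

(** * Lipschitz estimates for the nonlinearity in the weighted norms *)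

Section Nonlinearity.
Context {R : realType} {N : nat} (d : 'I_N.+1 -> R[i]) (alpha : 'I_N.+1 -> R).
Hypothesis alpha_ge1 : forall k, 1 <= alpha k.
Local Notation mu := (@lebesgue_measure R).
Local Notation nl := (nonlinearity d alpha).
Implicit Types (f g h F G : R -> R[i]) (z w : R[i]) (m : R).

Lemma Cae_eqB f f' g g' : Cae_eq f f' -> Cae_eq g g' ->
  Cae_eq (fun x => f x - g x) (fun x => f' x - g' x).
Proof. by move=> e1 e2; apply: (aeS2 e1 e2) => x -> ->. Qed.

Lemma normc_sum (I : Type) (r : seq I) (F : I -> R[i]) :
  normc (\sum_(k <- r) F k) <= \sum_(k <- r) normc (F k).
Proof.
elim: r => [|k r IH]; first by rewrite !big_nil normc0.
by rewrite !big_cons (le_trans (le_normcD _ _))// lerD2l.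
Qed.

Lemma nlE f x : nl f x = \sum_(k < N.+1) d k * pow (alpha k) (f x).
Proof.
by rewrite /nonlinearity mulr_suml; apply: eq_bigr => k _; rewrite /pow mulrA.
Qed.

(* [dnl] is the differential of the nonlinearity; on the disc of radius [m], [KK m] and [K1 m]
   are Lipschitz constants of the nonlinearity and of its differential. *)
Definition dnl z w := \sum_(k < N.+1) d k * dpow (alpha k) z w.
Definition KK m := \sum_(k < N.+1) normc (d k) * cpow (alpha k) * m `^ alpha k.
Definition K1 m := \sum_(k < N.+1) normc (d k) * cpow (alpha k) * m `^ (alpha k - 1).

Lemma cpow_ge0 k : 0 <= cpow (alpha k).
Proof.
rewrite /cpow; have := alpha_ge1 k; move: (alpha k) => a a1.
by have := sqr_ge0 a; lra.
Qed.

Lemma KK_ge0 m : 0 <= KK m.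
Proof.
apply: sumr_ge0 => k _; rewrite !mulr_ge0 ?powR_ge0 ?normc_ge0//; exact: cpow_ge0.
Qed.

Lemma K1_ge0 m : 0 <= K1 m.
Proof.
apply: sumr_ge0 => k _; rewrite !mulr_ge0 ?powR_ge0 ?normc_ge0//; exact: cpow_ge0.
Qed.

Lemma K1M m : 0 <= m -> K1 m * m = KK m.
Proof.
move=> m0; rewrite mulr_suml; apply: eq_bigr => k _.
by rewrite -!mulrA [_ * m]mulrC mulr_powRB1//; have := alpha_ge1 k; lra.
Qed.

Lemma nl_lip m f g x : 0 < m -> normc (f x) <= m -> normc (g x) <= m ->
  normc (nl f x - nl g x) <= KK m * normc (f x - g x).
Proof.
move=> m0 fm gm; rewrite !nlE -sumrB mulr_suml; apply: le_trans (normc_sum _ _) _.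
apply: ler_sum => k _; rewrite -mulrBr normcM -!mulrA ler_wpM2l ?normc_ge0//.
exact: pow_lip.
Qed.

Lemma dnl_lip m z w z' w' : 0 < m -> normc z <= m -> normc z' <= m ->
  normc (dnl z w - dnl z' w') <=
  KK m * normc (w - w') + K1 m * (normc (z - z') * normc w').
Proof.
move=> m0 zm zm'; rewrite /dnl -sumrB !mulr_suml -big_split /=.
apply: le_trans (normc_sum _ _) _; apply: ler_sum => k _.
rewrite -mulrBr normcM -!mulrA -!mulrDr ler_wpM2l ?normc_ge0//.
exact: dpow_lip.
Qed.

Lemma nl0 f x : f x = 0 -> nl f x = 0.
Proof. by move=> fx; rewrite /nonlinearity fx mulr0. Qed.

Lemma nl_ae f g : Cae_eq f g -> Cae_eq (nl f) (nl g).
Proof. by move=> e; apply: (aeS e) => x h; rewrite /nonlinearity h. Qed.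

Lemma nl_gauge (th : R -> R) f : nl (fun x => cis (th x) * f x) = fun x => cis (th x) * nl f x.
Proof.
apply: funext => x; rewrite /nonlinearity; under eq_bigr do rewrite normcM normc_cis mul1r.
by rewrite mulrCA.
Qed.

Lemma WD_sum (I : Type) (r : seq I) (F G : I -> R -> R[i]) : (forall k, WD (F k) (G k)) ->
  WD (fun x => \sum_(k <- r) F k x) (fun x => \sum_(k <- r) G k x).
Proof.
move=> W; elim: r => [|k r IH].
  by have := @WD0 R; congr WD; apply: funext => x; rewrite big_nil.
by have := WDD (W k) IH; congr WD; apply: funext => x; rewrite big_cons.
Qed.

Lemma WD_nl f g : WD f g -> WD (nl f) (fun x => dnl (f x) (g x)).
Proof.
move=> W; have := @WD_sum _ (index_enum 'I_N.+1) (fun k x => d k * pow (alpha k) (f x))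
  (fun k x => d k * dpow (alpha k) (f x) (g x)) (fun k => WDZ _ (WD_pow (alpha_ge1 k) W)).
by congr WD; apply: funext => x; rewrite nlE.
Qed.

Lemma nr_le1 (A : R) h u : 0 <= A -> L2 h -> L2 u ->
  {ae mu, forall x, normc (h x) <= A * normc (u x)} -> nr h <= A * nr u.
Proof.
move=> A0 hL uL H; rewrite -[A in _ <= A * _]ger0_norm// -normcR -nrZ//.
apply: nr_le => //; first exact: L2Z.
by apply: (aeS H) => x; rewrite normcM normcR ger0_norm.
Qed.

Lemma nr_le2 (A B : R) h u v : 0 <= A -> 0 <= B -> L2 h -> L2 u -> L2 v ->
  {ae mu, forall x, normc (h x) <= A * normc (u x) + B * normc (v x)} ->
  nr h <= A * nr u + B * nr v.
Proof.
move=> A0 B0 hL uL vL H.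
have nL (k : R -> R[i]) : L2 k -> L2 (fun x => (normc (k x))%:C) /\ nr (fun x => (normc (k x))%:C) = nr k.
  move=> kL; have mk : Cmeasurable (fun x => (normc (k x))%:C).
    by apply: Cmeas_real; apply: Cmeas_normc; exact: L2meas.
  have e : {ae mu, forall x, normc ((normc (k x))%:C) = normc (k x)}.
    by apply: aeT => x; rewrite normcR ger0_norm ?normc_ge0.
  split; last by apply: nr_eq => //; exact: L2meas.
  by apply: (L2_le mk kL); apply: (aeS e) => x ->.
have [u1 u2] := nL u uL; have [v1 v2] := nL v vL.
have S := L2D (L2Z A%:C u1) (L2Z B%:C v1).
apply: (@le_trans _ _ (nr (fun x => A%:C * (normc (u x))%:C + B%:C * (normc (v x))%:C))).
  apply: nr_le => //; apply: (aeS H) => x h1; apply: le_trans h1 _.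
  rewrite -!rmorphM -rmorphD /= normcR; exact: ler_norm.
apply: le_trans (nrD (L2Z A%:C u1) (L2Z B%:C v1)) _.
by rewrite !nrZ// u2 v2 !normcR !ger0_norm.
Qed.

(** The sup norm of [f1 - f2] is kept as a parameter [M]: in the decay estimate it carries a factor
    $(1+bt)^{-1/2}$ of its own. *)
Lemma nl_est m (M : R) f1 g1 f2 g2 : 0 < m -> 0 <= M -> WD f1 g1 -> WD f2 g2 ->
  {ae mu, forall x, normc (f1 x) <= m} -> {ae mu, forall x, normc (f2 x) <= m} ->
  {ae mu, forall x, normc (f1 x - f2 x) <= M} ->
  nr (fun x => nl f1 x - nl f2 x) <= KK m * nr (fun x => f1 x - f2 x) /\
  nr (fun x => dnl (f1 x) (g1 x) - dnl (f2 x) (g2 x)) <=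
    KK m * nr (fun x => g1 x - g2 x) + K1 m * M * nr g2.
Proof.
move=> m0 M0 W1 W2 m1 m2 m12; have [f1L g1L _] := W1; have [f2L g2L _] := W2.
have [n1 d1 _] := WD_nl W1; have [n2 d2 _] := WD_nl W2; split.
  apply: nr_le1; [exact: KK_ge0|exact: L2B|exact: L2B|].
  by apply: (aeS2 m1 m2) => x; exact: nl_lip.
apply: nr_le2; [exact: KK_ge0|by rewrite mulr_ge0 ?K1_ge0|exact: L2B|exact: L2B|exact: g2L|].
apply: (aeS2 (aeS2 m1 m2 (fun x => @conj _ _)) m12) => x [h1 h2] h3.
apply: le_trans (dnl_lip _ _ m0 h1 h2) _; rewrite lerD2l -mulrA.
by rewrite ler_wpM2l ?K1_ge0// ler_wpM2r ?normc_ge0.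
Qed.

Lemma nl_x m b f1 f2 : 0 < m -> P b f1 -> P b f2 -> L2 (nl f1) -> L2 (nl f2) ->
  {ae mu, forall x, normc (f1 x) <= m} -> {ae mu, forall x, normc (f2 x) <= m} ->
  L2 (fun x => (b * x)%:C * (nl f1 x - nl f2 x)) /\
  nr (fun x => (b * x)%:C * (nl f1 x - nl f2 x)) <=
    KK m * nr (fun x => (b * x)%:C * (f1 x - f2 x)).
Proof.
move=> m0 P1 P2 n1 n2 m1 m2; have xL := P_xL2 (PB P1 P2).
have mx := x_meas b (L2meas (L2B n1 n2)).
have H : {ae mu, forall x, normc ((b * x)%:C * (nl f1 x - nl f2 x)) <=
    KK m * normc ((b * x)%:C * (f1 x - f2 x))}.
  apply: (aeS2 m1 m2) => x h1 h2; rewrite !normcM mulrCA ler_wpM2l ?normc_ge0//.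
  exact: nl_lip.
have L : L2 (fun x => (b * x)%:C * (nl f1 x - nl f2 x)).
  apply: (L2_le mx (L2Z (KK m)%:C xL)); apply: (aeS H) => x h; apply: le_trans h _.
  by rewrite [leRHS]normcM normcR ger0_norm ?KK_ge0.
by split => //; apply: nr_le1 => //; exact: KK_ge0.
Qed.

Lemma sup_bound f g (A B : R) : WD f g -> nr f <= A -> nr g <= B ->
  {ae mu, forall x, normc (f x) <= Num.sqrt (2 * (A * B))}.
Proof.
move=> W fA gB; apply: (aeS (sup_H1 W)) => x h; apply: le_trans h _.
by apply: ler_wsqrtr; rewrite ler_wpM2l// ler_pM ?nr_ge0.
Qed.

Lemma P_nl b f : P b f -> P b (nl f).
Proof.
move=> Pf; have W := P_D Pf; have Wn := WD_nl W; split; first exact: WD_H1 Wn.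
have [nL _ _] := Wn; have [zL _ _] := WD_nl (@WD0 R).
pose m := Num.sqrt (2 * (nr f * nr (D f))) + 1.
have m0 : 0 < m by rewrite ltr_wpDl ?sqrtr_ge0.
have [] := nl_x m0 Pf (P_zero b) nL zL.
- by apply: (aeS (sup_H1 W)) => x h; apply: le_trans h _; rewrite lerDl.
- by apply: aeT => x; rewrite normc0 ltW.
- by move=> L _; move: L; congr L2; apply: funext => x; rewrite [nl (fun=> 0) x]nl0// subr0.
Qed.

Definition G (t : R) f := schrodinger (- t) (nl (schrodinger t f)).

Lemma P_G b t f : P b f -> P b (G t f).
Proof. by move=> Pf; apply: S_P; apply: P_nl; exact: S_P. Qed.

Lemma S_G t f : H1 f -> Cae_eq (schrodinger t (G t f)) (nl (schrodinger t f)).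
Proof.
move=> /P0 Pf; exact: S_NK (P_L2 (P_nl (S_P t Pf))).
Qed.

Lemma G_ae t f g : H1 f -> H1 g -> Cae_eq f g -> Cae_eq (G t f) (G t g).
Proof.
move=> /P0 Pf /P0 Pg e; apply: S_ae.
- exact: P_L2 (P_nl (S_P t Pf)).
- exact: P_L2 (P_nl (S_P t Pg)).
- by apply: nl_ae; apply: S_ae => //; [exact: P_L2 Pf|exact: P_L2 Pg].
Qed.

Lemma G_zero t : Cae_eq (G t (fun=> 0)) (fun=> 0).
Proof.
have z : Cae_eq (schrodinger t (fun=> 0 : R[i])) (fun=> 0).
  have := S_Z t 0 (@L2_0 R); rewrite (_ : (fun x : R => 0 * 0) = fun=> 0); last first.
    by apply: funext => x; rewrite mulr0.
  by move=> h; apply: (aeS h) => x ->; rewrite mul0r.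
have e : Cae_eq (nl (schrodinger t (fun=> 0))) (fun=> 0).
  by apply: (aeS z) => x h; rewrite nl0.
have nL := P_L2 (P_nl (S_P t (P_zero 0))).
apply: (ae_eq_trans (S_ae (- t) nL (@L2_0 R) e)).
have := S_Z (- t) 0 (@L2_0 R); rewrite (_ : (fun x : R => 0 * 0) = fun=> 0); last first.
  by apply: funext => x; rewrite mulr0.
by move=> h; apply: (aeS h) => x ->; rewrite mul0r.
Qed.

(** Since $s\ge1$, each power $s^{-\alpha_k/2}$ is at most the one with the smallest exponent, so
    one rate serves all terms of the nonlinearity. *)
Lemma KK_scale (M s : R) : 0 <= M -> 1 <= s -> (forall k, alpha ord0 <= alpha k) ->
  KK (M / Num.sqrt s) <= KK M * s `^ (- (alpha ord0 / 2)).
Proof.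
move=> M0 s1 am; have s0 : 0 < s by lra.
rewrite mulr_suml; apply: ler_sum => k _; rewrite -[leRHS]mulrA.
apply: ler_wpM2l; first by rewrite mulr_ge0 ?normc_ge0 ?cpow_ge0.
rewrite powRM// ?invr_ge0 ?sqrtr_ge0// ler_wpM2l ?powR_ge0//.
rewrite -powR12_sqrt ?(ltW s0)// -powRN -powRrM; apply: ler_powR => //.
by have := am k; lra.
Qed.

(** Each component of [nu] is estimated by [nl_est], where the sup norms come from Agmon's
    inequality after the lens transformation. The function itself contributes once [KK m * n12], the
    components [J] and [D] twice, since the derivative of a product also falls on the solution;
    hence the factor 5. *)
Lemma G_lip b t (M : R) f1 f2 : 0 <= b -> 0 <= b * t -> 0 < M ->
  (forall k, alpha ord0 <= alpha k) ->
  P b f1 -> P b f2 -> nu b f1 <= M -> nu b f2 <= M ->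
  nu b (fun x => G t f1 x - G t f2 x) <=
  5 * KK (2 * M) * (1 + b * t) `^ (- (alpha ord0 / 2)) * nu b (fun x => f1 x - f2 x).
Proof.
move=> b0 bt M0 am P1 P2 f1M f2M.
pose s := 1 + b * t; have s1 : 1 <= s by rewrite lerDl.
have s0 : 0 < s by apply: lt_le_trans s1.
have q0 : 0 < Num.sqrt s by rewrite sqrtr_gt0.
pose m := 2 * M / Num.sqrt s; have m0 : 0 < m by rewrite divr_gt0// mulr_gt0.
have P12 := PB P1 P2; set n12 := nu b (fun x => f1 x - f2 x).
have n120 : 0 <= n12 by exact: nu_ge0.
pose m12 := 2 * n12 / Num.sqrt s.
have m120 : 0 <= m12 by rewrite divr_ge0 ?mulr_ge0// ltW.
pose ph x := kap b t * x ^+ 2.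
pose u f := schrodinger t f; pose v f x := cis (ph x) * schrodinger t f x.
(* After the phase, Agmon's inequality gives $|u|^2\le2A\cdot A/s$; the square root of 2 is rounded
   up to 2. *)
have sup (A : R) f v' : 0 <= A -> P b f -> nu b f <= A -> WD (v f) v' -> nr v' = s^-1 * nr (J b f) ->
    {ae mu, forall x, normc (u f x) <= 2 * A / Num.sqrt s}.
  move=> A0 Pf fA W e; have [h1 h2 _] := nr_nu f b0.
  have vA : nr (v f) <= A.
    by rewrite /v nrcis S_nr ?(le_trans h1)//; exact: P_L2 Pf.
  have v'A : nr v' <= A / s by rewrite e mulrC ler_wpM2r ?invr_ge0 ?(ltW s0)// (le_trans h2).
  apply: (aeS (sup_bound W vA v'A)) => x.
  rewrite normcM normc_cis mul1r; move/le_trans; apply.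
  rewrite -(@ler_pXn2r _ 2)// ?nnegrE ?sqrtr_ge0//; last first.
    by rewrite divr_ge0 ?mulr_ge0// ltW.
  rewrite sqr_sqrtr; last by rewrite !mulr_ge0// invr_ge0 ltW.
  rewrite expr_div_n (sqr_sqrtr (ltW s0)).
  have -> : 2 * (A * (A / s)) = 2 * A ^+ 2 / s by ring.
  have -> : (2 * A) ^+ 2 = 4 * A ^+ 2 by ring.
  by rewrite ler_wpM2r ?invr_ge0 ?(ltW s0)// ler_wpM2r ?sqr_ge0// ler_nat.
have [v1' [W1 e1]] := lens P1 s0; have [v2' [W2 e2]] := lens P2 s0.
have [v12' [W12 e12]] := lens P12 s0.
have b1 := sup M f1 v1' (ltW M0) P1 f1M W1 e1; have b2 := sup M f2 v2' (ltW M0) P2 f2M W2 e2.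
have b12 := sup n12 _ v12' n120 P12 (lexx _) W12 e12.
have SB := S_B t (P_L2 P1) (P_L2 P2).
have b12' : {ae mu, forall x, normc (u f1 x - u f2 x) <= m12}.
  by apply: (aeS2 b12 SB) => x; rewrite /u => + <-.
have Pu1 := S_P t P1; have Pu2 := S_P t P2.
have Pn1 := P_nl Pu1; have Pn2 := P_nl Pu2.
have PG1 := P_G t P1; have PG2 := P_G t P2; have PY := PB PG1 PG2.
have [E1 E2] := nl_est m0 m120 (P_D Pu1) (P_D Pu2) b1 b2 b12'.
have [j1 j2 j3] := nr_nu (fun x => f1 x - f2 x) b0; rewrite -/n12 in j1 j2 j3.
have [l1 l2 l3] := nr_nu f2 b0.
have nu12 : nr (fun x => u f1 x - u f2 x) <= n12.
  apply: (nr_ae_le (P_L2 (PB Pu1 Pu2)) (S_L2 t (P_L2 P12)) (ae_eq_sym SB)).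
  by rewrite (S_nr t (P_L2 P12)).
have KS : KK m <= KK (2 * M) * (1 + b * t) `^ (- (alpha ord0 / 2)).
  by apply: KK_scale => //; rewrite mulr_ge0// ltW.
have fin (x y z n : R) : x <= y * z -> 0 <= n -> 5 * (x * n) <= 5 * y * z * n.
  by move=> h n0; rewrite -!mulrA ler_wpM2l// mulrA ler_wpM2r.
have two (X : R) : 2 * X = X + X by ring.
have KM0 : 0 <= K1 m * m12 by exact: mulr_ge0 (K1_ge0 m) m120.
(* [m] and [m12] carry the same factor $2/\sqrt s$, so [m12 * M = m * n12], and one power of [m]
   turns [K1] into [KK]. *)
have KM : K1 m * m12 * M = KK m * n12.
  by rewrite -(K1M (ltW m0)) -!mulrA; congr (_ * _); rewrite /m12 /m; field; rewrite gt_eqF.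
have le_KM x : x <= M -> K1 m * m12 * x <= KK m * n12.
  by move=> h; rewrite -KM; apply: ler_wpM2l.
have le_KM' x : x <= (1 + b) * M -> K1 m * m12 * x <= (1 + b) * (KK m * n12).
  by move=> h; rewrite -KM [leRHS]mulrCA; apply: ler_wpM2l.
have SY : Cae_eq (schrodinger t (fun x => G t f1 x - G t f2 x)) (fun x => nl (u f1) x - nl (u f2) x).
  apply: (ae_eq_trans (S_B t (P_L2 PG1) (P_L2 PG2))).
  exact: Cae_eqB (S_G t P1.1) (S_G t P2.1).
have K0 := KK_ge0 m.
have a1 : nr (fun x => G t f1 x - G t f2 x) <= KK m * n12.
  rewrite -(S_nr t (P_L2 PY)).
  apply: (nr_ae_le (S_L2 t (P_L2 PY)) (P_L2 (PB Pn1 Pn2)) SY).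
  exact: le_trans E1 (ler_wpM2l K0 nu12).
(* Gauge invariance makes the nonlinearity commute with the lens phase. All derivatives after the
   phase carry the factor $s^{-1}$, which cancels against the $s$ that converts back to [J]. *)
have a2 : nr (J b (fun x => G t f1 x - G t f2 x)) <= 2 * (KK m * n12).
  have [y [Wy ey]] := lens PY s0; rewrite -/s in ey e1 e2 e12.
  have -> : nr (J b (fun x => G t f1 x - G t f2 x)) = s * nr y.
    by rewrite ey mulrA divff ?mul1r// gt_eqF.
  have Wn := WDB (WD_nl W1) (WD_nl W2).
  have ev : Cae_eq (fun x => cis (kap b t * x ^+ 2) * schrodinger t (fun x => G t f1 x - G t f2 x) x)
     (fun x => nl (v f1) x - nl (v f2) x).
    have g1 f : nl (v f) = fun x => cis (ph x) * nl (u f) x := nl_gauge _ _.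
    apply: (aeS SY) => x h; rewrite (g1 f1) (g1 f2) -[RHS]mulrBr; congr (_ * _); exact: h.
  have ey' := WD_uniq Wy Wn ev; have [_ yL _] := Wy; have [_ nL _] := Wn.
  rewrite {yL nL ey'}(nr_aeL yL nL ey' : nr y = _).
  have bv f r : {ae mu, forall x, normc (u f x) <= r} -> {ae mu, forall x, normc (v f x) <= r}.
    by move=> h; apply: (aeS h) => x; rewrite /v normcM normc_cis mul1r.
  have bv12 : {ae mu, forall x, normc (v f1 x - v f2 x) <= m12}.
    by apply: (aeS b12') => x; rewrite /v -mulrBr normcM normc_cis mul1r.
  have [_ F2] := nl_est m0 m120 W1 W2 (bv _ _ b1) (bv _ _ b2) bv12.
  have ed : nr (fun x => v1' x - v2' x) = nr v12'.
    have W' := WDB W1 W2; have [_ w1 _] := W'; have [_ w2 _] := W12.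
    apply: (nr_aeL w1 w2); apply: (WD_uniq W' W12).
    by apply: (aeS SB) => x ->; rewrite mulrBr.
  apply: le_trans (ler_wpM2l (ltW s0) F2) _.
  rewrite ed e12 e2 (_ : s * _ = KK m * nr (J b (fun x => f1 x - f2 x)) + K1 m * m12 * nr (J b f2)); last first.
    by move: (nr (J b (fun x => _))) (nr (J b f2)) => p q; field; rewrite gt_eqF.
  rewrite (two (KK m * n12)); apply: lerD (ler_wpM2l K0 j2) _.
  by apply: le_KM; exact: le_trans l2 f2M.
have a3 : (1 + b)^-1 * nr (D (fun x => G t f1 x - G t f2 x)) <= 2 * (KK m * n12).
  have c0 : 0 < 1 + b by rewrite ltr_pwDl.
  rewrite ler_pdivrMl// -(nr_DS t PY.1).
  have Wn := WDB (WD_nl (P_D Pu1)) (WD_nl (P_D Pu2)); have [_ nL _] := Wn.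
  have eD := WD_uniq (P_D (S_P t PY)) Wn SY.
  apply: (nr_ae_le (P_DL2 (S_P t PY)) nL eD).
  have d12 : nr (fun x => D (u f1) x - D (u f2) x) = nr (D (fun x => f1 x - f2 x)).
    rewrite -(nr_DS t P12.1); apply: nr_aeL (L2B (P_DL2 Pu1) (P_DL2 Pu2)) (P_DL2 (S_P t P12)) _.
    apply: WD_uniq (WDB (P_D Pu1) (P_D Pu2)) (P_D (S_P t P12)) _.
    exact: ae_eq_sym.
  apply: le_trans E2 _; rewrite d12 (nr_DS t P2.1).
  rewrite (_ : (1 + b) * _ = KK m * ((1 + b) * n12) + (1 + b) * (KK m * n12)); last by ring.
  apply: lerD (ler_wpM2l K0 j3) _.
  by apply: le_KM'; exact: le_trans l3 (ler_wpM2l (ltW c0) f2M).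
have five (X : R) : 5 * X = X + 2 * X + 2 * X by ring.
apply: (@le_trans _ _ (5 * (KK m * n12))).
  by rewrite (five (KK m * n12)); exact: lerD (lerD a1 a2) a3.
exact: fin KS n120.
Qed.

End Nonlinearity.

(** * Continuity in time of the nonlinear term *)

Section NonlinearCurve.
Context {R : realType} {N : nat} (d : 'I_N.+1 -> R[i]) (alpha : 'I_N.+1 -> R).
Hypothesis alpha_ge1 : forall k, 1 <= alpha k.
Local Notation mu := (@lebesgue_measure R).
Local Notation nl := (nonlinearity d alpha).
Implicit Types (f g h : R -> R[i]) (b s t : R).

(** Serves only the continuity of [G t f] in [t] for fixed [f], so a constant that depends on the
    derivative of [f2] is acceptable. *)
Lemma nl_wn b m f1 f2 : 0 < m -> P b f1 -> P b f2 ->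
  {ae mu, forall x, normc (f1 x) <= m} -> {ae mu, forall x, normc (f2 x) <= m} ->
  wn b (fun x => nl f1 x - nl f2 x) <=
  (2 * KK d alpha m + 2 * K1 d alpha m * nr (D f2)) * wn b (fun x => f1 x - f2 x).
Proof.
move=> m0 P1 P2 m1 m2; have P12 := PB P1 P2.
have [n1 n2] := (P_nl d alpha_ge1 P1, P_nl d alpha_ge1 P2).
set w := wn b (fun x => f1 x - f2 x); have w0 : 0 <= w := wn_ge0 _ _.
have r0 := nr_ge0 (fun x => f1 x - f2 x); have r1 := nr_ge0 (D (fun x => f1 x - f2 x)).
have r2 := nr_ge0 (fun x => (b * x)%:C * (f1 x - f2 x)).
have h1 : nr (fun x => f1 x - f2 x) <= w by rewrite /w /wn -addrA lerDl addr_ge0.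
have h2 : nr (D (fun x => f1 x - f2 x)) <= w by rewrite /w /wn addrAC lerDr addr_ge0.
have M0 : 0 <= 2 * w by rewrite mulr_ge0.
have m12 : {ae mu, forall x, normc (f1 x - f2 x) <= 2 * w}.
  apply: (aeS (sup_bound (P_D P12) h1 h2)) => x h; apply: le_trans h _.
  rewrite -(@ler_pXn2r _ 2)// ?nnegrE ?sqrtr_ge0// sqr_sqrtr; last by rewrite !mulr_ge0.
  have -> : (2 * w) ^+ 2 = 4 * (w * w) by ring.
  by rewrite ler_wpM2r ?mulr_ge0// ler_nat.
have [E1 E2] := nl_est d alpha_ge1 m0 M0 (P_D P1) (P_D P2) m1 m2 m12.
have [_ E3] := nl_x alpha_ge1 m0 P1 P2 (P_L2 n1) (P_L2 n2) m1 m2.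
have Wn := WDB (WD_nl d alpha_ge1 (P_D P1)) (WD_nl d alpha_ge1 (P_D P2)).
have [_ nL _] := Wn; have eD := D_eq Wn.
have K0 := KK_ge0 d alpha_ge1 m.
have E4 : nr (D (fun x => nl f1 x - nl f2 x)) <=
   KK d alpha m * nr (D (fun x => f1 x - f2 x)) + K1 d alpha m * (2 * w) * nr (D f2).
  apply: (nr_ae_le (P_DL2 (PB n1 n2)) nL eD).
  by rewrite (nr_aeL (P_DL2 P12) (L2B (P_DL2 P1) (P_DL2 P2)) (D_B P1.1 P2.1)).
have alg (K k1 w' p q r z : R) : w' = p + q + r ->
    K * p + (K * q + k1 * (2 * w') * z) + K * r = K * w' + 2 * k1 * z * w'.
  by move=> ->; ring.
apply: le_trans (lerD (lerD E1 E4) E3) _.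
rewrite [leLHS](_ : _ = KK d alpha m * w + 2 * K1 d alpha m * nr (D f2) * w); last first.
  exact: alg.
by rewrite [leRHS]mulrDl lerD2r; apply: (ler_wpM2r w0); rewrite mulr_natl mulr2n lerDl.
Qed.

Lemma G_cont b t f : 0 <= b -> P b f -> forall e, 0 < e -> exists2 del : R, 0 < del &
  forall s, `|s - t| < del -> nu b (fun x => G d alpha s f x - G d alpha t f x) <= e.
Proof.
move=> b0 Pf e e0; have e4 : 0 < e / 4 by rewrite divr_gt0.
pose m := Num.sqrt (2 * (nr f * nr (D f))) + 1.
have m0 : 0 < m by rewrite ltr_wpDl ?sqrtr_ge0.
have bnd s : {ae mu, forall x, normc (schrodinger s f x) <= m}.
  have /sup_H1 h := P_D (S_P s Pf); apply: (aeS h) => x hx; apply: le_trans hx _.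
  by rewrite (S_nr s (P_L2 Pf)) (nr_DS s Pf.1) /m lerDl.
pose C := 2 * KK d alpha m + 2 * K1 d alpha m * nr (D f).
have C0 : 0 <= C.
  by rewrite addr_ge0// !mulr_ge0 ?nr_ge0// ?(KK_ge0 d alpha_ge1) ?(K1_ge0 d alpha_ge1).
pose B := 1 + 2 * (b * (`|t| + 1)).
have B0 : 0 < B by rewrite ltr_pwDl// !mulr_ge0// addr_ge0.
have Pw s := P_nl d alpha_ge1 (S_P s Pf).
have CB : 0 < C * B + 1 by rewrite ltr_wpDl// mulr_ge0// ltW.
have [d1 d10 H1'] := S_contP t b0 Pf (divr_gt0 e4 CB).
have [d2 d20 H2] := S_contP (- t) b0 (Pw t) e4.
(* The radius 1 keeps $|s|$ below $|t|+1$, the quantity from which the operator bound [B] of the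
   group is formed. *)
exists (Num.min 1 (Num.min d1 d2)); first by rewrite !lt_min ltr01 d10 d20.
move=> s; rewrite !lt_min => /and3P[s1 s2 s3].
have {}H1' := H1' s s2; have {}H2 : wn b (fun x => schrodinger (- s) (nl (schrodinger t f)) x -
   schrodinger (- t) (nl (schrodinger t f)) x) <= e / 4.
  by apply: H2; rewrite opprK addrC distrC.
have Pd := PB (Pw s) (Pw t).
have PGs := P_G d alpha_ge1 s Pf; have PGt := P_G d alpha_ge1 t Pf.
have PX := S_P (- s) Pd; have PY := PB (S_P (- s) (Pw t)) (S_P (- t) (Pw t)).
have E : Cae_eq (fun x => G d alpha s f x - G d alpha t f x)
   (fun x => schrodinger (- s) (fun x => nl (schrodinger s f) x - nl (schrodinger t f) x) x +
     (schrodinger (- s) (nl (schrodinger t f)) x - schrodinger (- t) (nl (schrodinger t f)) x)).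
  by apply: (aeS (S_B (- s) (P_L2 (Pw s)) (P_L2 (Pw t)))) => x ->; rewrite addrA subrK.
have PXY := PD PX PY.
rewrite (nu_ae PXY (ae_eq_sym E) (P_L2 (PB PGs PGt))).
apply: le_trans (nu_wn b0 PXY) _; apply: (@le_trans _ _ (2 * (e / 4 + e / 4))); last first.
  by rewrite le_eqVlt; apply/orP; left; apply/eqP; field.
rewrite ler_pM2l//; apply: le_trans (wnD PX PY) _; apply: lerD => //.
apply: le_trans (wn_S (- s) b0 Pd) _.
have st : 1 + 2 * (b * `|- s|) <= B.
  rewrite /B lerD2l ler_pM2l// ler_wpM2l// normrN.
  have := ler_normD (s - t) t; rewrite subrK => h; apply: le_trans h _.
  by rewrite addrC lerD2l ltW.
have hC := nl_wn m0 (S_P s Pf) (S_P t Pf) (bnd s) (bnd t); rewrite (nr_DS t Pf.1) -/C in hC.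
apply: (@le_trans _ _ (B * (C * (e / 4 / (C * B + 1))))).
  apply: ler_pM => //; [by rewrite addr_ge0// !mulr_ge0|exact: wn_ge0|].
  by apply: le_trans hC _; rewrite ler_wpM2l.
rewrite (_ : B * _ = e / 4 * (C * B / (C * B + 1))); last by ring.
by apply: ler_piMr; [exact: ltW|rewrite ler_pdivrMr// mul1r lerDl].
Qed.

End NonlinearCurve.

(** * Curves, primitives and the fixed point *)

Section Curves.
Context {R : realType} (b : R) (b0 : 0 <= b).
Implicit Types (F Q : R -> R -> R[i]) (A B s t r e xi : R).

Definition contP A B F := (forall t, A <= t <= B -> P b (F t)) /\
  forall t, A <= t <= B -> forall e, 0 < e -> exists2 del : R, 0 < del &
    forall s, A <= s <= B -> `|s - t| < del -> nu b (fun x => F s x - F t x) <= e.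

(* [Q' = F], uniformly, with an arbitrary tag instead of an endpoint: estimates then add up
   along tagged partitions. *)
Definition prim A B F Q := (forall t, A <= t <= B -> P b (Q t)) /\
  forall e, 0 < e -> exists2 del : R, 0 < del & forall s xi t,
    A <= s -> s <= xi -> xi <= t -> t <= B -> t - s < del ->
    nu b (fun x => Q t x - Q s x - (t - s)%:C * F xi x) <= e * (t - s).

Lemma ucontP A B F : contP A B F -> forall e, 0 < e -> exists2 del : R, 0 < del &
  forall s t, A <= s <= B -> A <= t <= B -> `|s - t| < del -> nu b (fun x => F s x - F t x) <= e.
Proof.
move=> [PF cF] e e0.
apply: (@heine R (fun s t => nu b (fun x => F s x - F t x)) A B _ _ e e0).
- move=> s t x sI tI xI; rewrite [X in _ + X](nuB_sym (PF t tI) (PF x xI)).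
  exact: nuB_trans (PF s sI) (PF x xI) (PF t tI).
- by move=> x xI d d0; have [del del0 H] := cF x xI d d0; exists del.
Qed.

Lemma nu_dist f g : P b f -> P b g -> `|nu b f - nu b g| <= nu b (fun x => f x - g x).
Proof.
move=> Pf Pg; rewrite ler_norml; apply/andP; split.
  have := nuD b0 (PB Pg Pf) Pf; rewrite (_ : (fun x => _) = g); last first.
    by apply: funext => x; rewrite subrK.
  by rewrite (nuB_sym Pg Pf); move: (nu b _) (nu b f) (nu b g) => p q u; lra.
have := nuD b0 (PB Pf Pg) Pg; rewrite (_ : (fun x => _) = f); last first.
  by apply: funext => x; rewrite subrK.
by move: (nu b (fun x => _)) (nu b f) (nu b g) => p q u; lra.
Qed.

Lemma contP_bounded A B F : A <= B -> contP A B F -> exists2 M : R, 0 < M &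
  forall t, A <= t <= B -> nu b (F t) <= M.
Proof.
move=> AB cF; have [PF _] := cF.
(* Clamping the time to the interval extends the norm to a continuous function on the whole line, to
   which the extreme value theorem applies. *)
pose cl t := Num.max A (Num.min t B).
have clI t : A <= cl t <= B by rewrite /cl le_max lexx /= ge_max AB ge_min lexx orbT.
have clE t : A <= t <= B -> cl t = t.
  by move=> /andP[h1 h2]; rewrite /cl min_l// max_r.
have cl1 s t : `|cl s - cl t| <= `|s - t|.
  wlog st : s t / s <= t.
    move=> H; have [st|/ltW ts] := leP s t; first exact: H.
    by rewrite distrC [leRHS]distrC; exact: H.
  have m1 : cl s <= cl t.
    by rewrite /cl ge_max le_max lexx /= le_max le_min !ge_min st lexx !orbT.
  rewrite !ler0_norm ?subr_le0// /cl.
  rewrite (_ : Num.max A (Num.min s B) = if s <= B then if A <= s then s else A else B).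
    rewrite (_ : Num.max A (Num.min t B) = if t <= B then if A <= t then t else A else B).
      by case: (leP s B) => h1; case: (leP t B) => h2; case: (leP A s) => h3; case: (leP A t) => h4; lra.
    by case: (leP t B) => h2; [case: (leP A t) => // /ltW|rewrite max_r].
  by case: (leP s B) => h2; [case: (leP A s) => // /ltW|rewrite max_r].
have cc : continuous (fun t => nu b (F (cl t))).
  move=> t; apply/cvgrPdist_le => e e0; have [del del0 H] := ucontP cF e0.
  exists del => //= s st; apply: le_trans (nu_dist (PF _ (clI t)) (PF _ (clI s))) _.
  by apply: H; rewrite ?clI//; exact: le_lt_trans (cl1 t s) st.
have [M M0 HM] := @cont_bounded R _ A B cc; exists (M + 1); first by rewrite ltr_wpDl.
move=> t tI; have := HM t tI; rewrite clE// => h; apply: le_trans (ler_norm _) _.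
by apply: le_trans h _; rewrite lerDl.
Qed.

(** Summation over a partition of mesh below [del], arranged as an induction on the number of steps
    of length [del / 2]. Comparison and norm bounds of primitives are instances, with [phi] the norm
    of an increment. *)
Lemma chain_le (phi : R -> R -> R) (m : R -> R) A B (del : R) : 0 < del -> A <= B ->
  (forall s t r, A <= s -> s <= t -> t <= r -> r <= B -> phi s r <= phi s t + phi t r) ->
  (forall s t, A <= s -> s <= t -> t <= B -> t - s < del -> phi s t <= m t - m s) ->
  phi A B <= m B - m A.
Proof.
move=> del0 AB sub small.
pose d := del / 2; have d0 : 0 < d by rewrite divr_gt0.
have ddel : d < del by rewrite /d ltr_pdivrMr// mulr_natr mulr2n ltrDl.
have key n : forall t, A <= t -> t <= B -> t <= A + n%:R * d -> phi A t <= m t - m A.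
  elim: n => [|n IH] t At tB tn.
    by apply: small => //; rewrite mul0r addr0 in tn; lra.
  have [h|h] := leP t (A + n%:R * d); first exact: IH.
  pose r := A + n%:R * d; have Ar : A <= r by rewrite lerDl mulr_ge0// ltW.
  have rt : r <= t by exact: ltW.
  apply: le_trans (sub A r t _ _ _ _) _ => //.
  have h1 : phi A r <= m r - m A by apply: IH => //; exact: le_trans tB.
  have h2 : phi r t <= m t - m r.
    by apply: small => //; move: tn ddel; rewrite -natr1 mulrDl mul1r /r; lra.
  by move: h1 h2; lra.
apply: (key (Num.truncn ((B - A) / d)).+1) => //.
rewrite -lerBlDl -ler_pdivrMr//; exact/ltW/truncnS_gt.
Qed.

Lemma P_sum (I : Type) (l : seq I) (c : I -> R[i]) (F : I -> R -> R[i]) :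
  (forall k, P b (F k)) -> P b (fun x => \sum_(k <- l) c k * F k x).
Proof.
move=> PF; elim: l => [|k l IH].
  by have := P_zero b; congr P; apply: funext => x; rewrite big_nil.
have := P_lin (c k) (PF k) IH; congr P; apply: funext => x; by rewrite big_cons.
Qed.

Lemma nu_sum (I : Type) (l : seq I) (c : I -> R) (e : I -> R) (F : I -> R -> R[i]) :
  (forall k, P b (F k)) -> (forall k, `|c k| * nu b (F k) <= e k) ->
  nu b (fun x => \sum_(k <- l) (c k)%:C * F k x) <= \sum_(k <- l) e k.
Proof.
move=> PF H; elim: l => [|k l IH].
  rewrite big_nil (_ : (fun x => _) = fun=> 0) ?nu0//.
  by apply: funext => x; rewrite big_nil.
rewrite big_cons (_ : (fun x => _) = fun x => (c k)%:C * F k x + \sum_(j <- l) (c j)%:C * F j x); last first.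
  by apply: funext => x; rewrite big_cons.
apply: le_trans (nuD b0 (PZ _ (PF k)) (P_sum _ _ PF)) _; apply: lerD => //.
by rewrite nuZ// normcR.
Qed.

Definition grid A (h : R) (k : nat) := A + k%:R * h.
Definition cell A (h : R) k t := Num.min t (grid A h k.+1) - Num.min t (grid A h k).

Lemma cell_mono A h k s t : 0 <= h -> s <= t -> cell A h k s <= cell A h k t.
Proof.
move=> h0 st; have g : grid A h k <= grid A h k.+1.
  by rewrite /grid lerD2l ler_wpM2r// ler_nat.
rewrite /cell; move: g; move: (grid A h k) (grid A h k.+1) => p q g.
by case: (leP s q); case: (leP s p); case: (leP t q); case: (leP t p); lra.
Qed.

Lemma cell_far A h k s t : 0 <= h -> s <= t -> (t <= grid A h k) || (grid A h k.+1 <= s) ->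
  cell A h k t - cell A h k s = 0.
Proof.
move=> h0 st; have g : grid A h k <= grid A h k.+1.
  by rewrite /grid lerD2l ler_wpM2r// ler_nat.
rewrite /cell; move: g; move: (grid A h k) (grid A h k.+1) => p q g /orP[] H.
  by case: (leP s q); case: (leP s p); case: (leP t q); case: (leP t p); lra.
by case: (leP s q); case: (leP s p); case: (leP t q); case: (leP t p); lra.
Qed.

Lemma cell_sum A h K t : A <= t -> t <= grid A h K -> \sum_(k < K) cell A h k t = t - A.
Proof.
move=> At tK; rewrite -(big_mkord xpredT (fun k => cell A h k t)) /cell.
rewrite (telescope_sumr (fun k => Num.min t (grid A h k)))//.
by rewrite (min_l tK) /grid mul0r addr0 min_r.
Qed.

(* [Q] is the primitive of the piecewise constant interpolation of [F] on a grid of mesh [h]. *)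
Lemma step_prim A B F (h : R) K : A <= B -> 0 < h -> B <= grid A h K -> contP A B F ->
  exists Q, [/\ (forall t, A <= t <= B -> P b (Q t)), Q A = (fun=> 0) &
    forall e del, h < del / 2 ->
    (forall s t, A <= s <= B -> A <= t <= B -> `|s - t| < del -> nu b (fun x => F s x - F t x) <= e) ->
    forall s xi t, A <= s -> s <= xi -> xi <= t -> t <= B -> t - s < del / 2 ->
    nu b (fun x => Q t x - Q s x - (t - s)%:C * F xi x) <= e * (t - s)].
Proof.
move=> AB h0 BK [PF cF]; pose p k := Num.min (grid A h k) B.
have gA k : A <= grid A h k by rewrite /grid lerDl mulr_ge0// ltW.
have pI k : A <= p k <= B by rewrite /p le_min gA AB ge_min lexx orbT.
exists (fun t x => \sum_(k < K) (cell A h k t)%:C * F (p k) x); split.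
- by move=> t _; apply: P_sum => k; exact: PF.
- apply: funext => x; rewrite big1// => k _; rewrite /cell !min_l ?gA// subrr mul0r//.
move=> e del hdel uc s xi t As sx xt tB ts; have st := le_trans sx xt.
have sI : A <= s <= B by rewrite As (le_trans st).
have xI : A <= xi <= B by rewrite (le_trans As) ?(le_trans xt).
have tI : A <= t <= B by rewrite tB (le_trans As).
have csum : \sum_(k < K) (cell A h k t - cell A h k s) = t - s.
  by rewrite sumrB !cell_sum//; [ring|exact: le_trans (le_trans st tB) BK|exact: le_trans (le_trans As st) _|exact: le_trans tB BK].
have alg (u v : R) (f g : R[i]) : u%:C * f - v%:C * f - (u - v)%:C * g = (u - v)%:C * (f - g).
  by rewrite rmorphB /=; ring.
rewrite (_ : (fun x => _) = fun x => \sum_(k < K) (cell A h k t - cell A h k s)%:C *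
    (F (p k) x - F xi x)); last first.
  apply: funext => x; rewrite -csum rmorph_sum mulr_suml -!sumrB /=.
  apply: eq_bigr => k _; exact: alg.
rewrite -csum mulr_sumr; apply: nu_sum => [k|k].
  by apply: PB; exact: PF.
have mono := cell_mono A k (ltW h0) st.
rewrite ger0_norm ?subr_ge0// [leRHS]mulrC.
have [far|near] := boolP ((t <= grid A h k) || (grid A h k.+1 <= s)).
  by rewrite (cell_far (ltW h0) st far) !mul0r.
move: near; rewrite negb_or -!ltNge => /andP[n1 n2].
apply: ler_wpM2l; first by rewrite subr_ge0.
apply: uc => //; rewrite /p min_l; last by apply: ltW; exact: lt_le_trans n1 tB.
move: n2; rewrite /grid -natr1 mulrDl mul1r addrA -/(grid A h k) => n2.
by rewrite ltr_norml; move: ts hdel n1 n2 sx xt; move: (grid A h k) => g; lra.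
Qed.

(** The common term [F xi] cancels, so on short intervals the two increments differ by at most
    [2 * e] times the length. This yields the Cauchy property of the approximate primitives. *)
Lemma prim_pair A B (e : R) F (del : R) Q Q' : 0 < del -> A <= B ->
  (forall t, A <= t <= B -> P b (F t)) ->
  (forall t, A <= t <= B -> P b (Q t)) -> (forall t, A <= t <= B -> P b (Q' t)) ->
  (forall s xi t, A <= s -> s <= xi -> xi <= t -> t <= B -> t - s < del ->
    nu b (fun x => Q t x - Q s x - (t - s)%:C * F xi x) <= e * (t - s)) ->
  (forall s xi t, A <= s -> s <= xi -> xi <= t -> t <= B -> t - s < del ->
    nu b (fun x => Q' t x - Q' s x - (t - s)%:C * F xi x) <= e * (t - s)) ->
  nu b (fun x => (Q B x - Q A x) - (Q' B x - Q' A x)) <= 2 * e * (B - A).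
Proof.
move=> del0 AB PF PQ PQ' H H'.
rewrite mulrBr.
apply: (@chain_le (fun s t => nu b (fun x => (Q t x - Q s x) - (Q' t x - Q' s x)))
  (fun t => 2 * e * t) A B del) => //.
- move=> s t r As st tr rB.
  have sI : A <= s <= B by rewrite As (le_trans st)// (le_trans tr).
  have tI : A <= t <= B by rewrite (le_trans As st) (le_trans tr).
  have rI : A <= r <= B by rewrite (le_trans (le_trans As st)).
  have h u v : A <= u <= B -> A <= v <= B -> P b (fun x => (Q u x - Q v x) - (Q' u x - Q' v x)).
    by move=> uI vI; apply: PB; apply: PB; auto.
  apply: le_trans (nuD b0 (h t s tI sI) (h r t rI tI)).
  rewrite le_eqVlt; apply/orP; left; apply/eqP; congr (nu b _); apply: funext => x; ring.
- move=> s t As st tB ts; rewrite -mulrBr.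
  have sI : A <= s <= B by rewrite As (le_trans st).
  have tI : A <= t <= B by rewrite (le_trans As st).
  have hh q : (forall t, A <= t <= B -> P b (q t)) ->
      P b (fun x => q t x - q s x - (t - s)%:C * F s x).
    by move=> Pq; apply: PB; [apply: PB; auto|apply: PZ; auto].
  have := nuB b0 (hh Q PQ) (hh Q' PQ').
  rewrite (_ : (fun x => _ - (_ - _)) = fun x => Q t x - Q s x - (Q' t x - Q' s x)); last first.
    by apply: funext => x; ring.
  move=> h; apply: le_trans h _.
  rewrite (_ : 2 * e * (t - s) = e * (t - s) + e * (t - s)); last by ring.
  by apply: lerD; [apply: H|apply: H'].
Qed.

End Curves.

(** * Existence and bounds of primitives; Riemann sums *)

Section Primitives.
Context {R : realType} (b : R) (b0 : 0 <= b).
Implicit Types (F Q : R -> R -> R[i]) (A B s t r e xi : R).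
Local Notation P := (P b).
Local Notation nu := (nu b).

(** The primitives of the piecewise constant interpolations on meshes $1/(n+1)$ are Cauchy by
    [prim_pair], and the defining estimate, being uniform in [n], passes to the limit. *)
Lemma prim_exists A B F : A <= B -> contP b A B F -> exists Q, prim b A B F Q.
Proof.
move=> AB cF; have [PF _] := cF.
pose h (n : nat) : R := n.+1%:R^-1.
have h0 n : 0 < h n by rewrite invr_gt0.
have step n : exists Q, [/\ (forall t, A <= t <= B -> P (Q t)), Q A = (fun=> 0) &
    forall e del, h n < del / 2 ->
    (forall s t, A <= s <= B -> A <= t <= B -> `|s - t| < del -> nu (fun x => F s x - F t x) <= e) ->
    forall s xi t, A <= s -> s <= xi -> xi <= t -> t <= B -> t - s < del / 2 ->
    nu (fun x => Q t x - Q s x - (t - s)%:C * F xi x) <= e * (t - s)].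
  pose K := (Num.truncn ((B - A) / h n)).+1.
  have BK : B <= grid A (h n) K.
    rewrite /grid -lerBlDl -ler_pdivrMr//; exact/ltW/truncnS_gt.
  by have [Q [q1 q2 q3]] := step_prim b0 AB (h0 n) BK cF; exists Q; split.
have /choice[Q HQ] := step.
have PQ n t : A <= t <= B -> P (Q n t) by have [H _ _] := HQ n; exact: H.
have QA n : Q n A = fun=> 0 by have [_ H _] := HQ n.
have small e : 0 < e -> exists2 del : R, 0 < del & exists n0, forall n, (n0 <= n)%N ->
    forall s xi t, A <= s -> s <= xi -> xi <= t -> t <= B -> t - s < del ->
    nu (fun x => Q n t x - Q n s x - (t - s)%:C * F xi x) <= e * (t - s).
  move=> e0; have [del del0 uc] := ucontP b0 cF e0.
  have d20 : 0 < del / 2 by rewrite divr_gt0.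
  exists (del / 2) => //; have [n0 _ Hn0] := near_infty_natSinv_lt (PosNum d20).
  exists n0 => n n0n; have [_ _ H] := HQ n.
  by apply: H => //; exact: Hn0.
have cauchy t e : A <= t <= B -> 0 < e -> exists n0, forall m n, (n0 <= m)%N -> (n0 <= n)%N ->
    nu (fun x => Q m t x - Q n t x) <= e.
  move=> tI e0; have /andP[At tB] := tI.
  have c0 : 0 < 2 * (B - A + 1) by rewrite mulr_gt0// ltr_wpDl ?subr_ge0.
  have [del del0 [n0 H]] := small _ (divr_gt0 e0 c0); exists n0 => m n hm hn.
  have sub u : A <= u <= t -> A <= u <= B by move=> /andP[-> /le_trans]; exact.
  have := @prim_pair R b b0 A t (e / (2 * (B - A + 1))) F del (Q m) (Q n) del0 At
    (fun u uI => PF u (sub u uI)) (fun u uI => PQ m u (sub u uI)) (fun u uI => PQ n u (sub u uI)).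
  move=> HH; have {}HH := HH (fun s xi u As sx xu ut us => H m hm s xi u As sx xu (le_trans ut tB) us)
    (fun s xi u As sx xu ut us => H n hn s xi u As sx xu (le_trans ut tB) us).
  rewrite (_ : (fun x => Q m t x - Q n t x) = fun x => Q m t x - Q m A x - (Q n t x - Q n A x)); last first.
    by apply: funext => x; rewrite !QA !subr0.
  have c1 : 0 < B - A + 1 by rewrite ltr_wpDl ?subr_ge0.
  apply: le_trans HH _; rewrite (_ : 2 * _ * _ = e * ((t - A) / (B - A + 1))); last first.
    by field; rewrite gt_eqF.
  apply: ler_piMr; first exact: ltW.
  rewrite ler_pdivrMr// mul1r; lra.
have lim t : exists G, A <= t <= B -> P G /\ forall e, 0 < e -> exists n0, forall n, (n0 <= n)%N ->
    nu (fun x => Q n t x - G x) <= e.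
  have [tI|tI] := boolP (A <= t <= B); last by exists (fun=> 0).
  have [n|e e0|G PG HG] := @nu_complete R b (fun n => Q n t) b0; [exact: PQ|exact: cauchy|].
  by exists G.
have /choice[QQ HQQ] := lim; exists QQ; split; first by move=> t tI; have [] := HQQ t tI.
move=> e e0; have [del del0 [n0 H]] := small e e0; exists del => // s xi t As sx xt tB ts.
have st := le_trans sx xt.
have sI : A <= s <= B by rewrite As (le_trans st).
have xI : A <= xi <= B by rewrite (le_trans As) ?(le_trans xt).
have tI : A <= t <= B by rewrite tB (le_trans As).
have [Ps Hs] := HQQ s sI; have [Pt Ht] := HQQ t tI.
apply/ler_addgt0Pl => d d0; have d20 : 0 < d / 2 by rewrite divr_gt0.
have [n1 H1] := Hs _ d20; have [n2 H2] := Ht _ d20; pose n := (n0 + n1 + n2)%N.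
have {}H1 : nu (fun x => Q n s x - QQ s x) <= d / 2 by apply: H1; rewrite /n addnAC leq_addl.
have {}H2 : nu (fun x => Q n t x - QQ t x) <= d / 2 by apply: H2; rewrite /n leq_addl.
have {}H : nu (fun x => Q n t x - Q n s x - (t - s)%:C * F xi x) <= e * (t - s).
  by apply: H => //; rewrite /n -addnA leq_addr.
have Pns := PQ n s sI; have Pnt := PQ n t tI.
have PX := PB (PB Pnt Pns) (PZ (t - s)%:C (PF xi xI)).
rewrite (_ : (fun x => _) = fun x => (Q n t x - Q n s x - (t - s)%:C * F xi x) +
   ((Q n s x - QQ s x) - (Q n t x - QQ t x))); last first.
  by apply: funext => x; move: (_%:C * _) => w; ring.
have PY := PB (PB Pns Ps) (PB Pnt Pt).
apply: le_trans (nuD b0 PX PY) _; rewrite addrC; apply: lerD => //.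
apply: le_trans (nuB b0 (PB Pns Ps) (PB Pnt Pt)) _; rewrite [leRHS]splitr; exact: lerD H1 H2.
Qed.

Lemma prim_sub A B A' B' F Q : A <= A' -> B' <= B -> prim b A B F Q -> prim b A' B' F Q.
Proof.
move=> AA BB [PQ H]; split.
  by move=> t /andP[h1 h2]; apply: PQ; rewrite (le_trans AA h1) (le_trans h2).
move=> e e0; have [del del0 Hd] := H e e0; exists del => // s xi t As sx xt tB ts.
by apply: Hd => //; [exact: le_trans AA As|exact: le_trans tB BB].
Qed.

(** Mean value inequality with a scalar majorant. Adding [e * t] to the majorant absorbs the error
    in the definition of [prim]; then [e] tends to 0. *)
Lemma prim_bound A B F Q (L : R -> R) (l : R -> R) : A <= B -> prim b A B F Q ->
  (forall t, A <= t <= B -> P (F t)) ->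
  (forall t, A <= t <= B -> is_derive t 1 L (l t)) ->
  (forall t, A <= t <= B -> nu (F t) <= l t) ->
  nu (fun x => Q B x - Q A x) <= L B - L A.
Proof.
move=> AB [PQ H] PF dL Fl.
suff key e : 0 < e -> nu (fun x => Q B x - Q A x) <= (L B + e * B) - (L A + e * A).
  apply/ler_addgt0Pl => d d0.
  have c0 : 0 < B - A + 1 by rewrite ltr_wpDl ?subr_ge0.
  apply: le_trans (key _ (divr_gt0 d0 c0)) _.
  rewrite [leLHS](_ : _ = d / (B - A + 1) * (B - A) + (L B - L A)); last by ring.
  by rewrite lerD2r mulrAC ler_pdivrMr// ler_pM2l// lerDl.
move=> e0; have [del del0 Hd] := H e e0.
apply: (@chain_le R (fun s t => nu (fun x => Q t x - Q s x)) (fun t => L t + e * t) A B del) => //.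
- move=> s t r As st tr rB.
  have sI : A <= s <= B by rewrite As (le_trans st)// (le_trans tr).
  have tI : A <= t <= B by rewrite (le_trans As st) (le_trans tr).
  have rI : A <= r <= B by rewrite (le_trans (le_trans As st)).
  by rewrite addrC; exact: nuB_trans (PQ r rI) (PQ t tI) (PQ s sI).
- move=> s t As; rewrite le_eqVlt => /predU1P[->|st] tB ts.
    by rewrite subrr (_ : (fun x => _) = fun=> 0) ?nu0//; apply: funext => x; rewrite subrr.
  have sI : A <= s <= B by rewrite As (le_trans (ltW st)).
  have tI : A <= t <= B by rewrite tB (le_trans As (ltW st)).
  have sub u : s <= u <= t -> A <= u <= B.
    by move=> /andP[h1 h2]; rewrite (le_trans As h1) (le_trans h2).
  (* The intermediate point for the majorant is used as the tag for the primitive, so the two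
     increments are compared at the same time. *)
  have [||xi xin xiE] := @MVT R L l s t st.
  + by move=> u; rewrite in_itv /= => /andP[h1 h2]; apply/dL/sub; rewrite !ltW.
  + apply: derivable_within_continuous => u; rewrite in_itv /= => h.
    by have [] := dL u (sub u h).
  move: xin; rewrite in_itv /= => /andP[/ltW sx /ltW xt].
  have xI : A <= xi <= B by apply: sub; rewrite sx.
  have Px := PZ (t - s)%:C (PF xi xI).
  have hd := Hd s xi t As sx xt tB ts.
  have := nuD b0 (PB (PB (PQ t tI) (PQ s sI)) Px) Px.
  rewrite (_ : (fun x => _ + _) = fun x => Q t x - Q s x); last first.
    by apply: funext => x; rewrite subrK.
  rewrite nuZ; last exact: PF.
  rewrite normcR ger0_norm ?subr_ge0 ?(ltW st)// => h.
  apply: le_trans h _; rewrite [leRHS](_ : _ = e * (t - s) + (L t - L s)); last by ring.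
  apply: lerD => //; rewrite xiE mulrC ler_wpM2r ?subr_ge0 ?(ltW st)//; exact: Fl.
Qed.

Lemma riemann_sumS n (p xi : nat -> R) F x :
  riemann_sum n.+1 p xi F x = riemann_sum n p xi F x + (p n.+1 - p n)%:C * F (xi n) x.
Proof. by rewrite /riemann_sum big_ord_recr. Qed.

Lemma part_mono n (p xi : nat -> R) : (forall k, (k < n)%N -> p k <= xi k /\ xi k <= p k.+1) ->
  forall k, (k <= n)%N -> p 0%N <= p k.
Proof.
move=> H; elim=> [//|k IH] kn; have [h1 h2] := H k kn.
by apply: le_trans (IH (ltnW kn)) _; exact: le_trans h2.
Qed.

Lemma prim_riem A B F Q : A <= B -> prim b A B F Q -> (forall t, A <= t <= B -> P (F t)) ->
  forall e, 0 < e -> exists2 del : R, 0 < del & forall (n : nat) (p xi : nat -> R),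
    p 0%N = A -> p n = B ->
    (forall k, (k < n)%N -> [/\ p k <= xi k, xi k <= p k.+1 & p k.+1 - p k < del]) ->
    P (riemann_sum n p xi F) /\
    nu (fun x => riemann_sum n p xi F x - (Q B x - Q A x)) <= e.
Proof.
move=> AB [PQ H] PF e e0; have c0 : 0 < B - A + 1 by rewrite ltr_wpDl ?subr_ge0.
have [del del0 Hd] := H _ (divr_gt0 e0 c0); exists del => // n p xi pA pB Hp.
have p0 k : (k <= n)%N -> A <= p k.
  by rewrite -pA; apply: (part_mono (xi := xi)) => j jn; have [] := Hp j jn.
have pn k : (k <= n)%N -> p k <= B.
  move=> kn; rewrite -pB -(subnKC kn).
  have := @part_mono (n - k) (fun j => p (k + j)%N) (fun j => xi (k + j)%N) _ (n - k)%N (leqnn _).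
  rewrite addn0; apply => j jn; rewrite addnS.
  by have [|h1 h2 _] := Hp (k + j)%N; first by rewrite -ltn_subRL.
have key m : (m <= n)%N -> P (riemann_sum m p xi F) /\
    nu (fun x => riemann_sum m p xi F x - (Q (p m) x - Q A x)) <= e / (B - A + 1) * (p m - A).
  elim: m => [_|m IH mn].
    have z : riemann_sum 0 p xi F = fun=> 0.
      by apply: funext => x; rewrite /riemann_sum big_ord0.
    rewrite z pA subrr mulr0; split; first exact: P_zero.
    rewrite (_ : (fun x => _) = fun=> 0) ?nu0//.
    by apply: funext => x; rewrite subrr subr0.
  have [Pm Hm] := IH (ltnW mn); have [h1 h2 h3] := Hp m mn.
  have mI : A <= p m <= B by rewrite p0 ?pn// ltnW.
  have SI : A <= p m.+1 <= B by rewrite p0 ?pn.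
  have AI : A <= A <= B by rewrite lexx.
  have xI : A <= xi m <= B.
    by have /andP[a1 _] := mI; have /andP[_ a2] := SI; rewrite (le_trans a1 h1) (le_trans h2).
  have hd := Hd _ _ _ (p0 _ (ltnW mn)) h1 h2 (pn _ mn) h3.
  have PS : P (riemann_sum m.+1 p xi F).
    have := PD Pm (PZ (p m.+1 - p m)%:C (PF _ xI)).
    by rewrite (_ : riemann_sum m.+1 p xi F = fun x => riemann_sum m p xi F x + (p m.+1 - p m)%:C * F (xi m) x)//; apply: funext => x; rewrite riemann_sumS.
  split => //.
  have PX := PB Pm (PB (PQ _ mI) (PQ _ AI)).
  have PY := PB (PB (PQ _ SI) (PQ _ mI)) (PZ (p m.+1 - p m)%:C (PF _ xI)).
  rewrite (_ : (fun x => _) = fun x => (riemann_sum m p xi F x - (Q (p m) x - Q A x)) -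
     (Q (p m.+1) x - Q (p m) x - (p m.+1 - p m)%:C * F (xi m) x)); last first.
    apply: funext => x; rewrite riemann_sumS.
    by move: (riemann_sum _ _ _ _ _) (_%:C * _) => u v; ring.
  apply: le_trans (nuB b0 PX PY) _.
  rewrite (_ : _ * (p m.+1 - A) = e / (B - A + 1) * (p m - A) + e / (B - A + 1) * (p m.+1 - p m)); last by ring.
  exact: lerD.
have [Pn Hn] := key n (leqnn _); split => //; move: Hn; rewrite pB => h; apply: le_trans h _.
by rewrite mulrAC ler_pdivrMr// ler_pM2l// lerDl.
Qed.

Lemma prim_cont A B F Q : prim b A B F Q -> (forall t, A <= t <= B -> P (F t)) -> contP b A B Q.
Proof.
move=> [PQ H] PF; split => // t tI e e0.
have [del del0 Hd] := H 1 ltr01; have n0 := nu_ge0 (F t) b0.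
have c0 : 0 < 1 + nu (F t) by rewrite ltr_pwDl.
exists (Num.min del (e / (1 + nu (F t)))); first by rewrite lt_min del0 divr_gt0.
move=> s sI; rewrite lt_min => /andP[s1 s2].
have Pst := PB (PQ s sI) (PQ t tI); have /andP[As sB] := sI; have /andP[At tB] := tI.
have PZt c := PZ c (PF t tI).
have bnd (u v : R) : A <= u <= B -> A <= v <= B -> u <= v -> v - u = `|s - t| ->
    nu (fun x => Q v x - Q u x - (v - u)%:C * F t x) <= 1 * (v - u) ->
    nu (fun x => Q v x - Q u x) <= e.
  move=> uI vI uv uvE h; have := nuD b0 (PB (PB (PQ v vI) (PQ u uI)) (PZt (v - u)%:C)) (PZt (v - u)%:C).
  rewrite (_ : (fun x => _ + _) = fun x => Q v x - Q u x); last first.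
    by apply: funext => x; rewrite subrK.
  rewrite nuZ; last exact: PF.
  rewrite normcR uvE normr_id => h'; apply: le_trans h' _; rewrite uvE in h.
  apply: le_trans (lerD h (lexx _)) _; rewrite mul1r -[X in X + _]mulr1 -mulrDr.
  by rewrite -ler_pdivlMr// ltW.
have [st|ts] := leP s t.
  rewrite (nuB_sym (PQ s sI) (PQ t tI)); have E : t - s = `|s - t|.
    by rewrite ler0_norm ?subr_le0// opprB.
  by apply: bnd => //; apply: Hd => //; rewrite E.
have E : s - t = `|s - t| by rewrite ger0_norm// subr_ge0 ltW.
apply: bnd => //; first exact: ltW.
by apply: Hd => //; [exact: ltW|rewrite E].
Qed.

Lemma contP_D A B F Q : contP b A B F -> contP b A B Q -> contP b A B (fun t x => F t x + Q t x).
Proof.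
move=> [PF cF] [PQ cQ]; split; first by move=> t tI; apply: PD; auto.
move=> t tI e e0; have e20 : 0 < e / 2 by rewrite divr_gt0.
have [d1 d10 H1] := cF t tI _ e20; have [d2 d20 H2] := cQ t tI _ e20.
exists (Num.min d1 d2); first by rewrite lt_min d10.
move=> s sI; rewrite lt_min => /andP[s1 s2].
rewrite (_ : (fun x => _) = fun x => (F s x - F t x) + (Q s x - Q t x)); last first.
  by apply: funext => x; rewrite opprD addrACA.
apply: le_trans (nuD b0 (PB (PF s sI) (PF t tI)) (PB (PQ s sI) (PQ t tI))) _.
by rewrite [leRHS]splitr; apply: lerD; auto.
Qed.

Lemma contP_Z A B F c : contP b A B F -> contP b A B (fun t x => c * F t x).
Proof.
move=> [PF cF]; split; first by move=> t tI; apply: PZ; auto.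
move=> t tI e e0; have c0 : 0 < normc c + 1 by rewrite ltr_wpDl ?normc_ge0.
have [d1 d10 H1] := cF t tI _ (divr_gt0 e0 c0); exists d1 => // s sI s1.
rewrite (_ : (fun x => _) = fun x => c * (F s x - F t x)); last first.
  by apply: funext => x; rewrite mulrBr.
rewrite nuZ; last by apply: PB; auto.
have := H1 s sI s1; rewrite ler_pdivlMr// mulrDr mulr1 => h.
by apply: le_trans h; rewrite mulrC lerDl nu_ge0.
Qed.

Lemma contP_cst A B f : P f -> contP b A B (fun=> f).
Proof.
move=> Pf; split => // t _ e e0; exists 1 => // s _ _.
rewrite (_ : (fun x => _) = fun=> 0) ?nu0 ?ltW//.
by apply: funext => x; rewrite subrr.
Qed.

Lemma contP_sub A B A' B' F : A <= A' -> B' <= B -> contP b A B F -> contP b A' B' F.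
Proof.
move=> AA BB [PF cF].
have sub t : A' <= t <= B' -> A <= t <= B.
  by move=> /andP[h1 h2]; rewrite (le_trans AA h1) (le_trans h2).
split; first by move=> t /sub; exact: PF.
move=> t tI e e0; have [del del0 H] := cF t (sub t tI) e e0; exists del => // s sI.
exact: H (sub s sI).
Qed.

Lemma contP_unif A B (Z : nat -> R -> R -> R[i]) F :
  (forall n, contP b A B (Z n)) -> (forall t, A <= t <= B -> P (F t)) ->
  (forall e, 0 < e -> exists n, forall t, A <= t <= B -> nu (fun x => Z n t x - F t x) <= e) ->
  contP b A B F.
Proof.
move=> cZ PF U; split => // t tI e e0; have e30 : 0 < e / 3 by rewrite divr_gt0.
have [n Hn] := U _ e30; have [PZn cZn] := cZ n; have [del del0 H] := cZn t tI _ e30.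
exists del => // s sI st.
have h1 := Hn s sI; have h2 := Hn t tI; have h3 := H s sI st.
have Ps := PF s sI; have Pt := PF t tI; have Zs := PZn s sI; have Zt := PZn t tI.
apply: le_trans (nuB_trans b0 Ps Zs Pt) _; rewrite (nuB_sym Ps Zs).
rewrite (_ : e = e / 3 + (e / 3 + e / 3)); last by field.
exact: lerD h1 (le_trans (nuB_trans b0 Zs Zt Pt) (lerD h3 h2)).
Qed.

End Primitives.

(** * Bounds from time 0 and Gronwall's lemma *)

Section Picard.
Context {R : realType} {N : nat} (d : 'I_N.+1 -> R[i]) (alpha : 'I_N.+1 -> R).
Hypothesis alpha_ge1 : forall k, 1 <= alpha k.
Hypothesis alpha_min : forall k, alpha ord0 <= alpha k.
Context (b : R) (b0 : 0 <= b).
Implicit Types (F Q z : R -> R -> R[i]) (A B s t r e xi M : R).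
Local Notation P := (P b).
Local Notation nu := (nu b).

Lemma prim_B A B F F' Q Q' : prim b A B F Q -> prim b A B F' Q' ->
  (forall t, A <= t <= B -> P (F t)) -> (forall t, A <= t <= B -> P (F' t)) ->
  prim b A B (fun t x => F t x - F' t x) (fun t x => Q t x - Q' t x).
Proof.
move=> [PQ H] [PQ' H'] PF PF'; split; first by move=> t tI; apply: PB; auto.
move=> e e0; have e20 : 0 < e / 2 by rewrite divr_gt0.
have [d1 d10 H1] := H _ e20; have [d2 d20 H2] := H' _ e20.
exists (Num.min d1 d2); first by rewrite lt_min d10.
move=> s xi t As sx xt tB; rewrite lt_min => /andP[t1 t2].
have h1 := H1 s xi t As sx xt tB t1; have h2 := H2 s xi t As sx xt tB t2.
have st := le_trans sx xt.
have sI : A <= s <= B by rewrite As (le_trans st).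
have xI : A <= xi <= B by rewrite (le_trans As) ?(le_trans xt).
have tI : A <= t <= B by rewrite tB (le_trans As).
have X1 := PB (PB (PQ t tI) (PQ s sI)) (PZ (t - s)%:C (PF xi xI)).
have X2 := PB (PB (PQ' t tI) (PQ' s sI)) (PZ (t - s)%:C (PF' xi xI)).
rewrite (_ : (fun x => _) = fun x => (Q t x - Q s x - (t - s)%:C * F xi x) -
  (Q' t x - Q' s x - (t - s)%:C * F' xi x)); last first.
  by apply: funext => x; rewrite mulrBr; move: (_%:C * _) (_%:C * _) => u v; ring.
apply: le_trans (nuB b0 X1 X2) _.
rewrite (_ : e * (t - s) = e / 2 * (t - s) + e / 2 * (t - s)); last by field.
exact: lerD h1 h2.
Qed.

Lemma derive_mono A B (L l : R -> R) : (forall t, A <= t <= B -> is_derive t 1 L (l t)) ->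
  (forall t, A <= t <= B -> 0 <= l t) -> forall s t, A <= s -> s <= t -> t <= B -> L s <= L t.
Proof.
move=> dL l0 s t As; rewrite le_eqVlt => /predU1P[->//|st] tB.
have sub u : s <= u <= t -> A <= u <= B.
  by move=> /andP[h1 h2]; rewrite (le_trans As h1) (le_trans h2).
have [||xi xin xiE] := @MVT R L l s t st.
- by move=> u; rewrite in_itv /= => /andP[h1 h2]; apply/dL/sub; rewrite !ltW.
- apply: derivable_within_continuous => u; rewrite in_itv /= => h.
  by have [] := dL u (sub u h).
move: xin; rewrite in_itv /= => /andP[/ltW sx /ltW xt].
rewrite -subr_ge0 xiE mulr_ge0 ?subr_ge0 ?(ltW st)//.
by apply/l0/sub; rewrite sx.
Qed.

(** Bounding by the increment of [L] over the whole interval gives one inequality for times on both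
    sides of 0. *)
Lemma prim_bound0 A B F Q (L l : R -> R) (c : R) : A <= 0 -> 0 <= B -> prim b A B F Q ->
  (forall t, A <= t <= B -> P (F t)) ->
  (forall t, A <= t <= B -> is_derive t 1 L (l t)) ->
  (forall t, A <= t <= B -> 0 <= l t) -> 0 <= c ->
  (forall t, A <= t <= B -> nu (F t) <= c * l t) ->
  forall t, A <= t <= B -> nu (fun x => Q t x - Q 0 x) <= c * (L B - L A).
Proof.
move=> A0 B0 pQ PF dL l0 c0 Fl t tI; have /andP[At tB] := tI.
have mono := derive_mono dL l0; have [PQ _] := pQ.
have I0 : A <= 0 <= B by rewrite A0.
have dcL u : A <= u <= B -> is_derive u 1 (fun v => c * L v) (c * l u).
  by move=> uI; have h := dL u uI; apply: is_deriveZ.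
have key s r : A <= s -> s <= r -> r <= B -> nu (fun x => Q r x - Q s x) <= c * (L B - L A).
  move=> As sr rB.
  have sub u : s <= u <= r -> A <= u <= B.
    by move=> /andP[h1 h2]; rewrite (le_trans As h1) (le_trans h2).
  apply: le_trans (prim_bound b0 sr (prim_sub As rB pQ) (fun u uI => PF u (sub u uI))
    (fun u uI => dcL u (sub u uI)) (fun u uI => Fl u (sub u uI))) _.
  rewrite -mulrBr ler_wpM2l//; apply: lerB.
    by apply: mono => //; exact: le_trans As sr.
  by apply: mono => //; exact: le_trans sr rB.
have [t0|t0] := leP 0 t; first exact: key.
rewrite (nuB_sym (PQ t tI) (PQ 0 I0)); apply: key => //; exact: ltW.
Qed.

(* A bound of the difference by [c e^(2 |L t - L 0|)] improves to the same bound with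
   [eta + c / 2] in place of [c]; iterate. *)
Lemma gronwall A B F F' Q Q' z z' (u u' : R -> R[i]) (L l : R -> R) : A <= 0 -> 0 <= B ->
  contP b A B z -> contP b A B z' -> P u -> P u' ->
  prim b A B F Q -> prim b A B F' Q' ->
  (forall t, A <= t <= B -> P (F t)) -> (forall t, A <= t <= B -> P (F' t)) ->
  (forall t, A <= t <= B -> Cae_eq (z t) (fun x => u x + 'i%C * (Q t x - Q 0 x))) ->
  (forall t, A <= t <= B -> Cae_eq (z' t) (fun x => u' x + 'i%C * (Q' t x - Q' 0 x))) ->
  (forall t, A <= t <= B -> is_derive t 1 L (l t)) ->
  (forall t, A <= t <= B -> 0 <= l t) ->
  (forall t, A <= t <= B -> nu (fun x => F t x - F' t x) <= l t * nu (fun x => z t x - z' t x)) ->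
  forall t, A <= t <= B -> nu (fun x => z t x - z' t x) <=
    2 * nu (fun x => u x - u' x) * expR (2 * `|L t - L 0|).
Proof.
move=> A0 B0 cz cz' Pu Pu' pQ pQ' PF PF' Ez Ez' dL l0 FF.
have I0 : A <= 0 <= B by rewrite A0.
have [Pz _] := cz; have [Pz' _] := cz'.
set eta := nu (fun x => u x - u' x); have eta0 : 0 <= eta by exact: nu_ge0.
have pQQ := prim_B pQ pQ' PF PF'; have [PQQ _] := pQQ.
have mono := derive_mono dL l0.
pose w t := nu (fun x => z t x - z' t x).
have PFF t : A <= t <= B -> P (fun x => F t x - F' t x) by move=> tI; apply: PB; auto.
have main t : A <= t <= B -> w t <= eta +
    nu (fun x => (Q t x - Q' t x) - (Q 0 x - Q' 0 x)).
  move=> tI; have PX := PB Pu Pu'; have PY := PB (PQQ t tI) (PQQ 0 I0).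
  rewrite /w.
  have E : Cae_eq (fun x => z t x - z' t x)
    (fun x => (u x - u' x) + 'i%C * ((Q t x - Q' t x) - (Q 0 x - Q' 0 x))).
    apply: (aeS2 (Ez t tI) (Ez' t tI)) => x -> ->.
    by move: (u x) (u' x) (Q t x) (Q' t x) (Q 0 x) (Q' 0 x) => *; ring.
  rewrite (nu_ae (PD PX (PZ 'i%C PY)) (ae_eq_sym E) (P_L2 (PB (Pz t tI) (Pz' t tI)))).
  apply: le_trans (nuD b0 PX (PZ 'i%C PY)) _.
  by rewrite (nuZ _ PY) normc_i mul1r.
have step (c : R) : 0 <= c -> 2 * eta <= c ->
    (forall t, A <= t <= B -> w t <= c * expR (2 * `|L t - L 0|)) ->
    forall t, A <= t <= B -> w t <= (eta + c / 2) * expR (2 * `|L t - L 0|).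
  move=> c0 ec H t tI; have /andP[At tB] := tI.
  suff : nu (fun x => (Q t x - Q' t x) - (Q 0 x - Q' 0 x)) <=
      c / 2 * (expR (2 * `|L t - L 0|) - 1).
    move=> h; apply: le_trans (main t tI) _.
    have : 0 <= (c / 2 - eta) + eta * expR (2 * `|L t - L 0|).
      by rewrite addr_ge0 ?mulr_ge0 ?expR_ge0//; lra.
    rewrite mulrBr mulr1 in h; move: h; rewrite (mulrDl eta (c / 2)).
    by move: (nu _) (expR _) => p q; lra.
  have [t0|/ltW t0] := leP 0 t.
    have sub s : 0 <= s <= t -> A <= s <= B.
      by move=> /andP[h1 h2]; rewrite (le_trans A0 h1) (le_trans h2).
    have LN s : 0 <= s <= t -> `|L s - L 0| = L s - L 0.
      by move=> /andP[h1 h2]; rewrite ger0_norm// subr_ge0 mono// (le_trans h2).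
    (* The exponent carries a factor 2, so the primitive of [c] times the exponential weight has
       coefficient [c / 2]; this is the gain of one iteration. *)
    have dE s : 0 <= s <= t -> is_derive s 1 (fun v => c / 2 * expR (2 * (L v - L 0)))
        (l s * (c * expR (2 * `|L s - L 0|))).
      move=> sI; have h1 := dL s (sub s sI).
      have h2 : is_derive s 1 (fun v => 2 * (L v - L 0)) (2 * (l s - 0)).
        have h3 : is_derive s 1 (fun v => L v - L 0) (l s - 0).
          by apply: (@is_deriveB R _ _ L (fun=> L 0) s 1).
        by apply: is_deriveZ.
      have h4 := @is_derive1_comp R expR (fun v => 2 * (L v - L 0)) s _ _ (is_derive_expR _) h2.
      have h5 := @is_deriveZ R _ _ _ (c / 2) s 1 _ h4.
      by apply: (is_derive_eq h5); rewrite LN// /GRing.scale /=; field.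
    have At0 : A <= 0 <= B by [].
    have := prim_bound b0 t0 (prim_sub A0 tB pQQ) (fun s sI => PFF s (sub s sI)) dE _.
    have -> : c / 2 * (expR (2 * `|L t - L 0|) - 1) =
       c / 2 * expR (2 * (L t - L 0)) - c / 2 * expR (2 * (L 0 - L 0)).
      by rewrite subrr mulr0 expR0 mulr1 LN ?lexx ?t0// mulrBr mulr1.
    apply => s sI; apply: le_trans (FF s (sub s sI)) _.
    by apply: ler_wpM2l; [apply/l0/sub|apply/H/sub].
  have sub s : t <= s <= 0 -> A <= s <= B.
    by move=> /andP[h1 h2]; rewrite (le_trans At h1) (le_trans h2).
  have LN s : t <= s <= 0 -> `|L s - L 0| = L 0 - L s.
    by move=> /andP[h1 h2]; rewrite ler0_norm ?opprB// subr_le0 mono// (le_trans At).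
  have dE s : t <= s <= 0 -> is_derive s 1 (fun v => - (c / 2) * expR (2 * (L 0 - L v)))
      (l s * (c * expR (2 * `|L s - L 0|))).
    move=> sI; have h1 := dL s (sub s sI).
    have h2 : is_derive s 1 (fun v => 2 * (L 0 - L v)) (2 * (0 - l s)).
      have h3 : is_derive s 1 (fun v => L 0 - L v) (0 - l s).
        by apply: (@is_deriveB R _ _ (fun=> L 0) L s 1).
      by apply: is_deriveZ.
    have h4 := @is_derive1_comp R expR (fun v => 2 * (L 0 - L v)) s _ _ (is_derive_expR _) h2.
    have h5 := @is_deriveZ R _ _ _ (- (c / 2)) s 1 _ h4.
    by apply: (is_derive_eq h5); rewrite LN// /GRing.scale /=; field.
  have := prim_bound b0 t0 (prim_sub At B0 pQQ) (fun s sI => PFF s (sub s sI)) dE _.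
  have -> : c / 2 * (expR (2 * `|L t - L 0|) - 1) =
     - (c / 2) * expR (2 * (L 0 - L 0)) - (- (c / 2)) * expR (2 * (L 0 - L t)).
    rewrite subrr mulr0 expR0 mulr1 LN ?lexx ?t0// mulrBr mulr1; ring.
  rewrite (nuB_sym (PQQ 0 I0) (PQQ t tI)); apply => s sI.
  apply: le_trans (FF s (sub s sI)) _.
  by apply: ler_wpM2l; [apply/l0/sub|apply/H/sub].
have AB := le_trans A0 B0.
have [D D0 HD] := contP_bounded b0 AB (contP_D b0 cz (contP_Z b0 (-1) cz')).
have iter n : forall t, A <= t <= B -> w t <= (2 * eta + D * 2^-1 ^+ n) * expR (2 * `|L t - L 0|).
  elim: n => [|n IH] t tI.
    have e1 : 1 <= expR (2 * `|L t - L 0|) by rewrite -expR0 ler_expR mulr_ge0.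
    apply: (@le_trans _ _ D).
      have := HD t tI; rewrite (_ : (fun x => _ + _) = fun x => z t x - z' t x)//.
      by apply: funext => x; rewrite mulN1r.
    rewrite expr0 mulr1; apply: (@le_trans _ _ (2 * eta + D)); first by rewrite lerDr mulr_ge0.
    by apply: ler_peMr => //; rewrite addr_ge0 ?mulr_ge0// ltW.
  have p0 : 0 <= D * 2^-1 ^+ n by rewrite mulr_ge0 ?exprn_ge0 ?invr_ge0// ltW.
  have := step (2 * eta + D * 2^-1 ^+ n) _ _ IH t tI.
  rewrite (_ : eta + _ / 2 = 2 * eta + D * 2^-1 ^+ n.+1); last by rewrite exprS; field.
  move=> hh; apply: hh; last by rewrite lerDl.
  by rewrite addr_ge0// mulr_ge0.
move=> t tI; apply/ler_addgt0Pl => e e0.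
pose E := expR (2 * `|L t - L 0|); have E0 : 0 < E by exact: expR_gt0.
have cv : (fun n => D * 2^-1 ^+ n * E) @ \oo --> (0 : R).
  rewrite -(mul0r E) -{1}(mulr0 D); apply: cvgM; last exact: cvg_cst.
  apply: cvgM; first exact: cvg_cst.
  by apply: cvg_expr; rewrite ger0_norm ?invr_ge0// invf_lt1// ltr1n.
have /cvgrPdist_le/(_ e e0)[n _ Hn] := cv; have := Hn n (leqnn n) => /=.
rewrite sub0r normrN ger0_norm; last first.
  by rewrite !mulr_ge0 ?exprn_ge0 ?invr_ge0 ?expR_ge0// ltW.
move=> h; apply: le_trans (iter n t tI) _.
by rewrite mulrDl addrC lerD2r.
Qed.

End Picard.

(** * The fixed point argument *)

Section MildSolutions.
Context {R : realType} {N : nat} (d : 'I_N.+1 -> R[i]) (alpha : 'I_N.+1 -> R).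
Hypothesis alpha_ge1 : forall k, 1 <= alpha k.
Hypothesis alpha_min : forall k, alpha ord0 <= alpha k.
Context (b : R) (b0 : 0 <= b).
Implicit Types (F Q z : R -> R -> R[i]) (A B s t r e xi M : R).
Local Notation P := (P b).
Local Notation nu := (nu b).
Local Notation G := (G d alpha).

(* [z t] stands for [e^(-it d_x^2) u t]. *)
Definition mild A B u0 z := contP b A B z /\
  exists2 Q, prim b A B (fun t => G t (z t)) Q &
    forall t, A <= t <= B -> Cae_eq (z t) (fun x => u0 x + 'i%C * (Q t x - Q 0 x)).

Definition lip M t := 5 * KK d alpha (2 * M) * (1 + b * t) `^ (- (alpha ord0 / 2)).

Lemma lip_ge0 M t : 0 <= lip M t.
Proof. by rewrite /lip !mulr_ge0 ?powR_ge0// (KK_ge0 d alpha_ge1). Qed.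

Lemma lip_le M t : 0 <= b * t -> lip M t <= 5 * KK d alpha (2 * M).
Proof.
move=> bt; apply: ler_piMr; first by rewrite mulr_ge0// (KK_ge0 d alpha_ge1).
rewrite -[leRHS](powRr0 (1 + b * t)); apply: ler_powR; first by rewrite lerDl.
by have := alpha_ge1 ord0; lra.
Qed.

Lemma nu_G M t f : 0 <= b * t -> 0 < M -> P f -> nu f <= M -> nu (G t f) <= M * lip M t.
Proof.
move=> bt M0 Pf fM; have P0f := P_zero b.
have zM : nu (fun=> 0) <= M by rewrite nu0 ltW.
have := G_lip d alpha_ge1 b0 bt M0 alpha_min Pf P0f fM zM; rewrite -/(lip M t).
have PG1 := P_G d alpha_ge1 t Pf; have PG0 := P_G d alpha_ge1 t P0f.
have E : Cae_eq (G t f) (fun x => G t f x - G t (fun=> 0) x).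
  by apply: (aeS (G_zero d alpha_ge1 t)) => x ->; rewrite subr0.
rewrite (nu_ae PG1 E (P_L2 (PB PG1 PG0))).
rewrite (_ : (fun x => f x - 0) = f); last by apply: funext => x; rewrite subr0.
move: (lip M t) (lip_ge0 M t) => l l0 h; apply: le_trans h _.
by rewrite [leRHS]mulrC; exact: (ler_wpM2l l0 fM).
Qed.

Lemma contP_G A B z : A <= B -> (forall t, A <= t <= B -> 0 <= b * t) -> contP b A B z ->
  contP b A B (fun t => G t (z t)).
Proof.
move=> AB bt cz; have [Pz Hz] := cz; have [M M0 HM] := contP_bounded b0 AB cz.
have PG t s : A <= s <= B -> P (G t (z s)) by move=> sI; exact: (P_G d alpha_ge1 t (Pz s sI)).
split; first by move=> t tI; exact: PG.
move=> t tI e e0; have e20 : 0 < e / 2 by rewrite divr_gt0.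
pose K := 5 * KK d alpha (2 * M); have K0 : 0 <= K by rewrite mulr_ge0// (KK_ge0 d alpha_ge1).
have K1 : 0 < K + 1 by rewrite ltr_wpDl.
have [d1 d10 H1] := Hz t tI _ (divr_gt0 e20 K1).
have [d2 d20 H2] := G_cont d alpha_ge1 t b0 (Pz t tI) e20.
exists (Num.min d1 d2); first by rewrite lt_min d10.
move=> s sI; rewrite lt_min => /andP[s1 s2].
apply: le_trans (nuB_trans b0 (PG s s sI) (PG s t tI) (PG t t tI)) _.
rewrite [leRHS]splitr; apply: lerD; last exact: H2.
apply: le_trans (G_lip d alpha_ge1 b0 (bt s sI) M0 alpha_min (Pz s sI) (Pz t tI) (HM s sI) (HM t tI)) _.
rewrite -/(lip M s).
have n0 : 0 <= nu (fun x => z s x - z t x) by exact: nu_ge0.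
apply: le_trans (ler_pM (lip_ge0 M s) n0 (lip_le M (bt s sI)) (H1 s sI s1)) _.
rewrite -/K mulrCA; apply: ler_piMr; first exact: ltW.
by rewrite ler_pdivrMr// mul1r lerDl.
Qed.

Lemma small_pow (c e : R) : 0 < e -> exists n, c * 2^-1 ^+ n <= e.
Proof.
move=> e0; have cv : (fun n => c * 2^-1 ^+ n) @ \oo --> (0 : R).
  rewrite -(mulr0 c); apply: cvgM; first exact: cvg_cst.
  by apply: cvg_expr; rewrite ger0_norm ?invr_ge0// invf_lt1// ltr1n.
have /cvgrPdist_le/(_ e e0)[n _ Hn] := cv; exists n; have := Hn n (leqnn n) => /=.
by rewrite sub0r normrN => /ler_normlP[].
Qed.

Section Picard.
Context (A B M : R) (u0 : R -> R[i]) (L : R -> R).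
(** The sign condition on [b * t] covers both uses at once: an interval around 0 when [b = 0], and
    an interval to the right of 0 when [b] is positive. *)
Hypotheses (A0 : A <= 0) (B0 : 0 <= B) (bt : forall t, A <= t <= B -> 0 <= b * t).
Hypotheses (M0 : 0 < M) (Pu : P u0) (uM : nu u0 <= M / 2).
Hypotheses (dL : forall t, A <= t <= B -> is_derive t 1 L (lip M t)) (L2' : L B - L A <= 1 / 2).

Let AB : A <= B. Proof. exact: le_trans A0 B0. Qed.
Let I0 : A <= 0 <= B. Proof. by rewrite A0. Qed.

Let inv z := contP b A B z /\ forall t, A <= t <= B -> nu (z t) <= M.
Let img Q t : R -> R[i] := fun x => u0 x + 'i%C * (Q t x - Q 0 x).

Let inv_img z Q : inv z -> prim b A B (fun t => G t (z t)) Q -> inv (img Q).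
Proof.
move=> [[Pz cz] zM] pQ; have PF t : A <= t <= B -> P (G t (z t)).
  by move=> tI; exact: (P_G d alpha_ge1 t (Pz t tI)).
have [PQ _] := pQ; have cQ := prim_cont b0 pQ PF; split.
  have c1 := contP_D b0 cQ (contP_cst A B (PZ (-1) (PQ 0 I0))).
  have := contP_D b0 (contP_cst A B Pu) (contP_Z b0 'i%C c1).
  by congr contP; apply: funext => t; apply: funext => x; rewrite /img mulN1r.
move=> t tI; have PX := PB (PQ t tI) (PQ 0 I0).
apply: le_trans (nuD b0 Pu (PZ 'i%C PX)) _; rewrite (nuZ _ PX) normc_i mul1r [leRHS]splitr.
have h s (sI : A <= s <= B) : nu (G s (z s)) <= M * lip M s := nu_G (bt sI) M0 (Pz s sI) (zM s sI).
suff H : nu (fun x => Q t x - Q 0 x) <= M / 2 by exact: lerD uM H.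
apply: le_trans (prim_bound0 b0 A0 B0 pQ PF dL (fun s _ => lip_ge0 M s) (ltW M0) h tI) _.
rewrite ler_pM2l//; move: L2'; lra.
Qed.

Let contr z z' Q Q' (c : R) : 0 <= c -> inv z -> inv z' ->
  prim b A B (fun t => G t (z t)) Q -> prim b A B (fun t => G t (z' t)) Q' ->
  (forall t, A <= t <= B -> nu (fun x => z t x - z' t x) <= c) ->
  forall t, A <= t <= B -> nu (fun x => img Q t x - img Q' t x) <= c / 2.
Proof.
move=> c0 [[Pz cz] zM] [[Pz' cz'] zM'] pQ pQ' H t tI.
have PF t' : A <= t' <= B -> P (G t' (z t')) by move=> t'I; exact: (P_G d alpha_ge1 t' (Pz t' t'I)).
have PF' t' : A <= t' <= B -> P (G t' (z' t')) by move=> t'I; exact: (P_G d alpha_ge1 t' (Pz' t' t'I)).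
have pp := prim_B b0 pQ pQ' PF PF'; have [PQ _] := pp.
have PX := PB (PQ t tI) (PQ 0 I0).
rewrite (_ : (fun x => _) = fun x => 'i%C * (Q t x - Q' t x - (Q 0 x - Q' 0 x))); last first.
  by apply: funext => x; rewrite /img; ring.
rewrite (nuZ _ PX) normc_i mul1r.
have h s : A <= s <= B -> nu (fun x => G s (z s) x - G s (z' s) x) <= c * lip M s.
  move=> sI; apply: le_trans (G_lip d alpha_ge1 b0 (bt sI) M0 alpha_min (Pz s sI) (Pz' s sI)
    (zM s sI) (zM' s sI)) _.
  by rewrite [leRHS]mulrC; apply: ler_wpM2l; [exact: lip_ge0|exact: H].
have PFF s : A <= s <= B -> P (fun x => G s (z s) x - G s (z' s) x).
  by move=> sI; apply: PB; auto.
apply: le_trans (prim_bound0 b0 A0 B0 pp PFF dL (fun s _ => lip_ge0 M s) c0 h tI) _.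
by apply: ler_wpM2l => //; move: L2'; lra.
Qed.

(** One smallness condition does two jobs. With total mass of [lip M] at most 1/2, the data and the
    integral term each take at most half of the radius [M], and the map halves distances. Uniqueness
    is left to Gronwall's lemma. *)
Lemma picard : exists z, mild A B u0 z /\ forall t, A <= t <= B -> nu (z t) <= M.
Proof.
have M00 := ltW M0.
have Qex z : inv z -> exists Q, prim b A B (fun t => G t (z t)) Q.
  move=> [cz _]; have cG := contP_G AB bt cz.
  exact: (prim_exists b0 AB cG).
(* Choice needs a total statement, hence the zero curve outside the invariant set. *)
have Tex z : exists Q, inv z -> prim b A B (fun t => G t (z t)) Q.
  have [iz|niz] := pselect (inv z); last by exists (fun=> fun=> 0).
  by have [Q pQ] := Qex z iz; exists Q.
have /choice[T HT] := Tex.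
pose Z n := iter n (fun z => img (T z)) (fun=> u0).
have ZS n : Z n.+1 = img (T (Z n)) by [].
have invZ n : inv (Z n).
  elim: n => [|n IH]; last by rewrite ZS; apply: (inv_img IH); exact: HT.
  split; first exact: contP_cst.
  by move=> t _; apply: le_trans uM _; rewrite ler_pdivrMr// ler_peMr// ler1n.
have PZn n t : A <= t <= B -> P (Z n t) by have [[H _] _] := invZ n; exact: H.
(* The first increment is at most [2 * M], which is half of [r 0]; and half of [r n] equals
   [r n - r n.+1], so the later increments telescope. *)
pose r n := 4 * M * 2^-1 ^+ n.
have rS n : r n.+1 = r n / 2 by rewrite /r exprS; ring.
have r0 n : 0 <= r n by rewrite /r !mulr_ge0// exprn_ge0// invr_ge0.
have dZ n : forall t, A <= t <= B -> nu (fun x => Z n.+1 t x - Z n t x) <= r n / 2.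
  elim: n => [|n IH] t tI.
    apply: le_trans (nuB b0 (PZn 1%N t tI) (PZn 0%N t tI)) _.
    have [_ h1] := invZ 1%N; have [_ h0] := invZ 0%N.
    apply: le_trans (lerD (h1 t tI) (h0 t tI)) _.
    by rewrite /r expr0 mulr1; lra.
  rewrite rS; apply: (contr _ (invZ n.+1) (invZ n) _ _ IH tI); [by rewrite divr_ge0|exact: HT|exact: HT].
have dZk n k t : A <= t <= B -> nu (fun x => Z (n + k)%N t x - Z n t x) <= r n - r (n + k)%N.
  move=> tI; elim: k => [|k IH].
    rewrite addn0 subrr (_ : (fun x => _) = fun=> 0) ?nu0//.
    by apply: funext => x; rewrite subrr.
  rewrite addnS; apply: le_trans (nuB_trans b0 (PZn _ t tI) (PZn (n + k)%N t tI) (PZn n t tI)) _.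
  apply: le_trans (lerD (dZ _ t tI) IH) _; rewrite rS; lra.
have dZr n m t : A <= t <= B -> (n <= m)%N -> nu (fun x => Z m t x - Z n t x) <= r n.
  move=> tI nm; rewrite -(subnKC nm); apply: le_trans (dZk n _ t tI) _.
  by rewrite lerBlDr lerDl.
have lim t : exists g, A <= t <= B -> P g /\ forall n, nu (fun x => Z n t x - g x) <= r n.
  have [tI|tI] := boolP (A <= t <= B); last by exists (fun=> 0).
  have [n|e e0|g Pg Hg] := @nu_complete R b (fun n => Z n t) b0; first exact: PZn.
    have e20 : 0 < e / 2 by rewrite divr_gt0.
    have [n0 hn0] := small_pow (4 * M) e20; exists n0 => m n hm hn.
    apply: le_trans (nuB_trans b0 (PZn m t tI) (PZn n0 t tI) (PZn n t tI)) _.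
    rewrite (nuB_sym (PZn n0 t tI) (PZn n t tI)) [leRHS]splitr.
    by apply: lerD; apply: le_trans hn0; apply: dZr.
  exists g => _; split => // n; apply/ler_addgt0Pl => e e0; have [n0 h] := Hg e e0.
  apply: le_trans (nuB_trans b0 (PZn n t tI) (PZn (n0 + n)%N t tI) Pg) _.
  rewrite (nuB_sym (PZn n t tI) (PZn (n0 + n)%N t tI)) addrC; apply: lerD.
    by apply: h; rewrite leq_addr.
  by apply: dZr => //; rewrite leq_addl.
have /choice[z Hz] := lim.
have Pz t : A <= t <= B -> P (z t) by move=> tI; have [] := Hz t tI.
have rz n t : A <= t <= B -> nu (fun x => Z n t x - z t x) <= r n.
  by move=> tI; have [_] := Hz t tI; exact.
have iz : inv z; first split.
- apply: (contP_unif b0 (fun n => (invZ n).1) Pz) => e e0.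
  have [n hn] := small_pow (4 * M) e0; exists n => t tI.
  exact: le_trans (rz n t tI) hn.
- move=> t tI; apply/ler_addgt0Pl => e e0; have [n hn] := small_pow (4 * M) e0.
  have := nuB b0 (PZn n t tI) (PB (PZn n t tI) (Pz t tI)).
  rewrite (_ : (fun x => _) = z t); last by apply: funext => x; rewrite opprB addrC subrK.
  move=> h; apply: le_trans h _; rewrite addrC; apply: lerD.
    exact: le_trans (rz n t tI) hn.
  by have [_] := invZ n; exact.
exists z; split; last by case: iz.
split; first by case: iz.
have pQ := HT z iz; exists (T z) => // t tI.
have ii := inv_img iz pQ; have PI : P (img (T z) t) by have [[H _] _] := ii; exact: H.
apply: (nuB_eq0 b0 (Pz t tI) PI); apply/eqP; rewrite eq_le nu_ge0// andbT.
apply/ler_addgt0Pl => e e0; rewrite addr0; have [n hn] := small_pow (4 * M) e0.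
apply: le_trans (nuB_trans b0 (Pz t tI) (PZn n.+1 t tI) PI) _.
rewrite (nuB_sym (Pz t tI) (PZn n.+1 t tI)).
have h1 := rz n.+1 t tI.
have h2 := contr (r0 n) (invZ n) iz (HT _ (invZ n)) pQ (rz n) tI.
rewrite rS in h1; have h := lerD h1 h2; rewrite -splitr in h.
exact: le_trans h hn.
Qed.

End Picard.

End MildSolutions.

(** * Solutions of the Duhamel equation *)

Section H1Limits.
Context {R : realType}.
Implicit Types (f h I : R -> R[i]) (F Q u : R -> R -> R[i]) (a b t r e : R).
Local Notation P := (P 0).
Local Notation nu := (nu 0).

Let b0 : 0 <= 0 :> R. Proof. exact: lexx. Qed.

Lemma nu0E f : nu f = nr f + 2 * nr (D f).
Proof.
rewrite /nu (_ : J 0 f = D f); last first.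
  by apply: funext => x; rewrite /J mul0r mul0r mulr0 subr0.
by rewrite addr0 invr1; ring.
Qed.

Lemma nu_S t f : P f -> nu (schrodinger t f) = nu f.
Proof. by move=> Pf; rewrite !nu0E (S_nr t (P_L2 Pf)) (nr_DS t Pf.1). Qed.

Lemma H1norm_le f r : P f -> nu f <= r -> (H1norm f <= r%:E)%E.
Proof.
move=> Pf; rewrite nu0E (H1normE (P_D Pf)) lee_fin => h; apply: le_trans h.
rewrite -(@ler_pXn2r _ 2)// ?nnegrE ?sqrtr_ge0 ?addr_ge0 ?mulr_ge0 ?nr_ge0//.
rewrite sqr_sqrtr ?addr_ge0 ?sqr_ge0//.
have := nr_ge0 f; have := nr_ge0 (D f); move: (nr f) (nr (D f)) => p q q0 p0; nra.
Qed.

(** The constant 3 arises since [nu 0] is $|f|+2|f'|$ and each term is bounded by the $H^1$ norm. *)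
Lemma H1norm_lt f r : (H1norm f < r%:E)%E -> P f /\ nu f < 3 * r.
Proof.
move=> h; have Hf : H1 f by move: h; rewrite /H1norm; case: asboolP.
have Pf := (P0 f).2 Hf; split => //; move: h; rewrite (H1normE (P_D Pf)) lte_fin nu0E.
set q := Num.sqrt _ => h.
have le (p p' : R) : 0 <= p -> p <= Num.sqrt (p ^+ 2 + p' ^+ 2).
  move=> p0; rewrite -[X in X <= _](ger0_norm p0) -sqrtr_sqr ler_wsqrtr//.
  by rewrite lerDl sqr_ge0.
have h1 : nr f <= q by apply: le; exact: nr_ge0.
have h2 : nr (D f) <= q by rewrite /q addrC; apply: le; exact: nr_ge0.
by move: h h1 h2; move: q (nr f) (nr (D f)) => q' p p'; lra.
Qed.

Lemma H1norm_ge0 f : (0 <= H1norm f)%E.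
Proof.
by rewrite /H1norm; case: asboolP => // _; exact: poweR_ge0.
Qed.

Lemma cvg0eP T (X : set_system T) (FX : Filter X) (g : T -> \bar R) : (forall s, 0 <= g s)%E ->
  (g s @[s --> X] --> 0%E) <-> (forall e, 0 < e -> \forall s \near X, (g s < e%:E)%E).
Proof.
move=> g0; split=> [h e e0|H].
  have U : nbhs (0 : \bar R)%E [set x : \bar R | (x < e%:E)%E].
    exists e => //= y; rewrite /= sub0r normrN lte_fin; exact: le_lt_trans (ler_norm y).
  exact: (h _ U).
move=> U /= [e e0 Ue]; have := H e e0; rewrite /= /nbhs /=; apply: filterS => s gs.
have : g s \is a fin_num by rewrite ge0_fin_numE// (lt_trans gs) ?ltry.
change (g s \is a fin_num -> U (g s)); move: (g0 s) gs; case: (g s) => // r r0 re _.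
apply: (Ue r) => /=.
by rewrite sub0r normrN ger0_norm.
Qed.

Lemma CH1P (T : set R) u : CH1 T u <-> (forall t, T t -> H1 (u t)) /\
  forall t, T t -> forall e, 0 < e -> exists2 del : R, 0 < del &
    forall s, T s -> `|s - t| < del -> nu (fun x => u s x - u t x) <= e.
Proof.
split=> -[Hu Cu]; split => // t tT.
  move=> e e0; have e30 : 0 < e / 3 by rewrite divr_gt0.
  have /cvg0eP H := Cu t tT; have [del del0 Hd] := H (fun s => H1norm_ge0 _) _ e30.
  exists del => // s sT st; have [|_ h] := H1norm_lt (Hd s _ sT).
    by rewrite /= distrC.
  by apply/ltW; rewrite mulrC divfK in h.
apply/cvg0eP => [s|e e0]; first exact: H1norm_ge0.
have e20 : 0 < e / 2 by rewrite divr_gt0.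
have [del del0 Hd] := Cu t tT _ e20; exists del => // s /=; rewrite distrC => st sT.
have Pst := PB ((P0 _).2 (Hu s sT)) ((P0 _).2 (Hu t tT)).
apply: le_lt_trans (H1norm_le Pst (Hd s sT st)) _.
by rewrite lte_fin ltr_pdivrMr// ltr_pMr// ltr1n.
Qed.

Lemma tag_in n (p xi : nat -> R) : (forall k, (k < n)%N -> p k <= xi k /\ xi k <= p k.+1) ->
  forall k, (k < n)%N -> p 0%N <= xi k <= p n.
Proof.
move=> H k kn; have [h1 h2] := H k kn; apply/andP; split.
  exact: le_trans (part_mono H (ltnW kn)) h1.
apply: le_trans h2 _; rewrite -(subnKC kn).
have := @part_mono _ (n - k.+1) (fun j => p (k.+1 + j)%N) (fun j => xi (k.+1 + j)%N) _ _ (leqnn _).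
rewrite addn0; apply => j jn; rewrite addnS; apply: H.
by rewrite -ltn_subRL.
Qed.

Lemma P_riemann n (p xi : nat -> R) F : (forall k, (k < n)%N -> P (F (xi k))) ->
  P (riemann_sum n p xi F).
Proof.
elim: n => [_|n IH H].
  have := P_zero (0 : R); rewrite (_ : (fun=> 0) = riemann_sum 0 p xi F)//.
  by apply: funext => x; rewrite /riemann_sum big_ord0.
have h1 : P (riemann_sum n p xi F) by apply: IH => k kn; apply: H; exact: ltnW.
have := PD h1 (PZ (p n.+1 - p n)%:C (H n (ltnSn n))).
rewrite (_ : (fun x => _) = riemann_sum n.+1 p xi F)//.
by apply: funext => x; rewrite riemann_sumS.
Qed.

Lemma S_riemann t n (p xi : nat -> R) F g :
  (forall k, (k < n)%N -> P (g (xi k)) /\ Cae_eq (F (xi k)) (schrodinger t (g (xi k)))) ->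
  Cae_eq (riemann_sum n p xi F) (schrodinger t (riemann_sum n p xi g)).
Proof.
elim: n => [_|n IH H].
  have := S_Z t 0 (@L2_0 R); rewrite (_ : (fun x : R => 0 * 0) = riemann_sum 0 p xi g).
    by move=> h; apply: (aeS h) => x ->; rewrite mul0r /riemann_sum big_ord0.
  by apply: funext => x; rewrite mul0r /riemann_sum big_ord0.
have {}IH := IH (fun k kn => H k (ltnW kn)); have [Pg E] := H n (ltnSn n).
have h1 : P (riemann_sum n p xi g) by apply: P_riemann => k kn; exact: (H k (ltnW kn)).1.
have := S_lin t (p n.+1 - p n)%:C (P_L2 Pg) (P_L2 h1).
rewrite (_ : (fun x => _) = riemann_sum n.+1 p xi g); last first.
  by apply: funext => x; rewrite riemann_sumS addrC.
move=> h; apply: (aeS2 h (aeS2 IH E (fun x => @conj _ _))) => x -> [e1 e2].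
by rewrite riemann_sumS e1 e2 addrC.
Qed.

(** The group is an isometry for [nu 0] and commutes with finite sums, so convergence of the Riemann
    sums of [g] is carried over to those of [F]. *)
Lemma riem_S t a b F g Q I : a <= b -> prim 0 a b g Q ->
  (forall s, a <= s <= b -> [/\ P (g s), P (F s) & Cae_eq (F s) (schrodinger t (g s))]) ->
  P I -> Cae_eq I (schrodinger t (fun x => Q b x - Q a x)) -> is_riemann a b F I.
Proof.
move=> ab pQ H PI EI e e0; have e20 : 0 < e / 2 by rewrite divr_gt0.
have Pg s : a <= s <= b -> P (g s) by case/H.
have [del del0 Hd] := prim_riem b0 ab pQ Pg e20; exists del => // n p xi pa pb Hp.
have [PS nS] := Hd n p xi pa pb Hp; have [PQ _] := pQ.
have tag k : (k < n)%N -> a <= xi k <= b.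
  by rewrite -pa -pb; apply: tag_in => j jn; have [] := Hp j jn.
have PF : P (riemann_sum n p xi F) by apply: P_riemann => k /tag/H[].
have E : Cae_eq (riemann_sum n p xi F) (schrodinger t (riemann_sum n p xi g)).
  by apply: S_riemann => k /tag/H[].
have aI : a <= a <= b by rewrite lexx.
have bI : a <= b <= b by rewrite lexx andbT.
have PQQ := PB (PQ b bI) (PQ a aI); have PX := PB PS PQQ.
have EX : Cae_eq (schrodinger t (fun x => riemann_sum n p xi g x - (Q b x - Q a x)))
    (fun x => riemann_sum n p xi F x - I x).
  by apply: (aeS2 (S_B t (P_L2 PS) (P_L2 PQQ)) (Cae_eqB E EI)) => x -> ->.
apply: (@le_lt_trans _ _ (e / 2)%:E); last first.
  by rewrite lte_fin ltr_pdivrMr// ltr_pMr// ltr1n.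
apply: H1norm_le; first exact: PB.
rewrite (nu_ae (S_P t PX) EX (P_L2 (PB PF PI))).
by rewrite nu_S.
Qed.

(** A uniform partition finer than both thresholds produces one Riemann sum close to both limits. *)
Lemma riem_uniq a b F I I' : a <= b -> is_riemann a b F I -> is_riemann a b F I' -> Cae_eq I I'.
Proof.
move=> ab H H'.
suff key e : 0 < e -> P (fun x => I x - I' x) /\ nu (fun x => I x - I' x) <= e.
  have [PI _] := key 1 ltr01; have n0 : nu (fun x => I x - I' x) = 0.
    apply/eqP; rewrite eq_le nu_ge0// andbT; apply/ler_addgt0Pl => e e0; rewrite addr0.
    by have [] := key e e0.
  by apply: (aeS (nu_eq0 b0 PI n0)) => x /eqP; rewrite subr_eq0 => /eqP.
move=> e0; have e60 : 0 < e / 6 by rewrite divr_gt0.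
have [d1 d10 H1] := H _ e60; have [d2 d20 H2] := H' _ e60.
pose del := Num.min d1 d2; have del0 : 0 < del by rewrite lt_min d10.
pose n := (Num.truncn ((b - a) / del)).+1; pose h := (b - a) / n%:R.
have n0 : 0 < n%:R :> R by rewrite ltr0n.
have h0 : 0 <= h by rewrite divr_ge0 ?subr_ge0// ltW.
have hdel : h < del by rewrite /h ltr_pdivrMr// mulrC -ltr_pdivrMr// truncnS_gt.
pose p k : R := a + k%:R * h.
have pS k : p k.+1 - p k = h by rewrite /p -natr1; ring.
have p0 : p 0%N = a by rewrite /p mul0r addr0.
have pn : p n = b by rewrite /p /h mulrC divfK ?gt_eqF//; ring.
have tag k : (k < n)%N -> [/\ p k <= p k, p k <= p k.+1 & p k.+1 - p k < del].
  by move=> _; rewrite lexx pS -subr_ge0 pS.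
have [|P1 h1] := H1norm_lt (H1 n p p p0 pn _).
  by move=> k kn; have [x1 x2] := tag k kn; rewrite lt_min => /andP[].
have [|P2 h2] := H1norm_lt (H2 n p p p0 pn _).
  by move=> k kn; have [x1 x2] := tag k kn; rewrite lt_min => /andP[].
have PX := PB P2 P1.
rewrite (_ : (fun x => I x - I' x) = fun x => (riemann_sum n p p F \- I') x - (riemann_sum n p p F \- I) x); last first.
  by apply: funext => x /=; ring.
split => //; apply: le_trans (nuB b0 P2 P1) _.
by move: h1 h2; move: (nu _) (nu _) => x1 x2; lra.
Qed.

End H1Limits.

(** * From the weighted norms to the $H^1$ norm *)

Section Weights.
Context {R : realType} {N : nat} (d : 'I_N.+1 -> R[i]) (alpha : 'I_N.+1 -> R).
Hypothesis alpha_ge1 : forall k, 1 <= alpha k.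

Lemma nu_le b (f : R -> R[i]) : 0 <= b -> P b f -> P 0 f /\ nu 0 f <= 2 * (6 + 3 * b) * nu b f.
Proof.
move=> bb Pb; have b0 := lexx (0 : R); have Pf := (P0 f).2 Pb.1; split => //.
apply: le_trans (nu_wn b0 Pf) _; rewrite -mulrA ler_wpM2l//.
apply: le_trans (wn_nu bb Pb); rewrite wn_x0 /wn lerDl; exact: nr_ge0.
Qed.

(** For fixed [b] the norm [nu 0] is bounded by a multiple of [nu b]. This makes the uniqueness and
    Duhamel results, proved with [b = 0], available to weighted solutions. *)
Lemma mild_0 b A B u0 z : 0 <= b -> mild d alpha b A B u0 z -> mild d alpha 0 A B u0 z.
Proof.
move=> bb [[Pz cz] [Q [PQ HQ] E]].
pose K := 2 * (6 + 3 * b); have K0 : 0 < K by rewrite /K; lra.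
have PG t : A <= t <= B -> P b (G d alpha t (z t)).
  by move=> tI; exact: (P_G d alpha_ge1 t (Pz t tI)).
split.
  split; first by move=> t tI; exact: (nu_le bb (Pz t tI)).1.
  move=> t tI e e0; have [del del0 H] := cz t tI _ (divr_gt0 e0 K0); exists del => // s sI st.
  have [_ h] := nu_le bb (PB (Pz s sI) (Pz t tI)); apply: le_trans h _.
  by have := H s sI st; rewrite ler_pdivlMr// mulrC.
exists Q => //; split; first by move=> t tI; exact: (nu_le bb (PQ t tI)).1.
move=> e e0; have [del del0 H] := HQ _ (divr_gt0 e0 K0); exists del => // s xi t As sx xt tB ts.
have st := le_trans sx xt.
have sI : A <= s <= B by rewrite As (le_trans st).
have xI : A <= xi <= B by rewrite (le_trans As) ?(le_trans xt).
have tI : A <= t <= B by rewrite tB (le_trans As).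
have [_ h] := nu_le bb (PB (PB (PQ t tI) (PQ s sI)) (PZ (t - s)%:C (PG xi xI))).
apply: le_trans h _; have := H s xi t As sx xt tB ts.
by rewrite mulrAC ler_pdivlMr// mulrC.
Qed.

End Weights.

(** * Equivalence with the Duhamel equation, and uniqueness *)

Section Duhamel.
Context {R : realType} {N : nat} (d : 'I_N.+1 -> R[i]) (alpha : 'I_N.+1 -> R).
Hypothesis alpha_ge1 : forall k, 1 <= alpha k.
Hypothesis alpha_min : forall k, alpha ord0 <= alpha k.
Implicit Types (f I : R -> R[i]) (F Q z : R -> R -> R[i]) (A B b s t r e M : R).
Local Notation P := (P 0).
Local Notation nu := (nu 0).
Local Notation G := (G d alpha).
Local Notation nl := (nonlinearity d alpha).
Local Notation mild := (mild d alpha).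

Let b0 : 0 <= 0 :> R. Proof. exact: lexx. Qed.

Lemma S_cont_nu A B z : contP 0 A B z -> contP 0 A B (fun t => schrodinger t (z t)).
Proof.
move=> [Pz cz]; split; first by move=> t tI; apply: S_P; exact: Pz.
move=> t tI e e0; have e20 : 0 < e / 2 by rewrite divr_gt0.
have e40 : 0 < e / 4 by rewrite divr_gt0.
have [d1 d10 H1] := cz t tI _ e20; have [d2 d20 H2] := S_contP t b0 (Pz t tI) e40.
exists (Num.min d1 d2); first by rewrite lt_min d10.
move=> s sI; rewrite lt_min => /andP[s1 s2].
have Pss := S_P s (Pz s sI); have Pst := S_P s (Pz t tI); have Ptt := S_P t (Pz t tI).
apply: le_trans (nuB_trans b0 Pss Pst Ptt) _; rewrite [leRHS]splitr; apply: lerD.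
  have PX := PB (Pz s sI) (Pz t tI).
  rewrite (nu_ae (S_P s PX) (S_B s (P_L2 (Pz s sI)) (P_L2 (Pz t tI))) (P_L2 (PB Pss Pst))).
  by rewrite nu_S//; exact: H1.
apply: le_trans (nu_wn b0 (PB Pst Ptt)) _.
by rewrite (_ : e / 2 = 2 * (e / 4)); [rewrite ler_pM2l//; exact: H2|field].
Qed.

Lemma duhamel_S f (g : R -> R[i]) t (c : R[i]) : L2 f -> L2 g ->
  Cae_eq (schrodinger t (fun x => f x + c * g x)) (fun x => schrodinger t f x + c * schrodinger t g x).
Proof.
move=> fL gL; have := S_D t fL (L2Z c gL).
by move=> h; apply: (aeS2 h (S_Z t c gL)) => x -> ->.
Qed.

Lemma S_G_sub t s f : P f ->
  Cae_eq (schrodinger (t - s) (nl (schrodinger s f))) (schrodinger t (G s f)).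
Proof. by move=> Pf; apply: ae_eq_sym; apply: S_group; exact: P_L2 (P_nl d alpha_ge1 (S_P s Pf)). Qed.

(** Minimum and maximum of 0 and [t] treat both directions of time together; for negative [t] the
    increment of [Q] changes sign along with the orientation. *)
Lemma oriented_riem t F g Q I : (forall s, Num.min 0 t <= s <= Num.max 0 t ->
    [/\ P (g s), P (F s) & Cae_eq (F s) (schrodinger t (g s))]) ->
  prim 0 (Num.min 0 t) (Num.max 0 t) g Q -> P I ->
  Cae_eq I (schrodinger t (fun x => Q t x - Q 0 x)) -> is_oriented_riemann 0 t F I.
Proof.
move=> H pQ PI EI; rewrite /is_oriented_riemann; case: (leP 0 t) => t0.
  by rewrite (min_l t0) (max_r t0) in H pQ; exact: riem_S pQ H PI EI.
have t0' := ltW t0; rewrite (min_r t0') (max_l t0') in H pQ.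
have [PQ _] := pQ.
have Pt : P (Q t) by apply: PQ; rewrite lexx.
have Po : P (Q 0) by apply: PQ; rewrite lexx andbT.
apply: (riem_S t0' pQ H).
  have := PZ (-1) PI; rewrite (_ : (fun x => _) = \- I)//.
  by apply: funext => x; rewrite mulN1r.
apply: (aeS2 (aeS2 (S_B t (P_L2 Pt) (P_L2 Po)) (S_B t (P_L2 Po) (P_L2 Pt)) (fun x => @conj _ _)) EI).
by move=> x /= [-> ->] ->; rewrite opprB.
Qed.

Lemma oriented_uniq t F I I' : is_oriented_riemann 0 t F I -> is_oriented_riemann 0 t F I' ->
  Cae_eq I I'.
Proof.
rewrite /is_oriented_riemann; case: (leP 0 t) => t0 h1 h2; first exact: riem_uniq h1 h2.
by apply: (aeS (riem_uniq (ltW t0) h1 h2)) => x /= /oppr_inj.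
Qed.

Lemma mild_duhamel A B u0 z : A <= 0 -> 0 <= B -> H1 u0 -> mild 0 A B u0 z ->
  forall t, A <= t <= B -> exists2 I : R -> R[i],
    is_oriented_riemann 0 t
      (fun s => schrodinger (t - s) (nl (schrodinger s (z s)))) I &
    Cae_eq (schrodinger t (z t)) (fun x => schrodinger t u0 x + 'i%C * I x).
Proof.
move=> A0 B0 Hu [[Pz cz] [Q pQ E]] t tI; have [PQ _] := pQ; have /andP[At tB] := tI.
have I0 : A <= 0 <= B by rewrite A0.
have PX := PB (PQ t tI) (PQ 0 I0); have Pu := (P0 _).2 Hu.
exists (schrodinger t (fun x => Q t x - Q 0 x)); last first.
  have h := duhamel_S t 'i%C (P_L2 Pu) (P_L2 PX); apply: ae_eq_trans h.
  exact: S_ae (P_L2 (Pz t tI)) (P_L2 (PD Pu (PZ 'i%C PX))) (E t tI).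
apply: (@oriented_riem t _ (fun s => G s (z s)) Q).
- move=> s /andP[s1 s2]; have sI : A <= s <= B.
    by rewrite (le_trans _ s1) ?le_min ?A0// (le_trans s2)// ge_max B0.
  split; [exact: (P_G d alpha_ge1 s (Pz s sI))|apply: S_P; exact: (P_nl d alpha_ge1 (S_P s (Pz s sI)))|].
  exact: S_G_sub (Pz s sI).
- by apply: prim_sub pQ; [rewrite le_min A0|rewrite ge_max B0].
- exact: S_P.
- exact: ae_eq_refl.
Qed.

Lemma solution_mild (T : set R) A B u0 u : A <= 0 -> 0 <= B -> (forall t, A <= t <= B -> T t) ->
  H1 u0 -> solution d alpha T u0 u -> mild 0 A B u0 (fun t => schrodinger (- t) (u t)).
Proof.
move=> A0 B0 AT Hu [/CH1P[Pu cu] E]; have AB := le_trans A0 B0.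
have I0 : A <= 0 <= B by rewrite A0.
have {}Pu t : A <= t <= B -> P (u t) by move=> /AT/Pu/P0.
pose z t := schrodinger (- t) (u t).
have cz : contP 0 A B z.
  (* [S_cont_nu] concerns curves of the form $S(t)z(t)$, while $z(t)=S(-t)u(t)$; reversing time
     brings it into that form. *)
  have cn : contP 0 (- B) (- A) (fun t => u (- t)).
    have sub t : - B <= t <= - A -> A <= - t <= B by move=> /andP[h1 h2]; apply/andP; split; lra.
    split; first by move=> t /sub; exact: Pu.
    move=> t /sub tI e e0; have [del del0 H] := cu _ (AT _ tI) e e0; exists del => // s /sub sI st.
    by apply: H; [exact: AT|rewrite opprK addrC distrC].
  have [Pc cc] := S_cont_nu cn.
  have sub t : A <= t <= B -> - B <= - t <= - A by move=> /andP[h1 h2]; apply/andP; split; lra.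
  split; first by move=> t tI; apply: S_P; exact: Pu.
  move=> t /sub tI e e0; have [del del0 H] := cc _ tI e e0; exists del => // s /sub sI st.
  by have := H (- s) sI; rewrite !opprK; apply; rewrite addrC distrC.
have [Pz _] := cz.
have bt s : A <= s <= B -> 0 <= 0 * s by rewrite mul0r.
have cG := contP_G d alpha_ge1 alpha_min b0 AB bt cz.
have [Q pQ] := prim_exists b0 AB cG; have [PQ _] := pQ.
split; first exact: cz.
exists Q; first exact: pQ.
move=> t tI; have /andP[At tB] := tI.
have [I HI EI] := E t (AT t tI).
have PX := PB (PQ t tI) (PQ 0 I0); have Pu0 := (P0 _).2 Hu.
(* The primitive of [G] gives a second Riemann integral of the same integrand; uniqueness identifies
   it with the one in the Duhamel equation. *)
have HI' : is_oriented_riemann 0 t (fun s => schrodinger (t - s) (nl (u s)))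
    (schrodinger t (fun x => Q t x - Q 0 x)).
  apply: (@oriented_riem t _ (fun s => G s (z s)) Q).
  - move=> s /andP[s1 s2]; have sI : A <= s <= B.
      by rewrite (le_trans _ s1) ?le_min ?A0// (le_trans s2)// ge_max B0.
    split; [exact: (P_G d alpha_ge1 s (Pz s sI))|apply: S_P; exact: (P_nl d alpha_ge1 (Pu s sI))|].
    apply: ae_eq_trans (S_G_sub t s (Pz s sI)).
    have Ps := S_P s (Pz s sI).
    apply: S_ae (P_L2 (P_nl d alpha_ge1 (Pu s sI))) (P_L2 (P_nl d alpha_ge1 Ps)) _.
    by apply: nl_ae; apply: ae_eq_sym; apply: S_NK; exact: P_L2 (Pu s sI).
  - by apply: prim_sub pQ; [rewrite le_min A0|rewrite ge_max B0].
  - exact: S_P.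
  - exact: ae_eq_refl.
have eI := oriented_uniq HI HI'.
have PW := PD Pu0 (PZ 'i%C PX).
have eu : Cae_eq (u t) (schrodinger t (fun x => u0 x + 'i%C * (Q t x - Q 0 x))).
  apply: (aeS2 (aeS2 EI eI (fun x => @conj _ _)) (duhamel_S t 'i%C (P_L2 Pu0) (P_L2 PX))).
  by move=> x [-> ->] ->.
apply: (ae_eq_trans (S_ae (- t) (P_L2 (Pu t tI)) (S_L2 t (P_L2 PW)) eu)).
exact: S_KN (P_L2 PW).
Qed.

Lemma mild_gronwall A B M u u' z z' : A <= 0 -> 0 <= B -> 0 < M -> P u -> P u' ->
  mild 0 A B u z -> mild 0 A B u' z' ->
  (forall t, A <= t <= B -> nu (z t) <= M) -> (forall t, A <= t <= B -> nu (z' t) <= M) ->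
  forall t, A <= t <= B -> nu (fun x => z t x - z' t x) <=
    2 * nu (fun x => u x - u' x) * expR (2 * (5 * KK d alpha (2 * M) * `|t|)).
Proof.
move=> A0 B0 M0 Pu Pu' [cz [Q pQ E]] [cz' [Q' pQ' E']] zM zM' t tI.
have [Pz _] := cz; have [Pz' _] := cz'.
pose K := 5 * KK d alpha (2 * M); have K0 : 0 <= K by rewrite mulr_ge0// (KK_ge0 d alpha_ge1).
have bt s : 0 <= 0 * s by rewrite mul0r.
have PG s : A <= s <= B -> P (G s (z s)) by move=> sI; exact: (P_G d alpha_ge1 s (Pz s sI)).
have PG' s : A <= s <= B -> P (G s (z' s)) by move=> sI; exact: (P_G d alpha_ge1 s (Pz' s sI)).
have dL s : A <= s <= B -> is_derive s 1 (fun v => K * v) K.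
  by move=> _; have h : is_derive s 1 (fun v : R => K * v) (K * 1) := is_deriveZ K (is_derive_id s 1); rewrite mulr1 in h.
have lipK s : A <= s <= B ->
    nu (fun x => G s (z s) x - G s (z' s) x) <= K * nu (fun x => z s x - z' s x).
  move=> sI; have h := G_lip d alpha_ge1 b0 (bt s) M0 alpha_min (Pz s sI) (Pz' s sI) (zM s sI) (zM' s sI).
  apply: le_trans h _; apply: ler_wpM2r; first exact: nu_ge0.
  exact: (lip_le d alpha_ge1 M (bt s)).
have := gronwall b0 A0 B0 cz cz' Pu Pu' pQ pQ' PG PG' E E' dL (fun _ _ => K0) lipK tI.
by rewrite mulr0 subr0 normrM (ger0_norm K0).
Qed.

(** The bound [M] required by Gronwall's lemma comes from continuity on a compact interval, so
    uniqueness holds among all continuous curves, not only those in the ball of the fixed point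
    argument. *)
Lemma mild_uniq A B u z z' : A <= 0 -> 0 <= B -> P u -> mild 0 A B u z -> mild 0 A B u z' ->
  forall t, A <= t <= B -> Cae_eq (z t) (z' t).
Proof.
move=> A0 B0 Pu mz mz' t tI; have AB := le_trans A0 B0.
have [cz _] := mz; have [cz' _] := mz'; have [Pz _] := cz; have [Pz' _] := cz'.
have [M M0 HM] := contP_bounded b0 AB cz; have [M' M0' HM'] := contP_bounded b0 AB cz'.
have h : nu (fun x => z t x - z' t x) <= _ :=
  @mild_gronwall A B (Num.max M M') u u z z' A0 B0 _ Pu Pu mz mz' _ _ t tI.
apply: (nuB_eq0 b0 (Pz t tI) (Pz' t tI)); apply/eqP; rewrite eq_le nu_ge0// andbT.
apply: le_trans (h _ _ _) _.
- by rewrite lt_max M0.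
- by move=> s /HM hs; rewrite le_max hs.
- by move=> s /HM' hs; rewrite le_max hs orbT.
rewrite (_ : (fun x => u x - u x) = fun=> 0) ?nu0 ?mulr0 ?mul0r//.
by apply: funext => x; rewrite subrr.
Qed.

End Duhamel.

(** * Local well-posedness *)

Section Solutions.
Context {R : realType} {N : nat} (d : 'I_N.+1 -> R[i]) (alpha : 'I_N.+1 -> R).
Hypothesis alpha_ge1 : forall k, 1 <= alpha k.
Hypothesis alpha_min : forall k, alpha ord0 <= alpha k.
Implicit Types (z : R -> R -> R[i]) (A B b s t r e M : R).
Local Notation G := (G d alpha).
Local Notation mild := (mild d alpha).
Local Notation K M := (5 * KK d alpha (2 * M)).

Let b0 : 0 <= 0 :> R. Proof. exact: lexx. Qed.

Lemma mild_sub b A B A' B' u0 z : A <= A' -> B' <= B -> mild b A B u0 z -> mild b A' B' u0 z.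
Proof.
move=> AA BB [cz [Q pQ E]]; split; first exact: contP_sub AA BB cz.
exists Q; first exact: prim_sub AA BB pQ.
by move=> t /andP[h1 h2]; apply: E; rewrite (le_trans AA h1) (le_trans h2).
Qed.

Lemma mild_ae b A B u0 z z' : 0 <= b -> (forall t, A <= t <= B -> P b (z' t) /\ Cae_eq (z t) (z' t)) ->
  mild b A B u0 z -> mild b A B u0 z'.
Proof.
move=> bb H [[Pz cz] [Q [PQ HQ] E]].
have Pz' t : A <= t <= B -> P b (z' t) by case/H.
have ez t : A <= t <= B -> Cae_eq (z t) (z' t) by case/H.
split.
  split; first exact: Pz'.
  move=> t tI e e0; have [del del0 Hd] := cz t tI e e0; exists del; first exact: del0.
  move=> s sI st.
  rewrite (nu_ae (PB (Pz s sI) (Pz t tI)) (Cae_eqB (ez s sI) (ez t tI)) (P_L2 (PB (Pz' s sI) (Pz' t tI)))).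
  exact: Hd.
exists Q; last by move=> t tI; apply: ae_eq_trans (E t tI); exact: ae_eq_sym (ez t tI).
split; first exact: PQ.
move=> e e0; have [del del0 Hd] := HQ e e0; exists del; first exact: del0.
move=> s xi t As sx xt tB ts.
have st := le_trans sx xt.
have sI : A <= s <= B by rewrite As (le_trans st).
have xI : A <= xi <= B by rewrite (le_trans As) ?(le_trans xt).
have tI : A <= t <= B by rewrite tB (le_trans As).
have PX := PB (PQ t tI) (PQ s sI).
have PG1 := P_G d alpha_ge1 xi (Pz xi xI); have PG2 := P_G d alpha_ge1 xi (Pz' xi xI).
have eG := G_ae d alpha_ge1 xi (Pz xi xI).1 (Pz' xi xI).1 (ez xi xI).
have E' : Cae_eq (fun x => Q t x - Q s x - (t - s)%:C * G xi (z xi) x)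
    (fun x => Q t x - Q s x - (t - s)%:C * G xi (z' xi) x).
  by apply: (aeS eG) => x ->.
rewrite (nu_ae (PB PX (PZ _ PG1)) E' (P_L2 (PB PX (PZ _ PG2)))).
exact: Hd.
Qed.

(** The interval may depend on the time, as long as it contains all nearby times of [T]; this allows
    a half-line, on which mild solutions are known only over bounded intervals. *)
Lemma solution_of_mild (T : set R) u0 z : H1 u0 ->
  (forall t, T t -> exists A B, [/\ A <= 0, 0 <= B, A <= t <= B, mild 0 A B u0 z &
     exists2 del : R, 0 < del & forall s, T s -> `|s - t| < del -> A <= s <= B]) ->
  solution d alpha T u0 (fun t => schrodinger t (z t)).
Proof.
move=> Hu H; split; last first.
  by move=> t /H[A [B [A0 B0 tI mz _]]]; exact: (mild_duhamel alpha_ge1 A0 B0 Hu mz tI).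
apply/CH1P; split=> t /H[A [B [A0 B0 tI mz [r r0 Hr]]]]; have [cz _] := mz; have [Pu cu] := S_cont_nu cz.
  exact: (Pu t tI).1.
move=> e e0; have [del del0 Hd] := cu t tI e e0.
exists (Num.min r del); first by rewrite lt_min r0.
by move=> s Ts; rewrite lt_min => /andP[sr sd]; apply: Hd => //; exact: Hr.
Qed.

Lemma solution_uniq (T : set R) A B u0 u v t : A <= 0 -> 0 <= B -> A <= t <= B ->
  (forall s, A <= s <= B -> T s) -> H1 u0 -> solution d alpha T u0 u -> solution d alpha T u0 v ->
  Cae_eq (v t) (u t).
Proof.
move=> A0 B0 tI AT Hu su sv; have Pu0 := (P0 u0).2 Hu.
have mu := solution_mild alpha_ge1 alpha_min A0 B0 AT Hu su.
have mv := solution_mild alpha_ge1 alpha_min A0 B0 AT Hu sv.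
have E := mild_uniq alpha_ge1 alpha_min A0 B0 Pu0 mv mu tI.
have [[Hus _] _] := su; have [[Hvs _] _] := sv.
have [uL _] := Hus t (AT t tI); have [vL _] := Hvs t (AT t tI).
have h := S_ae t (S_L2 (- t) vL) (S_L2 (- t) uL) E.
exact: ae_eq_trans (ae_eq_sym (S_NK t vL)) (ae_eq_trans h (S_NK t uL)).
Qed.

(** The existence time depends on [M] alone, so one interval serves a whole neighborhood of the
    data, as the continuity of the flow demands. *)
Lemma local_mild M : 0 < M -> exists2 T : R, 0 < T & forall u0, H1 u0 -> nu 0 u0 <= M / 2 ->
  exists z, mild 0 (- T) T u0 z /\ forall t, - T <= t <= T -> nu 0 (z t) <= M.
Proof.
move=> M0; have k0 : 0 <= K M by rewrite mulr_ge0// (KK_ge0 d alpha_ge1).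
(* Chosen so that the mass of the constant Lipschitz bound over [[- T, T]] is at most 1/2; the added
   1 keeps the denominator positive. *)
pose T := (4 * (K M + 1))^-1; have T0 : 0 < T by rewrite invr_gt0 mulr_gt0// ltr_wpDl.
exists T => // u0 Hu uM; have Pu := (P0 u0).2 Hu.
have NT : - T <= 0 by rewrite oppr_le0 ltW.
apply: (@picard R N d alpha alpha_ge1 alpha_min 0 b0 (- T) T M u0 (fun v => K M * v)) => //.
- exact: ltW.
- by move=> t _; rewrite mul0r.
- move=> t _; have h : is_derive t 1 (fun v : R => K M * v) (K M * 1) := is_deriveZ (K M) (is_derive_id t 1).
  by rewrite /lip mul0r addr0 powR1.
have k1 : 0 < K M + 1 by rewrite ltr_wpDl.
rewrite -mulrBr opprK /T -mulr2n -[X in _ * X]mulr_natl mulrA invfM mulrA ler_pdivrMr//.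
by move: k0; move: (K M) => k; lra.
Qed.

Lemma well_posed : locally_well_posed d alpha.
Proof.
move=> u0 Hu; have Pu := (P0 u0).2 Hu.
(* Data at $H^1$ distance less than 1 from [u0] differ from it by less than 3 in [nu 0], so they
   fill at most half of this radius. *)
pose M := 2 * (nu 0 u0 + 3); have n0 := nu_ge0 u0 b0.
have M0 : 0 < M by rewrite mulr_gt0// ltr_wpDl.
have [T T0 HT] := local_mild M0.
have T0' := ltW T0; have NT : - T <= 0 by rewrite oppr_le0.
pose V : set (R -> R[i]) := [set w | (H1dist w u0 < 1%:E)%E].
have VH w : V w -> H1 w /\ nu 0 w <= M / 2.
  move=> /H1norm_lt[Pw hw].
  have e : w = fun x => (w \- u0) x + u0 x by apply: funext => x /=; rewrite subrK.
  rewrite e; split; first exact: (PD Pw Pu).1.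
  have M2 : M / 2 = 3 + nu 0 u0 by rewrite /M mulrC mulKf// addrC.
  have h := nuD b0 Pw Pu; apply: le_trans h _; rewrite M2.
  by rewrite mulr1 in hw; exact: lerD (ltW hw) (lexx _).
have ex w : exists z, V w -> mild 0 (- T) T w z /\ forall t, - T <= t <= T -> nu 0 (z t) <= M.
  have [Vw|Vw] := pselect (V w); last by exists (fun=> fun=> 0).
  by have [Hw nw] := VH w Vw; have [z hz] := HT w Hw nw; exists z.
have /choice[Z HZ] := ex.
pose Phi w t := schrodinger t (Z w t).
have TE t : `[- T, T]%classic t -> - T <= t <= T by rewrite /= in_itv.
have ET t : - T <= t <= T -> `[- T, T]%classic t by rewrite /= in_itv.
have sol w : V w -> unique_solution d alpha `[- T, T] w (Phi w).
  move=> Vw; have [Hw _] := VH w Vw; have [mz _] := HZ w Vw.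
  have s1 : solution d alpha `[- T, T] w (Phi w).
    apply: solution_of_mild => // t tT; exists (- T), T.
    split; [exact: NT|exact: T0'|exact: TE|exact: mz|].
    by exists 1 => // s sT _; exact: TE.
  split => // v sv t tT; exact: (solution_uniq NT T0' (TE t tT) ET Hw s1 sv).
have V0 : V u0.
  rewrite /V /=; apply: (@le_lt_trans _ _ 0%:E); last by rewrite lte_fin.
  rewrite /H1dist (_ : u0 \- u0 = fun=> 0); last by apply: funext => x /=; rewrite subrr.
  by apply: H1norm_le; [exact: P_zero|rewrite nu0].
split; first by exists T => //; exists (Phi u0); exact: sol.
exists T => //; exists V; first by split; [move=> w /VH[]|exists 1].
exists Phi; split => // w Vw e e0.
(* Largest Gronwall factor on the interval. The 12 in the threshold is 2 from Gronwall's lemma, 3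
   from the comparison of norms and 2 for the target [e / 2]. *)
pose E := expR (2 * (K M * T)); have E0 : 0 < E by exact: expR_gt0.
have E12 : 0 < 12 * E by rewrite mulr_gt0.
exists (e / (12 * E)); first by rewrite divr_gt0.
move=> w' Vw' /H1norm_lt[Pd hd].
have [Hw _] := VH w Vw; have [Hw' _] := VH w' Vw'.
have [mz zM] := HZ w Vw; have [mz' zM'] := HZ w' Vw'.
have e20 : e / 2 < e by rewrite ltr_pdivrMr// ltr_pMr// ltr1n.
apply: (@le_lt_trans _ _ (e / 2)%:E); last by rewrite lte_fin.
apply: ge_ereal_sup => _ [t /TE tT <-].
have k0 : 0 <= K M by rewrite mulr_ge0// (KK_ge0 d alpha_ge1).
have h := mild_gronwall alpha_ge1 alpha_min NT T0' M0 ((P0 w').2 Hw') ((P0 w).2 Hw) mz' mz zM' zM tT.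
have [[Pz _] _] := mz; have [[Pz' _] _] := mz'.
have PX := PB (Pz' t tT) (Pz t tT).
have PY := PB (S_P t (Pz' t tT)) (S_P t (Pz t tT)).
apply: H1norm_le => //.
rewrite [leLHS](_ : _ = nu 0 (fun x => Z w' t x - Z w t x)); last first.
  by rewrite (nu_ae (S_P t PX) (S_B t (P_L2 (Pz' t tT)) (P_L2 (Pz t tT))) (P_L2 PY)) nu_S.
apply: le_trans h _; apply: (@le_trans _ _ (2 * (3 * (e / (12 * E))) * E)); last first.
  by rewrite le_eqVlt; apply/orP; left; apply/eqP; field; rewrite gt_eqF.
have hE : expR (2 * (K M * `|t|)) <= E.
  by rewrite ler_expR ler_pM2l// ler_wpM2l// ler_norml.
have hd' : nu 0 (fun x => w' x - w x) <= 3 * (e / (12 * E)) := ltW hd.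
have q0 : 0 <= nu 0 (fun x => w' x - w x) := nu_ge0 _ b0.
move: (nu 0 (fun x => w' x - w x)) (expR _) (expR_ge0 (2 * (K M * `|t|))) hE hd' q0 => q y y0 hE hq q0.
by apply: ler_pM => //; [rewrite mulr_ge0|rewrite ler_pM2l].
Qed.

End Solutions.

(** * Data with a quadratic phase *)

Section QuadraticPhase.
Context {R : realType}.
Implicit Types b : R.

(** The derivative of the data has norm at most $|v_0'|+b|xv_0|$; the weight $(1+b)^{-1}$ in [nu]
    cancels the factor $b$, and [J] contributes exactly $|v_0'|$. *)
Lemma P_phase b (v0 : R -> R[i]) : 0 < b -> H1 v0 -> L2 (fun x => x%:C * v0 x) ->
  P b (quadratic_phase b v0) /\
  nu b (quadratic_phase b v0) <= nr v0 + 2 * nr (D v0) + nr (fun x => x%:C * v0 x).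
Proof.
move=> bb Hv xL; have b0 := ltW bb; have W := WD_D Hv; have [vL DL _] := W.
have qE : quadratic_phase b v0 = fun x => cis (b / 4 * x ^+ 2) * v0 x.
  by apply: funext => x; rewrite /quadratic_phase mulrAC.
have kL (k : R) : L2 (fun x => (k * x)%:C * v0 x).
  by have := L2Z k%:C xL; congr L2; apply: funext => x; rewrite mulrA -rmorphM.
have Wq := WD_chirp W (kL (b / 4)).
pose g x := D v0 x + 'i%C * (2 * (b / 4 * x))%:C * v0 x.
have [_ gL _] := Wq.
have Pq : P b (quadratic_phase b v0).
  rewrite qE; split; first exact: WD_H1 Wq.
  have := L2cis (meas_sq (b / 4)) (kL b); congr L2; apply: funext => x.
  by rewrite mulrCA.
split => //.
have Dq : Cae_eq (D (quadratic_phase b v0)) (fun x => cis (b / 4 * x ^+ 2) * g x).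
  by rewrite qE; exact: D_eq Wq.
have n1 : nr (quadratic_phase b v0) = nr v0 by rewrite qE nrcis.
have n2 : nr (J b (quadratic_phase b v0)) = nr (D v0).
  rewrite -(nrcis (fun x => b / 4 * x ^+ 2) (D v0)).
  apply: (nr_aeL (J_L2 Pq) (L2cis (meas_sq (b / 4)) DL)).
  apply: (aeS Dq) => x e; rewrite /J e qE /g.
  rewrite (_ : (2 * (b / 4 * x))%:C = (2^-1)%:C * (b * x)%:C); last by rewrite -rmorphM /=; congr (_%:C); field.
  by move: ((_^-1)%:C) ((_ * x)%:C) (cis _) => p q c; ring.
have n3 : nr (D (quadratic_phase b v0)) <= nr (D v0) + b * nr (fun x => x%:C * v0 x).
  apply: (nr_ae_le (P_DL2 Pq) gL Dq); rewrite nrcis.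
  have e : g = fun x => D v0 x + ('i%C * (b / 2)%:C) * (x%:C * v0 x).
    apply: funext => x; rewrite /g (_ : (2 * (b / 4 * x))%:C = (b / 2)%:C * x%:C); last by rewrite -rmorphM /=; congr (_%:C); field.
    by rewrite !mulrA.
  change (nr g <= nr (D v0) + b * nr (fun x => x%:C * v0 x)).
  rewrite e; apply: le_trans (nrD DL (L2Z _ xL)) _; rewrite lerD2l nrZ// normcM normc_i mul1r normcR.
  rewrite ger0_norm ?divr_ge0//; apply: ler_wpM2r; first exact: nr_ge0.
  by rewrite ler_pdivrMr// ler_peMr// ler1n.
rewrite /nu n1 n2; have := nr_ge0 v0; have := nr_ge0 (D v0).
move: (nr_ge0 (fun x => x%:C * v0 x)) n3.
move: (nr (D (quadratic_phase b v0))) (nr v0) (nr (D v0)) (nr (fun x => x%:C * v0 x)) => q p p' p'' p''0 hq p'0 p0.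
have c0 : 0 < 1 + b by rewrite ltr_pwDl.
suff : (1 + b)^-1 * q <= p' + p'' by lra.
rewrite ler_pdivrMl//; apply: le_trans hq _; nra.
Qed.

End QuadraticPhase.

(** * Global solutions and scattering *)

Section Scattering.
Context {R : realType} {N : nat} (d : 'I_N.+1 -> R[i]) (alpha : 'I_N.+1 -> R).
Hypothesis alpha_ge1 : forall k, 1 <= alpha k.
Hypothesis alpha_min : forall k, alpha ord0 <= alpha k.
Hypothesis alpha_gt2 : 2 < alpha ord0.
Implicit Types (z : R -> R -> R[i]) (A B b s t r e M : R).
Local Notation G := (G d alpha).
Local Notation mild := (mild d alpha).
Local Notation K M := (5 * KK d alpha (2 * M)).

Definition decay : R := alpha ord0 / 2 - 1.

Lemma decay_gt0 : 0 < decay.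
Proof. by rewrite /decay subr_gt0 ltr_pdivlMr// mul1r. Qed.

(* The primitive of [lip d alpha b M] which vanishes at infinity. *)
Definition lip_prim b M t := - (K M / (b * decay)) * (1 + b * t) `^ (- decay).

Lemma lip_prim_le0 b M t : 0 < b -> lip_prim b M t <= 0.
Proof.
move=> bb; rewrite /lip_prim mulNr oppr_le0 !mulr_ge0 ?powR_ge0 ?(KK_ge0 d alpha_ge1)//.
by rewrite invr_ge0 mulr_ge0 ?(ltW decay_gt0)// ltW.
Qed.

Lemma is_derive_lip_prim b M t : 0 < b -> 0 <= t ->
  is_derive t 1 (lip_prim b M) (lip d alpha b M t).
Proof.
move=> bb t0; have s0 : 0 < 1 + b * t by rewrite ltr_pwDl// mulr_ge0// ltW.
have h1 : is_derive t 1 (fun v : R => 1 + b * v) (0 + b * 1).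
  have h : is_derive t 1 (fun v : R => b * v) (b * 1) := is_deriveZ b (is_derive_id t 1).
  have c1 : is_derive t 1 (fun=> 1 : R) (0 : R) by exact: is_derive_cst.
  exact: (@is_deriveD R _ _ _ _ t 1 _ _ c1 h).
have h2 := @is_derive1_comp R (fun y : R => y `^ (- decay)) (fun v => 1 + b * v) t _ _ (is_derive1_powR _ s0) h1.
have h3 := @is_deriveZ R _ _ _ (- (K M / (b * decay))) t 1 _ h2.
apply: (is_derive_eq h3); rewrite /lip /GRing.scale /=.
rewrite (_ : - decay - 1 = - (alpha ord0 / 2)); last by rewrite /decay; ring.
have d0 := decay_gt0; move: (_ `^ _) (KK _ _ _) (decay) d0 => p k dd d0.
by field; rewrite !gt_eqF.
Qed.

Lemma lip_prim_small b M e : 0 < b -> 0 < e -> exists2 s : R, 0 <= s & - lip_prim b M s <= e.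
Proof.
move=> bb e0; have d0 := decay_gt0.
pose c := K M / (b * decay).
have c0 : 0 <= c.
  by rewrite /c !mulr_ge0 ?(KK_ge0 d alpha_ge1)// invr_ge0 mulr_ge0// ltW.
have c1 : 0 < (c + 1) / e by rewrite divr_gt0// ltr_wpDl.
pose w := ((c + 1) / e) `^ (decay^-1); have w0 : 0 < w by rewrite powR_gt0.
have wE : w `^ decay = (c + 1) / e by rewrite -powRrM mulVf ?gt_eqF// powRr1// ltW.
exists (w / b); first by rewrite divr_ge0// ltW.
rewrite /lip_prim -/c mulNr opprK powRN mulrC.
have m : w `^ decay <= (1 + b * (w / b)) `^ decay.
  apply: ge0_ler_powR; first exact: ltW.
  - by rewrite nnegrE ltW.
  - by rewrite nnegrE mulrC divfK ?gt_eqF// addr_ge0// ltW.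
  - by rewrite mulrC divfK ?gt_eqF// lerDr.
rewrite wE in m; rewrite ler_pdivrMl; last exact: lt_le_trans m.
apply: (@le_trans _ _ ((c + 1) / e * e)); last by rewrite ler_wpM2r// ltW.
by rewrite divfK ?gt_eqF// lerDl.
Qed.

(** No continuation argument enters: the lower bound on [b] makes the mass of [lip M] over the whole
    half-line at most 1/2, so the same ball works on each bounded interval, and uniqueness makes the
    solutions compatible. *)
Lemma mild_global b M u0 : 0 < b -> 0 < M -> P b u0 -> nu b u0 <= M / 2 ->
  2 * K M / decay <= b -> exists z, forall n : nat, mild b 0 n%:R u0 z /\
    forall t, 0 <= t <= n%:R -> nu b (z t) <= M.
Proof.
move=> bb M0 Pu uM hb; have b0 := ltW bb; have d0 := decay_gt0.
have k0 : 0 <= K M by rewrite mulr_ge0// (KK_ge0 d alpha_ge1).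
have ex (n : nat) : exists z, mild b 0 n%:R u0 z /\ forall t, 0 <= t <= n%:R -> nu b (z t) <= M.
  have n0 : 0 <= n%:R :> R by exact: ler0n.
  have bt t : 0 <= t <= n%:R -> 0 <= b * t by move=> /andP[t0 _]; rewrite mulr_ge0.
  have dL t : 0 <= t <= n%:R -> is_derive t 1 (lip_prim b M) (lip d alpha b M t).
    by move=> /andP[t0 _]; exact: is_derive_lip_prim.
  apply: (@picard R N d alpha alpha_ge1 alpha_min b b0 0 n%:R M u0 (lip_prim b M)
    (lexx 0) n0 bt M0 Pu uM dL).
  (* The majorant is nonpositive, so its increment over any bounded interval from 0 is at most minus
     its value at 0, which is [K M / (b * decay)]. *)
  have h1 := lip_prim_le0 M n%:R bb.
  apply: (@le_trans _ _ (- lip_prim b M 0)); first by rewrite lerBlDr addNr.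
  rewrite /lip_prim mulr0 addr0 powR1 mulr1 opprK ler_pdivrMr ?mulr_gt0//.
  by move: hb; rewrite ler_pdivrMr//; move: (K M) (b * decay) => k q; lra.
have /choice[Z HZ] := ex.
(* At each time the solution on the next integer interval is taken. It agrees with those on longer
   intervals only almost everywhere in space, and [mild_ae] transfers the equation across such
   changes. *)
pose z t := Z (Num.truncn t).+1 t; exists z => n.
have lt_tr t : 0 <= t -> t <= (Num.truncn t).+1%:R by move=> t0; exact/ltW/truncnS_gt.
have Zz t : 0 <= t <= n%:R -> P b (z t) /\ Cae_eq (Z n t) (z t).
  move=> tI; have /andP[t0 tn] := tI; have [mn _] := HZ n; have [mk _] := HZ (Num.truncn t).+1.
  have [[Pk _] _] := mk.
  have tk : 0 <= t <= (Num.truncn t).+1%:R by rewrite t0 lt_tr.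
  split; first exact: Pk.
  have m1 := mild_0 alpha_ge1 b0 (mild_sub (lexx 0) tn mn).
  have m2 := mild_0 alpha_ge1 b0 (mild_sub (lexx 0) (lt_tr t t0) mk).
  have tt : 0 <= t <= t by rewrite t0 lexx.
  exact: (mild_uniq alpha_ge1 alpha_min (lexx 0) t0 ((P0 u0).2 Pu.1) m1 m2 tt).
have [mn _] := HZ n; split; first exact: mild_ae b0 Zz mn.
move=> t /andP[t0 _]; have [_ h] := HZ (Num.truncn t).+1; apply: h.
by rewrite t0 lt_tr.
Qed.

Lemma global_scattering b M u0 : 0 < b -> 0 < M -> P b u0 -> nu b u0 <= M / 2 ->
  2 * K M / decay <= b ->
  exists u, unique_solution d alpha `[0, +oo[ u0 u /\ scatters u.
Proof.
move=> bb M0 Pu uM hb; have b0 := ltW bb; have Hu := Pu.1; have M0' := ltW M0.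
have [z Hz] := mild_global bb M0 Pu uM hb.
have mz n := (Hz n).1; have zM n := (Hz n).2.
have lt_tr t : 0 <= t -> t <= (Num.truncn t).+1%:R by move=> t0; exact/ltW/truncnS_gt.
have Pz t : 0 <= t -> P b (z t).
  move=> t0; have [[H _] _] := mz (Num.truncn t).+1; apply: H.
  by rewrite t0 lt_tr.
pose u t := schrodinger t (z t).
have TE t : `[0, +oo[%classic t -> 0 <= t by rewrite /= in_itv /= andbT.
have ET t : 0 <= t -> `[0, +oo[%classic t by rewrite /= in_itv /= andbT.
have su : solution d alpha `[0, +oo[ u0 u.
  (* The right end lies beyond [t + 1], so every nonnegative time at distance less than 1 from [t]
     is covered. *)
  apply: solution_of_mild => // t /TE t0; exists 0, (Num.truncn (t + 1)).+1%:R.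
  have tt : t + 1 <= (Num.truncn (t + 1)).+1%:R by apply: lt_tr; rewrite addr_ge0.
  split; [exact: lexx|exact: ler0n| |exact: (mild_0 alpha_ge1 b0 (mz (Num.truncn (t + 1)).+1))|].
    by rewrite t0; apply: le_trans tt; rewrite lerDl.
  exists 1 => // s /TE s0 st; rewrite s0; apply: le_trans tt.
  by move: st; rewrite ltr_norml => /andP[_ h]; lra.
exists u; split.
  split => // v sv t /TE t0.
  have tt : 0 <= t <= t by rewrite t0 lexx.
  exact: (solution_uniq alpha_ge1 alpha_min (lexx 0) t0 tt (fun s sI => ET s (proj1 (andP sI))) Hu su sv).
(* The increment of the majorant from [s] to [t] is at most minus its value at [s], because its
   value at [t] is nonpositive; this is the tail that tends to 0. *)
have dec s t : 0 <= s -> s <= t -> nu b (fun x => z t x - z s x) <= M * - lip_prim b M s.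
  move=> s0 st; have t0 := le_trans s0 st; pose n := (Num.truncn t).+1.
  have tn : t <= n%:R := lt_tr t t0.
  have [[_ _] [Q pQ E]] := mz n; have [PQ _] := pQ.
  have sI : 0 <= s <= n%:R by rewrite s0 (le_trans st).
  have tI : 0 <= t <= n%:R by rewrite t0.
  have PX := PB (PQ t tI) (PQ s sI).
  have e : Cae_eq (fun x => 'i%C * (Q t x - Q s x)) (fun x => z t x - z s x).
    by apply: (aeS2 (E t tI) (E s sI)) => x -> ->; ring.
  rewrite (nu_ae (PZ 'i%C PX) e (P_L2 (PB (Pz t t0) (Pz s s0)))) (nuZ _ PX) normc_i mul1r.
  have sub r : s <= r <= t -> 0 <= r <= n%:R.
    by move=> /andP[h1 h2]; rewrite (le_trans s0 h1) (le_trans h2).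
  have PF r : s <= r <= t -> P b (G r (z r)).
    by move=> /sub/andP[r0 _]; exact: (P_G d alpha_ge1 r (Pz r r0)).
  have dL r : s <= r <= t -> is_derive r 1 (fun v => M * lip_prim b M v) (M * lip d alpha b M r).
    move=> /sub/andP[r0 _]; have h := is_derive_lip_prim M bb r0.
    by apply: is_deriveZ.
  have Fl r : s <= r <= t -> nu b (G r (z r)) <= M * lip d alpha b M r.
    move=> /sub rI; have /andP[r0 _] := rI.
    by apply: nu_G => //; [rewrite mulr_ge0|exact: Pz|exact: zM rI].
  apply: le_trans (prim_bound b0 st (prim_sub s0 tn pQ) PF dL Fl) _.
  rewrite -mulrBr ler_wpM2l//; have := lip_prim_le0 M t bb.
  by move: (lip_prim _ _ _) (lip_prim _ _ _) => p q; lra.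
have small e : 0 < e -> exists2 s : R, 0 <= s & forall t, s <= t -> nu b (fun x => z t x - z s x) <= e.
  move=> e0; have [s s0 hs] := lip_prim_small M bb (divr_gt0 e0 M0); exists s => // t st.
  apply: le_trans (dec s t s0 st) _.
  by move: hs; rewrite ler_pdivlMr// mulrC.
have small2 e : 0 < e -> exists2 r : R, 0 <= r & forall s t, r <= s -> r <= t ->
    nu b (fun x => z t x - z s x) <= e.
  move=> e0; have e20 : 0 < e / 2 by rewrite divr_gt0.
  have [r r0 hr] := small _ e20; exists r => // s t rs rt.
  have Ps := Pz s (le_trans r0 rs); have Pt := Pz t (le_trans r0 rt); have Pr := Pz r r0.
  apply: le_trans (nuB_trans b0 Pt Pr Ps) _; rewrite (nuB_sym Pr Ps) [leRHS]splitr.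
  exact: lerD (hr t rt) (hr s rs).
(* Completeness is sequential: the limit is taken along the integers, and the uniform Cauchy bound
   then extends it to all times. *)
have [n|e e0|up Pup Hup] := @nu_complete R b (fun n => z n%:R) b0; first exact: Pz.
  have [r r0 hr] := small2 e e0; exists (Num.truncn r).+1 => m n hm hn.
  by apply: hr; apply: le_trans (lt_tr r r0) _; rewrite ler_nat.
have lim e : 0 < e -> exists2 r : R, 0 <= r & forall t, r <= t -> nu b (fun x => z t x - up x) <= e.
  move=> e0; have e20 : 0 < e / 2 by rewrite divr_gt0.
  have [r r0 hr] := small2 _ e20; have [n0 hn] := Hup _ e20.
  exists r => // t rt; pose n := ((Num.truncn r).+1 + n0)%N.
  have rn : r <= n%:R by apply: le_trans (lt_tr r r0) _; rewrite ler_nat leq_addr.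
  apply: le_trans (nuB_trans b0 (Pz t (le_trans r0 rt)) (Pz n%:R (le_trans r0 rn)) Pup) _.
  rewrite [leRHS]splitr; apply: lerD (hr _ _ rn rt) (hn _ _).
  by rewrite /n leq_addl.
exists up; first exact: Pup.1.
apply/cvg0eP => [t|e e0]; first exact: H1norm_ge0.
pose C := 2 * (6 + 3 * b); have C0 : 0 < C by rewrite /C; lra.
have e20 : 0 < e / 2 by rewrite divr_gt0.
have [r r0 hr] := lim _ (divr_gt0 e20 C0).
exists r; split; first exact: num_real.
move=> t rt; have rt' := ltW rt; have t0 := le_trans r0 rt'.
have [Pzt _] := nu_le b0 (Pz t t0); have [Pup0 _] := nu_le b0 Pup.
have [PX hX] := nu_le b0 (PB (Pz t t0) Pup).
have PY := PB (S_P t Pzt) (S_P t Pup0).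
apply: (@le_lt_trans _ _ (e / 2)%:E); last by rewrite lte_fin ltr_pdivrMr// ltr_pMr// ltr1n.
apply: H1norm_le => //.
(* The group is an isometry for [nu 0], so convergence of [z t] to [up] is the same as convergence
   of $u(t)$ to the free evolution of [up]. *)
rewrite [leLHS](_ : _ = nu 0 (fun x => z t x - up x)); last first.
  by rewrite (nu_ae (S_P t PX) (S_B t (P_L2 Pzt) (P_L2 Pup0)) (P_L2 PY)) nu_S.
apply: le_trans hX _; have := hr t rt'.
by rewrite ler_pdivlMr// mulrC.
Qed.

End Scattering.

Theorem corollary1p11 (R : realType) (N : nat)
    (d : 'I_N.+1 -> R[i]) (alpha : 'I_N.+1 -> R)
    (d_neq0 : forall k, d k != 0)
    (alpha_ge1 : 1 <= alpha ord0)
    (alpha_nondecreasing : forall j k : 'I_N.+1, (j <= k)%N -> alpha j <= alpha k) :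
  locally_well_posed d alpha /\
  (2 < alpha ord0 ->
   forall v0 : R -> R[i], H1 v0 -> L2 (fun x => x%:C * v0 x) ->
   exists2 b0 : R, 0 < b0 & forall b : R, b0 <= b ->
     H1 (quadratic_phase b v0) /\
     exists u : R -> R -> R[i],
       unique_solution d alpha `[0, +oo[ (quadratic_phase b v0) u /\
       scatters u).
Proof.
have alpha_min k : alpha ord0 <= alpha k by exact: alpha_nondecreasing.
have alpha_ge k : 1 <= alpha k := le_trans alpha_ge1 (alpha_min k).
split; first exact: well_posed.
move=> a2 v0 Hv xL.
pose m := nr v0 + 2 * nr (D v0) + nr (fun x => x%:C * v0 x).
have m0 : 0 <= m by rewrite !addr_ge0 ?mulr_ge0 ?nr_ge0.
(* [m] bounds the norm of the data for every [b] at once, so [M], and with it the threshold for [b],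
   depends on [v0] and the equation only. *)
pose M := 2 * m + 1; have M0 : 0 < M by rewrite ltr_wpDl ?mulr_ge0.
(* Threshold that makes the Picard mass over the half-line at most 1/2; the 1 added to it below
   makes it positive. *)
pose c := 2 * (5 * KK d alpha (2 * M)) / decay alpha.
have c0 : 0 <= c.
  by rewrite /c !mulr_ge0 ?(KK_ge0 d alpha_ge)// invr_ge0 ltW// decay_gt0.
exists (c + 1); first by rewrite ltr_wpDl.
move=> b hb; have bb : 0 < b by apply: lt_le_trans hb; rewrite ltr_wpDl.
have [Pq nq] := P_phase bb Hv xL; split; first exact: Pq.1.
apply: (global_scattering alpha_ge alpha_min a2 bb M0 Pq).
  by apply: le_trans nq _; rewrite -/m /M ler_pdivlMr// mulrC lerDl.
by apply: le_trans hb; rewrite lerDl.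
Qed.
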